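(* Let $\Omega\subset\mathbb R^2$ be a regular polygon having $L\ge 3$ edges. Then there exists $c>0$ such that, for all $n=1,\dots,L$, $$E_n(Q^\gamma_\Omega)=-\frac{\gamma^2}{\sin^2\frac{(L-2)\pi}{2L}}+O\left(e^{-c\gamma}\right),\quad\gamma\to+\infty.$$
   Context: For $\gamma>0$, $Q^\gamma_\Omega$ is the Robin Laplacian: the self-adjoint operator in $L^2(\Omega)$ associated with the form $q^\gamma_\Omega(\psi,\psi)=\int_\Omega|\nabla\psi|^2dx-\gamma\int_{\partial\Omega}|\psi|^2ds$, $\psi\in H^1(\Omega)$ (so $Q^\gamma_\Omega\psi=-\Delta\psi$ with $\partial_\nu\psi=\gamma\psi$ on $\partial\Omega$, $\nu$ the outer unit normal). $E_n(Q^\gamma_\Omega)$ is its $n$th eigenvalue in non-decreasing order, counted with multiplicity. *)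

(* Defs.v *)
From HB Require Import structures.
From mathcomp Require Import all_boot all_order all_algebra.
From mathcomp Require Import all_classical all_reals all_analysis.
From mathcomp.real_closed Require Import complex.
From mathcomp Require Import measurable_realfun.
Import numFieldNormedType.Exports.

Set Implicit Arguments.
Unset Strict Implicit.
Unset Printing Implicit Defensive.

Import Order.TTheory GRing.Theory Num.Theory.

Local Open Scope classical_set_scope.
Local Open Scope ring_scope.
Local Open Scope complex_scope.

(* The Euclidean plane carrying the Borel sigma-algebra; it is convertible to
   [R * R], which carries the topology and the normed-module structure. *)
Notation mplane R := (measurableTypeR R * measurableTypeR R)%type.

(* Square-integrable complex functions are represented by actual functions (not
   by classes modulo a.e. equality), whose values off the set of integration
   are irrelevant. *)
Section complex_L2.
Context {d : measure_display} {T : measurableType d} {R : realType}.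
Variables (mu : {measure set T -> \bar R}) (D : set T).
Implicit Types (f g : T -> R[i]).

Definition sqmod (z : R[i]) : R := complex.Re z ^+ 2 + complex.Im z ^+ 2.

Definition cintegral f : R[i] :=
  (\int[mu]_(x in D) complex.Re (f x)) +i* (\int[mu]_(x in D) complex.Im (f x)).

Definition sqnormL2 f : \bar R := (\int[mu]_(x in D) (sqmod (f x))%:E)%E.

Definition L2 : set (T -> R[i]) := [set f |
  [/\ measurable_fun D (fun x => complex.Re (f x)),
      measurable_fun D (fun x => complex.Im (f x)) &
      (sqnormL2 f < +oo)%E]].

Definition ipL2 f g : R[i] := cintegral (fun x => f x * (g x)^*).

Definition L2_free m (u : 'I_m -> T -> R[i]) : Prop :=
  forall a : 'I_m -> R[i],
    {ae mu, forall x, D x -> \sum_(i < m) a i * u i x = 0} ->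
    forall i, a i = 0.

(* The linear subspace [V] of [L2] has dimension at least [m]. *)
Definition dim_ge (V : set (T -> R[i])) (m : nat) : Prop :=
  exists u : 'I_m -> T -> R[i], (forall i, V (u i)) /\ L2_free u.

End complex_L2.

Section sobolev.
Context {R : realType}.
Implicit Types (D : set (mplane R)) (u g : mplane R -> R[i]) (f : R * R -> R).

Definition area : {measure set (mplane R) -> \bar R} :=
  (@lebesgue_measure R \x @lebesgue_measure R)%E.

Definition dirx : R * R := (1, 0).
Definition diry : R * R := (0, 1).

Definition partial (b : bool) f : R * R -> R :=
  fun x => 'D_(if b then dirx else diry) f x.

(* C^infinity on the whole plane: all iterated partial derivatives exist and
   are continuous. *)
Definition smooth f : Prop := forall s : seq bool,
  let h := foldr partial f s in
  continuous h /\
  forall x, derivable h x dirx /\ derivable h x diry.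

Definition test_function D f : Prop :=
  smooth f /\
  exists K : set (R * R), [/\ compact K, K `<=` D & forall x, ~ K x -> f x = 0].

(* [g] is the weak partial derivative of [u] in [D]; [b] selects the
   variable. *)
Definition weak_partial D b u g : Prop :=
  L2 area D g /\
  forall f, test_function D f ->
    cintegral area D (fun x => u x * (partial b f x)%:C) =
    - cintegral area D (fun x => g x * (f x)%:C).

Definition H1 D : set (mplane R -> R[i]) := [set u |
  L2 area D u /\ forall b, exists g, weak_partial D b u g].

Definition wpartial D b u : mplane R -> R[i] :=
  xget (fun=> 0) [set g | weak_partial D b u g].

Definition sqnormH1 D u : \bar R :=
  (sqnormL2 area D u + sqnormL2 area D (wpartial D true u)
                     + sqnormL2 area D (wpartial D false u))%E.

End sobolev.

Section polygon.
Context {R : realType} {L : nat}.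
Variable v : 'I_L -> R * R.

Definition convex_hull : set (R * R) := [set x |
  exists w : 'I_L -> R, [/\ forall k, 0 <= w k, \sum_(k < L) w k = 1 &
    x = (\sum_(k < L) w k * (v k).1, \sum_(k < L) w k * (v k).2)]].

(* The open convex polygon with vertices [v 0, ..., v (L - 1)]. *)
Definition polygon : set (R * R) := interior convex_hull.

(* The [k]-th edge joins [v k] to the cyclically next vertex. *)
Definition edge (k : 'I_L) (t : R) : R * R :=
  ((1 - t) * (v k).1 + t * (v (ordS k)).1,
   (1 - t) * (v k).2 + t * (v (ordS k)).2).

Definition edge_length (k : 'I_L) : R :=
  Num.sqrt (((v (ordS k)).1 - (v k).1) ^+ 2 + ((v (ordS k)).2 - (v k).2) ^+ 2).

(* Arc length on the union of the edges. *)
Definition arclength (A : set (mplane R)) : \bar R :=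
  (\sum_(k < L) (edge_length k)%:E *
     @lebesgue_measure R (`[0%R, 1%R] `&` edge k @^-1` A))%E.

Lemma measurable_edge k :
  measurable_fun [set: measurableTypeR R] (edge k : _ -> mplane R).
Proof.
apply: measurable_fun_pair; apply: measurable_funD;
  by apply: measurable_funM => //; apply: measurable_funB.
Qed.

Let edge_measure k : {measure set (mplane R) -> \bar R} :=
  mscale (NngNum (sqrtr_ge0 _ : 0 <= edge_length k))
    (measure_function_pushforward__canonical__measure_function_Measure
      (mrestr (@lebesgue_measure R) (measurable_itv `[0%R, 1%R]))
      (measurable_edge k)).

Let arclengthE A : arclength A = (\sum_(k < L) edge_measure k A)%E.
Proof.
by apply: eq_bigr => k _; rewrite /= /mscale /= /pushforward /mrestr setIC.
Qed.

Let arclength0 : arclength set0 = 0%E.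
Proof. by rewrite arclengthE big1. Qed.

Let arclength_ge0 A : (0 <= arclength A)%E.
Proof. by rewrite arclengthE; apply: sume_ge0. Qed.

Let arclength_sigma_additive : semi_sigma_additive (arclength).
Proof.
move=> F mF tF mUF.
rewrite (_ : arclength = fun A => (\sum_(k < L) edge_measure k A)%E); last first.
  exact/funext.
rewrite [X in _ --> X](_ : _ =
    limn (fun n => \sum_(0 <= i < n) \sum_(k < L) edge_measure k (F i))%E).
  by apply: is_cvg_ereal_nneg_natsum => k _; exact: sume_ge0.
rewrite nneseries_sum//; apply: eq_bigr => /= i _.
exact: measure_semi_bigcup.
Qed.

HB.instance Definition _ := isMeasure.Build _ _ _ arclength
  arclength0 arclength_ge0 arclength_sigma_additive.

End polygon.

Section robin.
Context {R : realType} {L : nat}.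
Variable v : 'I_L -> R * R.
Implicit Types (u w t : mplane R -> R[i]) (gam : R).

Local Notation Omega := (polygon v).
Local Notation bd := (arclength v).

(* The trace on the boundary: the continuous extension from smooth functions
   to H^1 of the restriction map. *)
Definition is_trace u t : Prop :=
  L2 bd setT t /\
  exists phi : nat -> mplane R -> R[i],
    [/\ forall n, smooth (fun x => complex.Re (phi n x)) /\
                  smooth (fun x => complex.Im (phi n x)),
        sqnormH1 Omega (phi n \- u) @[n --> \oo] --> 0%E &
        sqnormL2 bd setT (phi n \- t) @[n --> \oo] --> 0%E].

Definition trace u : mplane R -> R[i] := xget (fun=> 0) [set t | is_trace u t].

Definition robin_form gam u w : R[i] :=
  (\sum_(b : bool) ipL2 area Omega (wpartial Omega b u) (wpartial Omega b w))
  - gam%:C * ipL2 bd setT (trace u) (trace w).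

(* The graph of the self-adjoint operator associated with the form:
   [u] is in the domain of the operator, which maps it to [f]. *)
Definition robin_laplacian gam u f : Prop :=
  [/\ H1 Omega u, L2 area Omega f &
      forall w, H1 Omega w -> robin_form gam u w = ipL2 area Omega f w].

Definition robin_eigenspace gam (lam : R) : set (mplane R -> R[i]) :=
  [set u | robin_laplacian gam u (fun x => lam%:C * u x)].

(* [E 0 <= E 1 <= ...] lists all eigenvalues, each repeated according to its
   multiplicity: [lam] occurs at least [m] times in [E] iff its eigenspace has
   dimension at least [m]. *)
Definition robin_spectrum gam (E : nat -> R) : Prop :=
  {homo E : m n / (m <= n)%N >-> m <= n} /\
  forall (lam : R) (m : nat),
    dim_ge area Omega (robin_eigenspace gam lam) m <->
    exists s : seq nat, [/\ uniq s, size s = m & forall n, n \in s -> E n = lam].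

(* The [n]-th eigenvalue, for [n >= 1]. *)
Definition robin_eigenvalue gam (n : nat) : R :=
  xget (fun=> 0) [set E | robin_spectrum gam E] n.-1.

End robin.

(* The vertices of a regular polygon, in cyclic order, with arbitrary centre,
   size and orientation. *)
Definition regular_vertices {R : realType} {L : nat} (v : 'I_L -> R * R) : Prop :=
  exists (c : R * R) (r theta : R), 0 < r /\
    forall k : 'I_L,
      v k = (c.1 + r * cos (theta + 2 * pi * k%:R / L%:R),
             c.2 + r * sin (theta + 2 * pi * k%:R / L%:R)).

(* Makes the Landau notations available at +oo. *)
Canonical pinfty_filter_on (R : numFieldType) :=
  FilterType (pinfty_nbhs R) _.

(* Main.v *)
From HB Require Import structures.
Require Import Defs.
From mathcomp Require Import all_boot all_order all_algebra.
From mathcomp Require Import all_classical all_reals all_analysis.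
From mathcomp.real_closed Require Import complex.
From mathcomp Require Import measurable_realfun.
From mathcomp Require Import ring lra.
Import numFieldNormedType.Exports.
Import Order.TTheory GRing.Theory Num.Theory.

Set Implicit Arguments.
Unset Strict Implicit.
Unset Printing Implicit Defensive.

Local Open Scope classical_set_scope.
Local Open Scope ring_scope.

(** The half angle of the polygon at a vertex has sine [s = cos (pi / L)]. Put
    [a = gam / s]. The exponential [exp (a (x - c) . e_k)], where [e_k] points from
    the centre [c] to the [k]-th vertex, satisfies [- Laplacian u = - a ^ 2 u] and has
    normal derivative [gam u] on the two edges that meet at this vertex. It is
    the ground state of the infinite sector with that vertex. On the other edges it
    is smaller than near its vertex by a factor exponential in [a], so it is almost
    an eigenfunction for [- a ^ 2].

    Upper bound. The [L] exponentials are almost orthogonal, and by Green's formula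
    the Robin form plus [a ^ 2] times the mass is exponentially small on their span
    ([robin_mode], [modes_upper]). By the minimum principle the first [L]
    eigenvalues are at most [- a ^ 2] plus an exponentially small error
    ([eigenvalue_upper]).

    Lower bound. The sum [Phi] of the exponentials is positive, so the divergence
    theorem for [phi ^ 2 grad Phi / Phi] gives an inequality of Jacobi
    ([jacobi_inequality]). Since [Laplacian Phi = a ^ 2 Phi], and since
    [grad Phi / Phi] has normal component [a s] on the boundary up to an
    exponentially small error, the form is at least [- a ^ 2] times the mass after an
    exponentially small increase of [a] ([boundary_modes], [lower_field]). Both bounds
    hold for the first [L] eigenvalues at once, the lower one by monotonicity.

    Existence and counting of the eigenvalues. The form domain is the closure of the
    smooth functions, each taken with its gradient and its boundary values
    ([energetic]). The radial field in the inequality of Jacobi gives the trace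
    inequality ([trace_inequality]), a Poincare inequality on the cells of a fine grid
    gives compactness ([grid_compact]), and [spectral] yields an orthonormal family
    of eigenvectors whose eigenvalues tend to infinity, with the minimum principle.
    To compare this with the Sobolev space of the statement, convolution after a
    dilation shows that functions with square-integrable weak derivatives belong to
    the closure ([weak_grad_dense], [weak_grad_energetic]). Complex functions are
    treated through their real and imaginary parts ([eigenspaceP]). The dimensions of
    the eigenspaces are then the multiplicities in the list ([eigenspace_dim]), and they
    determine the list ([robin_eigenvalueE]). *)

(** * An abstract spectral theorem *)

Lemma ex_kernel (F : fieldType) (m n : nat) (A : 'I_n -> 'I_m -> F) :
  (m < n)%N -> exists2 c : 'I_n -> F, exists j, c j != 0 &
    forall i, \sum_(j < n) c j * A j i = 0.
Proof.
move=> mn; pose M := \matrix_(j < n, i < m) A j i.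
have : kermx M != 0.
  rewrite -mxrank_eq0 mxrank_ker subn_eq0 -ltnNge.
  exact: leq_ltn_trans (rank_leq_col _) mn.
case/rowV0Pn => c cM /rV0Pn[j cj0]; exists (c ord0); first by exists j.
move=> i; have /sub_kermxP/matrixP/(_ ord0 i) := cM.
rewrite mxE [RHS]mxE => cM0; rewrite -[RHS]cM0.
by apply: eq_bigr => k _; rewrite mxE.
Qed.

Lemma ex_cvg_subseq (R : realType) (k : nat) (f : nat -> 'I_k -> R) :
    (forall n i, `|f n i| <= 1) ->
  exists2 phi : nat -> nat, increasing_seq phi &
    forall i, cvgn (fun n => f (phi n) i).
Proof.
move=> f1; suff [phi iphi cphi] : exists2 phi : nat -> nat, increasing_seq phi &
    forall i, i \in enum 'I_k -> cvgn (fun n => f (phi n) i).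
  by exists phi => // i; apply: cphi; rewrite mem_enum.
elim: (enum 'I_k) => [|i s [phi iphi cphi]]; first by exists id.
have [|psi ipsi cpsi] := bolzano_weierstrass (u_ := fun n => f (phi n) i).
  by exists 1; split => // x x1 n _; apply: le_trans (f1 _ _) (ltW x1).
exists (phi \o psi) => [m n|j]; first by rewrite /= iphi -leEnat ipsi.
rewrite inE => /predU1P[->//|/cphi cj].
apply: cvgP; apply: cvg_comp cj.
have ge_psi n : (n <= psi n)%N.
  elim: n => // n IHn; apply: leq_ltn_trans IHn _.
  by rewrite ltnNge -leEnat ipsi ltnn.
by apply/cvgnyPge => A; exists A => // n /= An; exact: leq_trans (ge_psi n).
Qed.

(** Phrased for a quadratic form in two variables so as to serve both for the
    Cauchy-Schwarz inequality and for Jensen's inequality. *)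
Lemma quadratic_disc (R : realType) (a c d : R) :
  (forall s t, 0 <= s ^+ 2 * a + 2 * s * t * c + t ^+ 2 * d) -> c ^+ 2 <= a * d.
Proof.
move=> pos.
have d0 : 0 <= d by have := pos 0 1; lra.
have a0 : 0 <= a by have := pos 1 0; lra.
have [d0'|dn0] := eqVneq d 0.
  have [->|cn0] := eqVneq c 0; first by rewrite d0'; lra.
  (* at this point the form takes the value [-1] *)
  have := pos 1 (- (a + 1) / (2 * c)); rewrite d0'.
  rewrite (_ : _ + _ = - 1); first by lra.
  by field.
have := pos d (- c).
rewrite (_ : _ + _ = d * (a * d - c ^+ 2)); last by ring.
by rewrite pmulr_rge0 ?subr_ge0// lt_neqAle eq_sym dn0.
Qed.

Section symmetric_forms.
Context {R : realType} {V : lmodType R}.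

Definition symbil (b : V -> V -> R) : Prop :=
  (forall u w, b u w = b w u) /\
  (forall a u w z, b (a *: u + w) z = a * b u z + b w z).

Variable b : V -> V -> R.
Hypothesis bS : symbil b.

Let bC u w : b u w = b w u. Proof. exact: bS.1. Qed.

Lemma symbilD u w z : b (u + w) z = b u z + b w z.
Proof. by rewrite -[u]scale1r bS.2 mul1r scale1r. Qed.

Lemma symbil0 z : b 0 z = 0.
Proof. by apply: (addrI (b 0 z)); rewrite -symbilD !addr0. Qed.

Lemma symbilZ a u z : b (a *: u) z = a * b u z.
Proof. by rewrite -[a *: u]addr0 bS.2 symbil0 addr0. Qed.

Lemma symbilDr u w z : b z (u + w) = b z u + b z w.
Proof. by rewrite !(bC z) symbilD. Qed.

Lemma symbilZr a u z : b z (a *: u) = a * b z u.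
Proof. by rewrite !(bC z) symbilZ. Qed.

Lemma symbilB u w z : b (u - w) z = b u z - b w z.
Proof. by rewrite symbilD -scaleN1r symbilZ mulN1r. Qed.

Lemma symbilBr u w z : b z (u - w) = b z u - b z w.
Proof. by rewrite !(bC z) symbilB. Qed.

Lemma symbil_sum n (c : 'I_n -> R) (u : 'I_n -> V) z :
  b (\sum_i c i *: u i) z = \sum_i c i * b (u i) z.
Proof.
elim/big_rec2: _ => [|i x y _ <-]; first by rewrite symbil0.
by rewrite symbilD symbilZ.
Qed.

Lemma symbil_sumr n (c : 'I_n -> R) (u : 'I_n -> V) z :
  b z (\sum_i c i *: u i) = \sum_i c i * b z (u i).
Proof. by rewrite bC symbil_sum; under eq_bigr do rewrite bC. Qed.

Lemma symbil_sqD u w : b (u + w) (u + w) = b u u + 2 * b u w + b w w.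
Proof. rewrite symbilD !symbilDr (bC w u); ring. Qed.

Lemma symbil_sqB u w : b (u - w) (u - w) = b u u - 2 * b u w + b w w.
Proof. rewrite symbilB !symbilBr (bC w u); ring. Qed.

Lemma symbil_sqZ a u : b (a *: u) (a *: u) = a ^+ 2 * b u u.
Proof. rewrite symbilZ symbilZr; ring. Qed.

(** Positivity on the plane spanned by [u] and [w] is enough, so that the
    inequality applies to forms that are only positive on a subspace. *)
Lemma symbil_CS u w : (forall s t, 0 <= b (s *: u + t *: w) (s *: u + t *: w)) ->
  b u w ^+ 2 <= b u u * b w w.
Proof.
move=> pos; apply: quadratic_disc => s t.
have := pos s t; rewrite symbil_sqD !symbil_sqZ symbilZ symbilZr; lra.
Qed.

End symmetric_forms.

Section spectral.
Context {R : realType} {V : lmodType R}.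
Variables (b q : V -> V -> R) (K : R).
Hypotheses (bS : symbil b) (qS : symbil q).
Let p u := q u u + K * b u u.
Hypotheses (b_ge0 : forall u, 0 <= b u u) (coercive : forall u, b u u <= p u).
Hypothesis complete : forall x : nat -> V,
  (forall e, 0 < e -> exists N, forall m n, (N <= m)%N -> (N <= n)%N ->
    p (x m - x n) <= e) ->
  exists y, forall e, 0 < e -> exists N, forall n, (N <= n)%N -> p (x n - y) <= e.
Hypothesis compact : forall e, 0 < e -> exists k (l : 'I_k -> V -> R),
  [/\ forall i a u w, l i (a *: u + w) = a * l i u + l i w,
      forall i u, l i u ^+ 2 <= b u u &
      forall u, b u u <= e * p u + \sum_i l i u ^+ 2].
Hypothesis infinite_dim : forall m, exists u : 'I_m -> V, forall c : 'I_m -> R,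
  b (\sum_i c i *: u i) (\sum_i c i *: u i) = 0 -> forall i, c i = 0.

Let lB k (l : 'I_k -> V -> R) :
  (forall i a u w, l i (a *: u + w) = a * l i u + l i w) ->
  forall i u w, l i (u - w) = l i u - l i w.
Proof. by move=> lP i u w; rewrite addrC -scaleN1r lP mulN1r addrC. Qed.

Let eigenpair (E : R) (w : V) := b w w = 1 /\ forall z, q w z = E * b w z.

Section next_eigenpair.
Variables (n : nat) (e : 'I_n -> V) (E : 'I_n -> R).
Hypothesis eE : forall i, eigenpair (E i) (e i).
Hypothesis eO : forall i j, i != j -> b (e i) (e j) = 0.
Let perp u := forall i, b u (e i) = 0.

Let perpP a u w : perp u -> perp w -> perp (a *: u + w).
Proof. by move=> pu pw i; rewrite bS.2 pu pw mulr0 addr0. Qed.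

Let perpZ a u : perp u -> perp (a *: u).
Proof. by move=> pu i; rewrite symbilZ// pu mulr0. Qed.

Let perpB u w : perp u -> perp w -> perp (u - w).
Proof. by move=> pu pw i; rewrite symbilB// pu pw subr0. Qed.

Let perpD u w : perp u -> perp w -> perp (u + w).
Proof. by move=> pu pw i; rewrite symbilD// pu pw addr0. Qed.

Let ex_perp : exists u, perp u /\ b u u = 1.
Proof.
have [u ui] := infinite_dim n.+1.
have [c [j cj] cA] := ex_kernel (fun j i => b (u j) (e i)) (ltnSn n).
set w := \sum_i c i *: u i.
have w0 : 0 < b w w.
  rewrite lt_neqAle b_ge0 andbT; apply/negP => /eqP/esym/ui/(_ j) cj0.
  by rewrite cj0 eqxx in cj.
exists ((Num.sqrt (b w w))^-1 *: w); split.
  by apply: perpZ => i; rewrite symbil_sum// cA.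
by rewrite symbil_sqZ// exprVn sqr_sqrtr ?(ltW w0)// mulVf// gt_eqF.
Qed.

Let A := [set x | exists2 u, perp u /\ b u u = 1 & x = q u u].
Let mu := inf A.

Let A_lb : lbound A (1 - K).
Proof. by move=> x [u [_ bu] ->]; have := coercive u; rewrite /p bu; lra. Qed.

Let A_inf : has_inf A.
Proof.
have [u pu] := ex_perp; split; last by exists (1 - K); exact: A_lb.
by exists (q u u); exists u.
Qed.

Let muK : 1 <= mu + K.
Proof. by rewrite -lerBlDr; apply: lb_le_inf A_lb; case: A_inf. Qed.

Let r u w := q u w - mu * b u w.

Let rS : symbil r.
Proof.
split=> [u w|a u w z]; first by rewrite /r qS.1 bS.1.
rewrite /r qS.2 bS.2; ring.
Qed.

Let r_ge0 u : perp u -> 0 <= r u u.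
Proof.
move=> pu; have [b0|bn0] := eqVneq (b u u) 0.
  by have := coercive u; rewrite /p /r b0 !mulr0 addr0 subr0.
have b0 : 0 < b u u by rewrite lt_neqAle eq_sym bn0 b_ge0.
have : mu <= q ((Num.sqrt (b u u))^-1 *: u) ((Num.sqrt (b u u))^-1 *: u).
  apply: ge_inf; first by case: A_inf.
  exists ((Num.sqrt (b u u))^-1 *: u) => //; split; first exact: perpZ.
  by rewrite symbil_sqZ// exprVn sqr_sqrtr ?(ltW b0)// mulVf.
by rewrite symbil_sqZ// exprVn sqr_sqrtr ?(ltW b0)// ler_pdivlMl// /r subr_ge0 mulrC.
Qed.

Let ex_minseq : exists x : nat -> V, forall m,
  [/\ perp (x m), b (x m) (x m) = 1 & r (x m) (x m) <= m.+1%:R^-1].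
Proof.
suff /choice[x xP] : forall m : nat, exists u, [/\ perp u, b u u = 1 & r u u <= m.+1%:R^-1].
  by exists x.
move=> m; have [||x [u [pu bu] ->] xmu] := @inf_adherent _ A m.+1%:R^-1; rewrite ?invr_gt0//.
by exists u; split=> //; rewrite /r bu mulr1 lerBlDl ltW.
Qed.

Let pE d : p d = r d d + (mu + K) * b d d. Proof. rewrite /p /r; ring. Qed.

(** Along a minimising sequence the finitely many linear forms of [compact]
    converge after extraction; the parallelogram law then makes the sequence
    Cauchy for [p], since [r] is nonnegative on the complement. *)
Lemma ex_minimizer : exists w, [/\ perp w, b w w = 1 & r w w = 0].
Proof.
have [x xP] := ex_minseq.
have muK0 : 0 < mu + K by exact: lt_le_trans muK.
have [|k [l [lP lb bl]]] := compact (e := (2 * (mu + K))^-1).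
  by rewrite invr_gt0 mulr_gt0.
have [|phi iphi cl] := @ex_cvg_subseq _ k (fun m i => l i (x m)).
  move=> m i; rewrite -(@ler_pXn2r _ 2)// ?nnegrE// expr1n -normrX ger0_norm ?sqr_ge0//.
  by have [_ <- _] := xP m.
have ge_phi m : (m <= phi m)%N.
  elim: m => // m IHm; apply: leq_ltn_trans IHm _.
  by rewrite ltnNge -leEnat iphi ltnn.
pose y m := x (phi m).
have yP m : [/\ perp (y m), b (y m) (y m) = 1 & r (y m) (y m) <= m.+1%:R^-1].
  have [h1 h2 h3] := xP (phi m); split=> //; apply: le_trans h3 _.
  by rewrite lef_pV2 ?posrE// ler_nat ltnS.
pose lim_l i := limn (fun m => l i (y m)).
pose D m := \sum_i (l i (y m) - lim_l i) ^+ 2.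
have D0 : D m @[m --> \oo] --> 0.
  rewrite -[X in _ --> X](_ : \sum_(i < k) (lim_l i - lim_l i) ^+ 2 = 0); last first.
    by rewrite big1// => i _; rewrite subrr expr0n.
  apply: cvg_big => [|i _]; first exact: add_continuous.
  rewrite expr2; under eq_fun do rewrite expr2.
  by apply: cvgM; apply: cvgB; try exact: cvg_cst; exact: cl.
have pB m n' : p (y m - y n') <= 4 * (m.+1%:R^-1 + n'.+1%:R^-1) +
     4 * (mu + K) * (D m + D n').
  set d := y m - y n'.
  have [pm bm rm] := yP m; have [pn bn rn] := yP n'.
  have rd : r d d <= 2 * (m.+1%:R^-1 + n'.+1%:R^-1).
    have : 0 <= r (y m + y n') (y m + y n').
      by apply: r_ge0; exact: perpD.
    rewrite /d (symbil_sqD rS) (symbil_sqB rS); move: rm rn.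
    move: (r (y m) (y m)) (r (y m) (y n')) (r (y n') (y n')) => x1 x2 x3.
    move: (m.+1%:R^-1) (n'.+1%:R^-1) => x4 x5; lra.
  have ld : \sum_i l i d ^+ 2 <= 2 * (D m + D n').
    rewrite -big_split/= mulr_sumr; apply: ler_sum => i _.
    rewrite /d lB//; set u := l i _; set v := l i _.
    have : 0 <= (u + v - 2 * lim_l i) ^+ 2 by exact: sqr_ge0.
    by rewrite !expr2; lra.
  have := bl d; rewrite pE.
  move=> h.
  have {}h : (mu + K) * b d d <= r d d + 2 * (mu + K) * \sum_i l i d ^+ 2.
    have c0 : 0 < 2 * (mu + K) by rewrite mulr_gt0.
    move: h; rewrite -(ler_pM2l c0) [leRHS]mulrDr mulVKf ?gt_eqF//; lra.
  have : 2 * (mu + K) * \sum_i l i d ^+ 2 <= 2 * (mu + K) * (2 * (D m + D n')).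
    by rewrite ler_pM2l ?mulr_gt0.
  move: rd h; move: (r d d) (b d d) (\sum_i l i d ^+ 2) => x1 x2 x3.
  move: (m.+1%:R^-1) (n'.+1%:R^-1) => x4 x5; lra.
have B0 : 4 * m.+1%:R^-1 + 4 * (mu + K) * D m @[m --> \oo] --> 0.
  rewrite -[X in _ --> X](_ : 4 * 0 + 4 * (mu + K) * 0 = 0); last by rewrite !mulr0 addr0.
  apply: cvgD; apply: cvgM; try exact: cvg_cst; first exact: cvg_harmonic.
  exact: D0.
have [|z zP] := complete (x := y).
  move=> eps eps0.
  have /cvgrPdist_le/(_ (eps / 2)) [|N _ NP] := B0; first by rewrite divr_gt0.
  exists N => m n' Nm Nn; apply: le_trans (pB _ _) _.
  have := NP _ Nm; have := NP _ Nn; rewrite /= !sub0r !normrN.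
  move=> /(le_trans (ler_norm _)) + /(le_trans (ler_norm _)).
  by move: (m.+1%:R^-1) (n'.+1%:R^-1) => x1 x2 h1 h2; lra.
have zb : forall eps, 0 < eps -> exists m, [/\ m.+1%:R^-1 <= eps, p (y m - z) <= eps & b (y m - z) (y m - z) <= eps].
  move=> eps eps0; have [N NP] := zP _ eps0.
  have /cvgrPdist_le/(_ eps eps0) [M _ MP] := @cvg_harmonic R.
  exists (N + M)%N; have h := NP _ (leq_addr M N); split=> //.
    have := MP _ (leq_addl N M); rewrite /= sub0r normrN.
    exact/le_trans/ler_norm.
  exact: le_trans (coercive _) h.
have pz : perp z.
  move=> i; apply/eqP; rewrite -sqrf_eq0 eq_le sqr_ge0 andbT.
  apply/ler_addgt0Pr => eps eps0; rewrite add0r.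
  have [m [_ _ bm]] := zb _ eps0.
  have [pm _ _] := yP m.
  have -> : b z (e i) = - b (y m - z) (e i) by rewrite symbilB// pm sub0r opprK.
  rewrite sqrrN; apply: le_trans (symbil_CS bS _) _ => //.
  by have [-> _] := eE i; rewrite mulr1.
have rz : r z z = 0.
  apply/eqP; rewrite eq_le r_ge0// andbT; apply/ler_addgt0Pr => eps eps0; rewrite add0r.
  have [|m [hm pm bm]] := zb (eps / 4); first by rewrite divr_gt0.
  have [py _ ry] := yP m.
  have : 0 <= r (y m + (y m - z)) (y m + (y m - z)).
    by apply: r_ge0; apply: perpD => //; exact: perpB.
  have : r (y m - z) (y m - z) <= eps / 4.
    move: pm; rewrite pE; have : 0 <= (mu + K) * b (y m - z) (y m - z).
      by rewrite mulr_ge0// ltW.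
    lra.
  rewrite (symbil_sqD rS _ (y m - z)) (symbil_sqB rS) (symbilBr rS).
  move: ry hm; move: (r (y m) (y m)) (r (y m) z) (r z z) (m.+1%:R^-1) => x1 x2 x3 x4; lra.
have bz : 0 < b z z.
  have [|m [hm pm bm]] := zb (1 / 4); first by rewrite divr_gt0.
  have [_ by_ _] := yP m; have := b_ge0 (z - (y m - z)).
  rewrite (symbil_sqB bS z) symbilBr// (symbil_sqB bS (y m)) by_ (bS.1 z (y m)).
  move: bm; rewrite (symbil_sqB bS (y m)) by_; lra.
exists ((Num.sqrt (b z z))^-1 *: z); split; first exact: perpZ.
  by rewrite symbil_sqZ// exprVn sqr_sqrtr ?(ltW bz)// mulVf// gt_eqF.
by rewrite symbil_sqZ// rz mulr0.
Qed.

(** The minimiser lies in the kernel of [r] on the complement, by the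
    Cauchy-Schwarz inequality for [r]; on the previous eigenvectors the
    equation holds by orthogonality. *)
Lemma next_eigenpair : exists Ew : R * V,
  [/\ eigenpair Ew.1 Ew.2, forall i, b Ew.2 (e i) = 0 &
    forall z, (forall i, b z (e i) = 0) -> Ew.1 * b z z <= q z z].
Proof.
have [w [pw bw rw]] := ex_minimizer; exists (mu, w); split=> //=; last first.
  by move=> z pz; have := r_ge0 pz; rewrite subr_ge0.
split=> // z.
pose z' := z - \sum_i b z (e i) *: e i.
have pz' : perp z'.
  move=> i; rewrite /z' symbilB// symbil_sum// (bigD1 i)//= (eE i).1 big1; first by ring.
  by move=> j ji; rewrite eO ?mulr0.
have : r w z' = 0.
  apply/eqP; rewrite -sqrf_eq0 eq_le sqr_ge0 andbT -[leRHS](mul0r (r z' z')) -rw.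
  by apply: symbil_CS => // s t; apply: r_ge0; apply: perpP => //; exact: perpZ.
have -> : z = z' + \sum_i b z (e i) *: e i by rewrite subrK.
rewrite (symbilDr qS) (symbilDr bS) (symbil_sumr qS) (symbil_sumr bS) /r => /eqP; rewrite subr_eq0 => /eqP ->.
rewrite [X in _ + X = _]big1 => [|i _]; last first.
  by rewrite qS.1 (eE i).2 (bS.1 (e i)) pw !mulr0.
by rewrite big1 => [|i _]; rewrite ?pw ?mulr0// !addr0.
Qed.

End next_eigenpair.

(** The eigenpairs are found one after the other: the next one minimises the
    Rayleigh quotient on the orthogonal complement of the previous ones. *)
Lemma spectral : exists (E : nat -> R) (e : nat -> V),
  [/\ forall i j, b (e i) (e j) = (i == j)%:R,
      forall i w, q (e i) w = E i * b (e i) w,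
      {homo E : m n / (m <= n)%N >-> m <= n},
      forall n w, (forall i, (i < n)%N -> b w (e i) = 0) -> E n * b w w <= q w w &
      forall M, exists n, M < E n].
Proof.
pose nxt n (f : nat -> R * V) Ew := [/\ eigenpair Ew.1 Ew.2,
  forall i, (i < n)%N -> b Ew.2 (f i).2 = 0 &
  forall z, (forall i, (i < n)%N -> b z (f i).2 = 0) -> Ew.1 * b z z <= q z z].
pose good n (f : nat -> R * V) := forall i, (i < n)%N -> nxt i f (f i).
have goodP n f : good n f -> exists Ew, nxt n f Ew.
  move=> gf; have [| |Ew [h1 h2 h3]] := @next_eigenpair n (fun i => (f i).2) (fun i => (f i).1).
  - by move=> i; case: (gf i).
  - move=> i j; case: (ltngtP i j) => // [ij _|ji _|/val_inj->]; last by rewrite eqxx.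
      by rewrite bS.1; have [_ -> //] := gf j (ltn_ord j).
    by have [_ -> //] := gf i (ltn_ord i).
  exists Ew; split=> // [i ni|z zi]; first exact: (h2 (Ordinal ni)).
  by apply: h3 => i; exact: zi.
have /choice[F FP] : forall nf : nat * (nat -> R * V),
    exists Ew, good nf.1 nf.2 -> nxt nf.1 nf.2 Ew.
  move=> [n f] /=.
  have [gf|ngf] := pselect (good n f); last by exists (0, 0).
  by have [Ew h] := goodP _ _ gf; exists Ew.
pose s := fix s n := if n is m.+1 then rcons (s m) (F (m, nth (0, 0) (s m))) else [::].
pose f n := F (n, nth (0, 0) (s n)).
have size_s n : size (s n) = n by elim: n => //= n IH; rewrite size_rcons IH.
have nth_s n i : (i < n)%N -> nth (0, 0) (s n) i = f i.
  elim: n => // n IH; rewrite ltnS leq_eqVlt /= nth_rcons size_s.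
  case/predU1P => [->|ni]; first by rewrite ltnn eqxx.
  by rewrite ni IH.
have nxt_ext n g g' Ew : (forall i, (i < n)%N -> g i = g' i) -> nxt n g Ew -> nxt n g' Ew.
  move=> gg' [h1 h2 h3]; split=> // [i ni|z zi]; first by rewrite -gg'// h2.
  by apply: h3 => i ni; rewrite gg'// zi.
have good_s n : good n (nth (0, 0) (s n)).
  elim: n => // n IH i; rewrite ltnS leq_eqVlt => /predU1P[->|ni].
    rewrite nth_s//; apply: nxt_ext (FP (n, _) IH) => j jn /=.
    by rewrite nth_rcons size_s (jn : (j < n)%N).
  have ni1 : (i < n.+1)%N by exact: ltnW.
  have := IH _ ni; rewrite nth_s// (nth_s _ _ ni1); apply: nxt_ext => j ji.
  by rewrite (nth_s _ _ (ltn_trans ji ni1)) nth_s// (ltn_trans ji).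
have fP n : nxt n f (f n).
  by apply: nxt_ext (FP (n, _) (good_s n)) => i ni /=; rewrite nth_s.
have fO i j : b (f i).2 (f j).2 = (i == j)%:R.
  case: (ltngtP i j) => [ij|ji|->]; last by case: (fP j) => -[].
  - by rewrite bS.1; case: (fP j) => _ ->.
  - by case: (fP i) => _ ->.
exists (fun n => (f n).1), (fun n => (f n).2); split=> //.
- by move=> i w; case: (fP i) => -[].
- apply: homo_leq => // [x y z|n]; first exact: le_trans.
  have [[bn qn] on _] := fP n.+1; have [_ _ /(_ (f n.+1).2)] := fP n.
  rewrite qn bn !mulr1; apply=> i ni; apply: on; exact: ltnW.
- by move=> n w wn; case: (fP n) => _ _; apply.
move=> M; apply: contrapT => nM.
have fM n : (f n).1 <= M by rewrite leNgt; apply/negP => Mn; apply: nM; exists n.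
have MK : 1 <= M + K.
  have [[b0 q0] _ _] := fP 0; have := coercive (f 0).2.
  by rewrite /p q0 b0; have := fM 0; lra.
have MK0 : 0 < M + K by exact: lt_le_trans MK.
have [|k [l [lP lb bl]]] := compact (e := (2 * (M + K))^-1).
  by rewrite invr_gt0 mulr_gt0.
have [c [j cj] cA] := ex_kernel (fun j i => l i (f (val j)).2) (ltnSn k).
set u := \sum_(j < k.+1) c j *: (f j).2.
have bu : b u u = \sum_j c j ^+ 2.
  rewrite symbil_sum//; apply: eq_bigr => i _; rewrite symbil_sumr//.
  rewrite (bigD1 i)//= fO eqxx big1 => [|i' i'i]; first by rewrite addr0 mulr1 expr2.
  by rewrite fO eq_sym (negbTE (i'i : (i' != i :> nat))) mulr0.
have qu : q u u <= M * b u u.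
  rewrite bu symbil_sum// mulr_sumr; apply: ler_sum => i _; rewrite symbil_sumr//.
  rewrite (bigD1 i)//= big1 => [|i' i'i]; last first.
    by case: (fP i) => -[_ ->] _ _; rewrite fO eq_sym (negbTE (i'i : (i' != i :> nat))) !mulr0.
  case: (fP i) => -[bi ->] _ _; rewrite bi addr0 mulr1 mulrA -expr2 mulrC.
  by rewrite ler_wpM2r ?sqr_ge0.
have lu i : l i u = 0.
  rewrite -(cA i) /u; elim/big_rec2: _ => [|i' x y _ <-]; last by rewrite lP.
  have := lP i 0 0 0; rewrite scale0r mul0r !add0r => h.
  by have := lP i (- 1) 0 0; rewrite scaler0 add0r mulN1r addNr.
have bu0 : 0 < b u u.
  rewrite bu (bigD1 j)//= ltr_pwDl ?sumr_ge0// => [|i _]; last exact: sqr_ge0.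
  by rewrite exprn_even_gt0.
have := bl u; rewrite big1 => [|i _]; last by rewrite lu expr0n.
by rewrite addr0 ler_pdivlMl ?mulr_gt0// /p; have := mulr_gt0 MK0 bu0; lra.
Qed.

End spectral.

(** * Square-integrable functions *)

Section square_integrable.
Context d {T : measurableType d} {R : realType}.
Variables (mu : {measure set T -> \bar R}) (D : set T).
Hypothesis mD : measurable D.
Implicit Types f g h : T -> R.

Definition sqint : set (T -> R) := [set f : T -> R |
  measurable_fun D f /\ (\int[mu]_(x in D) (f x ^+ 2)%:E < +oo)%E].

Definition ip f g : R := \int[mu]_(x in D) (f x * g x).

Lemma ipC f g : ip f g = ip g f.
Proof. by apply: eq_Rintegral => x _; rewrite mulrC. Qed.

Lemma sqint_integrable2 f : sqint f -> mu.-integrable D (fun x => (f x ^+ 2)%:E).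
Proof.
move=> [mf f2]; apply/integrableP; split.
  by apply/measurable_EFinP; exact: measurable_funX.
by under eq_integral do rewrite gee0_abs ?lee_fin ?sqr_ge0//.
Qed.

Lemma sqint_integrableM f g : sqint f -> sqint g ->
  mu.-integrable D (fun x => (f x * g x)%:E).
Proof.
move=> sf sg; apply: (@le_integrable _ _ _ _ _ mD _
    (fun x => (f x ^+ 2)%:E + (g x ^+ 2)%:E)%E).
- by apply/measurable_EFinP; apply: measurable_funM; [case: sf|case: sg].
- move=> x Dx; rewrite -EFinD /= lee_fin [leRHS]ger0_norm ?addr_ge0 ?sqr_ge0//.
  rewrite ler_norml; have := sqr_ge0 (f x + g x); have := sqr_ge0 (f x - g x).
  have := sqr_ge0 (f x); have := sqr_ge0 (g x).
  by move=> *; apply/andP; split; lra.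
- by apply: integrableD => //; exact: sqint_integrable2.
Qed.

Lemma sqint_int f : sqint f -> (\int[mu]_(x in D) (f x ^+ 2)%:E)%E = (ip f f)%:E.
Proof.
move=> sf; rewrite /ip /Rintegral fineK; last first.
  by apply: integrable_fin_num => //; under eq_fun do rewrite -expr2; exact: sqint_integrable2.
by apply: eq_integral => x _; rewrite expr2.
Qed.

Lemma sqint0 : sqint (0 : T -> R).
Proof.
split; first exact: measurable_cst.
by rewrite integral0_eq// => x _; rewrite expr0n.
Qed.

Lemma sqintP a f g : sqint f -> sqint g -> sqint (a *: f + g).
Proof.
move=> sf sg; have mf := sf.1; have mg := sg.1; split.
  by apply: measurable_funD => //; apply: measurable_funM.
have : mu.-integrable D (fun x => (a * a)%:E * (f x * f x)%:E +
    ((2 * a)%:E * (f x * g x)%:E + (g x * g x)%:E))%E.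
  apply: integrableD => //; last apply: integrableD => //.
  - by apply: integrableZl => //; exact: sqint_integrableM.
  - by apply: integrableZl => //; exact: sqint_integrableM.
  - exact: sqint_integrableM.
move/integrable_lty => /(_ mD); congr (_ < _)%E; apply: eq_integral => x _.
by rewrite -!EFinM -!EFinD; congr EFin; rewrite /= !fctE /GRing.scale/=; ring.
Qed.

Lemma sqintD f g : sqint f -> sqint g -> sqint (f + g).
Proof. by move=> sf sg; rewrite -[f]scale1r; exact: sqintP. Qed.

Lemma sqintZ a f : sqint f -> sqint (a *: f).
Proof. by move=> sf; rewrite -[_ *: f]addr0; apply: sqintP => //; exact: sqint0. Qed.

Lemma sqintB f g : sqint f -> sqint g -> sqint (f - g).
Proof. by move=> sf sg; rewrite addrC -scaleN1r; exact: sqintP. Qed.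

Lemma ip_linear a f g h : sqint f -> sqint g -> sqint h ->
  ip (a *: f + g) h = a * ip f h + ip g h.
Proof.
move=> sf sg sh; rewrite /ip -RintegralZl//; last exact: sqint_integrableM.
rewrite -RintegralD//.
- by apply: eq_Rintegral => x _; rewrite !fctE /GRing.scale/=; ring.
- rewrite /comp; under eq_fun do rewrite EFinM.
  by apply: integrableZl => //; exact: sqint_integrableM.
- exact: sqint_integrableM.
Qed.

Lemma ipD f g h : sqint f -> sqint g -> sqint h -> ip (f + g) h = ip f h + ip g h.
Proof. by move=> sf sg sh; rewrite -[f]scale1r ip_linear// mul1r scale1r. Qed.

Lemma ipZ a f h : sqint f -> sqint h -> ip (a *: f) h = a * ip f h.
Proof.
move=> sf sh; rewrite -[_ *: f]addr0 ip_linear//; last exact: sqint0.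
rewrite [X in _ + X](_ : _ = 0) ?addr0// /ip (eq_Rintegral _ (g := cst 0)) ?Rintegral_cst ?mul0r//.
by move=> x _; rewrite mul0r.
Qed.

Lemma ipB f g h : sqint f -> sqint g -> sqint h -> ip (f - g) h = ip f h - ip g h.
Proof. by move=> sf sg sh; rewrite addrC -scaleN1r ip_linear// mulN1r addrC. Qed.

Lemma ip_ge0 f : 0 <= ip f f.
Proof. by apply: Rintegral_ge0 => x _; rewrite -expr2 sqr_ge0. Qed.

Lemma ip_CS f g : sqint f -> sqint g -> ip f g ^+ 2 <= ip f f * ip g g.
Proof.
move=> sf sg; apply: quadratic_disc => s t.
have := ip_ge0 (s *: f + t *: g).
have h1 := sqintZ s sf; have h2 := sqintZ t sg; have h3 := sqintP s sf h2.
rewrite ip_linear// ipZ// (ipC f) (ipC g) !ip_linear// !ipZ// (ipC g f); lra.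
Qed.

Lemma ip_sqD f g : sqint f -> sqint g ->
  ip (f + g) (f + g) = ip f f + 2 * ip f g + ip g g.
Proof.
move=> sf sg; have h := sqintD sf sg.
rewrite ipD// (ipC f) (ipC g) !ipD// (ipC g f); ring.
Qed.

Lemma ip_sqB f g : sqint f -> sqint g ->
  ip (f - g) (f - g) = ip f f - 2 * ip f g + ip g g.
Proof.
move=> sf sg; have h := sqintB sf sg.
rewrite ipB// (ipC f) (ipC g) !ipB// (ipC g f); ring.
Qed.

Lemma ip_sqD_le f g : sqint f -> sqint g ->
  ip (f + g) (f + g) <= 2 * ip f f + 2 * ip g g.
Proof.
move=> sf sg; have := ip_ge0 (f - g).
rewrite ip_sqB// ip_sqD//; lra.
Qed.

Lemma ip_eq0 f : sqint f -> ip f f = 0 -> {ae mu, forall x, D x -> f x = 0}.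
Proof.
move=> sf f0.
have mf2 : measurable_fun D (fun x => (f x ^+ 2)%:E).
  by apply/measurable_EFinP; apply: measurable_funX; case: sf.
have := ae_eq_integral_abs mu mD mf2.
under eq_integral do rewrite gee0_abs ?lee_fin ?sqr_ge0//.
rewrite sqint_int// f0 => -[/(_ erefl) + _].
apply: filterS => x /= h Dx; have [/eqP] := h Dx.
by rewrite sqrf_eq0 => /eqP.
Qed.

Lemma ip_ae f f' g g' : measurable_fun D f -> measurable_fun D f' ->
  measurable_fun D g -> measurable_fun D g' ->
  {ae mu, forall x, D x -> f x = f' x} -> {ae mu, forall x, D x -> g x = g' x} ->
  ip f g = ip f' g'.
Proof.
move=> mf mf' mg mg' ff' gg'; rewrite /ip /Rintegral; congr fine.
apply: ae_eq_integral => //; try by apply/measurable_EFinP; apply: measurable_funM.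
by move: ff' gg'; apply: filterS2 => x fx gx Dx /=; rewrite fx// gx.
Qed.

Lemma bounded_sqint f (M : R) : (mu D < +oo)%E -> measurable_fun D f ->
  (forall x, D x -> `|f x| <= M) -> sqint f.
Proof.
move=> muD mf fM; split=> //.
apply: (@le_lt_trans _ _ (\int[mu]_(x in D) (M ^+ 2)%:E)%E).
  apply: ge0_le_integral => //.
  - by move=> x _; rewrite lee_fin sqr_ge0.
  - by apply/measurable_EFinP; exact: measurable_funX.
  - move=> x Dx; have := fM x Dx; rewrite ler_norml => /andP[h1 h2].
    by rewrite lee_fin -subr_ge0 subr_sqr mulr_ge0//; lra.
by rewrite integral_cst// lte_mul_pinfty// lee_fin sqr_ge0.
Qed.

End square_integrable.

Section riesz_fischer.
Context d {T : measurableType d} {R : realType}.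
Variables (mu : {measure set T -> \bar R}) (D : set T).
Hypothesis mD : measurable D.

Lemma sum_abs_cvg (a : nat -> R) :
    (\sum_(k <oo) (2 ^+ k * a k ^+ 2)%:E < +oo)%E ->
  cvgn (fun n => \sum_(0 <= k < n) a k).
Proof.
set H := (\sum_(k <oo) _)%E => Hoo.
have H0 : (0 <= H)%E.
  by apply: nneseries_ge0 => n _ _; rewrite lee_fin mulr_ge0 ?sqr_ge0 ?exprn_ge0.
have HE : H = (fine H)%:E by rewrite fineK// ge0_fin_numE.
apply: normed_cvg; apply: nondecreasing_is_cvgn.
  by apply: nondecreasing_series => k _ _; exact: normr_ge0.
exists (fine H + 2) => _ [n _ <-]; rewrite /series/=.
apply: (@le_trans _ _ (\sum_(0 <= k < n) (2 ^+ k * a k ^+ 2) + \sum_(0 <= k < n) (1 / 2 ^+ k))).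
  rewrite -big_split/=; apply: ler_sum => k _.
  set t : R := 2 ^+ k; have t0 : 0 < t by rewrite exprn_gt0.
  have : 0 <= (t * `|a k| - 1) ^+ 2 by exact: sqr_ge0.
  have -> : t * a k ^+ 2 = t * `|a k| ^+ 2 by rewrite real_normK// num_real.
  move=> h; have e : t * `|a k| <= t * (t * `|a k| ^+ 2) + 1.
    have : 0 <= (t * `|a k|) ^+ 2 by exact: sqr_ge0.
    by rewrite !expr2 in h *; have := normr_ge0 (a k); nra.
  rewrite -(ler_pM2l t0) mulrDr mul1r mulfV ?gt_eqF//.
apply: lerD.
  rewrite -lee_fin -HE -sumEFin; apply: nneseries_lim_ge => k _ _.
  by rewrite lee_fin mulr_ge0 ?sqr_ge0 ?exprn_ge0.
have -> : \sum_(0 <= k < n) (1 / 2 ^+ k) = 2 - 2 / 2 ^+ n :> R.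
  elim: n => [|n IH]; first by rewrite big_nil expr0 divr1 subrr.
  rewrite big_nat_recr//= IH exprS; field.
  by rewrite expf_neq0.
by rewrite lerBlDr lerDl divr_ge0 ?exprn_ge0.
Qed.

(** The squares of the increments, with the weights [2 ^ k], have a summable
    integral; hence they are summable almost everywhere, and so are the increments
    themselves. *)
Lemma fast_cauchy_ae_cvg (g : nat -> T -> R) : (forall n, sqint mu D (g n)) ->
    (forall k, ip mu D (g k.+1 - g k) (g k.+1 - g k) <= (4 ^+ k)^-1) ->
  {ae mu, forall x, D x -> cvgn (fun n => g n x)}.
Proof.
move=> sg dg.
pose h k x : \bar R := (2 ^+ k * (g k.+1 x - g k x) ^+ 2)%:E.
have h0 k x : D x -> (0 <= h k x)%E.
  by move=> _; rewrite lee_fin mulr_ge0 ?sqr_ge0 ?exprn_ge0.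
have mg k : measurable_fun D (g k) by case: (sg k).
have mh k : measurable_fun D (h k).
  apply/measurable_EFinP; apply: measurable_funM => //; apply: measurable_funX.
  exact: measurable_funB.
have int_h : (\int[mu]_(x in D) \sum_(k <oo) h k x < +oo)%E.
  rewrite integral_nneseries//.
  apply: (@le_lt_trans _ _ (\sum_(k <oo) ((2 / (2 ^ (k + 1))%:R)%:E))%E); last first.
    have /cvg_lim -> // := @cvg_geometric_eseries_half R 2 0; exact: ltry.
  apply: lee_nneseries => k _; first by move=> _; apply: integral_ge0 => x; exact: h0.
  rewrite /h; under eq_integral do rewrite EFinM.
  rewrite ge0_integralZl_EFin//; try by exact: exprn_ge0.
  all: try by move=> x _; rewrite lee_fin sqr_ge0.
  all: try by apply/measurable_EFinP/measurable_funX; exact: measurable_funB.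
  rewrite (sqint_int mD (f := g k.+1 - g k)); last exact: sqintB.
  rewrite -EFinM lee_fin; apply: (@le_trans _ _ (2 ^+ k * (4 ^+ k)^-1)).
    by rewrite ler_pM2l ?exprn_gt0.
  rewrite (_ : 4 = 2 * 2) ?exprMn; last by ring.
  by rewrite natrX addn1 exprS le_eqVlt; apply/orP; left; apply/eqP; field; rewrite expf_neq0.
have /integrable_ae : mu.-integrable D (fun x => \sum_(k <oo) h k x)%E.
  apply/integrableP; split; first by apply: ge0_emeasurable_sum => [k x Dx _|k _]; [exact: h0|exact: mh].
  move: int_h; congr (_ < _)%E; apply: eq_integral => x /set_mem Dx.
  by rewrite gee0_abs// nneseries_ge0// => k _ _; exact: h0.
move=> /(_ mD); apply: filterS => x hx Dx; have := hx Dx.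
rewrite ge0_fin_numE ?nneseries_ge0//; last by move=> k _ _; exact: h0.
move=> /sum_abs_cvg c.
rewrite (_ : (fun n => g n x) = (fun n => g 0%N x + \sum_(0 <= k < n) (g k.+1 x - g k x))).
  by apply: is_cvgD => //; exact: is_cvg_cst.
by apply/funext => n; rewrite telescope_sumr// addrC subrK.
Qed.

(** A subsequence converging fast enough converges almost everywhere, and
    Fatou's lemma turns its pointwise limit into a limit in mean. *)
Lemma sqint_complete (f : nat -> T -> R) : (forall n, sqint mu D (f n)) ->
    (forall e, 0 < e -> exists N, forall m n, (N <= m)%N -> (N <= n)%N ->
      ip mu D (f m - f n) (f m - f n) <= e) ->
  exists2 g, sqint mu D g & forall e, 0 < e -> exists N, forall n, (N <= n)%N ->
    ip mu D (f n - g) (f n - g) <= e.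
Proof.
move=> sf cf.
have /choice[N NP] : forall k, exists N, forall m n, (N <= m)%N -> (N <= n)%N ->
    ip mu D (f m - f n) (f m - f n) <= (4 ^+ k)^-1.
  by move=> k; apply: cf; rewrite invr_gt0 exprn_gt0.
pose M k := (\sum_(j < k.+1) N j)%N.
have NM k : (N k <= M k)%N by rewrite /M big_ord_recr/= leq_addl.
have MM k : (M k <= M k.+1)%N by rewrite /M [leqRHS]big_ord_recr/= leq_addr.
pose g k := f (k + M k)%N.
have mf n : measurable_fun D (f n) by case: (sf n).
have mg n : measurable_fun D (g n) by exact: mf.
have /fast_cauchy_ae_cvg : forall n, sqint mu D (g n) by move=> n; exact: sf.
have dg k : ip mu D (g k.+1 - g k) (g k.+1 - g k) <= (4 ^+ k)^-1.
  apply: NP; first by rewrite (leq_trans (NM k))// (leq_trans (MM k))// leq_addl.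
  by rewrite (leq_trans (NM k))// leq_addl.
move=> /(_ dg) cg.
pose F x := fine (limn_esup (fun n => (g n x)%:E)).
have mF : measurable_fun D F.
  apply: measurableT_comp => //; apply: measurable_fun_limn_esup => n.
  apply/measurable_EFinP; exact: mf.
have gF : {ae mu, forall x, D x -> g n x @[n --> \oo] --> F x}.
  apply: filterS cg => x cx Dx; have {}cx := cx Dx.
  rewrite /F; have /cvg_limn_einf_sup[_ ->] : (g n x)%:E @[n --> \oo] --> (limn (fun n => g n x))%:E.
    by apply/cvg_EFin => //; exact: nearW.
  by [].
have FB e n : (exists N, forall m, (N <= m)%N -> ip mu D (f n - f m) (f n - f m) <= e) ->
    (\int[mu]_(x in D) ((f n x - F x) ^+ 2)%:E <= e%:E)%E.
  move=> [N0 N0P].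
  apply: (@le_trans _ _ (\int[mu]_(x in D) limn_einf (fun k => ((f n x - g k x) ^+ 2)%:E))%E).
    apply: ae_ge0_le_integral => //.
    - by move=> x _; rewrite lee_fin sqr_ge0.
    - by apply/measurable_EFinP/measurable_funX; exact: measurable_funB.
    - move=> x _; rewrite limn_einf_lim; apply: lime_ge; first exact: is_cvg_einfs.
      apply: nearW => k; apply: le_ereal_inf_tmp => _ [j _ <-].
      by rewrite lee_fin sqr_ge0.
    - under eq_fun do rewrite -[limn_einf _]oppeK -limn_esupN.
      apply: measurableT_comp; first exact: oppe_measurable.
      apply: measurable_fun_limn_esup => k.
      apply: measurableT_comp; first exact: oppe_measurable.
      by apply/measurable_EFinP/measurable_funX; exact: measurable_funB.
    apply: filterS gF => x gFx Dx; have {}gFx := gFx Dx.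
    have /cvg_limn_einf_sup[-> _] // : ((f n x - g k x) ^+ 2)%:E @[k --> \oo] --> ((f n x - F x) ^+ 2)%:E.
    apply/cvg_EFin; first exact: nearW.
    rewrite expr2 /=; under eq_fun do rewrite expr2.
    by apply: cvgM; apply: cvgB => //; exact: cvg_cst.
  apply: le_trans.
    apply: fatou => //.
    - by move=> k; apply/measurable_EFinP/measurable_funX; exact: measurable_funB.
    - by move=> k x _; rewrite lee_fin sqr_ge0.
  rewrite limn_einf_lim; apply: lime_le; first exact: is_cvg_einfs.
  apply: nearW => k; apply: ge_ereal_inf.
  exists (\int[mu]_(x in D) ((f n x - g (k + N0)%N x) ^+ 2)%:E)%E.
    by exists (k + N0)%N => //=; rewrite leq_addr.
  rewrite (sqint_int mD (f := f n - g (k + N0)%N)); last by apply: sqintB => //; exact: sf.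
  by rewrite lee_fin; apply: N0P; rewrite -addnA addnCA leq_addr.
have [N1 N1P] := cf 1 ltr01.
have sfF : sqint mu D (f N1 - F).
  split; first exact: measurable_funB.
  apply: le_lt_trans (FB 1 N1 _) _; last exact: ltry.
  by exists N1 => m Nm; exact: N1P.
have sF : sqint mu D F.
  rewrite (_ : F = f N1 - (f N1 - F)); first exact: sqintB.
  by rewrite opprB addrC subrK.
exists F => // e e0; have [N0 N0P] := cf e e0; exists N0 => n Nn.
rewrite -lee_fin -sqint_int//; last exact: sqintB.
by apply: FB; exists N0 => m Nm; exact: N0P.
Qed.

End riesz_fischer.

(** * Lebesgue measure on the plane *)

Section affine_change_of_variables.
Context {R : realType}.
Local Notation mu := (@lebesgue_measure R).
Local Notation mR := (measurableTypeR R).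

Let mphi (a b : R) : measurable_fun [set: mR] (fun x : mR => (a * x + b : mR)).
Proof. by apply: measurable_funD => //; apply: measurable_funM. Qed.

Let push (a b : R) : {measure set mR -> \bar R} :=
  measure_function_pushforward__canonical__measure_function_Measure mu (mphi a b).

Let lebesgue_affine (a b : R) (a0 : a != 0) (A : set mR) : measurable A ->
  mu A = mscale (NngNum (normr_ge0 a)) (push a b) A.
Proof.
move=> mA; apply: lebesgue_measure_unique => // _ [[c d]] _ <-.
change (mu `]c, d] = (`|a|%:E * mu ((fun x : mR => (a * x + b)%R : mR) @^-1` `]c, d]))%E).
have [a1|a1] := ltP 0 a.
  rewrite (_ : _ @^-1` _ = `](c - b) / a, (d - b) / a]%classic); last first.
    apply/seteqP; split=> x /=; rewrite !in_itv/=;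
      by rewrite ltr_pdivrMr// ler_pdivlMr// mulrC ltrBlDr lerBrDr.
  rewrite !lebesgue_measure_itv/= !lte_fin ltr_pM2r ?invr_gt0// ltrD2r.
  case: ifPn => _; last by rewrite mule0.
  rewrite -!EFinB -EFinM; congr EFin; rewrite gtr0_norm//; field.
  by rewrite gt_eqF.
have {}a1 : a < 0 by rewrite lt_neqAle a0.
rewrite (_ : _ @^-1` _ = `[(d - b) / a, (c - b) / a[%classic); last first.
  apply/seteqP; split=> x /=; rewrite !in_itv/=;
    by rewrite ltr_ndivlMr// ler_ndivrMr// mulrC ltrBlDr lerBrDr andbC.
rewrite !lebesgue_measure_itv/= !lte_fin ltr_nM2r ?invr_lt0// ltrD2r.
case: ifPn => _; last by rewrite mule0.
by rewrite -!EFinB -EFinM; congr EFin; rewrite ltr0_norm//; field; rewrite lt_eqF.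
Qed.

Lemma ge0_integral_affine (a b : R) (f : mR -> \bar R) : a != 0 ->
    measurable_fun setT f -> (forall x, 0 <= f x)%E ->
  (`|a|%:E * \int[mu]_x f (a * x + b)%R = \int[mu]_x f x)%E.
Proof.
move=> a0 mf f0.
rewrite [RHS](eq_measure_integral (mscale (NngNum (normr_ge0 a)) (push a b))); last first.
  by move=> A mA _; exact: lebesgue_affine.
rewrite ge0_integral_mscale//.
by rewrite (ge0_integral_pushforward (mphi a b)).
Qed.

End affine_change_of_variables.

Section plane_change_of_variables.
Context {R : realType}.
Local Notation mu := (@lebesgue_measure R).
Local Notation mR := (measurableTypeR R).
Implicit Type f : mplane R -> \bar R.

Lemma measurable_fun_slice1 f (g h : R -> R) : measurable_fun setT f ->
  measurable_fun [set: mR] g -> measurable_fun [set: mR] h ->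
  measurable_fun [set: mR] (fun x : mR => f (g x, h x)).
Proof.
move=> mf mg mh; apply: (measurableT_comp mf).
by apply: measurable_fun_pair.
Qed.

Lemma measurable_affine2 (a b c : R) :
  measurable_fun setT (fun z : mplane R => a * z.1 + b * z.2 + c).
Proof.
by do 2 (apply: measurable_funD => //); apply: measurable_funM.
Qed.

Definition affine2 (a1 b1 c1 a2 b2 c2 : R) (z : R * R) : R * R :=
  (a1 * z.1 + b1 * z.2 + c1, a2 * z.1 + b2 * z.2 + c2).

Lemma measurable_affine_plane (a1 b1 c1 a2 b2 c2 : R) :
  measurable_fun setT (affine2 a1 b1 c1 a2 b2 c2 : mplane R -> mplane R).
Proof. by apply: measurable_fun_pair; exact: measurable_affine2. Qed.

Lemma area_swap f : measurable_fun setT f -> (forall z, 0 <= f z)%E ->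
  (\int[area]_z f (z.2, z.1) = \int[area]_z f z)%E.
Proof.
move=> mf f0; have ms : measurable_fun setT (fun z : mplane R => f (z.2, z.1)).
  apply: (measurableT_comp mf); apply: measurable_fun_pair.
    exact: measurable_snd.
  exact: measurable_fst.
have e1 := fubini_tonelli1 (m1 := @lebesgue_measure R) (m2 := @lebesgue_measure R) _ ms (fun z => f0 (z.2, z.1)).
have e2 := fubini_tonelli1 (m1 := @lebesgue_measure R) (m2 := @lebesgue_measure R) _ mf f0.
rewrite /area [LHS]e1 [RHS]e2.
exact: (esym (fubini_tonelli (m1 := @lebesgue_measure R) (m2 := @lebesgue_measure R) f mf f0)).
Qed.

Let area_linear_pivot f (a1 b1 c1 a2 b2 c2 : R) : a1 != 0 -> a1 * b2 - a2 * b1 != 0 ->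
    measurable_fun setT f -> (forall z, 0 <= f z)%E ->
  (`|a1 * b2 - a2 * b1|%:E * \int[area]_z f (affine2 a1 b1 c1 a2 b2 c2 z) =
    \int[area]_z f z)%E.
Proof.
move=> a10 D0 mf f0; set D := a1 * b2 - a2 * b1 in D0 *.
have mfA := measurableT_comp mf (measurable_affine_plane a1 b1 c1 a2 b2 c2).
rewrite /area [in LHS]fubini_tonelli1//= /fubini_F.
rewrite (fubini_tonelli _ mfA)//=.
pose h (z : mplane R) := f (z.1, c2 + (a2 / a1) * (z.1 - c1) + (D / a1) * z.2).
have mh : measurable_fun setT h.
  rewrite (_ : h = fun z => f (affine2 1 0 0 (a2 / a1) (D / a1) (c2 - (a2 / a1) * c1) z)).
    exact: (measurableT_comp mf (measurable_affine_plane _ _ _ _ _ _)).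
  by apply/funext => -[x y]; rewrite /h /affine2/=; congr (f (_, _)); ring.
have h0 z : (0 <= h z)%E by exact: f0.
have step1 y : (\int[mu]_x f (affine2 a1 b1 c1 a2 b2 c2 (x, y)) =
    `|a1|^-1%:E * \int[mu]_x h (x, y))%E.
  rewrite -(ge0_integral_affine (b1 * y + c1) a10 (f := fun x => h (x, y)))//; last first.
    by apply: (measurable_fun_slice1 mh).
  rewrite muleA -EFinM mulVf ?normr_eq0// mul1e; apply: eq_integral => x _.
  by rewrite /h /affine2/=; congr (f (_, _)); [ring|rewrite /D; field].
under eq_integral do rewrite step1.
rewrite ge0_integralZl_EFin//; last 2 first.
- by move=> y _; apply: integral_ge0.
- exact: (measurable_fun_fubini_tonelli_G _ mh).
rewrite -(fubini_tonelli _ mh)// muleA -EFinM.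
rewrite -ge0_integralZl_EFin//; last 2 first.
- by move=> y _; apply: integral_ge0.
- exact: (measurable_fun_fubini_tonelli_F _ mh).
rewrite [RHS]fubini_tonelli1//=; apply: eq_integral => x _.
rewrite /fubini_F -normfV -normrM /h/=.
have Da0 : D / a1 != 0 by rewrite mulf_neq0 ?invr_eq0.
rewrite -[RHS](ge0_integral_affine (c2 + a2 / a1 * (x - c1)) Da0)//.
  by under eq_integral do rewrite addrC.
by apply: (measurable_fun_slice1 mf).
Qed.

(** Tonelli's theorem reduces a linear map with nonzero pivot to two affine maps
    of the line; exchanging the coordinates covers a vanishing pivot. *)
Lemma area_linear f (a1 b1 c1 a2 b2 c2 : R) : a1 * b2 - a2 * b1 != 0 ->
    measurable_fun setT f -> (forall z, 0 <= f z)%E ->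
  (`|a1 * b2 - a2 * b1|%:E * \int[area]_z f (affine2 a1 b1 c1 a2 b2 c2 z) =
    \int[area]_z f z)%E.
Proof.
move=> D0 mf f0; have [a10|a10] := eqVneq a1 0; last exact: area_linear_pivot.
rewrite -[RHS]area_swap//.
have a20 : a2 != 0 by apply: contra_neq D0 => ->; rewrite a10; ring.
have mg : measurable_fun setT (fun z : mplane R => f (z.2, z.1)).
  apply: (measurableT_comp mf); apply: measurable_fun_pair.
    exact: measurable_snd.
  exact: measurable_fst.
have D0' : a2 * b1 - a1 * b2 != 0 by rewrite -oppr_eq0 opprB.
by rewrite -(area_linear_pivot c2 c1 a20 D0' mg)//= distrC.
Qed.

End plane_change_of_variables.

Section plane_measurability.
Context {R : realType}.

(** An open set is the countable union of the rational squares that it contains. *)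
Lemma open_measurable_plane (U : set (R * R)) : open U ->
  measurable (U : set (mplane R)).
Proof.
move=> oU.
pose B (p : rat * rat * nat) : set (R * R) :=
  ball (ratr p.1.1 : R) p.2.+1%:R^-1 `*` ball (ratr p.1.2 : R) p.2.+1%:R^-1.
have -> : U = \bigcup_p (if `[< B p `<=` U >] then B p else set0).
  apply/seteqP; split=> [[x y] Uxy|z [p _]]; last by case: asboolP => // + Bz; apply.
  move: oU; rewrite openE => /(_ _ Uxy) /nbhs_ballP[e /= e0 eU].
  have e20 : 0 < e / 2 by rewrite divr_gt0.
  have [n] := ltr_add_invr e20; rewrite add0r => ne.
  have n0 : 0 < n.+1%:R^-1 :> R by rewrite invr_gt0.
  have rat_near (t : R) : exists r : rat, `|ratr r - t| < n.+1%:R^-1.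
    have [|r] := @rat_in_itvoo R (t - n.+1%:R^-1) (t + n.+1%:R^-1).
      by rewrite ltrBlDr -addrA ltrDl addr_gt0.
    rewrite in_itv/= => /andP[r1 r2]; exists r.
    by rewrite ltr_norml; move: (n.+1%:R^-1) r1 r2 => ?? ?; apply/andP; split; lra.
  have [r1 r1x] := rat_near x; have [r2 r2y] := rat_near y.
  exists (r1, r2, n) => //; rewrite asboolT//=.
  move=> [x' y'] [/= h1 h2]; apply: eU; split=> /=; rewrite /ball/= in h1 h2 *.
    rewrite (_ : x - x' = (ratr r1 - x') - (ratr r1 - x)); last by ring.
    by apply: le_lt_trans (ler_normB _ _) _; move: (n.+1%:R^-1) h1 h2 r1x r2y ne => ??????; lra.
  rewrite (_ : y - y' = (ratr r2 - y') - (ratr r2 - y)); last by ring.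
  by apply: le_lt_trans (ler_normB _ _) _; move: (n.+1%:R^-1) h1 h2 r1x r2y ne => ??????; lra.
apply: countable_bigcupT_measurable; first exact: countableP.
move=> p; case: asboolP => // _.
by apply: measurableX; apply: open_measurable; exact: ball_open.
Qed.

Lemma continuous_measurable_plane (f : R * R -> R) : continuous f ->
  measurable_fun setT (f : mplane R -> R).
Proof.
move=> /continuousP cf; apply: (measurability _ (RGenOpens.measurableE R)).
move=> _ [_ [a [b ->] <-]]; rewrite setTI; apply: open_measurable_plane.
exact/cf/interval_open.
Qed.

End plane_measurability.

(** * Functions with continuous partial derivatives *)

Section C1_functions.
Context {R : realType}.
Implicit Types (f : R * R -> R) (g : bool -> R * R -> R) (x d : R * R).

Definition ray x d (t : R) : R * R := (x.1 + t * d.1, x.2 + t * d.2).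

Lemma ray0 x d : ray x d 0 = x.
Proof. by case: x => a b; rewrite /ray !mul0r !addr0. Qed.

Lemma ray_shift x d s t : ray (ray x d s) d t = ray x d (s + t).
Proof. by rewrite /ray/=; congr pair; ring. Qed.

(** A function together with its gradient; the derivative is taken along
    lines, the form in which the fundamental theorem of calculus uses it. *)
Definition C1 f g : Prop := [/\ continuous f, forall b, continuous (g b) &
  forall x d, is_derive (0 : R) (1 : R) (fun t => f (ray x d t))
    (g true x * d.1 + g false x * d.2)].

Lemma is_derive_cvg (f : R -> R) (a l : R) :
  h^-1 * (f (h + a) - f a) @[h --> 0^'] --> l -> is_derive a 1 f l.
Proof.
move=> fl; have e : (fun h : R => h^-1 *: ((f \o shift a) (h *: (1 : R)) - f a)) =
    (fun h => h^-1 * (f (h + a) - f a)).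
  by apply/funext => h; rewrite /= /GRing.scale/= mulr1.
apply: DeriveDef; first by rewrite /derivable e; apply/cvg_ex; exists l.
by rewrite /derive e; exact: cvg_lim.
Qed.

Lemma cvg_is_derive (f : R -> R) (a l : R) : is_derive a 1 f l ->
  h^-1 * (f (h + a) - f a) @[h --> 0^'] --> l.
Proof.
move=> [fa <-]; have := @derivable_nbhs; move: fa; rewrite /derivable /derive.
have e : (fun h : R => h^-1 *: ((f \o shift a) (h *: (1 : R)) - f a)) =
    (fun h => h^-1 * (f (h + a) - f a)).
  by apply/funext => h; rewrite /= /GRing.scale/= mulr1.
by rewrite e.
Qed.

Lemma C1_line f g x d (t : R) : C1 f g ->
  is_derive t (1 : R) (fun s => f (ray x d s)) (g true (ray x d t) * d.1 + g false (ray x d t) * d.2).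
Proof.
move=> [_ _ /(_ (ray x d t) d)/cvg_is_derive h]; apply: is_derive_cvg; move: h.
apply: cvg_trans; apply: near_eq_cvg; near=> h.
by rewrite !ray_shift !addr0 (addrC h).
Unshelve. all: by end_near. Qed.

Lemma MVT_between (f df : R -> R) (a b : R) : (forall s : R, is_derive s (1 : R) f (df s)) ->
  exists2 c, `|c - a| <= `|b - a| & f b - f a = df c * (b - a).
Proof.
move=> fd; have cf : continuous f.
  by move=> s; apply: differentiable_continuous; apply/derivable1_diffP; case: (fd s).
have [ab|ba] := leP a b.
  have [|c] := MVT_segment ab (fun s _ => fd s).
    exact: continuous_subspaceT.
  rewrite in_itv/= => /andP[ac cb] e; exists c => //.
  by rewrite !ger0_norm ?subr_ge0// lerB.
have [|c] := MVT_segment (ltW ba) (fun s _ => fd s).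
  exact: continuous_subspaceT.
rewrite in_itv/= => /andP[ac cb] e; exists c.
  by rewrite distrC (distrC b) !ger0_norm ?subr_ge0 ?(ltW ba)// lerB.
by rewrite -opprB e -mulrN opprB.
Qed.

Lemma partial_is_derive f (y : R * R) (b : bool) :
  derivable f y (if b then dirx else diry) ->
  is_derive (0 : R) (1 : R) (fun t => f (ray y (if b then dirx else diry) t)) (partial b f y).
Proof.
move=> df; apply: is_derive_cvg.
have e : (fun h : R => h^-1 *: ((f \o shift y) (h *: (if b then dirx else diry)) - f y)) =
  (fun h => h^-1 * (f (ray y (if b then dirx else diry) (h + 0)) -
     f (ray y (if b then dirx else diry) 0))).
  apply/funext => h; rewrite ray0 addr0 /=; congr (_ * (f _ - _)).
  by case: b {df}; rewrite /ray /dirx /diry; apply/eqP; rewrite -pair_eqE /=; apply/andP; split;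
    rewrite /GRing.scale /= addrC.
move: df; rewrite /partial /derivable /derive e.
by case: b {e}.
Qed.

Lemma C1_partial f g b : C1 f g -> partial b f = g b.
Proof.
move=> [_ _ fg]; apply/funext => y.
have /cvg_is_derive h := fg y (if b then dirx else diry).
rewrite /partial /derive; apply: cvg_lim => //.
have -> : g b y = g true y * (if b then dirx else diry).1 + g false y * (if b then dirx else diry).2.
  by case: b {h} => /=; rewrite mulr1 mulr0 ?addr0 ?add0r.
apply: cvg_trans h; apply: near_eq_cvg; near=> t; rewrite ray0 addr0 /=.
congr (_ * (f _ - _)).
by case: b; rewrite /ray /dirx /diry; apply/eqP; rewrite -pair_eqE /=; apply/andP; split;
    rewrite /GRing.scale /= addrC.
Unshelve. all: by end_near. Qed.

(** The increment along a line is split into the two sides of a rectangle, and the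
    mean value theorem applies to each of them. *)
Lemma partials_C1 f : continuous f ->
  (forall b, continuous (partial b f)) ->
  (forall y, derivable f y dirx /\ derivable f y diry) ->
  C1 f (fun b => partial b f).
Proof.
move=> cf cp df; split=> // x d.
have D1 (s y : R) : is_derive s (1 : R) (fun s => f (s, y)) (partial true f (s, y)).
  have /cvg_is_derive h := @partial_is_derive f (s, y) true (df (s, y)).1; apply: is_derive_cvg; move: h.
  apply: cvg_trans; apply: near_eq_cvg; near=> h'.
  by rewrite ray0 addr0 /ray /dirx/= mulr1 mulr0 addr0 (addrC h').
have D2 (s y : R) : is_derive s (1 : R) (fun s => f (y, s)) (partial false f (y, s)).
  have /cvg_is_derive h := @partial_is_derive f (y, s) false (df (y, s)).2; apply: is_derive_cvg; move: h.
  apply: cvg_trans; apply: near_eq_cvg; near=> h'.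
  by rewrite ray0 addr0 /ray /diry/= mulr1 mulr0 addr0 (addrC h').
apply: is_derive_cvg; apply/cvgrPdist_le => e e0.
pose M : R := `|d.1| + `|d.2| + 1.
have M0 : 0 < M by rewrite ltr_wpDl ?addr_ge0.
have e'0 : 0 < e / M by rewrite divr_gt0.
have near_p b : \forall z \near x, `|partial b f x - partial b f z| <= e / M.
  by have /cvgrPdist_le := cp b x; apply.
have /nbhs_ballP[r /= r0 rB] : \forall z \near x,
    `|partial true f x - partial true f z| <= e / M /\
    `|partial false f x - partial false f z| <= e / M.
  exact: filterI (near_p true) (near_p false).
near=> h; rewrite ray0 addr0.
have h0 : h != 0 by near: h; exact: nbhs_dnbhs_neq.
have hr : `|h| * M < r.
  rewrite -ltr_pdivlMr//; near: h; apply: dnbhs0_lt; exact: divr_gt0.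
have [c1 c1x e1] := MVT_between x.1 (x.1 + h * d.1) (fun s => D1 s (x.2 + h * d.2)).
have [c2 c2x e2] := MVT_between x.2 (x.2 + h * d.2) (fun s => D2 s x.1).
rewrite addrAC subrr add0r in e1; rewrite addrAC subrr add0r in e2.
have -> : f (ray x d h) - f x = h * (partial true f (c1, x.2 + h * d.2) * d.1 +
   partial false f (x.1, c2) * d.2).
  by rewrite mulrDr (mulrCA h) (mulrCA h) -e1 -e2 addrA subrK -surjective_pairing.
rewrite mulKf//.
have hd1 : `|h * d.1| < r.
  by apply: le_lt_trans hr; rewrite normrM ler_wpM2l// /M; have := normr_ge0 d.2; lra.
have hd2 : `|h * d.2| < r.
  by apply: le_lt_trans hr; rewrite normrM ler_wpM2l// /M; have := normr_ge0 d.1; lra.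
have [|p1 _] := rB (c1, x.2 + h * d.2).
  split; rewrite /ball/= /ball_/= distrC.
    by apply: le_lt_trans hd1; rewrite addrAC subrr add0r in c1x.
  by rewrite addrAC subrr add0r.
have [|_ p2] := rB (x.1, c2).
  split; rewrite /ball/= /ball_/= distrC ?subrr ?normr0//.
  by apply: le_lt_trans hd2; rewrite addrAC subrr add0r in c2x.
rewrite (_ : _ - _ = (partial true f x - partial true f (c1, x.2 + h * d.2)) * d.1 +
  (partial false f x - partial false f (x.1, c2)) * d.2); last by ring.
apply: le_trans (ler_normD _ _) _; rewrite !normrM.
apply: (@le_trans _ _ (e / M * `|d.1| + e / M * `|d.2|)).
  by apply: lerD; rewrite ler_wpM2r.
rewrite -mulrDr -mulrA ler_piMr ?(ltW e0)// mulrC ler_pdivrMr// mul1r /M.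
by rewrite lerDl.
Unshelve. all: by end_near. Qed.

Lemma smooth_C1 f : smooth f -> C1 f (fun b => partial b f).
Proof.
move=> sf; apply: partials_C1; first by have [] := sf [::].
  by move=> b; have [] := sf [:: b].
by have [] := sf [::].
Qed.

Lemma C1_cst (c : R) : C1 (fun=> c) (fun _ _ => 0).
Proof.
split; [exact: cst_continuous|by move=> b; exact: cst_continuous|move=> x d].
by rewrite !mul0r addr0; exact: is_derive_cst.
Qed.

Lemma fst_continuous : continuous (fun x : R * R => x.1).
Proof. by move=> x; exact: cvg_fst. Qed.

Lemma snd_continuous : continuous (fun x : R * R => x.2).
Proof. by move=> x; exact: cvg_snd. Qed.

Lemma C1_affine (a b c : R) : C1 (fun z => a * z.1 + b * z.2 + c) (fun i _ => if i then a else b).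
Proof.
split=> [x||x d]; last 2 first.
- by case; exact: cst_continuous.
- apply: is_derive_cvg; apply: cvg_near_cst; near=> h; rewrite /ray/=.
  have h0 : h != 0 by near: h; exact: nbhs_dnbhs_neq.
  by rewrite addr0; field.
apply: cvgD; last exact: cvg_cst.
apply: cvgD; (apply: cvgM; first exact: cvg_cst); [exact: fst_continuous|exact: snd_continuous].
Unshelve. all: by end_near. Qed.

Lemma C1D f f' g g' : C1 f g -> C1 f' g' ->
  C1 (fun x => f x + f' x) (fun b x => g b x + g' b x).
Proof.
move=> [cf cg dg] [cf' cg' dg']; split=> [x|b x|x d].
- by apply: cvgD; [exact: cf|exact: cf'].
- by apply: cvgD; [exact: cg|exact: cg'].
have := is_deriveD (dg x d) (dg' x d); congr is_derive; ring.
Qed.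

Lemma C1M f f' g g' : C1 f g -> C1 f' g' ->
  C1 (fun x => f x * f' x) (fun b x => f x * g' b x + f' x * g b x).
Proof.
move=> [cf cg dg] [cf' cg' dg']; split=> [x|b x|x d].
- by apply: cvgM; [exact: cf|exact: cf'].
- by apply: cvgD; apply: cvgM; [exact: cf|exact: cg'|exact: cf'|exact: cg].
have := is_deriveM (dg x d) (dg' x d); rewrite !ray0; congr is_derive.
by rewrite /GRing.scale/=; ring.
Qed.

Lemma C1Z c f g : C1 f g -> C1 (fun x => c * f x) (fun b x => c * g b x).
Proof.
move=> fg; have := C1M (C1_cst c) fg; congr C1.
by apply/funext => b; apply/funext => x; rewrite mulr0 addr0.
Qed.

Lemma C1_sum (I : finType) (f : I -> R * R -> R) (g : I -> bool -> R * R -> R) :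
  (forall i, C1 (f i) (g i)) ->
  C1 (fun x => \sum_i f i x) (fun b x => \sum_i g i b x).
Proof.
move=> fg; have : forall s : seq I, C1 (fun x => \sum_(i <- s) f i x) (fun b x => \sum_(i <- s) g i b x).
  elim=> [|i s IH].
    have := C1_cst 0; congr C1; first by apply/funext => x; rewrite big_nil.
    by apply/funext => b; apply/funext => x; rewrite big_nil.
  have := C1D (fg i) IH; congr C1; first by apply/funext => x; rewrite big_cons.
  by apply/funext => b; apply/funext => x; rewrite big_cons.
exact.
Qed.

Lemma C1_expR f g : C1 f g -> C1 (fun x => expR (f x)) (fun b x => expR (f x) * g b x).
Proof.
move=> [cf cg dg].
have ce x : {for x, continuous (fun x => expR (f x))}.
  by apply: continuous_comp; [exact: cf|exact: continuous_expR].
split=> [x|b x|x d]; first exact: ce.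
  by apply: cvgM; [exact: ce|exact: cg].
have := @is_derive1_comp _ expR (fun t => f (ray x d t)) 0 _ _ (is_derive_expR _) (dg x d).
rewrite /comp ray0; congr is_derive.
by rewrite /GRing.scale/=; ring.
Qed.

Lemma C1V f g : C1 f g -> (forall x, f x != 0) ->
  C1 (fun x => (f x)^-1) (fun b x => - (f x ^- 2) * g b x).
Proof.
move=> [cf cg dg] f0.
have ci x : {for x, continuous (fun x => (f x)^-1)} by apply: cvgV; [exact: f0|exact: cf].
split=> [x|b x|x d]; first exact: ci.
  apply: cvgM; last exact: cg.
  apply: cvgN; rewrite [X in _ --> X](_ : _ = (f x)^-1 * (f x)^-1) -?exprVn ?expr2//.
  under eq_fun do rewrite -exprVn expr2.
  by apply: cvgM; exact: ci.
have := is_deriveV (f0 (ray x d 0)) (dg x d); rewrite ray0; congr is_derive.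
by rewrite /GRing.scale/=; ring.
Qed.

End C1_functions.

(** * Geometry of the regular polygon *)

Section trigonometry.
Context {R : realType}.

Definition dot (a b : R * R) : R := a.1 * b.1 + a.2 * b.2.

Lemma cosD2pi_mul (x : R) : cos (x + 2 * pi) = cos x.
Proof. by rewrite mulrC mulr_natr cosD2pi. Qed.

Lemma sinD2pi_mul (x : R) : sin (x + 2 * pi) = sin x.
Proof. by rewrite mulrC mulr_natr sinD2pi. Qed.

Lemma cos_far (a t : R) : 0 <= a <= pi -> a <= t <= 2 * pi - a -> cos t <= cos a.
Proof.
move=> /andP[a0 api] /andP[at1 ta]; have [tpi|pit] := leP t pi.
  by rewrite leNgt ltr_cos ?in_itv/= ?a0 ?api ?(le_trans a0)// -leNgt.
rewrite -(cosN t) -cosD2pi_mul leNgt ltr_cos ?in_itv/= ?a0 ?api//; last first.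
  by apply/andP; split; lra.
by rewrite -leNgt; lra.
Qed.

End trigonometry.

Section regular_polygon.
Context {R : realType} {L : nat}.
Variables (c : R * R) (r theta : R).
Hypotheses (hL : (3 <= L)%N) (r_gt0 : 0 < r).

Local Notation step := (pi / L%:R : R).

Let L_gt0 : 0 < L%:R :> R. Proof. by rewrite ltr0n (leq_trans _ hL). Qed.

Let L_ge3 : 3 <= L%:R :> R. Proof. by rewrite ler_nat. Qed.

Let pi0 : 0 < pi :> R. Proof. exact: pi_gt0. Qed.

Lemma step_gt0 : 0 < step. Proof. by rewrite divr_gt0. Qed.

Lemma step3_le : 3 * step <= pi.
Proof. by rewrite mulrCA ler_piMr ?(ltW pi0)// ler_pdivrMr// mul1r. Qed.

Definition mid_angle (k : 'I_L) : R := theta + 2 * pi * k%:R / L%:R + step.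

Definition vdir (k : 'I_L) : R * R :=
  (cos (theta + 2 * pi * k%:R / L%:R), sin (theta + 2 * pi * k%:R / L%:R)).

Definition edge_normal (k : 'I_L) : R * R := (cos (mid_angle k), sin (mid_angle k)).

Definition apothem : R := r * cos step.

Definition height (k : 'I_L) (x : R * R) : R :=
  (x.1 - c.1) * (edge_normal k).1 + (x.2 - c.2) * (edge_normal k).2.

Definition vertex (k : 'I_L) : R * R := (c.1 + r * (vdir k).1, c.2 + r * (vdir k).2).

Lemma cos_step_gt0 : 0 < cos step.
Proof.
apply: cos_gt0_pihalf; apply/andP; split; have := step_gt0; have := step3_le; lra.
Qed.

Lemma sin_step_gt0 : 0 < sin step.
Proof.
apply: sin_gt0_pi; rewrite step_gt0/=; have := step_gt0; have := step3_le; lra.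
Qed.

Lemma apothem_gt0 : 0 < apothem.
Proof. by rewrite mulr_gt0// cos_step_gt0. Qed.

Lemma vdirE k : vdir k = (cos (mid_angle k - step), sin (mid_angle k - step)).
Proof. by rewrite /mid_angle addrK. Qed.

Lemma vdirSE k : vdir (ordS k) = (cos (mid_angle k + step), sin (mid_angle k + step)).
Proof.
rewrite /vdir /mid_angle /=; have := ltn_ord k; rewrite leq_eqVlt => /predU1P[kL|kL].
  rewrite kL modnn.
  have -> : theta + 2 * pi * k%:R / L%:R + step + step = theta + 2 * pi * 0%:R / L%:R + 2 * pi.
    have -> : k%:R = L%:R - 1 :> R by rewrite -[in RHS]kL -natr1 addrK.
    by field; rewrite gt_eqF.
  by rewrite cosD2pi_mul sinD2pi_mul.
have -> : theta + 2 * pi * (k.+1 %% L)%:R / L%:R = theta + 2 * pi * k%:R / L%:R + step + step.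
  by rewrite modn_small// -natr1; field; rewrite gt_eqF.
by [].
Qed.

Lemma edge_normal_sq k : (edge_normal k).1 ^+ 2 + (edge_normal k).2 ^+ 2 = 1.
Proof. exact: cos2Dsin2. Qed.

Lemma vdir_sq k : (vdir k).1 ^+ 2 + (vdir k).2 ^+ 2 = 1.
Proof. exact: cos2Dsin2. Qed.

Lemma dot_vdir_normal k : dot (vdir k) (edge_normal k) = cos step.
Proof. by rewrite vdirE /dot/= -cosB -cosN; congr cos; ring. Qed.

Lemma dot_vdirS_normal k : dot (vdir (ordS k)) (edge_normal k) = cos step.
Proof. by rewrite vdirSE /dot/= -cosB; congr cos; ring. Qed.

Lemma vdirS_sub k : (vdir (ordS k)).1 - (vdir k).1 = - (2 * sin step) * (edge_normal k).2 /\
  (vdir (ordS k)).2 - (vdir k).2 = 2 * sin step * (edge_normal k).1.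
Proof.
rewrite (vdirE k) vdirSE /edge_normal /=; move: (mid_angle k) => A.
by rewrite !cosD !sinD !cosN !sinN; split; ring.
Qed.

Lemma cross_vdir k : (vdir k).1 * (vdir (ordS k)).2 - (vdir k).2 * (vdir (ordS k)).1 = sin (2 * step).
Proof.
rewrite vdirE vdirSE /= [RHS](_ : _ = sin ((mid_angle k + step) - (mid_angle k - step))).
  by rewrite (sinD (mid_angle k + step)) cosN sinN; ring.
by congr sin; ring.
Qed.

Lemma sin_2step_gt0 : 0 < sin (2 * step).
Proof.
apply: sin_gt0_pi; have := step_gt0; have := step3_le => h1 h2.
by apply/andP; split; lra.
Qed.

(** The direction of a vertex other than the ends of the edge makes an angle of at
    least [3 pi / L] with the normal, against [pi / L] for the ends. *)
Lemma dot_vdir_normal_far k j : j != k -> j != ordS k ->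
  dot (vdir j) (edge_normal k) <= cos (3 * step).
Proof.
move=> jk jSk.
have -> : dot (vdir j) (edge_normal k) = cos ((2 * j%:R - 2 * k%:R - 1) * step).
  rewrite /dot/= -cosB; congr cos; rewrite /mid_angle; field.
  by rewrite gt_eqF.
have h3 : 0 <= 3 * step <= pi by rewrite step3_le mulr_ge0 ?(ltW step_gt0).
have LE : 2 * pi - 3 * step = (2 * L%:R - 3) * step by field; rewrite gt_eqF.
have nL (n : nat) : (n.+2 <= L)%N -> 2 + n%:R <= L%:R :> R.
  by move=> nL; rewrite -natrD ler_nat.
case: (ltngtP j k) => [jltk|kltj|/val_inj e]; last by rewrite e eqxx in jk.
- rewrite -cosN -mulNr; apply: cos_far => //; rewrite LE !ler_pM2r ?step_gt0//.
  have h1 : j%:R + 1 <= k%:R :> R by rewrite natr1 ler_nat.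
  have : ((k - j).+2 <= L)%N.
    have := ltn_ord k; rewrite leq_eqVlt => /predU1P[kL|kL]; last first.
      by apply: leq_trans kL; rewrite ltnS ltnS leq_subr.
    apply: leq_trans (eq_leq kL); rewrite ltnS; have j0 : (0 < j)%N.
      rewrite lt0n; apply: contra jSk => /eqP j0; apply/eqP/val_inj => /=.
      by rewrite kL modnn.
    by rewrite ltn_subrL j0 (leq_ltn_trans _ jltk).
  move=> /nL; rewrite natrB ?(ltnW jltk)// => h2; apply/andP; split; lra.
- apply: cos_far => //; rewrite LE !ler_pM2r ?step_gt0//.
  have h1 : k%:R + 2 <= j%:R :> R.
    rewrite -natrD ler_nat addn2 ltn_neqAle kltj andbT.
    apply: contra jSk => /eqP kj; apply/eqP/val_inj => /=.
    by rewrite modn_small// kj.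
  have h2 : j%:R + 1 <= L%:R :> R by rewrite natr1 ler_nat.
  have h3' : 0 <= k%:R :> R by [].
  apply/andP; split; lra.
Qed.

Lemma cos3_lt : cos (3 * step) < cos step.
Proof.
have h1 := step_gt0; have h2 := step3_le.
by rewrite ltr_cos ?in_itv/=; [lra|apply/andP; split; lra..].
Qed.

Lemma dot_vdir_normal_le k j : dot (vdir j) (edge_normal k) <= cos step.
Proof.
have [->|jk] := eqVneq j k; first by rewrite dot_vdir_normal.
have [->|jSk] := eqVneq j (ordS k); first by rewrite dot_vdirS_normal.
exact: le_trans (dot_vdir_normal_far jk jSk) (ltW cos3_lt).
Qed.

Lemma dot_vdir_far k j : j != k -> dot (vdir j) (vdir k) <= cos (2 * step).
Proof.
move=> jk.
have -> : dot (vdir j) (vdir k) = cos ((2 * j%:R - 2 * k%:R) * step).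
  by rewrite /dot/= -cosB; congr cos; field; rewrite gt_eqF.
have h2 : 0 <= 2 * step <= pi.
  by have := step3_le; have := step_gt0 => h1 h2; apply/andP; split; lra.
have LE : 2 * pi - 2 * step = (2 * L%:R - 2) * step by field; rewrite gt_eqF.
have jL : j%:R + 1 <= L%:R :> R by rewrite natr1 ler_nat.
have kL : k%:R + 1 <= L%:R :> R by rewrite natr1 ler_nat.
have j0 : 0 <= j%:R :> R by []. 
have k0 : 0 <= k%:R :> R by [].
case: (ltngtP j k) => [jltk|kltj|/val_inj e]; last by rewrite e eqxx in jk.
- rewrite -cosN -mulNr; apply: cos_far => //; rewrite LE !ler_pM2r ?step_gt0//.
  have h1 : j%:R + 1 <= k%:R :> R by rewrite natr1 ler_nat.
  by apply/andP; split; lra.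
- apply: cos_far => //; rewrite LE !ler_pM2r ?step_gt0//.
  have h1 : k%:R + 1 <= j%:R :> R by rewrite natr1 ler_nat.
  by apply/andP; split; lra.
Qed.

Lemma cos2_lt1 : cos (2 * step) < 1.
Proof.
rewrite -[ltRHS]cos0 ltr_cos ?in_itv/=; have h1 := step_gt0; have h2 := step3_le.
- lra.
- by apply/andP; split; lra.
- by apply/andP; split; lra.
Qed.

Lemma dot_vdir_le k j : dot (vdir j) (vdir k) <= 1.
Proof.
have [->|/dot_vdir_far h] := eqVneq j k; last exact: le_trans h (ltW cos2_lt1).
by rewrite /dot -!expr2 vdir_sq.
Qed.

Lemma ordS_neq (k : 'I_L) : ordS k != k.
Proof.
rewrite -(inj_eq val_inj) /=; have := ltn_ord k; rewrite leq_eqVlt => /predU1P[kL|kL].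
  by rewrite kL modnn; case: (val k) kL => // e; move: hL; rewrite -e.
by rewrite modn_small// gtn_eqF.
Qed.

Lemma ordSS_neq (k : 'I_L) : ordS (ordS k) != k.
Proof.
rewrite -(inj_eq val_inj) /=; have := ltn_ord k; rewrite leq_eqVlt => /predU1P[kL|kL].
  rewrite kL modnn modn_small ?(leq_trans _ hL)//.
  by apply: contraTneq hL => k1; rewrite -kL -k1.
rewrite (modn_small kL); move: kL; rewrite leq_eqVlt => /predU1P[kL|kL].
  by rewrite kL modnn; apply: contraTneq hL => k0; rewrite -kL -k0.
by rewrite modn_small// gtn_eqF// ltnS ltnW.
Qed.

Lemma sum_vdir : \sum_k (vdir k).1 = 0 /\ \sum_k (vdir k).2 = 0.
Proof.
set s1 := \sum_k _; set s2 := \sum_k _.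
pose C := cos (2 * step); pose S := sin (2 * step).
have rot k : (vdir (ordS k)).1 = (vdir k).1 * C - (vdir k).2 * S /\
             (vdir (ordS k)).2 = (vdir k).2 * C + (vdir k).1 * S.
  rewrite (vdirE k) vdirSE /= /C /S -cosD -sinD.
  by split; [congr cos|congr sin]; ring.
have e1 : s1 = s1 * C - s2 * S.
  rewrite {1}/s1 (reindex_inj (@ordS_inj L)) /s1 /s2 !mulr_suml -sumrB.
  by apply: eq_bigr => k _; rewrite (rot k).1.
have e2 : s2 = s2 * C + s1 * S.
  rewrite {1}/s2 (reindex_inj (@ordS_inj L)) /s1 /s2 !mulr_suml -big_split.
  by apply: eq_bigr => k _; rewrite (rot k).2.
have C1 : C < 1 := cos2_lt1.
have : (s1 ^+ 2 + s2 ^+ 2) * (1 - C) = 0.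
  rewrite mulrBr mulr1 [X in X - _](_ : _ = s1 * s1 + s2 * s2) ?expr2//.
  rewrite {1}e1 [X in _ + s2 * X - _]e2; ring.
move/eqP; rewrite mulf_eq0 subr_eq0 [1 == C]gt_eqF// orbF.
rewrite paddr_eq0 ?sqr_ge0// !sqrf_eq0 => /andP[/eqP -> /eqP ->].
by [].
Qed.

Lemma heightE k p q j :
  height j (affine2 (r * (vdir k).1) (r * (vdir (ordS k)).1) c.1
    (r * (vdir k).2) (r * (vdir (ordS k)).2) c.2 (p, q)) =
  p * (r * dot (vdir k) (edge_normal j)) + q * (r * dot (vdir (ordS k)) (edge_normal j)).
Proof. by rewrite /height /affine2 /dot/=; ring. Qed.

(** Barycentric coordinates of the triangle with vertices [c], [v k] and
    [v (ordS k)]. *)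
Definition tri (k : 'I_L) : R * R -> R * R :=
  affine2 (r * (vdir k).1) (r * (vdir (ordS k)).1) c.1
    (r * (vdir k).2) (r * (vdir (ordS k)).2) c.2.

Definition tri_det : R := r ^+ 2 * sin (2 * step).

Lemma tri_det_gt0 : 0 < tri_det.
Proof. by rewrite mulr_gt0 ?exprn_gt0// sin_2step_gt0. Qed.

Lemma tri_detE k : (r * (vdir k).1) * (r * (vdir (ordS k)).2) -
  (r * (vdir k).2) * (r * (vdir (ordS k)).1) = tri_det.
Proof. by rewrite /tri_det -(cross_vdir k); ring. Qed.

Lemma tri_surj k x : exists p, tri k p = x.
Proof.
have D0 : (r * (vdir k).1) * (r * (vdir (ordS k)).2) -
  (r * (vdir k).2) * (r * (vdir (ordS k)).1) != 0 by rewrite tri_detE gt_eqF// tri_det_gt0.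
move: D0; rewrite /tri; move: (r * (vdir k).1) (r * (vdir k).2) => a1 a2.
move: (r * (vdir (ordS k)).1) (r * (vdir (ordS k)).2) => b1 b2 D0.
exists (((x.1 - c.1) * b2 - (x.2 - c.2) * b1) / (a1 * b2 - a2 * b1),
        (a1 * (x.2 - c.2) - a2 * (x.1 - c.1)) / (a1 * b2 - a2 * b1)).
case: x => x1 x2; rewrite /affine2/=; congr pair.
  by field.
by field.
Qed.

Lemma height_tri k p : height k (tri k p) = (p.1 + p.2) * apothem.
Proof. by case: p => p q; rewrite heightE dot_vdir_normal dot_vdirS_normal /apothem/=; ring. Qed.

Lemma height_triS k p : height k (tri k p) - height (ordS k) (tri k p) =
  p.1 * (r * (cos step - dot (vdir k) (edge_normal (ordS k)))).
Proof.
case: p => p q; rewrite !heightE dot_vdir_normal dot_vdirS_normal dot_vdir_normal/=; ring.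
Qed.

Lemma height_tri_pred k p : height k (tri k p) - height (ord_pred k) (tri k p) =
  p.2 * (r * (cos step - dot (vdir (ordS k)) (edge_normal (ord_pred k)))).
Proof.
case: p => p q; rewrite !heightE dot_vdir_normal dot_vdirS_normal.
rewrite -[X in dot (vdir X) (edge_normal (ord_pred k))]ord_predK dot_vdirS_normal/=; ring.
Qed.

Let coef_gt0 k j : j != k -> j != ordS k -> 0 < r * (cos step - dot (vdir j) (edge_normal k)).
Proof.
move=> jk jSk; rewrite mulr_gt0// subr_gt0.
exact: le_lt_trans (dot_vdir_normal_far jk jSk) cos3_lt.
Qed.

Let coefS_gt0 k : 0 < r * (cos step - dot (vdir k) (edge_normal (ordS k))).
Proof. by apply: coef_gt0; rewrite eq_sym ?ordS_neq ?ordSS_neq. Qed.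

Let coef_pred_gt0 k : 0 < r * (cos step - dot (vdir (ordS k)) (edge_normal (ord_pred k))).
Proof.
apply: coef_gt0; last by rewrite ord_predK ordS_neq.
by rewrite -{1}[k]ord_predK ordSS_neq.
Qed.

(** The edge of largest height at a point is the one whose sector, seen from the
    centre, contains the point. *)
Lemma tri_cone k p : (forall j, height j (tri k p) <= height k (tri k p)) ->
  0 <= p.1 /\ 0 <= p.2.
Proof.
move=> h; split.
  by have := h (ordS k); rewrite -subr_ge0 height_triS pmulr_lge0.
by have := h (ord_pred k); rewrite -subr_ge0 height_tri_pred pmulr_lge0.
Qed.

Lemma tri_interior k p : 
  (forall j, j != k -> height j (tri k p) < height k (tri k p)) <-> 0 < p.1 /\ 0 < p.2.
Proof.
split=> [h|[p1 p2] j jk].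
  split.
    by have := h (ordS k) (ordS_neq k); rewrite -subr_gt0 height_triS pmulr_lgt0.
  have : ord_pred k != k by rewrite -{2}[k]ord_predK eq_sym ordS_neq.
  by move/h; rewrite -subr_gt0 height_tri_pred pmulr_lgt0.
rewrite -subr_gt0; case: p p1 p2 => p q /= p1 p2.
rewrite !heightE dot_vdir_normal dot_vdirS_normal.
rewrite (_ : _ - _ = p * (r * (cos step - dot (vdir k) (edge_normal j))) +
   q * (r * (cos step - dot (vdir (ordS k)) (edge_normal j)))); last by ring.
have nn i : 0 <= r * (cos step - dot (vdir i) (edge_normal j)).
  by rewrite mulr_ge0 ?(ltW r_gt0)// subr_ge0 dot_vdir_normal_le.
have [kSj|kSj] := eqVneq k (ordS j).
  apply: ltr_wpDl; first by rewrite mulr_ge0// ltW.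
  by rewrite mulr_gt0// coef_gt0// kSj ?ordSS_neq ?ordS_neq.
apply: ltr_pwDl; last by rewrite mulr_ge0// ltW.
by rewrite mulr_gt0// coef_gt0// eq_sym.
Qed.

Lemma ex_max_height x : exists k, forall j, height j x <= height k x.
Proof.
have i0 : 'I_L by exists 0%N; exact: leq_trans hL.
by case: (@arg_maxP _ _ 'I_L i0 xpredT (fun k => height k x)) => // k _ h; exists k => j; exact: h.
Qed.

End regular_polygon.

Lemma area_setX {R : realType} (A B : set (measurableTypeR R)) : measurable A -> measurable B ->
  area (A `*` B) = (@lebesgue_measure R A * @lebesgue_measure R B)%E.
Proof. by move=> mA mB; exact: product_measure1E. Qed.

Section polygon_set.
Context {R : realType} {L : nat}.
Variables (c : R * R) (r theta : R).
Hypotheses (hL : (3 <= L)%N) (r_gt0 : 0 < r).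

Local Notation step := (pi / L%:R : R).
Local Notation nu := (@edge_normal R L theta).
Local Notation ht := (@height R L c theta).
Local Notation v := (@vertex R L c r theta).
Local Notation h := (@apothem R L r).
Local Notation Omega := (polygon v).

Lemma heightD (k : 'I_L) (x y : R * R) :
  ht k (x.1 + y.1, x.2 + y.2) = ht k x + dot y (nu k).
Proof. by rewrite /height /dot/=; ring. Qed.

Lemma height_C1 (k : 'I_L) : C1 (ht k) (fun b _ => if b then (nu k).1 else (nu k).2).
Proof.
have := C1_affine (nu k).1 (nu k).2 (- (c.1 * (nu k).1 + c.2 * (nu k).2)).
by congr C1; apply/funext => z; rewrite /height; ring.
Qed.

Lemma height_vertex k j : ht k (v j) = r * dot (vdir theta j) (nu k).
Proof. by rewrite /height /vertex /dot/=; ring. Qed.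

Lemma height_hull k x : convex_hull v x -> ht k x <= h.
Proof.
move=> [w [w0 w1 ->]].
have sum_sub (f : 'I_L -> R) a : \sum_j w j * f j - a = \sum_j w j * (f j - a).
  by under [RHS]eq_bigr do rewrite mulrBr; rewrite sumrB -mulr_suml w1 mul1r.
have -> : ht k (\sum_j w j * (v j).1, \sum_j w j * (v j).2) = \sum_j w j * ht k (v j).
  rewrite /height !sum_sub !mulr_suml -big_split.
  by apply: eq_bigr => j _ /=; ring.
have -> : h = \sum_j w j * h by rewrite -mulr_suml w1 mul1r.
apply: ler_sum => j _.
by rewrite ler_wpM2l// height_vertex ler_pM2l// dot_vdir_normal_le.
Qed.

Lemma hull_tri (k : 'I_L) p q : 0 <= p -> 0 <= q -> p + q <= 1 ->
  convex_hull v (tri c r theta k (p, q)).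
Proof.
move=> p0 q0 pq.
have L0 : L%:R != 0 :> R by rewrite pnatr_eq0; case: L hL.
exists (fun i => (1 - p - q) / L%:R + p * (i == k)%:R + q * (i == ordS k)%:R).
set t := (1 - p - q) / L%:R.
have sum_w (f : 'I_L -> R) : \sum_i (t + p * (i == k)%:R + q * (i == ordS k)%:R) * f i =
    t * \sum_i f i + p * f k + q * f (ordS k).
  under eq_bigr do rewrite !mulrDl.
  rewrite !big_split/= mulr_sumr; congr (_ + _ + _).
    by rewrite (bigD1 k)//= eqxx mulr1 big1 ?addr0// => i /negbTE->; rewrite mulr0 mul0r.
  by rewrite (bigD1 (ordS k))//= eqxx mulr1 big1 ?addr0// => i /negbTE->; rewrite mulr0 mul0r.
split.
- move=> i; rewrite /t !addr_ge0// ?mulr_ge0// ?invr_ge0//.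
  by rewrite -addrA -opprD subr_ge0.
- have := sum_w (fun=> 1); under eq_bigr do rewrite mulr1.
  by move=> ->; rewrite sumr_const card_ord /t; field.
- have [s1 s2] := @sum_vdir R L theta hL.
  rewrite /tri /affine2; congr pair; rewrite sum_w /vertex/=.
    by rewrite big_split/= -mulr_sumr s1 sumr_const card_ord -mulr_natl /t; field.
  by rewrite big_split/= -mulr_sumr s2 sumr_const card_ord -mulr_natl /t; field.
Qed.

(** A point of the interior can be pushed outwards along a normal without leaving
    the hull; conversely the sector containing a point below all edges writes
    it as a convex combination. *)
Lemma polygonE : Omega = [set x | forall k, ht k x < h].
Proof.
apply/seteqP; split=> x.
  move=> /nbhs_ballP[e /= e0 eh] k.
  have n1 : `|(nu k).1| <= 1 by rewrite cos_max.
  have n2 : `|(nu k).2| <= 1 by rewrite sin_max.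
  have /height_hull : convex_hull v (x.1 + e / 2 * (nu k).1, x.2 + e / 2 * (nu k).2).
    apply: eh; split; rewrite /ball/= opprD addNKr normrN normrM ger0_norm ?divr_ge0 ?(ltW e0)//.
      by apply: le_lt_trans (ler_wpM2l _ n1) _; rewrite ?divr_ge0 ?(ltW e0)// mulr1; lra.
    by apply: le_lt_trans (ler_wpM2l _ n2) _; rewrite ?divr_ge0 ?(ltW e0)// mulr1; lra.
  move=> /(_ k); rewrite (heightD k x (e / 2 * (nu k).1, e / 2 * (nu k).2)).
  rewrite (_ : dot _ _ = e / 2 * ((nu k).1 ^+ 2 + (nu k).2 ^+ 2)); last by rewrite /dot /=; ring.
  rewrite edge_normal_sq; lra.
move=> xh; have : \forall z \near x, forall k, ht k z < h.
  apply: (@filter_forall _ _ (fun k => [set z | ht k z < h]) (nbhs x)) => k; have [ch _ _] := height_C1 k.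
  by apply: cvgr_lt; [exact: ch|exact: xh].
apply: filterS => z zh; have [k hk] := ex_max_height c theta hL z.
have [[p q] e] := tri_surj c theta hL r_gt0 k z; subst z.
have [/= p0 q0] := tri_cone hL r_gt0 hk.
apply: hull_tri => //; have := zh k; rewrite height_tri//=.
by rewrite -{2}[h]mul1r ltr_pM2r ?apothem_gt0// => /ltW.
Qed.

Lemma open_polygon : open Omega.
Proof. exact: open_interior. Qed.

Lemma measurable_polygon : measurable (Omega : set (mplane R)).
Proof. exact: open_measurable_plane open_polygon. Qed.

Lemma polygon_tri x : Omega x -> exists (k : 'I_L) p q, [/\ 0 <= p, 0 <= q, p + q < 1 & x = tri c r theta k (p, q)].
Proof.
rewrite polygonE => xh; have [k hk] := ex_max_height c theta hL x.
have [[p q] e] := tri_surj c theta hL r_gt0 k x; subst x.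
have [/= p0 q0] := tri_cone hL r_gt0 hk.
exists k, p, q; split=> //; have := xh k; rewrite height_tri//=.
by rewrite -{2}[h]mul1r ltr_pM2r ?apothem_gt0.
Qed.

Lemma norm_vdir (k : 'I_L) : `|(vdir theta k).1| <= 1 /\ `|(vdir theta k).2| <= 1.
Proof. by rewrite cos_max sin_max. Qed.

Lemma bounded_tri (k : 'I_L) p q : 0 <= p -> 0 <= q -> p + q <= 1 ->
  `|(tri c r theta k (p, q)).1 - c.1| <= r /\ `|(tri c r theta k (p, q)).2 - c.2| <= r.
Proof.
move=> p0 q0 pq; have [a1 a2] := norm_vdir k; have [b1 b2] := norm_vdir (ordS k).
have key (a b : R) : `|a| <= 1 -> `|b| <= 1 -> `|r * a * p + r * b * q| <= r.
  move=> ha hb; apply: le_trans (ler_normD _ _) _; rewrite !normrM !(ger0_norm (ltW r_gt0)) (ger0_norm p0) (ger0_norm q0).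
  rewrite -!mulrA -mulrDr ler_piMr ?(ltW r_gt0)//; apply: le_trans pq.
  by apply: lerD; rewrite ler_piMl.
by rewrite /tri /affine2/= !addrK; split; apply: key.
Qed.

Lemma bounded_polygon x : Omega x -> `|x.1 - c.1| <= r /\ `|x.2 - c.2| <= r.
Proof.
by move=> /polygon_tri[k [p [q [p0 q0 pq ->]]]]; apply: bounded_tri => //; exact: ltW.
Qed.

(** Shrinking the polygon leaves room for a ball around each point. *)
Lemma polygon_margin x y (l : R) : Omega x -> 0 < l -> 
  `|y.1| + `|y.2| <= (1 - l) * h ->
  Omega (c.1 + l * (x.1 - c.1) + y.1, c.2 + l * (x.2 - c.2) + y.2).
Proof.
rewrite polygonE => xh l0 yh k.
have -> : ht k (c.1 + l * (x.1 - c.1) + y.1, c.2 + l * (x.2 - c.2) + y.2) = l * ht k x + dot y (nu k).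
  by rewrite /height /dot/=; ring.
apply: (@lt_le_trans _ _ (l * h + (1 - l) * h)); last by rewrite -mulrDl addrC subrK mul1r.
apply: ltr_leD; first by rewrite ltr_pM2l.
apply: le_trans yh; apply: le_trans (ler_norm _) _; apply: le_trans (ler_normD _ _) _.
have n1 : `|(nu k).1| <= 1 by rewrite cos_max.
have n2 : `|(nu k).2| <= 1 by rewrite sin_max.
by rewrite !normrM; apply: lerD; rewrite ler_piMr.
Qed.

Lemma polygon_convex x y (t : R) : Omega x -> Omega y -> 0 <= t <= 1 ->
  Omega (ray x (y.1 - x.1, y.2 - x.2) t).
Proof.
rewrite !polygonE => xh yh /andP[t0 t1] k.
rewrite (_ : ht k _ = (1 - t) * ht k x + t * ht k y); last by rewrite /height /ray/=; ring.
have [->|tn0] := eqVneq t 0; first by rewrite subr0 mul1r mul0r addr0.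
rewrite -[ltRHS](_ : (1 - t) * h + t * h = h); last by ring.
apply: ler_ltD; first by rewrite ler_wpM2l ?subr_ge0// ltW.
by rewrite ltr_pM2l// lt_neqAle eq_sym tn0.
Qed.

Lemma area_polygon_lty : (area (Omega : set (mplane R)) < +oo)%E.
Proof.
pose I (a : R) := `[a - r, a + r]%classic.
apply: (@le_lt_trans _ _ (area (I c.1 `*` I c.2))).
  apply: le_measure; rewrite ?inE; [exact: measurable_polygon|by apply: measurableX; exact: measurable_itv|].
  move=> x /bounded_polygon[]; rewrite !ler_norml => /andP[? ?] /andP[? ?].
  by split; rewrite /I/= in_itv/=; apply/andP; split; lra.
rewrite area_setX; [|exact: measurable_itv..]; rewrite /I !lebesgue_measure_itv/=.
by case: ifP => _; case: ifP => _; rewrite ?mule0 ?mul0e// -!EFinB -EFinM ltry.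
Qed.

End polygon_set.

Section bounded_integrability.
Context {R : realType}.

Lemma continuous_bounded_box (f : R * R -> R) (a b : R * R) : continuous f ->
  exists M, forall x, a.1 <= x.1 <= b.1 -> a.2 <= x.2 <= b.2 -> `|f x| <= M.
Proof.
move=> cf.
have cpt : compact (`[a.1, b.1] `*` `[a.2, b.2] : set (R * R)).
  by apply: compact_setX; exact: segment_compact.
have : compact (f @` (`[a.1, b.1] `*` `[a.2, b.2])).
  by apply: continuous_compact => //; exact: continuous_subspaceT.
move=> /compact_bounded[M [_ MP]]; exists (M + 1) => x x1 x2; apply: MP.
  by rewrite ltrDl.
by exists x => //; split; rewrite /= in_itv.
Qed.

End bounded_integrability.

Section null_lines.
Context {R : realType}.

Lemma line_negligible (a b d : R) : (a, b) != (0, 0) ->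
  {ae area, forall z : mplane R, a * z.1 + b * z.2 + d != 0}.
Proof.
move=> ab0; pose A : set (mplane R) := [set z | a * z.1 + b * z.2 + d = 0].
have mA : measurable A.
  rewrite (_ : A = (fun z => a * z.1 + b * z.2 + d) @^-1` [set 0]) //.
  by rewrite -[X in measurable X]setTI; apply: measurable_affine2.
exists A; split=> //; last by move=> z /=; apply: contra_notP => /eqP.
have A0 (a1 b1 c1 a2 b2 c2 : R) : a1 * b2 - a2 * b1 != 0 ->
    (forall z, a * (affine2 a1 b1 c1 a2 b2 c2 z).1 + b * (affine2 a1 b1 c1 a2 b2 c2 z).2 + d = z.1) ->
    area A = 0.
  move=> D0 Az; rewrite -[A in LHS]setIT -(integral_indic area)//.
  rewrite -(area_linear c1 c2 D0)//; last 1 first.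
    by apply/measurable_EFinP; exact: measurable_indic.
  rewrite (eq_integral (fun z : mplane R => (\1_([set 0] `*` setT) z)%:E)); last first.
    move=> z _; rewrite !indicE; congr ((nat_of_bool _)%:R%:E).
    apply/idP/idP; rewrite !inE/= /A/= Az; first by [].
    by case.
  rewrite integral_indic ?setIT//; last by apply: measurableX.
  by rewrite area_setX// lebesgue_measure_set1 mul0e mule0.
have [a0|an0] := eqVneq a 0.
  have b0 : b != 0 by move: ab0; rewrite a0 xpair_eqE eqxx.
  apply: (A0 0 1 0 b^-1 0 (- d / b)); first by rewrite mul0r sub0r mulr1 oppr_eq0 invr_eq0.
  by move=> z; rewrite /affine2/= a0; field.
apply: (A0 a^-1 (- b / a) (- d / a) 0 1 0).
  by rewrite mulr1 mul0r subr0 invr_eq0.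
by move=> z; rewrite /affine2/=; field.
Qed.

End null_lines.

(** * Integration over the polygon through barycentric coordinates *)

Section unit_triangle.
Context {R : realType}.
Local Notation mu := (@lebesgue_measure R).

Definition unit_tri : set (mplane R) := [set p | [/\ 0 <= p.1, 0 <= p.2 & p.1 + p.2 <= 1]].

Lemma measurable_halfplane (a b d : R) :
  measurable ([set z | 0 <= a * z.1 + b * z.2 + d] : set (mplane R)).
Proof.
rewrite (_ : [set _ | _] = setT `&` (fun z : mplane R => a * z.1 + b * z.2 + d) @^-1` `[0, +oo[).
  by apply: measurable_affine2 => //; exact: measurable_itv.
by rewrite setTI; apply/seteqP; split=> z /=; rewrite in_itv/= andbT.
Qed.

Lemma measurable_unit_tri : measurable unit_tri.
Proof.
rewrite (_ : unit_tri = [set z | 0 <= 1 * z.1 + 0 * z.2 + 0] `&`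
  ([set z | 0 <= 0 * z.1 + 1 * z.2 + 0] `&` [set z | 0 <= (- 1) * z.1 + (- 1) * z.2 + 1])).
  by apply: measurableI; [|apply: measurableI]; exact: measurable_halfplane.
by apply/seteqP; split=> [z [? ? ?]|z [/= ? [/= ? ?]]]; repeat split => /=; lra.
Qed.

Lemma area_unit_tri_lty : (area unit_tri < +oo)%E.
Proof.
apply: (@le_lt_trans _ _ (area (`[0, 1] `*` `[0, 1] : set (mplane R)))).
  apply: le_measure; rewrite ?inE; [exact: measurable_unit_tri|by apply: measurableX; exact: measurable_itv|].
  move=> z [z1 z2 z12]; split; rewrite /= in_itv/=; apply/andP; split; lra.
rewrite area_setX; [|exact: measurable_itv..].
by rewrite !lebesgue_measure_itv/= lte_fin ltr01 -EFinB -EFinM ltry.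
Qed.

Lemma bounded_integrable d (T : measurableType d) (m : {measure set T -> \bar R})
    (D : set T) (f : T -> R) (M : R) : measurable D -> (m D < +oo)%E ->
  measurable_fun D f -> (forall x, D x -> `|f x| <= M) -> m.-integrable D (EFin \o f).
Proof.
move=> mD mDoo mf fM; apply: measurable_bounded_integrable => //.
exists M; split; first exact: num_real.
by move=> N MN x Dx; apply: le_trans (fM x Dx) (ltW MN).
Qed.

Lemma FTC (F f : R -> R) (a b : R) : a <= b -> (forall t : R, is_derive t (1 : R) F (f t)) ->
  continuous f -> \int[mu]_(x in `[a, b]) f x = F b - F a.
Proof.
rewrite le_eqVlt => /predU1P[->|ab] Ff cf.
  by rewrite subrr /Rintegral set_itv1 integral_set1.
have cF : continuous F.
  by move=> t; apply: differentiable_continuous; apply/derivable1_diffP; case: (Ff t).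
rewrite /Rintegral (@continuous_FTC2 _ f F a b ab).
- by rewrite -EFinB.
- exact: continuous_subspaceT.
- split.
  + by move=> t _; case: (Ff t).
  + by apply: cvg_at_right_filter; exact: cF.
  + by apply: cvg_at_left_filter; exact: cF.
- by move=> t _; rewrite derive1E; case: (Ff t).
Qed.

Lemma pair_continuous (T : topologicalType) (f g : T -> R) : continuous f -> continuous g ->
  continuous (fun t => (f t, g t)).
Proof. by move=> cf cg t; exact: (cvg_pair (cf t) (cg t)). Qed.

Lemma comp_continuous (T U W : topologicalType) (f : T -> U) (g : U -> W) :
  continuous f -> continuous g -> continuous (fun t => g (f t)).
Proof. by move=> cf cg t; apply: continuous_comp; [exact: cf|exact: cg]. Qed.

Lemma id_continuous : continuous (fun t : R => t).
Proof. by move=> t; exact: cvg_id. Qed.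

Lemma slice1_continuous (f : R * R -> R) (y : R) : continuous f -> continuous (fun x => f (x, y)).
Proof.
move=> cf; apply: (comp_continuous _ cf); apply: pair_continuous; first exact: id_continuous.
exact: cst_continuous.
Qed.

Lemma slice2_continuous (f : R * R -> R) (x : R) : continuous f -> continuous (fun y => f (x, y)).
Proof.
move=> cf; apply: (comp_continuous _ cf); apply: pair_continuous; last exact: id_continuous.
exact: cst_continuous.
Qed.

Lemma onem_continuous : continuous (fun t : R => 1 - t).
Proof. by move=> t; apply: cvgB; [exact: cvg_cst|exact: cvg_id]. Qed.

Lemma continuous_itv_integrable (f : R -> R) (a b : R) : continuous f ->
  mu.-integrable `[a, b] (fun x => (f x)%:E).
Proof.
move=> cf; apply: continuous_compact_integrable; first exact: segment_compact.
exact: continuous_subspaceT.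
Qed.

Lemma unit_tri_integrable (f : R * R -> R) : continuous f ->
  area.-integrable unit_tri (EFin \o f).
Proof.
move=> cf; have mf := continuous_measurable_plane cf.
have [M fM] := continuous_bounded_box (0, 0) (1, 1) cf.
apply: (bounded_integrable (M := M) measurable_unit_tri area_unit_tri_lty).
  exact: measurable_funTS.
by move=> z [z1 z2 z12]; apply: fM => /=; apply/andP; split; lra.
Qed.

Lemma unit_tri_iter2 (f : R * R -> R) : continuous f ->
  \int[area]_(z in unit_tri) f z =
  \int[mu]_(y in `[0, 1]) \int[mu]_(x in `[0, 1 - y]) f (x, y).
Proof.
move=> cf; have int_f := unit_tri_integrable cf.
rewrite /Rintegral integral_mkcond.
have int_f' : area.-integrable setT ((EFin \o f) \_ unit_tri).
  by rewrite -integrable_mkcond//; exact: measurable_unit_tri.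
rewrite -(integral21_prod_meas1 int_f') [in RHS]integral_mkcond; congr fine.
apply: eq_integral => y _; rewrite /fubini_G /patch.
have cy := @slice1_continuous f y cf.
case: ifPn => y01; last first.
  rewrite integral0_eq// => x _; rewrite memNset//= => -[/= x0 y0 xy].
  by move/negP: y01; apply; rewrite inE/= in_itv/=; apply/andP; split; lra.
rewrite fineK; last by apply: integrable_fin_num => //; exact: continuous_itv_integrable.
rewrite [RHS]integral_mkcond; apply: eq_integral => x _; rewrite patchE.
congr (if _ then _ else _); move: y01; rewrite !inE/= in_itv/= => /andP[y0 y1].
apply/idP/idP; rewrite !inE/= in_itv/=.
  by move=> [/= x0 _ xy]; apply/andP; split; lra.
by move=> /andP[x0 xy]; split => //=; lra.
Qed.

Lemma unit_tri_iter1 (f : R * R -> R) : continuous f ->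
  \int[area]_(z in unit_tri) f z =
  \int[mu]_(x in `[0, 1]) \int[mu]_(y in `[0, 1 - x]) f (x, y).
Proof.
move=> cf; have int_f := unit_tri_integrable cf.
rewrite /Rintegral integral_mkcond.
have int_f' : area.-integrable setT ((EFin \o f) \_ unit_tri).
  by rewrite -integrable_mkcond//; exact: measurable_unit_tri.
rewrite -(integral12_prod_meas1 int_f') [in RHS]integral_mkcond; congr fine.
apply: eq_integral => x _; rewrite /fubini_F /patch.
have cy := @slice2_continuous f x cf.
case: ifPn => x01; last first.
  rewrite integral0_eq// => y _; rewrite memNset//= => -[/= x0 y0 xy].
  by move/negP: x01; apply; rewrite inE/= in_itv/=; apply/andP; split; lra.
rewrite fineK; last by apply: integrable_fin_num => //; exact: continuous_itv_integrable.
rewrite [RHS]integral_mkcond; apply: eq_integral => y _; rewrite patchE.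
congr (if _ then _ else _); move: x01; rewrite !inE/= in_itv/= => /andP[x0 x1].
apply/idP/idP; rewrite !inE/= in_itv/=.
  by move=> [/= _ y0 xy]; apply/andP; split; lra.
by move=> /andP[y0 xy]; split => //=; lra.
Qed.

(** One iterated integral for each term, and the fundamental theorem of calculus in
    the inner variable; the three sides of the triangle remain. *)
Lemma unit_tri_green (G H : R * R -> R) (g h : bool -> R * R -> R) : C1 G g -> C1 H h ->
  \int[area]_(z in unit_tri) (g true z - h false z) =
  \int[mu]_(t in `[0, 1]) (G (1 - t, t) - H (1 - t, t)) +
  \int[mu]_(t in `[0, 1]) H (t, 0) - \int[mu]_(t in `[0, 1]) G (0, t).
Proof.
move=> CG CH; have [cG cg dG] := CG; have [cH ch dH] := CH.
rewrite RintegralB//; [|exact: measurable_unit_tri|exact: unit_tri_integrable..].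
rewrite unit_tri_iter2// unit_tri_iter1//.
have eG y : y \in `[0, 1]%classic -> \int[mu]_(x in `[0, 1 - y]) g true (x, y) = G (1 - y, y) - G (0, y).
  rewrite inE/= in_itv/= => /andP[y0 y1]; have {}y1 : 0 <= 1 - y by rewrite subr_ge0.
  have dGy (t : R) : is_derive t (1 : R) (fun x => G (x, y)) (g true (t, y)).
    have := C1_line (0, y) (1, 0) t CG; rewrite /ray/= mulr1 !mulr0 !addr0 add0r mulr1.
    by under eq_fun do rewrite mulr1 mulr0 addr0 add0r.
  by rewrite (FTC y1 dGy)//; exact: slice1_continuous.
have eH x : x \in `[0, 1]%classic -> \int[mu]_(y in `[0, 1 - x]) h false (x, y) = H (x, 1 - x) - H (x, 0).
  rewrite inE/= in_itv/= => /andP[x0 x1]; have {}x1 : 0 <= 1 - x by rewrite subr_ge0.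
  have dHx (t : R) : is_derive t (1 : R) (fun y => H (x, y)) (h false (x, t)).
    have := C1_line (x, 0) (0, 1) t CH; rewrite /ray/= mulr1 !mulr0 addr0 !add0r mulr1.
    by under eq_fun do rewrite mulr1 mulr0 addr0 add0r.
  by rewrite (FTC x1 dHx)//; exact: slice2_continuous.
have -> : \int[mu]_(y in `[0, 1]) \int[mu]_(x in `[0, 1 - y]) g true (x, y) =
    \int[mu]_(y in `[0, 1]) (G (1 - y, y) - G (0, y)) by apply: eq_Rintegral => y; exact: eG.
have -> : \int[mu]_(x in `[0, 1]) \int[mu]_(y in `[0, 1 - x]) h false (x, y) =
    \int[mu]_(x in `[0, 1]) (H (x, 1 - x) - H (x, 0)) by apply: eq_Rintegral => y; exact: eH.
have c1 (F : R * R -> R) : continuous F -> continuous (fun t : R => F (1 - t, t)).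
  move=> cF; apply: (comp_continuous _ cF); apply: pair_continuous; last exact: id_continuous.
  exact: onem_continuous.
have c2 (F : R * R -> R) : continuous F -> continuous (fun t : R => F (t, 1 - t)).
  move=> cF; apply: (comp_continuous _ cF); apply: pair_continuous; first exact: id_continuous.
  exact: onem_continuous.
rewrite !RintegralB//; try (apply: continuous_itv_integrable; (apply: c1 || apply: c2 ||
  apply: slice1_continuous || apply: slice2_continuous) => //).
rewrite (_ : \int[mu]_(x in `[0, 1]) H (x, 1 - x) = \int[mu]_(t in `[0, 1]) H (1 - t, t)); last first.
  rewrite (Rintegration_by_substitution_onem (r := 1)) ?ler01 ?lexx//; last first.
    by apply: continuous_subspaceT; exact: c2.
  rewrite /unstable.onem subrr; apply: eq_Rintegral => t _.
  by congr (H (_, _)); lra.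
ring.
Qed.

End unit_triangle.

(** Carries an integration formula from nonnegative functions to signed ones,
    through positive and negative parts. *)
Lemma Rintegral_transfer (R : realType) (d d' : measure_display) (T : measurableType d)
    (T' : measurableType d') (mu : {measure set T -> \bar R}) (mu' : {measure set T' -> \bar R})
    (D : set T) (D' : set T') n (w : 'I_n -> R) (phi : 'I_n -> T' -> T) (f : T -> R) :
  measurable D' -> (forall k, 0 <= w k) ->
  (forall F : T -> \bar R, measurable_fun setT F -> (forall x, 0 <= F x)%E ->
    \int[mu]_(x in D) F x = \sum_(k < n) (w k)%:E * \int[mu']_(p in D') F (phi k p))%E ->
  measurable_fun setT f ->
  (forall k, mu'.-integrable D' (EFin \o (fun p => f (phi k p)))) ->
  \int[mu]_(x in D) f x = \sum_(k < n) w k * \int[mu']_(p in D') f (phi k p).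
Proof.
move=> mD' w0 H mf intk.
rewrite /Rintegral integralE.
have mfE : measurable_fun setT (EFin \o f) by exact/measurable_EFinP.
rewrite !H//; [|exact: measurable_funeneg|exact: measurable_funepos].
pose F k := EFin \o (fun p => f (phi k p)).
pose P k := fine (\int[mu']_(p in D') ((F k)^\+ p))%E.
pose N k := fine (\int[mu']_(p in D') ((F k)^\- p))%E.
have PE k : (\int[mu']_(p in D') ((F k)^\+ p) = (P k)%:E)%E.
  by rewrite fineK//; apply: integrable_fin_num => //; exact: (integrable_funepos mD' (intk k)).
have NE k : (\int[mu']_(p in D') ((F k)^\- p) = (N k)%:E)%E.
  by rewrite fineK//; apply: integrable_fin_num => //; exact: (integrable_funeneg mD' (intk k)).
have PE' k : (\int[mu']_(p in D') ((EFin \o f)^\+ (phi k p)) = (P k)%:E)%E.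
  by rewrite -PE; apply: eq_integral => p _; rewrite -[LHS]/(((EFin \o f)^\+ \o phi k)%E p) -funepos_comp.
have NE' k : (\int[mu']_(p in D') ((EFin \o f)^\- (phi k p)) = (N k)%:E)%E.
  by rewrite -NE; apply: eq_integral => p _; rewrite -[LHS]/(((EFin \o f)^\- \o phi k)%E p) -funeneg_comp.
under eq_bigr do rewrite PE' -EFinM.
under [X in (_ - X)%E]eq_bigr do rewrite NE' -EFinM.
rewrite !sumEFin -EFinB /= -sumrB; apply: eq_bigr => k _; rewrite -mulrBr; congr (_ * _).
by rewrite [in RHS]integralE -/(F k) PE NE.
Qed.

Section polygon_triangles.
Context {R : realType} {L : nat}.
Variables (c : R * R) (r theta : R).
Hypotheses (hL : (3 <= L)%N) (r_gt0 : 0 < r).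

Local Notation step := (pi / L%:R : R).
Local Notation nu := (@edge_normal R L theta).
Local Notation ht := (@height R L c theta).
Local Notation v := (@vertex R L c r theta).
Local Notation h := (@apothem R L r).
Local Notation Omega := (polygon v).
Local Notation tri := (@tri R L c r theta).
Local Notation tri_det := (@tri_det R L r).

Lemma edge_normal_inj (j k : 'I_L) : j != k ->
  ((nu j).1 - (nu k).1, (nu j).2 - (nu k).2) != (0, 0).
Proof.
move=> jk; apply/negP; rewrite xpair_eqE !subr_eq0 => /andP[/eqP e1 /eqP e2].
have e (i : 'I_L) : dot (vdir theta i) (nu j) = dot (vdir theta i) (nu k) by rewrite /dot e1 e2.
have far i : dot (vdir theta i) (nu k) = cos step -> i = k \/ i = ordS k.
  move=> ik; have [->|ik1] := eqVneq i k; first by left.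
  have [->|ik2] := eqVneq i (ordS k); first by right.
  by have := dot_vdir_normal_far theta hL ik1 ik2; rewrite ik leNgt cos3_lt.
have [ej|ej] := far _ (etrans (esym (e j)) (dot_vdir_normal theta j)).
  by rewrite ej eqxx in jk.
have := far _ (etrans (esym (e _)) (dot_vdirS_normal theta hL j)); rewrite ej => -[e'|e'].
  by have := ordSS_neq hL k; rewrite e' eqxx.
by have := ordS_neq hL (ordS k); rewrite e' eqxx.
Qed.

(** Outside a finite union of lines a single edge has the largest height, so the
    sectors may be treated as disjoint. *)
Lemma ae_heights : {ae area, forall x, forall jk : 'I_L * 'I_L,
  jk.1 != jk.2 -> ht jk.1 x != ht jk.2 x}.
Proof.
apply: (@filter_forall _ _ (fun jk : 'I_L * 'I_L => [set x | jk.1 != jk.2 -> ht jk.1 x != ht jk.2 x])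
  (almost_everywhere area) (ae_filter_ringOfSetsType area)) => -[j k].
have [->|jk] := eqVneq j k; first by apply: aeW => x /=; rewrite eqxx.
have := line_negligible (- c.1 * ((nu j).1 - (nu k).1) - c.2 * ((nu j).2 - (nu k).2)) (edge_normal_inj jk).
apply: filterS => x /= x0 _; rewrite -subr_eq0; apply: contra_neq x0 => <-.
by case: x => x1 x2; rewrite /height/=; ring.
Qed.

Let T k : set (mplane R) := [set x | Omega x /\ forall j, j != k -> ht j x < ht k x].

Let measurable_ht k : measurable_fun setT (ht k : mplane R -> R).
Proof. by apply: continuous_measurable_plane; have [] := height_C1 c theta k. Qed.

Let mT k : measurable (T k).
Proof.
rewrite (_ : T k = Omega `&` \bigcap_(j in setT) [set x | j != k -> ht j x < ht k x]); last first.
  by apply/seteqP; split=> x [xO xT]; split=> // j; [move=> _; exact: xT|exact: xT].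
apply: measurableI; first exact: measurable_polygon.
apply: fin_bigcap_measurable => [|j _]; first exact: finite_finset.
have [->|jk] := eqVneq j k.
  by rewrite (_ : [set _ | _] = setT)//; apply/seteqP; split=> // x _ /=; rewrite eqxx.
rewrite (_ : [set _ | _] = setT `&` (fun x : mplane R => ht k x - ht j x) @^-1` `]0, +oo[).
  by apply: measurable_funB => //; exact: measurable_itv.
by rewrite setTI; apply/seteqP; split=> x /=; rewrite in_itv/= andbT subr_gt0; [apply|].
Qed.

Let T_tri k (p : R * R) : p.1 != 0 -> p.2 != 0 -> p.1 + p.2 != 1 ->
  T k (tri k p) <-> unit_tri p.
Proof.
move=> p1 p2 p12; rewrite /T /unit_tri/=; split=> [[pO /(tri_interior c theta hL r_gt0)[h1 h2]]|[h1 h2 h3]].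
  split; [exact: ltW..|]; move: pO; rewrite (polygonE c theta hL r_gt0) => /(_ k).
  by rewrite height_tri// -{2}[h]mul1r ltr_pM2r ?apothem_gt0// => /ltW.
have {}h1 : 0 < p.1 by rewrite lt_neqAle eq_sym p1.
have {}h2 : 0 < p.2 by rewrite lt_neqAle eq_sym p2.
have {}h3 : p.1 + p.2 < 1 by rewrite lt_neqAle p12.
have tk : forall j, j != k -> ht j (tri k p) < ht k (tri k p) by apply/(tri_interior c theta hL r_gt0).
split=> //; rewrite (polygonE c theta hL r_gt0) => j.
have hk : ht k (tri k p) < h by rewrite height_tri// -{2}[h]mul1r ltr_pM2r ?apothem_gt0.
by have [->//|/tk/lt_trans] := eqVneq j k; apply.
Qed.

(** The sectors are, up to null sets, affine images of the unit triangle. *)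
Lemma ge0_integral_polygon (f : mplane R -> \bar R) : measurable_fun setT f ->
  (forall x, 0 <= f x)%E ->
  (\int[area]_(x in Omega) f x = \sum_(k < L) tri_det%:E * \int[area]_(p in unit_tri) f (tri k p))%E.
Proof.
move=> mf f0; have D0 : 0 < tri_det := tri_det_gt0 hL r_gt0.
have mO := @measurable_polygon R L c r theta.
have [N [mN N0 NP]] := ae_heights.
rewrite (ge0_negligible_integral mN mO _ _ N0)//; last exact: measurable_funTS.
have mTT : measurable (\big[setU/set0]_(k < L) T k) by exact: bigsetU_measurable.
have -> : Omega `\` N = (\big[setU/set0]_(k < L) T k) `\` N.
  apply/seteqP; split=> x [xO xN]; split=> //; last first.
    by move: xO; rewrite -bigcup_seq => -[k _ []].
  rewrite -bigcup_seq; have [k hk] := ex_max_height c theta hL x.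
  exists k; first by rewrite /= mem_index_enum.
  split=> // j jk; rewrite lt_neqAle hk andbT.
  by apply: contrapT => h1; apply: xN; apply: NP => /(_ (j, k)) /= h2; apply: h1; exact: h2.
rewrite -(ge0_negligible_integral mN mTT _ _ N0)//; last exact: measurable_funTS.
rewrite ge0_integral_bigsetU//; last 3 first.
- exact: index_enum_uniq.
- move=> j k _ _ [x [[_ xj] [_ xk]]]; apply/eqP/negPn/negP => jk.
  by have := lt_trans (xj k _) (xk j jk); rewrite eq_sym jk ltxx => /(_ isT).
- exact: measurable_funTS.
apply: eq_bigr => k _.
rewrite integral_mkcond -(tri_detE r theta hL k) in D0 *.
have mfT : measurable_fun setT (f \_ (T k)).
  by apply/(measurable_restrictT f (mT k)); exact: measurable_funTS.
rewrite -(area_linear c.1 c.2 (lt0r_neq0 D0) mfT); last first.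
  by move=> z; rewrite patchE; case: ifP.
rewrite gtr0_norm//; congr (_ * _)%E; rewrite [RHS]integral_mkcond.
have mtri : measurable_fun setT (tri k : mplane R -> mplane R).
  exact: measurable_affine_plane.
apply: ge0_ae_eq_integral => //.
- exact: (measurableT_comp mfT mtri).
- apply/(measurable_restrictT _ measurable_unit_tri); apply: measurable_funTS.
  exact: (measurableT_comp mf mtri).
- by move=> z _; rewrite patchE; case: ifP.
- by move=> z _; rewrite patchE; case: ifP.
have l1 := @line_negligible R 1 0 0; have l2 := @line_negligible R 0 1 0.
have l3 := @line_negligible R 1 1 (- 1).
have {}l1 := l1 _; have {}l1 : {ae area, forall z : mplane R, 1 * z.1 + 0 * z.2 + 0 != 0}.
  by apply: l1; rewrite xpair_eqE oner_eq0.
have {}l2 : {ae area, forall z : mplane R, 0 * z.1 + 1 * z.2 + 0 != 0}.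
  by apply: l2; rewrite xpair_eqE oner_eq0 andbF.
have {}l3 : {ae area, forall z : mplane R, 1 * z.1 + 1 * z.2 + - 1 != 0}.
  by apply: l3; rewrite xpair_eqE oner_eq0.
apply: filterS3 l1 l2 l3 => z z1 z2 z3 _.
rewrite !mul1r !mul0r !addr0 ?add0r subr_eq0 in z1 z2 z3.
rewrite !patchE; have := T_tri k z1 z2 z3; rewrite -/(tri k z) => zT.
by case: ifPn; case: ifPn => //; rewrite notin_setE !inE => h1 h2; [case: h1; apply/zT|case: h2; apply/zT].
Qed.

Lemma Rintegral_polygon (f : R * R -> R) : continuous f ->
  \int[area]_(x in Omega) f x = \sum_(k < L) tri_det * \int[area]_(p in unit_tri) f (tri k p).
Proof.
move=> cf; have mf := continuous_measurable_plane cf.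
have D0 : 0 < tri_det := tri_det_gt0 hL r_gt0.
have ctri k : continuous (fun p => f (tri k p)).
  apply: (comp_continuous _ cf); apply: pair_continuous.
    by have [] := C1_affine (r * (vdir theta k).1) (r * (vdir theta (ordS k)).1) c.1.
  by have [] := C1_affine (r * (vdir theta k).2) (r * (vdir theta (ordS k)).2) c.2.
apply: Rintegral_transfer => //; first exact: measurable_unit_tri.
- by move=> k; exact: ltW.
- exact: ge0_integral_polygon.
- by move=> k; exact: unit_tri_integrable (ctri k).
Qed.

End polygon_triangles.

(** * The divergence theorem on the polygon *)

Lemma ge0_integral_mrestr d (T : measurableType d) (R : realType)
    (mu : {measure set T -> \bar R}) (D : set T) (mD : measurable D) (f : T -> \bar R) :
  measurable_fun setT f -> (forall x, 0 <= f x)%E ->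
  (\int[mrestr mu mD]_x f x = \int[mu]_(x in D) f x)%E.
Proof.
move=> mf f0; rewrite [LHS](ge0_negligible_integral (measurableC mD))//; last first.
  by rewrite /= /mrestr setICl measure0.
rewrite setTD setCK; apply: eq_measure_integral => A mA AD.
by rewrite /= /mrestr setIidl.
Qed.

Section boundary_integral.
Context {R : realType} {L : nat}.
Variable v : 'I_L -> R * R.
Local Notation mu := (@lebesgue_measure R).

Let edge_measure k : {measure set (mplane R) -> \bar R} :=
  mscale (NngNum (sqrtr_ge0 _ : 0 <= edge_length v k))
    (measure_function_pushforward__canonical__measure_function_Measure
      (mrestr (@lebesgue_measure R) (measurable_itv `[0%R, 1%R]))
      (measurable_edge v k)).

Let m_ (n : nat) : {measure set (mplane R) -> \bar R} :=
  if insub n is Some k then edge_measure k else mzero.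

Let arclength_msum A : arclength v A = msum m_ L A.
Proof.
rewrite /msum /arclength; apply: eq_bigr => k _.
rewrite /m_ valK /= /mscale /= /pushforward /mrestr.
by rewrite setIC.
Qed.

Lemma ge0_integral_arclength (f : mplane R -> \bar R) : measurable_fun setT f ->
  (forall x, 0 <= f x)%E ->
  (\int[arclength v]_x f x =
    \sum_(k < L) (edge_length v k)%:E * \int[mu]_(t in `[0%R, 1%R]) f (edge v k t))%E.
Proof.
move=> mf f0; rewrite (eq_measure_integral (msum m_ L)); last first.
  by move=> A _ _; exact: arclength_msum.
rewrite ge0_integral_measure_sum//; apply: eq_bigr => k _; rewrite /m_ valK.
rewrite ge0_integral_mscale//= (ge0_integral_pushforward (measurable_edge v k))//=.
by rewrite preimage_setT ge0_integral_mrestr//; exact: (measurableT_comp mf (measurable_edge v k)).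
Qed.

Lemma edge_continuous k : continuous (fun t => edge v k t).
Proof.
apply: pair_continuous => t; apply: cvgD; apply: cvgM; try exact: cvg_cst;
  by [exact: onem_continuous|exact: cvg_id].
Qed.

Lemma Rintegral_arclength (f : R * R -> R) : continuous f ->
  \int[arclength v]_x f x = \sum_(k < L) edge_length v k * \int[mu]_(t in `[0, 1]) f (edge v k t).
Proof.
move=> cf; apply: Rintegral_transfer => //.
- by move=> k; exact: sqrtr_ge0.
- exact: ge0_integral_arclength.
- exact: continuous_measurable_plane.
- move=> k; apply: continuous_itv_integrable; apply: (comp_continuous _ cf).
  exact: edge_continuous.
Qed.

End boundary_integral.

Section divergence.
Context {R : realType} {L : nat}.
Variables (c : R * R) (r theta : R).
Hypotheses (hL : (3 <= L)%N) (r_gt0 : 0 < r).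

Local Notation mu := (@lebesgue_measure R).
Local Notation step := (pi / L%:R : R).
Local Notation nu := (@edge_normal R L theta).
Local Notation v := (@vertex R L c r theta).
Local Notation h := (@apothem R L r).
Local Notation Omega := (polygon v).
Local Notation tri := (@tri R L c r theta).
Local Notation tri_det := (@tri_det R L r).

Lemma edge_lengthE k : edge_length v k = 2 * r * sin step.
Proof.
have [e1 e2] := vdirS_sub theta hL k.
have E1 : (v (ordS k)).1 - (v k).1 = r * (- (2 * sin step) * (nu k).2) by rewrite -e1 /vertex/=; ring.
have E2 : (v (ordS k)).2 - (v k).2 = r * (2 * sin step * (nu k).1) by rewrite -e2 /vertex/=; ring.
rewrite /edge_length E1 E2.
rewrite (_ : _ + _ = (2 * r * sin step) ^+ 2 * ((nu k).1 ^+ 2 + (nu k).2 ^+ 2)); last by ring.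
rewrite edge_normal_sq mulr1 sqrtr_sqr ger0_norm// !mulr_ge0// ?(ltW r_gt0)//.
exact: ltW (sin_step_gt0 hL).
Qed.

Lemma C1_comp_affine (f : R * R -> R) g a1 b1 c1 a2 b2 c2 : C1 f g ->
  C1 (fun z => f (affine2 a1 b1 c1 a2 b2 c2 z))
     (fun i z => g true (affine2 a1 b1 c1 a2 b2 c2 z) * (if i then a1 else b1) +
                 g false (affine2 a1 b1 c1 a2 b2 c2 z) * (if i then a2 else b2)).
Proof.
move=> [cf cg dg].
have cA : continuous (affine2 a1 b1 c1 a2 b2 c2).
  apply: pair_continuous.
    by have [] := C1_affine a1 b1 c1.
  by have [] := C1_affine a2 b2 c2.
split=> [|i|x d]; first exact: comp_continuous cA cf.
  move=> x; apply: cvgD; (apply: cvgM; last exact: cvg_cst);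
    exact: (comp_continuous cA (cg _)).
have := dg (affine2 a1 b1 c1 a2 b2 c2 x) (a1 * d.1 + b1 * d.2, a2 * d.1 + b2 * d.2).
rewrite (_ : (fun t => f (ray _ _ t)) = (fun t => f (affine2 a1 b1 c1 a2 b2 c2 (ray x d t)))).
  by congr is_derive => /=; ring.
by apply/funext => t; congr f; rewrite /ray /affine2/=; congr pair; ring.
Qed.

Lemma edge_tri k t : edge v k t = tri k (1 - t, t).
Proof. by rewrite /edge /vertex /tri /affine2/=; congr pair; ring. Qed.

(** Green's formula in each sector, pulled back to the unit triangle: the fluxes
    through the radii cancel between neighbouring sectors. *)
Lemma divergence (F : bool -> R * R -> R) (g : bool -> bool -> R * R -> R) :
  (forall b, C1 (F b) (g b)) ->
  \int[area]_(x in Omega) (g true true x + g false false x) =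
  \sum_(k < L) edge_length v k * \int[mu]_(t in `[0, 1])
    (F true (edge v k t) * (nu k).1 + F false (edge v k t) * (nu k).2).
Proof.
move=> CF.
have cF b : continuous (F b) by have [] := CF b.
have cg b b' : continuous (g b b') by have [_ cg _] := CF b; exact: cg.
rewrite Rintegral_polygon//; last first.
  by move=> x; apply: cvgD; exact: cg.
pose Z (k : 'I_L) t := F true (c.1 + t * (r * (vdir theta k).1), c.2 + t * (r * (vdir theta k).2)) * (r * (vdir theta k).2) -
  F false (c.1 + t * (r * (vdir theta k).1), c.2 + t * (r * (vdir theta k).2)) * (r * (vdir theta k).1).
suff key k : tri_det * \int[area]_(p in unit_tri) (g true true (tri k p) + g false false (tri k p)) =
    edge_length v k * \int[mu]_(t in `[0, 1]) (F true (edge v k t) * (nu k).1 + F false (edge v k t) * (nu k).2) +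
    \int[mu]_(t in `[0, 1]) Z k t - \int[mu]_(t in `[0, 1]) Z (ordS k) t.
  under eq_bigr do rewrite key.
  rewrite sumrB big_split/= [X in _ + X - _](reindex_inj (@ordS_inj L))/=; ring.
pose a1 := r * (vdir theta k).1; pose a2 := r * (vdir theta k).2.
pose b1 := r * (vdir theta (ordS k)).1; pose b2 := r * (vdir theta (ordS k)).2.
have CT b : C1 (fun p => F b (tri k p)) _ := C1_comp_affine a1 b1 c.1 a2 b2 c.2 (CF b).
have CG := C1D (C1Z b2 (CT true)) (C1Z (- b1) (CT false)).
have CH := C1D (C1Z a2 (CT true)) (C1Z (- a1) (CT false)).
have := unit_tri_green CG CH.
rewrite (_ : \int[area]_(z in unit_tri) _ = tri_det * \int[area]_(p in unit_tri) (g true true (tri k p) + g false false (tri k p))); last first.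
  rewrite -RintegralZl//; [|exact: measurable_unit_tri|]; last first.
    have ctri : continuous (tri k).
      by apply: pair_continuous; [case: (C1_affine a1 b1 c.1)|case: (C1_affine a2 b2 c.2)].
    apply: unit_tri_integrable => p; apply: cvgD; exact: (comp_continuous ctri (cg _ _)).
  apply: eq_Rintegral => p _; rewrite -(tri_detE r theta hL k) -/a1 -/a2 -/b1 -/b2 /tri -/a1 -/a2 -/b1 -/b2; ring.
move=> ->; congr (_ + _ - _); last 2 first.
- apply: eq_Rintegral => t _; rewrite /Z /tri /affine2/= -/a1 -/a2.
  by rewrite !mulr0 !addr0 !(mulrC t) !(addrC (_ * t)); ring.
- apply: eq_Rintegral => t _; rewrite /Z /tri /affine2/= -/b1 -/b2.
  by rewrite !mulr0 !add0r !(mulrC t) !(addrC (_ * t)); ring.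
rewrite edge_lengthE -RintegralZl//; last first.
  apply: continuous_itv_integrable => t; apply: cvgD; (apply: cvgM; last exact: cvg_cst);
    exact: (comp_continuous (@edge_continuous _ _ v k) (cF _)).
have [e1 e2] := vdirS_sub theta hL k.
apply: eq_Rintegral => t _; rewrite edge_tri.
have -> : b2 = a2 + r * (2 * sin step * (nu k).1) by rewrite -e2 /a2 /b2; ring.
have -> : b1 = a1 + r * (- (2 * sin step) * (nu k).2) by rewrite -e1 /a1 /b1; ring.
ring.
Qed.

Lemma polygon_integrable (f : R * R -> R) : continuous f -> area.-integrable Omega (EFin \o f).
Proof.
move=> cf; have [M fM] := continuous_bounded_box (c.1 - r, c.2 - r) (c.1 + r, c.2 + r) cf.
apply: (bounded_integrable (M := M)).
- exact: measurable_polygon.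
- exact: area_polygon_lty.
- by apply: measurable_funTS; exact: continuous_measurable_plane.
- move=> x /(bounded_polygon hL r_gt0)[h1 h2].
  by apply: fM => /=; [move: h1|move: h2]; rewrite ler_norml => /andP[? ?]; apply/andP; split; lra.
Qed.

(** Integrating the divergence of [phi^2 W] gives Hardy-type bounds: a field
    [W] with [W . nu >= gam] controls the boundary term by the energy. *)
Lemma jacobi_inequality (W : bool -> R * R -> R) (w : bool -> bool -> R * R -> R)
    (gam M : R) (phi : R * R -> R) (g : bool -> R * R -> R) :
  (forall b, C1 (W b) (w b)) -> C1 phi g ->
  (forall k t, 0 <= t <= 1 ->
    gam <= W true (edge v k t) * (nu k).1 + W false (edge v k t) * (nu k).2) ->
  (forall x, Omega x ->
    W true x ^+ 2 + W false x ^+ 2 + (w true true x + w false false x) <= M) ->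
  gam * \int[arclength v]_x (phi x * phi x) <=
  \int[area]_(x in Omega) (g true x * g true x + g false x * g false x) +
  M * \int[area]_(x in Omega) (phi x * phi x).
Proof.
move=> CW Cphi Wnu WM.
have cphi : continuous phi by case: Cphi.
have cg b : continuous (g b) by case: Cphi.
have cW b : continuous (W b) by case: (CW b).
have cw b b' : continuous (w b b') by case: (CW b) => _ + _; apply.
have cM (f f' : R * R -> R) : continuous f -> continuous f' -> continuous (fun x => f x * f' x).
  by move=> cf cf' x; apply: cvgM; [exact: cf|exact: cf'].
have cD (f f' : R * R -> R) : continuous f -> continuous f' -> continuous (fun x => f x + f' x).
  by move=> cf cf' x; apply: cvgD; [exact: cf|exact: cf'].
have cpp := cM _ _ cphi cphi.
have Cp2 := C1M Cphi Cphi.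
have := divergence (fun b => C1M (CW b) Cp2) => /= div.
apply: (@le_trans _ _ (\int[area]_(x in Omega)
  (W true x * (phi x * g true x + phi x * g true x) + phi x * phi x * w true true x +
   (W false x * (phi x * g false x + phi x * g false x) + phi x * phi x * w false false x)))).
  rewrite div Rintegral_arclength; last exact: cM.
  rewrite mulr_sumr; apply: ler_sum => k _; rewrite mulrCA ler_wpM2l ?sqrtr_ge0//.
  have ce (f : R * R -> R) : continuous f -> continuous (fun t => f (edge v k t)).
    by move=> cf; apply: (comp_continuous _ cf); exact: edge_continuous.
  rewrite -RintegralZl//; last by apply: continuous_itv_integrable; exact: (ce _ cpp).
  apply: le_Rintegral => //.
  - apply: continuous_itv_integrable => t; apply: cvgM; first exact: cvg_cst.
    exact: (ce _ cpp).
  - apply: continuous_itv_integrable => t; apply: cvgD; (apply: cvgM; last exact: cvg_cst);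
      [exact: (ce _ (cM _ _ (cW true) cpp))|exact: (ce _ (cM _ _ (cW false) cpp))].
  - move=> t; rewrite /= in_itv/= => /(Wnu k) h1.
    rewrite [leRHS](_ : _ = (W true (edge v k t) * (nu k).1 + W false (edge v k t) * (nu k).2) *
      (phi (edge v k t) * phi (edge v k t))); last by rewrite /edge_normal/=; ring.
    by rewrite ler_wpM2r// -expr2 sqr_ge0.
rewrite -RintegralZl//; [|exact: measurable_polygon|exact: (polygon_integrable cpp)].
rewrite -RintegralD//; [|exact: measurable_polygon|apply: polygon_integrable..]; last 2 first.
- by apply: (cD); exact: cM.
- by apply: (cM _ _ _ cpp); exact: cst_continuous.
apply: le_Rintegral; [exact: measurable_polygon|apply: polygon_integrable..|]; last 1 first.
- move=> x /WM wM.
  have := sqr_ge0 (g true x - phi x * W true x); have := sqr_ge0 (g false x - phi x * W false x).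
  have : (W true x ^+ 2 + W false x ^+ 2 + (w true true x + w false false x)) * phi x ^+ 2 <= M * phi x ^+ 2.
    by rewrite ler_wpM2r// sqr_ge0.
  by rewrite !expr2; lra.
- have ct b := cD _ _ (cM _ _ (cW b) (cD _ _ (cM _ _ cphi (cg b)) (cM _ _ cphi (cg b))))
     (cM _ _ cpp (cw b b)).
  exact: (cD _ _ (ct true) (ct false)).
- exact: (cD _ _ (cD _ _ (cM _ _ (cg true) (cg true)) (cM _ _ (cg false) (cg false)))
    (cM _ _ (@cst_continuous _ _ M) cpp)).
Qed.

End divergence.

(** * A Poincare inequality on convex cells *)

(** A copy of [area] that carries the structure of a sigma-finite measure, which
    Tonelli's theorem asks for. *)
Definition lebesgue_plane {R : realType} : set (mplane R) -> \bar R := @area R.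

HB.instance Definition _ (R : realType) :=
  Measure.copy (@lebesgue_plane R) (Measure.sort (@area R)).

Lemma lebesgue_plane_sigma_finite (R : realType) : sigma_finite setT (@lebesgue_plane R).
Proof.
have /sigma_finiteP[F [TF ndF Foo]] := sigma_finiteT (@lebesgue_measure R).
exists (fun n => F n `*` F n).
  rewrite -setXTT TF predeqE => -[x y]; split.
    move=> [/= [n _ Fnx] [k _ Gky]]; exists (maxn n k) => //; split.
    - by move: x Fnx; exact/subsetPset/ndF/leq_maxl.
    - by move: y Gky; exact/subsetPset/ndF/leq_maxr.
  by move=> [n _ []/= ? ?]; split; exists n.
move=> k; have [? ?] := Foo k.
split; first exact: measurableX.
by rewrite /lebesgue_plane area_setX// lte_mul_pinfty// ge0_fin_numE.
Qed.

HB.instance Definition _ (R : realType) :=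
  Measure_isSigmaFinite.Build _ _ _ (@lebesgue_plane R) (@lebesgue_plane_sigma_finite R).

Lemma area_tonelli (R : realType) (f : mplane R * mplane R -> \bar R) :
  measurable_fun setT f -> (forall z, 0 <= f z)%E ->
  (\int[area]_x \int[area]_y f (x, y) = \int[area]_y \int[area]_x f (x, y))%E.
Proof.
by move=> mf f0; exact: (@fubini_tonelli _ _ _ _ R (@lebesgue_plane R) (@lebesgue_plane R) f mf f0).
Qed.

Lemma area_line_tonelli (R : realType) (f : mplane R * measurableTypeR R -> \bar R) :
  measurable_fun setT f -> (forall z, 0 <= f z)%E ->
  (\int[area]_x \int[lebesgue_measure]_t f (x, t) =
   \int[lebesgue_measure]_t \int[area]_x f (x, t))%E.
Proof.
by move=> mf f0; exact: (@fubini_tonelli _ _ _ _ R (@lebesgue_plane R) (@lebesgue_measure R) f mf f0).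
Qed.

Lemma continuous_sqr (R : realType) (T : topologicalType) (f : T -> R) :
  continuous f -> continuous (fun x => f x ^+ 2).
Proof.
move=> cf; rewrite (_ : (fun x => _) = (fun x => f x * f x)); last first.
  by apply/funext => x; rewrite expr2.
by move=> x; apply: cvgM; exact: cf.
Qed.

Section poincare.
Context {R : realType}.
Local Notation mu := (@lebesgue_measure R).
Variables (C : set (mplane R)) (d : R) (u : R * R -> R) (g : bool -> R * R -> R).
Hypotheses (mC : measurable C) (C_lty : (area C < +oo)%E).
Hypothesis C_convex : forall x y t, C x -> C y -> 0 <= t <= 1 ->
  C (ray x (y.1 - x.1, y.2 - x.2) t).
Hypothesis C_diam : forall x y, C x -> C y -> `|x.1 - y.1| <= d /\ `|x.2 - y.2| <= d.
Hypothesis C_int : forall f : R * R -> R, continuous f -> area.-integrable C (EFin \o f).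
Hypothesis Cu : C1 u g.

Let cu : continuous u. Proof. by case: Cu. Qed.
Let cg b : continuous (g b). Proof. by case: Cu => _ + _; apply. Qed.
Let G x := g true x * g true x + g false x * g false x.
Let cG : continuous G.
Proof. by move=> x; apply: cvgD; apply: cvgM; exact: cg. Qed.
Let G_ge0 x : 0 <= G x. Proof. by rewrite addr_ge0// -expr2 sqr_ge0. Qed.

Let mid (x y : R * R) : R * R := ((x.1 + y.1) / 2, (x.2 + y.2) / 2).

Let segment_bound x y : C x -> C y ->
  (u y - u (mid x y)) ^+ 2 <=
  d ^+ 2 * \int[mu]_(t in `[2^-1, 1]) G (ray x (y.1 - x.1, y.2 - x.2) t).
Proof.
move=> Cx Cy; set e := (y.1 - x.1, y.2 - x.2).
pose f t := g true (ray x e t) * e.1 + g false (ray x e t) * e.2.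
have cray : continuous (ray x e).
  by apply: pair_continuous => t; apply: cvgD; (try exact: cvg_cst);
    apply: cvgM; [exact: cvg_id|exact: cvg_cst|exact: cvg_id|exact: cvg_cst].
have cf : continuous f.
  have c1 b : continuous (fun t => g b (ray x e t)) := comp_continuous cray (@cg b).
  by move=> t; apply: cvgD; (apply: cvgM; last exact: cvg_cst); exact: c1.
have le21 : 2^-1 <= 1 :> R by lra.
have -> : u y - u (mid x y) = \int[mu]_(t in `[2^-1, 1]) f t.
  rewrite (FTC le21 (fun t => C1_line x e t Cu) cf); congr (u _ - u _).
    by rewrite /ray /e !mul1r ![_ + (_ - _)]addrC !subrK -surjective_pairing.
  by rewrite /ray /mid /e/=; congr pair; field.
have m01 : measurable (`[2^-1, 1] : set (measurableTypeR R)) by exact: measurable_itv.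
have mu01 : mu `[2^-1, 1] = (2^-1)%:E.
  by rewrite lebesgue_measure_itv/= lte_fin invf_lt1 ?ltr1n// -EFinB; congr EFin; field.
have sf : sqint mu `[2^-1, 1] f.
  split; first by apply: measurable_funTS; exact: continuous_measurable_fun.
  have cf2 := continuous_sqr cf.
  exact: (integrable_lty m01 (continuous_itv_integrable _ _ cf2)).
have s1 : sqint mu `[2^-1, 1] (cst 1).
  by apply: (bounded_sqint m01 _ (M := 1)); [rewrite [X in (X < _)%E]mu01 ltry|exact: measurable_cst|move=> t _; rewrite normr1].
have := ip_CS m01 sf s1.
have -> : ip mu `[2^-1, 1] f (cst 1) = \int[mu]_(t in `[2^-1, 1]) f t.
  by apply: eq_Rintegral => t _; rewrite mulr1.
have -> : ip mu `[2^-1, 1] (cst 1) (cst 1) = 2^-1.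
  by rewrite /ip (eq_Rintegral _ (g := cst 1)) ?Rintegral_cst ?mul1r ?[X in fine X]mu01// => t _; rewrite mulr1.
move=> /le_trans; apply.
rewrite mulrC -!RintegralZl//; last 2 first.
- by apply: continuous_itv_integrable => t; apply: cvgM; exact: cf.
- by apply: continuous_itv_integrable; exact: (comp_continuous cray cG).
have [e1 e2] := C_diam Cy Cx.
apply: le_Rintegral => //.
- by apply: continuous_itv_integrable => t; apply: cvgM; [exact: cvg_cst|apply: cvgM; exact: cf].
- apply: continuous_itv_integrable => t; apply: cvgM; first exact: cvg_cst.
  exact: (comp_continuous cray cG).
- move=> t _; rewrite /f /G.
  have : e.1 ^+ 2 <= d ^+ 2.
    by rewrite -[e.1 ^+ 2]real_normK ?num_real// lerXn2r// nnegrE// (le_trans _ e1).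
  have : e.2 ^+ 2 <= d ^+ 2.
    by rewrite -[e.2 ^+ 2]real_normK ?num_real// lerXn2r// nnegrE// (le_trans _ e2).
  move: (g true _) (g false _) (e.1) (e.2) (d ^+ 2) => a b' p q D hq hp.
  have h1 : (a * p + b' * q) * (a * p + b' * q) <= (a * a + b' * b') * (p ^+ 2 + q ^+ 2).
    by have := sqr_ge0 (a * q - b' * p); rewrite !expr2; lra.
  rewrite ler_pdivrMl//; apply: le_trans h1 _; rewrite mulrA [leRHS]mulrC.
  by rewrite ler_wpM2l ?addr_ge0 -?expr2 ?sqr_ge0//; lra.
Qed.

Let GC : mplane R -> R := fun z => G z * \1_C z.
Let mGC : measurable_fun setT GC.
Proof.
apply: measurable_funM; first exact: continuous_measurable_plane.
exact: measurable_indic.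
Qed.
Let GC_ge0 z : 0 <= GC z. Proof. by rewrite mulr_ge0. Qed.

Let GC_int : (\int[area]_z (GC z)%:E = (\int[area]_(z in C) G z)%:E)%E.
Proof.
have : (\int[area]_(z in C) (G z)%:E = (\int[area]_(z in C) G z)%:E)%E.
  by rewrite fineK//; apply: integrable_fin_num => //; exact: C_int.
move=> <-; rewrite [RHS]integral_mkcond; apply: eq_integral => z _.
by rewrite /GC patchE indicE; case: ifP => _; rewrite ?mulr1 ?mulr0.
Qed.

Let shrink_bound x : C x ->
  (\int[area]_(y in C) ((u y - u (mid x y)) ^+ 2)%:E <=
   (2 * d ^+ 2 * \int[area]_(z in C) G z)%:E)%E.
Proof.
move=> Cx.
pose H (z : mplane R * measurableTypeR R) : R :=
  \1_C z.1 * \1_(`[2^-1, 1]%classic) z.2 *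
   GC (ray x (z.1.1 - x.1, z.1.2 - x.2) z.2).
have mR : measurable_fun setT (fun z : mplane R * measurableTypeR R =>
    ray x (z.1.1 - x.1, z.1.2 - x.2) z.2 : mplane R).
  have m11 : measurable_fun setT (fun z : mplane R * measurableTypeR R => z.1.1).
    by apply: measurableT_comp.
  have m12 : measurable_fun setT (fun z : mplane R * measurableTypeR R => z.1.2).
    by apply: measurableT_comp.
  have m2 : measurable_fun setT (fun z : mplane R * measurableTypeR R => z.2).
    exact: measurable_snd.
  by apply: measurable_fun_pair;
    apply: measurable_funD => //; apply: measurable_funM => //; exact: measurable_funB.
have mH : measurable_fun setT H.
  apply: measurable_funM; last exact: (measurableT_comp mGC).
  apply: measurable_funM.
  - by apply: (measurableT_comp _ measurable_fst); exact: measurable_indic.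
  - by apply: (measurableT_comp _ measurable_snd); apply: measurable_indic; exact: measurable_itv.
have mHE : measurable_fun setT (fun z => (H z)%:E) by exact/measurable_EFinP.
have H0 z : 0 <= H z by rewrite !mulr_ge0.
have HE0 z : (0 <= (H z)%:E)%E by rewrite lee_fin.
have m01 : measurable (`[2^-1, 1] : set (measurableTypeR R)) by exact: measurable_itv.
have cray y : continuous (ray x (y.1 - x.1, y.2 - x.2)).
  by apply: pair_continuous => t; apply: cvgD; (try exact: cvg_cst);
    apply: cvgM; [exact: cvg_id|exact: cvg_cst|exact: cvg_id|exact: cvg_cst].
apply: (@le_trans _ _ ((d ^+ 2)%:E * \int[area]_y \int[mu]_t (H (y, t))%:E)%E).
  have mF := measurable_fun_fubini_tonelli_F (m2 := @lebesgue_measure R) _ mHE HE0.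
  rewrite -ge0_integralZl//; last 2 first.
  - by move=> y _; apply: integral_ge0.
  - by rewrite lee_fin sqr_ge0.
  rewrite [leLHS]integral_mkcond; apply: ge0_le_integral => //.
  - by move=> y _; rewrite patchE; case: ifP => // _; rewrite lee_fin sqr_ge0.
  - apply/(measurable_restrictT _ mC)/measurable_funTS/measurable_EFinP.
    under eq_fun do rewrite expr2.
    have m1 : measurable_fun setT (fun y : mplane R => u y - u (mid x y)).
      apply: measurable_funB; apply: continuous_measurable_plane => //.
      apply: (comp_continuous _ cu); apply: pair_continuous => y; apply: cvgM; try exact: cvg_cst;
        (apply: cvgD; first exact: cvg_cst); [exact: cvg_fst|exact: cvg_snd].
    exact: measurable_funM.
  - by apply: measurable_funeM; exact: mF.
  - move=> y _; rewrite patchE; case: ifPn => [/set_mem Cy|_]; last first.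
      by apply: mule_ge0; [rewrite lee_fin sqr_ge0|apply: integral_ge0].
    have -> : (\int[mu]_t (H (y, t))%:E = \int[mu]_(t in `[2^-1%R, 1%R]) (G (ray x (y.1 - x.1, y.2 - x.2) t))%:E)%E.
      rewrite [RHS]integral_mkcond; apply: eq_integral => t _.
      rewrite patchE /H/= indicE mem_set// mul1r indicE; case: ifPn => [/set_mem/= t01|_]; last by rewrite mul0r.
      rewrite mul1r /GC indicE mem_set ?mulr1//.
      by apply: C_convex => //; move: t01; rewrite in_itv/= => /andP[? ->]; rewrite andbT; lra.
    have := integrable_fin_num m01 (continuous_itv_integrable 2^-1 1 (comp_continuous (cray y) cG)).
    move=> /fineK <-; rewrite -EFinM lee_fin; exact: segment_bound.
rewrite [X in (_ <= X)%E](_ : _ = (d ^+ 2)%:E * (2 * \int[area]_(z in C) G z)%:E)%E; last first.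
  by rewrite -EFinM; congr EFin; ring.
apply: lee_wpmul2l; first by rewrite lee_fin sqr_ge0.
rewrite (area_line_tonelli mHE HE0).
apply: (@le_trans _ _ (\int[mu]_(t in `[2^-1%R, 1%R]) (cst (4 * \int[area]_(z in C) G z)%:E) t)%E); last first.
  have mu01 : mu `[2^-1, 1] = (2^-1)%:E.
    by rewrite lebesgue_measure_itv/= lte_fin invf_lt1 ?ltr1n// -EFinB; congr EFin; field.
  rewrite integral_cst// [X in (_ * X <= _)%E]mu01 -EFinM lee_fin.
  by rewrite le_eqVlt; apply/orP; left; apply/eqP; field.
have mG := measurable_fun_fubini_tonelli_G (m1 := @lebesgue_plane R) _ mHE HE0.
rewrite [leRHS]integral_mkcond; apply: ge0_le_integral => //.
- by move=> t _; apply: integral_ge0.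
- by apply/(measurable_restrictT _ m01)/measurable_funTS.
- move=> t _; rewrite patchE; case: ifPn => [/set_mem/= t01|tn]; last first.
    rewrite integral0_eq// => y _; rewrite /H/= [\1_(`[2^-1, 1]) t]indicE (negbTE tn) mulr0 mul0r//.
  move: t01; rewrite in_itv/= => /andP[t1 t2].
  have t0 : 0 < t by lra.
  apply: (@le_trans _ _ (\int[area]_y (GC (affine2 t 0 ((1 - t) * x.1) 0 t ((1 - t) * x.2) y))%:E)%E).
    apply: ge0_le_integral => //.
    - by apply: (measurableT_comp mHE); exact: measurable_fun_pair.
    - by apply/measurable_EFinP; exact: (measurableT_comp mGC (measurable_affine_plane _ _ _ _ _ _)).
    - move=> y _; rewrite lee_fin /H/=.
      rewrite (_ : ray _ _ _ = affine2 t 0 ((1 - t) * x.1) 0 t ((1 - t) * x.2) y); last first.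
        by rewrite /ray /affine2/=; congr pair; ring.
      by rewrite ler_piMl// !indicE; do 2 case: (_ \in _) => //=; rewrite ?mulr1 ?mulr0.
  have td : t * t - 0 * 0 != 0 by rewrite mul0r subr0 mulf_neq0// gt_eqF.
  have mGCE : measurable_fun setT (EFin \o GC) by exact/measurable_EFinP.
  have GCE0 z : (0 <= (EFin \o GC) z)%E by rewrite lee_fin.
  have := area_linear ((1 - t) * x.1) ((1 - t) * x.2) td mGCE GCE0.
  rewrite mul0r subr0 ger0_norm ?mulr_ge0 ?(ltW t0)// /= GC_int => e1.
  have : ((4 * (t * t))%:E * (\int[area]_y (GC (affine2 t 0 ((1 - t) * x.1) 0 t ((1 - t) * x.2) y))%:E) =
    (4 * \int[area]_(z in C) G z)%:E)%E by rewrite [RHS]EFinM -[X in (_ = _ * X)%E]e1 muleA -EFinM.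
  move=> <-; rewrite -[leLHS]mul1e; apply: lee_wpmul2r; first by apply: integral_ge0 => y _; rewrite lee_fin.
  rewrite lee_fin; nra.
Qed.

(** Averaging the difference quotient over all pairs of points of the cell;
    comparing both points with their midpoint keeps the contraction ratios of
    the change of variables in [[1/2, 1]]. *)
Lemma poincare : fine (area C) * \int[area]_(x in C) (u x * u x) <=
  (\int[area]_(x in C) u x) ^+ 2 +
  4 * d ^+ 2 * fine (area C) * \int[area]_(x in C) G x.
Proof.
have cuu : continuous (fun x => u x * u x) by move=> x; apply: cvgM; exact: cu.
have cc1 : continuous (cst 1 : R * R -> R) by exact: cst_continuous.
have areaC : area C = (fine (area C))%:E by rewrite fineK// ge0_fin_numE.
have finI f : continuous f -> (\int[area]_(x in C) (f x)%:E = (\int[area]_(x in C) f x)%:E)%E.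
  by move=> cf; rewrite fineK//; apply: integrable_fin_num => //; exact: C_int.
set V := fine (area C) in areaC *; set I1 := \int[area]_(x in C) u x.
set I2 := \int[area]_(x in C) (u x * u x); set IG := \int[area]_(x in C) G x.
have inner x : \int[area]_(y in C) ((u y - u x) ^+ 2) = I2 - 2 * u x * I1 + u x ^+ 2 * V.
  rewrite (eq_Rintegral _ (g := fun y : mplane R => u y * u y + (- 2 * u x) * u y + (u x ^+ 2) * cst 1 y)); last first.
    by move=> y _ /=; ring.
  have i1 : area.-integrable C (EFin \o (fun y => - 2 * u x * u y)).
    by apply: C_int => y; apply: cvgM; [exact: cvg_cst|exact: cu].
  have i3 : area.-integrable C (EFin \o (fun y => u x ^+ 2 * cst 1 y)).
    by apply: C_int => y; apply: cvgM; exact: cvg_cst.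
  rewrite !RintegralD//; [|exact: C_int|]; last first.
    by apply: C_int => y; apply: cvgD; [exact: cuu|apply: cvgM; [exact: cvg_cst|exact: cu]].
  rewrite (RintegralZl _ mC (C_int cu)) (RintegralZl _ mC (C_int cc1)).
  by rewrite Rintegral_cst// mul1r -/V -/I1 -/I2; ring.
have cdd (x : R * R) : continuous (fun y => (u y - u x) ^+ 2).
  by apply: continuous_sqr => y; apply: cvgB; [exact: cu|exact: cvg_cst].
have cin : continuous (fun x : R * R => I2 - 2 * u x * I1 + u x ^+ 2 * V).
  by move=> x; apply: cvgD; [apply: cvgB; [exact: cvg_cst|]|]; apply: cvgM; try exact: cvg_cst;
    [apply: cvgM; [exact: cvg_cst|exact: cu]|exact: (continuous_sqr cu)].
have outer : (\int[area]_(x in C) \int[area]_(y in C) ((u y - u x) ^+ 2)%:E = (2 * V * I2 - 2 * I1 ^+ 2)%:E)%E.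
  under eq_integral do rewrite finI// inner.
  rewrite (finI _ cin).
  congr EFin; rewrite (eq_Rintegral _ (g := fun x : mplane R => I2 * cst 1 x + (- 2 * I1) * u x + V * (u x * u x))); last first.
    by move=> x _ /=; ring.
  have i1 : area.-integrable C (EFin \o (fun y => - 2 * I1 * u y)).
    by apply: C_int => y; apply: cvgM; [exact: cvg_cst|exact: cu].
  have i2 : area.-integrable C (EFin \o (fun y => V * (u y * u y))).
    by apply: C_int => y; apply: cvgM; [exact: cvg_cst|exact: cuu].
  have i3 : area.-integrable C (EFin \o (fun y => I2 * cst 1 y)).
    by apply: C_int => y; apply: cvgM; exact: cvg_cst.
  rewrite !RintegralD//; last first.
    by apply: C_int => y; apply: cvgD; (apply: cvgM; first exact: cvg_cst); [exact: cvg_cst|exact: cu].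
  rewrite (RintegralZl _ mC (C_int cu)) (RintegralZl _ mC (C_int cc1)).
  rewrite (RintegralZl _ mC (C_int cuu)).
  by rewrite Rintegral_cst// mul1r -/V -/I1 -/I2; ring.
pose P (z : mplane R * mplane R) : \bar R :=
  (\1_C z.1 * \1_C z.2 * (u z.2 - u (mid z.1 z.2)) ^+ 2)%:E.
have P0 z : (0 <= P z)%E by rewrite lee_fin; apply: mulr_ge0; [exact: mulr_ge0|exact: sqr_ge0].
have mP : measurable_fun setT P.
  apply/measurable_EFinP; apply: measurable_funM.
    apply: measurable_funM.
    - by apply: (measurableT_comp _ measurable_fst); exact: measurable_indic.
    - by apply: (measurableT_comp _ measurable_snd); exact: measurable_indic.
  under eq_fun do rewrite expr2.
  have mu' := continuous_measurable_plane cu.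
  suff mB : measurable_fun setT (fun z : mplane R * mplane R => u z.2 - u (mid z.1 z.2)) by exact: measurable_funM.
  apply: measurable_funB; first exact: (measurableT_comp mu' measurable_snd).
  apply: (measurableT_comp mu'); apply: measurable_fun_pair; apply: measurable_funM => //;
    apply: measurable_funD.
  - exact: (measurableT_comp measurable_fst measurable_fst).
  - exact: (measurableT_comp measurable_fst measurable_snd).
  - exact: (measurableT_comp measurable_snd measurable_fst).
  - exact: (measurableT_comp measurable_snd measurable_snd).
have mPF := measurable_fun_fubini_tonelli_F (m2 := @lebesgue_plane R) _ mP P0.
have mPG := measurable_fun_fubini_tonelli_G (m1 := @lebesgue_plane R) _ mP P0.
have mP1 (x : mplane R) : measurable_fun setT (fun y : mplane R => P (x, y)).
  by apply: (measurableT_comp mP); exact: measurable_fun_pair.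
have mP2 (x : mplane R) : measurable_fun setT (fun y : mplane R => P (y, x)).
  by apply: (measurableT_comp mP); exact: measurable_fun_pair.
have P_le : (\int[area]_x \int[area]_y P (x, y) <= (2 * d ^+ 2 * IG * V)%:E)%E.
  rewrite [leRHS](_ : _ = \int[area]_(x in C) (cst (2 * d ^+ 2 * IG)%:E) x)%E; last first.
    by rewrite integral_cst// areaC.
  rewrite [leRHS]integral_mkcond; apply: ge0_le_integral => //.
  - by move=> x _; apply: integral_ge0.
  - by apply/(measurable_restrictT _ mC)/measurable_funTS.
  move=> x _; rewrite patchE; case: ifPn => [/set_mem/= Cx|xn]; last first.
    by rewrite integral0_eq// => y _; rewrite /P/= indicE (negbTE xn) ?mul0r.
  apply: le_trans (shrink_bound Cx); rewrite [leRHS]integral_mkcond le_eqVlt; apply/orP; left; apply/eqP.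
  apply: eq_integral => y _; rewrite /P/= patchE indicE mem_set// mul1r indicE.
  by case: ifP => _; rewrite ?mul1r ?mul0r.
have main : ((2 * V * I2 - 2 * I1 ^+ 2)%:E <= (8 * d ^+ 2 * IG * V)%:E)%E.
  rewrite -outer; apply: (@le_trans _ _ (\int[area]_x \int[area]_y (2%:E * P (x, y) + 2%:E * P (y, x)))%E).
    have mS : measurable_fun setT (fun z : mplane R * mplane R => 2%:E * P z + 2%:E * P (z.2, z.1))%E.
      apply: emeasurable_funD; apply: emeasurable_funM => //.
      by apply: (measurableT_comp mP); apply: measurable_fun_pair; [exact: measurable_snd|exact: measurable_fst].
    have S0 z : (0 <= 2%:E * P z + 2%:E * P (z.2, z.1))%E by rewrite adde_ge0// mule_ge0// lee_fin.
    have mSF := measurable_fun_fubini_tonelli_F (m2 := @lebesgue_plane R) _ mS S0.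
    have inE (x : mplane R) : C x -> (\int[area]_(y in C) ((u y - u x) ^+ 2)%:E <= \int[area]_y (2%:E * P (x, y) + 2%:E * P (y, x)))%E.
      move=> Cx; rewrite [leLHS]integral_mkcond; apply: ge0_le_integral => //.
      - by move=> y _; rewrite patchE; case: ifP => // _; rewrite lee_fin sqr_ge0.
      - apply/(measurable_restrictT _ mC)/measurable_funTS/measurable_EFinP.
        exact: continuous_measurable_plane.
      - by apply: (measurableT_comp mS); exact: measurable_fun_pair.
      move=> y _; rewrite patchE; case: ifPn => [/set_mem Cy|_ //].
      rewrite /P/= !indicE !mem_set// !mul1r -!EFinM -EFinD lee_fin.
      have -> : mid y x = mid x y by rewrite /mid (addrC y.1) (addrC y.2).
      have := sqr_ge0 ((u y - u (mid x y)) + (u x - u (mid x y))); rewrite !expr2; lra.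
    rewrite [leLHS]integral_mkcond; apply: ge0_le_integral => //.
    - by move=> x _; rewrite patchE; case: ifP => // _; apply: integral_ge0 => y _; rewrite lee_fin sqr_ge0.
    - apply/(measurable_restrictT _ mC)/measurable_funTS.
      rewrite (_ : (fun x => _) = (fun x => (I2 - 2 * u x * I1 + u x ^+ 2 * V)%:E)).
        by apply/measurable_EFinP; exact: (continuous_measurable_plane cin).
      by apply/funext => x; rewrite finI// inner.
    - by move=> x _; rewrite patchE; case: ifPn => [/set_mem/inE//|_]; apply: integral_ge0.
  under eq_integral => x _ do [rewrite ge0_integralD//; [|by move=> y _; rewrite mule_ge0// lee_fin|
    by apply: emeasurable_funM|by move=> y _; rewrite mule_ge0// lee_fin|by apply: emeasurable_funM];
    rewrite !ge0_integralZl//].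
  rewrite ge0_integralD//; last 4 first.
  - by move=> x _; apply: mule_ge0; rewrite ?lee_fin//; apply: integral_ge0.
  - by apply: emeasurable_funM.
  - by move=> x _; apply: mule_ge0; rewrite ?lee_fin//; apply: integral_ge0.
  - by apply: emeasurable_funM.
  rewrite !ge0_integralZl//; [|by move=> x _; apply: integral_ge0|by move=> x _; apply: integral_ge0].
  rewrite -(area_tonelli mP P0).
  rewrite [leRHS](_ : _ = 2%:E * (2 * d ^+ 2 * IG * V)%:E + 2%:E * (2 * d ^+ 2 * IG * V)%:E)%E; last first.
    by rewrite -!EFinM -EFinD; congr EFin; ring.
  by apply: leeD; apply: lee_wpmul2l.
have rearr (a b W D I : R) : 2 * W * a - 2 * b <= 8 * D * I * W -> W * a <= b + 4 * D * W * I by lra.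
by apply: rearr; rewrite -lee_fin.
Qed.

End poincare.

(** * Compactness from a fine grid *)

Section polygon_compactness.
Context {R : realType} {L : nat}.
Variables (c : R * R) (r theta : R).
Hypotheses (hL : (3 <= L)%N) (r_gt0 : 0 < r).
Local Notation Omega := (polygon (@vertex R L c r theta)).

Lemma sqint_continuous (f : R * R -> R) : continuous f -> sqint area Omega f.
Proof.
move=> cf; split; first by apply: measurable_funTS; exact: continuous_measurable_plane.
have /integrableP[_] := polygon_integrable c theta hL r_gt0 (continuous_sqr cf).
by congr (_ < _)%E; apply: eq_integral => x _; rewrite /= ger0_norm// sqr_ge0.
Qed.

(** Up to a small multiple of the Dirichlet energy, the mass of a function is
    controlled by finitely many of its averages: cut the polygon by a fine
    square grid and use the Poincare inequality in each cell. *)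
Lemma grid_compact (e : R) : 0 < e -> exists (k : nat) (w : 'I_k -> mplane R -> R),
  (forall i, sqint area Omega (w i) /\ ip area Omega (w i) (w i) <= 1) /\
  forall u g, C1 u g ->
    ip area Omega u u <= e * (ip area Omega (g true) (g true) + ip area Omega (g false) (g false)) +
      \sum_(i < k) ip area Omega (w i) u ^+ 2.
Proof.
move=> e0; have lt3 (a b : R) : a <= b -> 0 < b -> a + b < 3 * b by move=> *; lra.
have itv_conv (a b p q t : R) : a <= p -> p < b -> a <= q -> q < b -> 0 <= t -> t <= 1 ->
    a <= (1 - t) * p + t * q < b.
  move=> ap pb aq qb t0 t1.
  have h1 : 0 <= (1 - t) * (p - a) by rewrite mulr_ge0 ?subr_ge0.
  have h2 : 0 <= t * (q - a) by rewrite mulr_ge0 ?subr_ge0.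
  have h3 : 0 <= (1 - t) * (b - p) by rewrite mulr_ge0 ?subr_ge0// ltW.
  apply/andP; split; first lra.
  have [->|tn] := eqVneq t 0; first by rewrite subr0 mul1r mul0r addr0.
  have h4 : 0 < t * (b - q) by rewrite mulr_gt0 ?subr_gt0// lt_def tn.
  by lra.
have itv_diam (a z1 z2 w d : R) : a * d <= z1 - w -> z1 - w < (a + 1) * d ->
    a * d <= z2 - w -> z2 - w < (a + 1) * d -> `|z1 - z2| <= d.
  by move=> e1 e2 e3 e4; rewrite ler_norml; apply/andP; split; lra.
have mO : measurable (Omega : set (mplane R)) by exact: measurable_polygon.
have [n n_gt0 nE] : exists2 n : nat, (0 < n)%N & 4 * (3 * r / n%:R) ^+ 2 <= e.
  pose m := Num.trunc (36 * r ^+ 2 / e); exists m.+1 => //.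
  have m1 : 36 * r ^+ 2 / e < m.+1%:R by exact: truncnS_gt.
  have : 1 <= m.+1%:R :> R by rewrite ler1n.
  move: m1; move: (m.+1%:R : R) => q; rewrite ltr_pdivrMr// => h1 h2.
  have q0 : 0 < q by lra.
  rewrite expr_div_n mulrA ler_pdivrMr ?exprn_gt0//.
  rewrite (_ : 4 * (3 * r) ^+ 2 = 36 * r ^+ 2); last by ring.
  by rewrite (le_trans (ltW h1))// mulrC ler_wpM2l ?(ltW e0)// expr2 ler_peMl// ltW.
pose d := 3 * r / n%:R.
have d0 : 0 < d by rewrite divr_gt0 ?ltr0n// mulr_gt0.
pose I := ('I_n * 'I_n)%type.
pose cell (p : I) : set (mplane R) := Omega `&`
  ([set x | p.1%:R <= (x.1 - (c.1 - r)) / d < p.1.+1%:R] `&`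
   [set x | p.2%:R <= (x.2 - (c.2 - r)) / d < p.2.+1%:R]).
have mcell p : measurable (cell p).
  have mcoord (m : nat) (z : R) (f : mplane R -> R) : measurable_fun setT f ->
      measurable [set x | m%:R <= (f x - z) / d < m.+1%:R].
    move=> mf; rewrite (_ : [set x | _] = (fun x => (f x - z) / d) @^-1` `[m%:R, m.+1%:R[%classic).
      rewrite -[X in measurable X]setTI; suff mg : measurable_fun setT (fun x => (f x - z) / d) by exact: mg.
      by apply: measurable_funM => //; exact: measurable_funB.
    by apply/seteqP; split=> x /=; rewrite in_itv.
  by apply: measurableI => //; apply: measurableI; exact: mcoord.
have cellO p : cell p `<=` Omega by move=> x [].
have cover : Omega = \big[setU/set0]_(p <- index_enum I) cell p :> set (mplane R).
  apply/seteqP; split=> x; last by rewrite -bigcup_seq => -[p _] /cellO.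
  move=> Ox; rewrite -bigcup_seq.
  have [x1 x2] := bounded_polygon hL r_gt0 Ox.
  have loc (y z : R) : `|y - z| <= r -> 0 <= (y - (z - r)) / d /\ (Num.trunc ((y - (z - r)) / d) < n)%N.
    rewrite ler_norml => /andP[h1 h2]; have h3 : 0 <= (y - (z - r)) / d by rewrite divr_ge0 ?(ltW d0)//; lra.
    split=> //; rewrite truncn_lt_nat//.
    rewrite ltr_pdivrMr// (_ : n%:R * d = 3 * r); first by rewrite opprB addrCA addrC; exact: lt3.
    by rewrite /d mulrC divfK// pnatr_eq0 -lt0n.
  have [h1 l1] := loc _ _ x1; have [h2 l2] := loc _ _ x2.
  exists (Ordinal l1, Ordinal l2); first by rewrite /= mem_index_enum.
  by split=> //; split; exact: trunc_itv.
have triv : trivIset [set` index_enum I] cell.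
  move=> p q _ _ [x [[_ [/= a1 a2]] [_ [b1 b2]]]].
  rewrite [p]surjective_pairing [q]surjective_pairing; congr pair; apply: val_inj => /=.
    by rewrite -(truncn_def a1) -(truncn_def b1).
  by rewrite -(truncn_def a2) -(truncn_def b2).
have cell_lty p : (area (cell p) < +oo)%E.
  apply: le_lt_trans (area_polygon_lty c theta hL r_gt0).
  by apply: le_measure; rewrite ?inE//; exact: cellO.
have cell_int p f : continuous f -> area.-integrable (cell p) (EFin \o f).
  move=> cf; apply: (integrableS mO) => //; exact: polygon_integrable.
have cell_convex p x y t : cell p x -> cell p y -> 0 <= t <= 1 -> cell p (ray x (y.1 - x.1, y.2 - x.2) t).
  move=> [Ox [/= /andP[a1 a2] /andP[a3 a4]]] [Oy [/= /andP[b1 b2] /andP[b3 b4]]] t01.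
  split; first exact: (polygon_convex hL r_gt0).
  have conv (a b z1 z2 w : R) : a <= (z1 - w) / d -> (z1 - w) / d < b -> a <= (z2 - w) / d -> (z2 - w) / d < b ->
      a <= (z1 + t * (z2 - z1) - w) / d < b.
    move=> e1 e2 e3 e4; move: t01 => /andP[t0 t1].
    rewrite (_ : (z1 + t * (z2 - z1) - w) / d = (1 - t) * ((z1 - w) / d) + t * ((z2 - w) / d)); last by field; rewrite gt_eqF.
    exact: itv_conv.
  by split; rewrite /ray/=; exact: conv.
have cell_diam p x y : cell p x -> cell p y -> `|x.1 - y.1| <= d /\ `|x.2 - y.2| <= d.
  move=> [Ox [/= /andP[a1 a2] /andP[a3 a4]]] [Oy [/= /andP[b1 b2] /andP[b3 b4]]].
  have diam (a z1 z2 w : R) : a <= (z1 - w) / d -> (z1 - w) / d < a + 1 -> a <= (z2 - w) / d -> (z2 - w) / d < a + 1 ->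
      `|z1 - z2| <= d.
    move=> e1 e2 e3 e4; apply: (itv_diam a _ _ w).
    - by move: e1; rewrite ler_pdivlMr.
    - by move: e2; rewrite ltr_pdivrMr.
    - by move: e3; rewrite ler_pdivlMr.
    - by move: e4; rewrite ltr_pdivrMr.
  by rewrite -!natr1 in a2 a4 b2 b4; split; [exact: (diam _ _ _ _ a1 a2 b1 b2)|exact: (diam _ _ _ _ a3 a4 b3 b4)].
pose wt (p : I) (x : mplane R) : R := (Num.sqrt (fine (area (cell p))))^-1 * \1_(cell p) x.
have wt_int p (f : mplane R -> R) : area.-integrable (cell p) (EFin \o f) -> ip area Omega (wt p) f =
    (Num.sqrt (fine (area (cell p))))^-1 * \int[area]_(x in cell p) f x.
  move=> intf; rewrite /ip -(RintegralZl _ (mcell p) intf).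
  rewrite Rintegral_mkcond [RHS]Rintegral_mkcond; apply: eq_Rintegral => x _.
  rewrite !patchE /wt indicE; case: ifPn => [xO|/negP xO].
    by case: ifP => _; rewrite ?mulr1 ?mulr0 ?mul0r.
  by case: ifPn => // /set_mem/cellO/mem_set.
have sum_cells (f : R * R -> R) : continuous f -> (forall x, 0 <= f x) ->
    \int[area]_(x in Omega) f x = \sum_p \int[area]_(x in cell p) f x.
  move=> cf f0; apply: EFin_inj; rewrite -sumEFin.
  have finE (D : set (mplane R)) : measurable D -> area.-integrable D (EFin \o f) ->
      (\int[area]_(x in D) f x)%:E = (\int[area]_(x in D) (f x)%:E)%E.
    by move=> mD intf; rewrite fineK//; exact: integrable_fin_num.
  rewrite finE//; last exact: polygon_integrable.
  under eq_bigr => p _ do rewrite (finE _ (mcell p) (cell_int p _ cf)).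
  rewrite {1}cover ge0_integral_bigsetU//.
  - exact: index_enum_uniq.
  - by apply: measurable_funTS; apply/measurable_EFinP; exact: continuous_measurable_plane.
  - by move=> x _; rewrite lee_fin.
exists #|{: I}|, (fun i => wt (enum_val i)); split.
  move=> i; move: (enum_val i) => p {i}.
  have mw : measurable_fun setT (wt p) by apply: measurable_funM => //; exact: measurable_indic.
  have s0 : 0 <= (Num.sqrt (fine (area (cell p))))^-1 by rewrite invr_ge0 sqrtr_ge0.
  have wb x : `|wt p x| <= (Num.sqrt (fine (area (cell p))))^-1.
    by rewrite /wt normrM ger0_norm// ler_piMr// indicE; case: (_ \in _); rewrite ?normr1 ?normr0.
  split.
    apply: (bounded_sqint mO (M := (Num.sqrt (fine (area (cell p))))^-1)) => //.
    - exact: area_polygon_lty.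
    - exact: measurable_funTS.
  rewrite wt_int; last first.
    by apply: bounded_integrable (cell_lty p) _ _ => //; exact: measurable_funTS.
  rewrite (eq_Rintegral _ (g := cst (Num.sqrt (fine (area (cell p))))^-1)); last first.
    by move=> x /set_mem px; rewrite /wt indicE mem_set// mulr1.
  rewrite Rintegral_cst// mulrA -invfM -expr2 sqr_sqrtr ?fine_ge0//.
  have [->|V0] := eqVneq (fine (area (cell p))) 0; first by rewrite mulr0.
  by rewrite mulVf.
move=> u g Cu.
have cu : continuous u by case: Cu.
have cg b : continuous (g b) by case: Cu => _ + _; apply.
have cM (f : R * R -> R) : continuous f -> continuous (fun x => f x * f x).
  by move=> cf x; apply: cvgM; exact: cf.
have cG : continuous (fun x => g true x * g true x + g false x * g false x).
  by move=> x; apply: cvgD; exact: cM (cg _) _.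
rewrite /ip -(RintegralD mO (polygon_integrable c theta hL r_gt0 (cM _ (cg true)))
  (polygon_integrable c theta hL r_gt0 (cM _ (cg false)))).
rewrite (sum_cells _ (cM _ cu)); last by move=> x; rewrite -expr2 sqr_ge0.
rewrite (sum_cells _ cG); last by move=> x; rewrite addr_ge0// -expr2 sqr_ge0.
rewrite -(big_enum_val (fun p : I => (\int[area]_(x in Omega) (wt p x * u x)) ^+ 2)) /=.
rewrite mulr_sumr -big_split/=; apply: ler_sum => p _.
have := wt_int p u (cell_int p _ cu); rewrite /ip => ->.
have := poincare (mcell p) (cell_lty p) (@cell_convex p) (@cell_diam p) (@cell_int p) Cu.
set V := fine (area (cell p)); set J := \int[area]_(x in cell p) u x.
have -> : ((Num.sqrt V)^-1 * J) ^+ 2 = V^-1 * J ^+ 2 by rewrite exprMn exprVn sqr_sqrtr ?fine_ge0.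
set IG := \int[area]_(x in cell p) (_ + _); set I2 := \int[area]_(x in cell p) (u x * u x).
have IG0 : 0 <= IG by apply: Rintegral_ge0 => x _; rewrite addr_ge0// -expr2 sqr_ge0.
have [V0 _|V0] := eqVneq V 0; last first.
  have V_gt0 : 0 < V by rewrite lt_def V0 fine_ge0.
  move=> pc; have : V * I2 <= V * (e * IG + V^-1 * J ^+ 2); last by rewrite ler_pM2l.
  rewrite mulrDr [V * (V^-1 * _)]mulrA mulfV// mul1r (le_trans pc)// addrC lerD2r.
  rewrite -mulrA mulrCA ler_wpM2l ?(ltW V_gt0)// ler_wpM2r//.
rewrite [X in X <= _](_ : _ = 0) ?V0 ?invr0 ?mul0r ?addr0 ?mulr_ge0 ?(ltW e0)//.
have cellO0 : area (cell p) = 0%E.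
  have : area (cell p) \is a fin_num by rewrite ge0_fin_numE.
  by move=> /fineK <-; rewrite -/V V0.
rewrite /I2 /Rintegral (_ : integral _ _ _ = 0%E)//.
apply: null_set_integral => //.
by apply: measurable_funTS; apply/measurable_EFinP; exact: continuous_measurable_plane (cM _ cu).
Qed.

End polygon_compactness.

(** * Smooth test functions *)

Section flat_functions.
Context {R : realType}.

(** The functions [s^-k exp(-1/s)], extended by [0] to [s <= 0]: a family
    closed under differentiation up to linear combinations. *)
Definition flat (k : nat) (s : R) : R := if 0 < s then s^-1 ^+ k * expR (- s^-1) else 0.

Lemma flat_ge0 k s : 0 <= flat k s.
Proof. by rewrite /flat; case: ifPn => // s0; rewrite mulr_ge0 ?expR_ge0// exprn_ge0// invr_ge0 ltW. Qed.

Lemma flat_gt0 k s : 0 < s -> 0 < flat k s.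
Proof. by move=> s0; rewrite /flat s0 mulr_gt0 ?expR_gt0// exprn_gt0// invr_gt0. Qed.

Lemma flat_eq0 k s : s <= 0 -> flat k s = 0.
Proof. by rewrite /flat leNgt => /negbTE ->. Qed.

Lemma flat0_le1 s : flat 0 s <= 1.
Proof.
rewrite /flat; case: ifPn => // s0; rewrite expr0 mul1r -expR0 ler_expR.
by rewrite oppr_le0 invr_ge0 ltW.
Qed.

(** The exponential beats the pole; a quadratic bound makes the derivative at [0]
    vanish. *)
Lemma flat_le_sqr k s : flat k s <= (k.+2)`!%:R * s ^+ 2.
Proof.
rewrite /flat; case: ifPn => [s0|_]; last by rewrite mulr_ge0// sqr_ge0.
have x0 : 0 < s^-1 by rewrite invr_gt0.
have := expR_ge1Dxn k.+1 (ltW x0).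
have F0 : 0 < (k.+2)`!%:R :> R by rewrite ltr0n fact_gt0.
set F := (k.+2)`!%:R in F0 *.
have e0 := expR_gt0 s^-1.
rewrite expRN ler_pdivrMr// => h.
have {}h : s^-1 ^+ k.+2 <= F * expR s^-1.
  by rewrite mulrC -ler_pdivrMr//; apply: le_trans h; rewrite lerDr.
have -> : s^-1 ^+ k = s^-1 ^+ k.+2 * s ^+ 2.
  by rewrite -addn2 exprD -mulrA -exprMn mulVf ?gt_eqF// expr1n mulr1.
by rewrite [leRHS]mulrAC; apply: ler_wpM2r => //; exact: sqr_ge0.
Qed.

Let derive_powV k (s : R) : s != 0 ->
  is_derive s (1 : R) (fun y : R => y^-1 ^+ k) (- k%:R * s^-1 ^+ k.+1).
Proof.
move=> s0; elim: k => [|k IH].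
  by rewrite oppr0 mul0r; under eq_fun do rewrite expr0; exact: is_derive_cst.
have dV : is_derive s (1 : R) (fun y : R => y^-1) (- s ^- 2).
  have := @is_deriveV R id s 1 1 s0 (is_derive_id _ _).
  by rewrite /GRing.scale/= mulr1.
have := is_deriveM dV IH.
rewrite (_ : (fun y => y^-1) * (fun y => y^-1 ^+ k) = (fun y => y^-1 ^+ k.+1)); last first.
  by apply/funext => y; rewrite exprS.
rewrite (_ : _ + _ = - k.+1%:R * s^-1 ^+ k.+2)// /GRing.scale/= -!exprVn -natr1.
rewrite -/(s^-1 ^+ 2) !exprS expr0; ring.
Qed.

Lemma is_derive_flat k (s : R) :
  is_derive s (1 : R) (flat k) (flat k.+2 s - k%:R * flat k.+1 s).
Proof.
have [s0|s0|->] := ltgtP s 0.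
- rewrite !flat_eq0 ?(ltW s0)// mulr0 subr0.
  apply: (near_eq_is_derive _ (is_derive_cst (0 : R) s (1 : R))).
  near=> y; rewrite flat_eq0// ltW//; near: y.
  exact: lt_nbhsl.
- have s_neq0 : s != 0 by rewrite gt_eqF.
  suff : is_derive s (1 : R) (fun y => y^-1 ^+ k * expR (- y^-1)) (flat k.+2 s - k%:R * flat k.+1 s).
    apply: near_eq_is_derive; near=> y; rewrite /flat; case: ifPn => // /negP[].
    by near: y; exact: lt_nbhsr.
  have dE : is_derive s (1 : R) (fun y => expR (- y^-1)) (expR (- s^-1) * s^-1 ^+ 2).
    have dN := is_deriveN (derive_powV 1 s_neq0).
    have := @is_derive1_comp R expR (- (fun y : R => y^-1 ^+ 1)) s _ _ (is_derive_expR _) dN.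
    by rewrite mulN1r opprK.
  have := is_deriveM (derive_powV k s_neq0) dE.
  rewrite (_ : _ + _ = flat k.+2 s - k%:R * flat k.+1 s)//.
  by rewrite /flat s0 /GRing.scale/= !exprS; ring.
- rewrite !flat_eq0// mulr0 subr0; apply: is_derive_cvg.
  apply/cvgrPdist_le => e e0; near=> h; rewrite [flat k 0]flat_eq0// subr0 addr0 sub0r normrN normrM.
  have h0 : h != 0 by near: h; exact: nbhs_dnbhs_neq.
  have F0 : 0 < (k.+2)`!%:R :> R by rewrite ltr0n fact_gt0.
  rewrite normrV ?unitfE// ler_pdivrMl ?normr_gt0// ger0_norm ?flat_ge0//.
  apply: le_trans (flat_le_sqr _ _) _; rewrite -real_normK ?num_real// expr2 mulrA.
  rewrite [leRHS]mulrC ler_wpM2r// mulrC -ler_pdivlMr//.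
  near: h; apply: (@dnbhs0_le R R); exact: divr_gt0.
Unshelve. all: by end_near. Qed.

Lemma flat_continuous k : continuous (flat k).
Proof.
move=> s; apply: differentiable_continuous; apply/derivable1_diffP.
by case: (is_derive_flat k s).
Qed.

(** A family of functions of the plane closed under sums, products and partial
    derivatives, rich enough to contain mollifiers and cut-offs. *)
Inductive elementary : (R * R -> R) -> Prop :=
| elementary_cst (a : R) : elementary (cst a)
| elementary_flat k (a b c : R) : elementary (fun x => flat k (a * x.1 + b * x.2 + c))
| elementary_exp (a b c : R) : elementary (fun x => expR (a * x.1 + b * x.2 + c))
| elementaryD f g : elementary f -> elementary g -> elementary (fun x => f x + g x)
| elementaryM f g : elementary f -> elementary g -> elementary (fun x => f x * g x).

Lemma elementaryZ a f : elementary f -> elementary (fun x => a * f x).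
Proof. exact: elementaryM (elementary_cst a). Qed.

Lemma elementary_prod (I : Type) (s : seq I) (F : I -> R * R -> R) :
  (forall i, elementary (F i)) -> elementary (fun x => \prod_(i <- s) F i x).
Proof.
move=> eF; elim: s => [|i s IH].
  by rewrite (_ : (fun x => _) = cst 1); [exact: elementary_cst|apply/funext => x; rewrite big_nil].
rewrite (_ : (fun x => _) = (fun x => F i x * \prod_(j <- s) F j x)); first exact: elementaryM.
by apply/funext => x; rewrite big_cons.
Qed.

Lemma elementary_affine f a1 b1 c1 a2 b2 c2 : elementary f ->
  elementary (fun z => f (affine2 a1 b1 c1 a2 b2 c2 z)).
Proof.
elim=> [a|k a b c|a b c|g1 g2 _ e1 _ e2|g1 g2 _ e1 _ e2].
- exact: elementary_cst.
- rewrite (_ : (fun z => _) = (fun z => flat k ((a * a1 + b * a2) * z.1 + (a * b1 + b * b2) * z.2 + (a * c1 + b * c2 + c)))).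
    exact: elementary_flat.
  by apply/funext => z; rewrite /affine2/=; congr flat; ring.
- rewrite (_ : (fun z => _) = (fun z => expR ((a * a1 + b * a2) * z.1 + (a * b1 + b * b2) * z.2 + (a * c1 + b * c2 + c)))).
    exact: elementary_exp.
  by apply/funext => z; rewrite /affine2/=; congr expR; ring.
- exact: elementaryD.
- exact: elementaryM.
Qed.

Lemma C1_flat k f g : C1 f g ->
  C1 (fun x => flat k (f x)) (fun b x => (flat k.+2 (f x) - k%:R * flat k.+1 (f x)) * g b x).
Proof.
move=> [cf cg fg]; split.
- exact: (comp_continuous cf (@flat_continuous k)).
- move=> b x; apply: cvgM; last exact: cg.
  apply: cvgB; first exact: (comp_continuous cf (@flat_continuous k.+2)).
  by apply: cvgM; [exact: cvg_cst|exact: (comp_continuous cf (@flat_continuous k.+1))].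
- move=> x d; rewrite -!mulrA -mulrDr.
  have := @is_derive1_comp R (flat k) (fun t => f (ray x d t)) 0 _ _ _ (fg x d); rewrite ray0; apply.
  exact: is_derive_flat.
Qed.

Lemma elementary_C1 f : elementary f -> exists2 g, C1 f g & forall b, elementary (g b).
Proof.
elim=> [a|k a b c|a b c|f1 f2 _ [g1 C1f e1] _ [g2 C2f e2]|f1 f2 E1 [g1 C1f e1] E2 [g2 C2f e2]].
- by exists (fun b => cst 0); [exact: C1_cst|move=> b; exact: elementary_cst].
- eexists; first exact: (C1_flat k (C1_affine a b c)).
  move=> i; apply: elementaryM; last by case: i; exact: elementary_cst.
  rewrite (_ : (fun x => _) = (fun x : R * R => flat k.+2 (a * x.1 + b * x.2 + c) + (- k%:R) * flat k.+1 (a * x.1 + b * x.2 + c))).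
    by apply: elementaryD; [exact: elementary_flat|apply: elementaryZ; exact: elementary_flat].
  by apply/funext => x; ring.
- eexists; first exact: (C1_expR (C1_affine a b c)).
  by move=> i; apply: elementaryM; [exact: elementary_exp|case: i; exact: elementary_cst].
- by eexists; [exact: (C1D C1f C2f)|move=> b; exact: elementaryD].
- by eexists; [exact: (C1M C1f C2f)|move=> b; apply: elementaryD; exact: elementaryM].
Qed.

Lemma C1_derivable (f : R * R -> R) g x : C1 f g -> derivable f x dirx /\ derivable f x diry.
Proof.
move=> [_ _ fg]; suff D b : derivable f x (if b then dirx else diry) by have := (D true, D false); case.
have /cvg_is_derive h := fg x (if b then dirx else diry).
apply/cvg_ex; exists (g true x * (if b then dirx else diry).1 + g false x * (if b then dirx else diry).2).
apply: cvg_trans h; apply: near_eq_cvg; near=> t; rewrite ray0 addr0 /=.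
congr (_ * (f _ - _)).
by case: b; rewrite /ray /dirx /diry; apply/eqP; rewrite -pair_eqE /=; apply/andP; split;
    rewrite /GRing.scale /= addrC.
Unshelve. all: by end_near. Qed.

(** A class of differentiable functions closed under partial differentiation
    consists of smooth functions. *)
Lemma smooth_closed (P : (R * R -> R) -> Prop) :
  (forall f, P f -> exists2 g, C1 f g & forall b, P (g b)) -> forall f, P f -> smooth f.
Proof.
move=> HP f Pf s; suff Ps : P (foldr partial f s).
  have [g Cg _] := HP _ Ps; split; first by case: Cg.
  by move=> x; exact: C1_derivable Cg.
elim: s => //= b s /HP[g Cg Pg]; by rewrite (C1_partial b Cg).
Qed.

Lemma elementary_smooth f : elementary f -> smooth f.
Proof. exact: (smooth_closed elementary_C1). Qed.

Lemma elementary_continuous f : elementary f -> continuous f.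
Proof. by move=> /elementary_C1[g []]. Qed.

End flat_functions.

(** * Uniqueness of weak derivatives *)

Section vanishing.
Context {R : realType} {L : nat}.
Variables (c : R * R) (r theta : R).
Hypotheses (hL : (3 <= L)%N) (r_gt0 : 0 < r).
Local Notation Omega := (polygon (@vertex R L c r theta)).
Local Notation h := (@apothem R L r).
Local Notation height := (@height R L c theta).

Let mO : measurable (Omega : set (mplane R)). Proof. exact: measurable_polygon. Qed.

Lemma flat0_cvg (u : nat -> R) : u n @[n --> \oo] --> +oo -> flat 0 (u n) @[n --> \oo] --> (1 : R).
Proof.
move=> uoo; apply/cvgrPdist_le => e e0; near=> n.
have un : e^-1 <= u n by near: n; exact: (cvgry_ge uoo).
have un0 : 0 < u n by apply: lt_le_trans un; rewrite invr_gt0.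
rewrite ger0_norm ?subr_ge0 ?flat0_le1// lerBlDr -lerBlDl /flat un0 expr0 mul1r.
apply: le_trans (expR_ge1Dx _); rewrite lerD2l lerN2.
by rewrite invf_ple.
Unshelve. all: by end_near. Qed.

Lemma natmul_cvg (p q : R) : 0 < p -> n%:R * p + q @[n --> \oo] --> +oo.
Proof.
move=> p0; apply/cvgryPge => A; near=> n.
rewrite -lerBlDr -ler_pdivrMr//; near: n; exact: nbhs_infty_ger.
Unshelve. all: by end_near. Qed.

(** Each factor vanishes unless the distance to the edge exceeds [1 / n], so the
    support is compact in the polygon; the limit is [1] inside. *)
Definition cutoff (n : nat) (x : R * R) : R := \prod_(k < L) flat 0 (n%:R * (h - height k x) - 1).

Lemma heightE' k (x : R * R) : height k x = (edge_normal theta k).1 * x.1 + (edge_normal theta k).2 * x.2 +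
  - ((edge_normal theta k).1 * c.1 + (edge_normal theta k).2 * c.2).
Proof. rewrite /height/dot/=; ring. Qed.

Lemma cutoff_elementary n : elementary (cutoff n).
Proof.
apply: elementary_prod => k.
pose A := n%:R * (edge_normal theta k).1; pose B := n%:R * (edge_normal theta k).2.
rewrite (_ : (fun x => _) = fun x => flat 0 (- A * x.1 + - B * x.2 + (n%:R * h - 1 + A * c.1 + B * c.2))).
  exact: elementary_flat.
by apply/funext => x; rewrite heightE' /A /B; congr flat; ring.
Qed.

Lemma cutoff_01 n x : 0 <= cutoff n x <= 1.
Proof.
apply: (big_ind (fun y : R => 0 <= y <= 1)) => [|a b /andP[a0 a1] /andP[b0 b1]|k _].
- by rewrite ler01 lexx.
- by rewrite mulr_ge0//= mulr_ile1.
- by rewrite flat_ge0 flat0_le1.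
Qed.

Lemma cutoff_cvg x : Omega x -> cutoff n x @[n --> \oo] --> (1 : R).
Proof.
rewrite polygonE//= => Ox; rewrite /cutoff; elim: (index_enum _) => [|k s IH].
  by under eq_fun do rewrite big_nil; exact: cvg_cst.
have k1 : flat 0 (n%:R * (h - height k x) - 1) @[n --> \oo] --> (1 : R).
  by apply: flat0_cvg; apply: natmul_cvg; rewrite subr_gt0.
have -> : (fun n => \prod_(j <- k :: s) flat 0 (n%:R * (h - height j x) - 1)) =
    (fun n => flat 0 (n%:R * (h - height k x) - 1) * \prod_(j <- s) flat 0 (n%:R * (h - height j x) - 1)).
  by apply/funext => n; rewrite big_cons.
rewrite -[X in _ @ _ --> X](mulr1 1); exact: cvgM k1 IH.
Qed.

Lemma cutoff_test n (f : R * R -> R) : elementary f -> test_function Omega (fun x => cutoff n x * f x).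
Proof.
move=> ef; split; first by apply: elementary_smooth; apply: elementaryM => //; exact: cutoff_elementary.
pose K : set (R * R) := [set x | (forall k : 'I_L, 1 <= n%:R * (h - height k x))].
have KO : K `<=` Omega.
  move=> x Kx; rewrite polygonE//= => k; rewrite -subr_gt0; have := Kx k.
  by apply: contraTT; rewrite -leNgt -ltNge => hk; rewrite (le_lt_trans _ ltr01)// mulr_ge0_le0.
exists K; split => //.
- apply: (@subclosed_compact _ _ (`[c.1 - r, c.1 + r] `*` `[c.2 - r, c.2 + r])).
  + rewrite (_ : K = \bigcap_k [set x | 1 <= n%:R * (h - height k x)]); last first.
      by apply/seteqP; split=> x Kx k; [move=> _; exact: Kx|exact: Kx].
    apply: closed_bigI => k _.
    have cF : continuous (fun x => n%:R * (h - height k x)).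
      move=> x; apply: cvgM; first exact: cvg_cst.
      by apply: cvgB; [exact: cvg_cst|have [ch _ _] := height_C1 c theta k; exact: ch].
    exact: (closed_comp (fun x _ => cF x) (@closed_ge R 1)).
  + by apply: compact_setX; exact: segment_compact.
  + move=> x /KO Ox; have [] := bounded_polygon hL r_gt0 Ox; rewrite !ler_norml => /andP[? ?] /andP[? ?].
    by split; rewrite /= in_itv/=; apply/andP; split; lra.
- move=> x Kx; have [k hk] : exists k, n%:R * (h - height k x) < 1.
    by move/existsNP: Kx => [k /negP]; rewrite -ltNge => ?; exists k.
  by rewrite /cutoff (bigD1 k)//= flat_eq0 ?mul0r//; lra.
Qed.

Variable g : mplane R -> R.
Hypothesis g_int : area.-integrable Omega (EFin \o g).
Hypothesis g_test : forall f, test_function Omega f -> \int[area]_(x in Omega) (g x * f x) = 0.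

Let P (A : set (mplane R)) : Prop := (\int[area]_(x in Omega `&` A) (g x)%:E = 0)%E.

Let step_fun (n : nat) (a b t : R) : R := flat 0 (n%:R * (t - a)) * flat 0 (n%:R * (n%:R * (b - t) + 1)).

Let step_01 n a b t : 0 <= step_fun n a b t <= 1.
Proof.
by rewrite mulr_ge0 ?flat_ge0//= mulr_ile1 ?flat_ge0 ?flat0_le1.
Qed.

Let step_cvg a b t : step_fun n a b t @[n --> \oo] --> (\1_(`]a, b]%classic : set R) t : R).
Proof.
rewrite indicE; have [|tn] := boolP (t \in _) => /=; last first.
  apply: cvg_near_cst.
  have [ta|ta] := leP t a.
    by near=> n; rewrite /step_fun flat_eq0 ?mul0r// mulr_ge0_le0// subr_le0.
  have bt : b < t.
    by rewrite ltNge; apply: contra tn => tb; rewrite inE/= in_itv/= ta.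
  near=> n; rewrite /step_fun [X in _ * X]flat_eq0 ?mulr0// mulr_ge0_le0//.
  rewrite -(opprB t) mulrN addrC subr_le0 -ler_pdivrMr ?subr_gt0//.
  by near: n; exact: nbhs_infty_ger.
rewrite inE/= in_itv/= => /andP[at_ tb].
rewrite -[X in _ --> X]mulr1; apply: cvgM; apply: flat0_cvg.
  by under eq_fun do rewrite -[_ * _]addr0; apply: natmul_cvg; rewrite subr_gt0.
apply/cvgryPge => A; near=> n.
have n1 : A <= n%:R by near: n; exact: nbhs_infty_ger.
apply: le_trans n1 _; rewrite ler_peMr// lerDr mulr_ge0// subr_ge0//.
Unshelve. all: by end_near. Qed.

Let step_elementary1 n a b : elementary (fun x => step_fun n a b x.1).
Proof.
apply: elementaryM.
  rewrite (_ : (fun x => _) = fun x : R * R => flat 0 (n%:R * x.1 + 0 * x.2 + - n%:R * a)).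
    exact: elementary_flat.
  by apply/funext => x; congr flat; ring.
rewrite (_ : (fun x => _) = fun x : R * R => flat 0 (- (n%:R * n%:R) * x.1 + 0 * x.2 + n%:R * (n%:R * b + 1))).
  exact: elementary_flat.
by apply/funext => x; congr flat; ring.
Qed.

Let step_elementary2 n a b : elementary (fun x => step_fun n a b x.2).
Proof.
have -> : (fun x : R * R => step_fun n a b x.2) = (fun x => step_fun n a b (affine2 0 1 0 1 0 0 x).1).
  by apply/funext => x; rewrite /affine2/=; congr step_fun; ring.
exact: (elementary_affine 0 1 0 1 0 0 (step_elementary1 n a b)).
Qed.

Let P_box a b a' b' : P (`]a, b]%classic `*` `]a', b']%classic).
Proof.
pose f n x := cutoff n x * (step_fun n a b x.1 * step_fun n a' b' x.2).
have ef n : elementary (f n).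
  by apply: elementaryM; [exact: cutoff_elementary|exact: elementaryM].
have mf n : measurable_fun Omega (fun x => (g x * f n x)%:E).
  apply/measurable_EFinP; apply: measurable_funM.
    by apply/measurable_EFinP; case/integrableP: g_int.
  by apply: measurable_funTS; apply: continuous_measurable_plane; exact: elementary_continuous.
pose gA (x : mplane R) := (g x * (\1_(`]a, b]%classic : set R) x.1 * \1_(`]a', b']%classic : set R) x.2))%:E.
have lim x : Omega x -> (g x * f n x)%:E @[n --> \oo] --> gA x.
  move=> Ox; apply: cvg_EFin; first by near=> n.
  apply: cvgM; first exact: cvg_cst.
  rewrite -[X in _ --> X]mul1r; apply: cvgM; first exact: cutoff_cvg.
  by apply: cvgM; exact: step_cvg.
have f1 n x : `|f n x| <= 1.
  have /andP[c0 c1] := cutoff_01 n x; have /andP[s0 s1] := step_01 n a b x.1.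
  have /andP[t0 t1] := step_01 n a' b' x.2.
  rewrite /f ger0_norm; last exact: (mulr_ge0 c0 (mulr_ge0 s0 t0)).
  exact: mulr_ile1 c0 (mulr_ge0 s0 t0) c1 (mulr_ile1 s0 t0 s1 t1).
have dom n x : Omega x -> (`|(g x * f n x)%:E| <= `|(g x)%:E|)%E.
  by move=> Ox; rewrite lee_fin normrM ler_piMr.
have := dominated_cvg mO mf lim _ (integrable_abse g_int) dom.
have -> : (fun n => \int[area]_(x in Omega) (g x * f n x)%:E)%E = cst 0%E.
  apply/funext => n; have ig : area.-integrable Omega (fun x => (g x * f n x)%:E).
    apply: (le_integrable mO (mf n) _ g_int) => x Ox; exact: dom.
  have tf : test_function Omega (f n).
      by apply: cutoff_test; apply: elementaryM; [exact: step_elementary1|exact: step_elementary2].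
    by rewrite -(fineK (integrable_fin_num mO ig)) [fine _](g_test tf).
move=> /(_ (fun _ _ => isT)) /cvg_lim e; have {e} : (\int[area]_(x in Omega) gA x = 0)%E.
  by rewrite -e// lim_cst.
rewrite /P integral_mkcondr => <-; apply: eq_integral => x _; rewrite patchE /gA !indicE.
rewrite in_setX; case: (_ \in _); case: (_ \in _) => /=; by rewrite ?mulr1 ?mulr0 ?mul0r.
Unshelve. all: by end_near. Qed.

Let P_D A B : measurable A -> measurable B -> B `<=` A -> P A -> P B -> P (A `\` B).
Proof.
move=> mA mB BA PA PB; have mD := measurableD mA mB.
have e : Omega `&` A = (Omega `&` B) `|` (Omega `&` (A `\` B)).
  by rewrite -setIUr setDUK.
move: PA; rewrite /P e integral_setU_EFin//; first by rewrite [X in (X + _)%E]PB add0e.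
- exact: measurableI.
- exact: measurableI.
- rewrite -e; apply/measurable_EFinP; apply: (measurable_funS mO) => //.
  by case/integrableP: g_int.
- by apply/disj_setPS => x [[_ Bx] [_ []]].
Qed.

Let P_bigcup (F : nat -> set (mplane R)) : (forall n, measurable (F n)) -> trivIset setT F ->
  (forall n, P (F n)) -> P (\bigcup_k F k).
Proof.
move=> mF tF PF; rewrite /P setI_bigcupr integral_bigcup.
- by rewrite eseries0// => k _ _; exact: PF.
- apply/trivIsetP => i j _ _ ij; rewrite setIACA setIid.
  by move/trivIsetP : tF => /(_ i j Logic.I Logic.I ij) ->; rewrite setI0.
- by move=> k; exact: measurableI.
- apply: (integrableS mO) g_int; last by move=> x [k _ []].
  by apply: bigcup_measurable => k _; exact: measurableI.
Qed.

Let P_eq A B : (forall x, Omega x -> A x <-> B x) -> P A -> P B.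
Proof.
move=> AB; rewrite /P; suff -> : Omega `&` A = Omega `&` B by [].
by apply/seteqP; split=> x [Ox /(AB x Ox)].
Qed.

Let mT := measurableTypeR R.

Let big_itv (z x : R) : `|x - z| <= r -> `]z - 2 * r, z + 2 * r]%classic x.
Proof. by have := r_gt0; rewrite ler_norml /= in_itv/= => ? /andP[? ?]; apply/andP; split; lra. Qed.

Let P_left (A : set mT) a b : measurable A -> P (A `*` `]a, b]%classic).
Proof.
have mab : measurable (`]a, b]%classic : set mT) by exact: measurable_itv.
have PT : P ([set: mT] `*` `]a, b]%classic).
  apply: P_eq (P_box (c.1 - 2 * r) (c.1 + 2 * r) a b) => x /(bounded_polygon hL r_gt0)[x1 x2].
  by split=> -[_ ?]; split=> //; exact: big_itv.
move=> mA; apply: (@dynkin_induction _ mT (@ocitv R) (fun A => P (A `*` `]a, b]%classic))) => //.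
- exact: ocitvI.
- by move=> _ [[a' b'] _ <-]; exact: P_box.
- move=> S mS PS; rewrite (_ : _ `*` _ = ([set: mT] `*` `]a, b]%classic) `\` (S `*` `]a, b]%classic)).
    by apply: P_D => //; [exact: measurableX|exact: measurableX|move=> x []].
  apply/seteqP; split=> x [/= nS xab]; first by split=> // -[].
  by split; [move=> Sx; apply: xab; split; [exact: Sx|case: nS]|case: nS].
- move=> F mF tF PF; rewrite (_ : _ `*` _ = \bigcup_k (F k `*` `]a, b]%classic)).
    apply: P_bigcup => //; first by move=> n; exact: measurableX.
    apply/trivIsetP => i j _ _ ij; rewrite -subset0 => x [[Fi _] [Fj _]].
    by move/trivIsetP : tF => /(_ i j Logic.I Logic.I ij); rewrite -subset0 => /(_ x.1); apply.
  apply/seteqP; split=> x; first by move=> [[k _ Fk] xab]; exists k.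
  by move=> [k _ [Fk xab]]; split=> //; exists k.
Qed.

Let P_rect (A B : set mT) : measurable A -> measurable B -> P (A `*` B).
Proof.
move=> mA; have PT : P (A `*` [set: mT]).
  apply: P_eq (P_left (c.2 - 2 * r) (c.2 + 2 * r) mA) => x /(bounded_polygon hL r_gt0)[x1 x2].
  by split=> -[? _]; split=> //; exact: big_itv.
move=> mB; apply: (@dynkin_induction _ mT (@ocitv R) (fun B => P (A `*` B))) => //.
- exact: ocitvI.
- by move=> _ [[a' b'] _ <-]; exact: P_left.
- move=> S mS PS; rewrite (_ : _ `*` _ = (A `*` [set: mT]) `\` (A `*` S)).
    by apply: P_D => //; [exact: measurableX|exact: measurableX|move=> x []].
  apply/seteqP; split=> x [/= Ax nS]; first by split=> // -[].
  by split; [case: Ax|move=> Sx; apply: nS; split; [case: Ax|exact: Sx]].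
- move=> F mF tF PF; rewrite (_ : _ `*` _ = \bigcup_k (A `*` F k)).
    apply: P_bigcup => //; first by move=> n; exact: measurableX.
    apply/trivIsetP => i j _ _ ij; rewrite -subset0 => x [[_ Fi] [_ Fj]].
    by move/trivIsetP : tF => /(_ i j Logic.I Logic.I ij); rewrite -subset0 => /(_ x.2); apply.
  apply/seteqP; split=> x; first by move=> [Ax [k _ Fk]]; exists k.
  by move=> [k _ [Ax Fk]]; split=> //; exists k.
Qed.

Let P_all (A : set (mplane R)) : measurable A -> P A.
Proof.
move=> mA; have E := measurable_prod_measurableType mT mT.
apply: (dynkin_induction E) => //.
- move=> _ _ [A1 mA1 [B1 mB1 <-]] [A2 mA2 [B2 mB2 <-]].
  exists (A1 `&` A2); first exact: measurableI.
  by exists (B1 `&` B2); [exact: measurableI|rewrite setXI].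
- by rewrite -setXTT; exact: P_rect.
- by move=> _ [A1 mA1 [B1 mB1 <-]]; exact: P_rect.
- move=> S mS PS; rewrite -setTD; apply: P_D => //.
  by rewrite -setXTT; exact: P_rect.
- by rewrite -E.
Qed.

(** A function orthogonal to all test functions vanishes: its integral over
    every box is a limit of integrals against test functions, and boxes
    generate the Borel sets. *)
Lemma test_vanish : {ae area, forall x, Omega x -> g x = 0}.
Proof.
have m0 : measurable_fun Omega (cst 0%E : mplane R -> \bar R) by exact: measurable_cst.
have := integral_ae_eq mO g_int m0.
have H E : E `<=` Omega -> measurable E -> (\int[area]_(x in E) (EFin \o g) x = \int[area]_(x in E) cst 0 x)%E.
  move=> EO mE; rewrite integral_cst ?mul0e//; have := P_all mE.
  by rewrite /P (setIidr EO).
move=> /(_ H); apply: filterS => x + Ox => /(_ Ox)[].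
by [].
Qed.

End vanishing.

(** * Density of test functions *)

Section projection.
Context d {T : measurableType d} {R : realType}.
Variables (mu : {measure set T -> \bar R}) (D : set T).
Hypothesis mD : measurable D.
Variable S : set (T -> R).
Hypothesis S_sqint : S `<=` sqint mu D.
Hypothesis S0 : S 0.
Hypothesis SP : forall a f g, S f -> S g -> S (a *: f + g).

Local Notation ip := (ip mu D).

(** A subspace with trivial orthogonal complement is dense: a minimising
    sequence for the distance converges to the orthogonal projection. *)
Lemma total_dense : (forall p, sqint mu D p -> (forall s, S s -> ip p s = 0) -> ip p p = 0) ->
  forall u, sqint mu D u -> forall e, 0 < e -> exists2 s, S s & ip (u - s) (u - s) <= e.
Proof.
move=> total u su e e0.
pose dist := [set ip (u - s) (u - s) | s in S].
have dist0 : has_inf dist.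
  split; first by exists (ip (u - 0) (u - 0)), 0.
  by exists 0 => _ [s _ <-]; exact: ip_ge0.
pose K (n : nat) : R := n.+1%:R^-1.
have K0 n : 0 < K n by rewrite invr_gt0.
have /choice[s sP] : forall n, exists s, S s /\ ip (u - s) (u - s) < inf dist + K n.
  by move=> n; have [_ [s Ss <-] h] := inf_adherent (K0 n) dist0; exists s.
have Ss n : S (s n) := (sP n).1; have ss n : sqint mu D (s n) := S_sqint (Ss n).
have key n z : S z -> ip (u - s n) z ^+ 2 <= K n * ip z z.
  move=> Sz; have sz := S_sqint Sz; apply: quadratic_disc => x y.
  have [->|x0] := eqVneq x 0.
    by rewrite expr0n mul0r mulr0 !mul0r !add0r mulr_ge0 ?sqr_ge0 ?ip_ge0.
  pose t := y / x; have -> : y = t * x by rewrite divfK.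
  suff : 0 <= K n + 2 * t * ip (u - s n) z + t ^+ 2 * ip z z.
    move=> h; have := mulr_ge0 (sqr_ge0 x) h; congr (_ <= _); ring.
  have Sz' : S (- t *: z + s n) by exact: SP.
  have h1 : inf dist <= ip (u - (- t *: z + s n)) (u - (- t *: z + s n)).
    by apply: inf_lbound => //; [exact: dist0.2|exists (- t *: z + s n)].
  have sus : sqint mu D (u - s n) by exact: sqintB.
  have stz : sqint mu D (t *: z) by exact: sqintZ.
  have e1 : u - (- t *: z + s n) = (u - s n) + t *: z.
    by apply/funext => a; rewrite !fctE /GRing.scale/=; ring.
  move: h1; rewrite e1 ip_sqD// (ipC _ _ _ (t *: z)) ipZ// ipZ// (ipC _ _ z (t *: z)) ipZ// (ipC _ _ z).
  have := (sP n).2; rewrite expr2; lra.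
have cauchy n m : ip (s n - s m) (s n - s m) <= 2 * (K n + K m).
  have Sz : S (s n - s m) by rewrite addrC -scaleN1r; exact: SP.
  have sz := S_sqint Sz; set N := ip _ _.
  have h1 := key n _ Sz; have h2 := key m _ Sz; rewrite -/N in h1 h2.
  have e1 : N = ip (u - s m) (s n - s m) - ip (u - s n) (s n - s m).
    rewrite -ipB//; last 2 first.
    - exact: sqintB.
    - exact: sqintB.
    by rewrite (_ : u - s m - (u - s n) = s n - s m)//; apply/funext => a; rewrite !fctE/=; ring.
  have N0 : 0 <= N by exact: ip_ge0.
  have [->|Nn0] := eqVneq N 0; first by rewrite mulr_ge0// addr_ge0// ltW.
  have N_gt0 : 0 < N by rewrite lt_def Nn0.
  rewrite -(ler_pM2r N_gt0); move: h1 h2 e1.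
  move: (ip (u - s n) _) (ip (u - s m) _) (K n) (K m) => b a Kn Km h1 h2 e1.
  have := sqr_ge0 (a + b); have : N * N = (a - b) ^+ 2 by rewrite -e1.
  rewrite !expr2 in h1 h2 *; lra.
have small (x : R) : 0 < x -> exists N, forall n, (N <= n)%N -> K n <= x.
  move=> x0; exists (Num.trunc x^-1) => n Nn; rewrite /K invf_ple ?posrE//.
  by apply: ltW; apply: lt_le_trans (truncnS_gt _) _; rewrite ler_nat.
have [|w sw wlim] := sqint_complete mD ss.
  move=> x x0; have [N NP] := small (x / 4) (divr_gt0 x0 (ltr0n _ 4)).
  exists N => m n Nm Nn; apply: le_trans (cauchy m n) _.
  have := NP m Nm; have := NP n Nn; move: (K m) (K n) => a b; lra.
have sp : sqint mu D (u - w) by exact: sqintB.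
have p_orth z : S z -> ip (u - w) z = 0.
  move=> Sz; have sz := S_sqint Sz; apply/eqP; rewrite -sqrf_eq0 -normr_eq0 ger0_norm ?sqr_ge0//.
  have d0 : 0 <= ip z z by exact: ip_ge0.
  rewrite eq_le sqr_ge0 andbT; apply/ler_addgt0Pl => x x0; rewrite addr0.
  pose q := x / (4 * (ip z z + 1)).
  have q0 : 0 < q by rewrite divr_gt0// mulr_gt0// ltr_wpDl.
  have [N1 N1P] := small q q0; have [N2 N2P] := wlim q q0.
  pose n := maxn N1 N2; have h1 := N1P n (leq_maxl _ _); have h2 := N2P n (leq_maxr _ _).
  have swn : sqint mu D (s n - w) by exact: sqintB.
  have susn : sqint mu D (u - s n) by exact: sqintB.
  have e1 : ip (u - w) z = ip (u - s n) z + ip (s n - w) z.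
    by rewrite -ipD//; congr ip; apply/funext => a; rewrite !fctE/=; ring.
  have k1 := le_trans (key n z Sz) (ler_wpM2r d0 h1).
  have k2 := le_trans (ip_CS mD swn sz) (ler_wpM2r d0 h2).
  have qx : 4 * (q * ip z z) <= x.
    have : q * (4 * (ip z z + 1)) = x by rewrite divfK// mulf_neq0// gt_eqF// ltr_wpDl.
    by move: q0; clear; move: q (ip z z) => q' N q'0; lra.
  rewrite e1; move: k1 k2 qx; move: (ip _ _) (ip _ _) (q * _) => a b y k1 k2 qx.
  have := sqr_ge0 (a - b); rewrite !expr2 in k1 k2 *; lra.
have p0 := total _ sp p_orth.
have [N NP] := wlim (e / 2) (divr_gt0 e0 (ltr0n _ 2)).
exists (s N) => //; have swN : sqint mu D (s N - w) by exact: sqintB.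
have -> : u - s N = (u - w) - (s N - w) by apply/funext => a; rewrite !fctE/=; ring.
have := NP N (leqnn _); rewrite (ip_sqB mD sp swN).
have := ip_CS mD sp swN; rewrite p0 mul0r => h.
have -> : ip (u - w) (s N - w) = 0.
  by apply/eqP; rewrite -sqrf_eq0 eq_le h sqr_ge0.
by rewrite mulr0 subr0 add0r; lra.
Qed.

End projection.

(** ** Mollifiers *)

Section mollifier.
Context {R : realType}.
Variable e : R.
Hypothesis e_gt0 : 0 < e.

Definition bump (w : R * R) : R :=
  (flat 0 (e + w.1) * flat 0 (e - w.1)) * (flat 0 (e + w.2) * flat 0 (e - w.2)).

Lemma bump_elementary : elementary bump.
Proof.
have E (a b : R) : elementary (fun w : R * R => flat 0 (e + (a * w.1 + b * w.2))).
  rewrite (_ : (fun w => _) = (fun w => flat 0 (a * w.1 + b * w.2 + e))); first exact: elementary_flat.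
  by apply/funext => w; rewrite addrC.
rewrite (_ : bump = fun w => (flat 0 (e + (1 * w.1 + 0 * w.2)) * flat 0 (e + (-1 * w.1 + 0 * w.2))) *
    (flat 0 (e + (0 * w.1 + 1 * w.2)) * flat 0 (e + (0 * w.1 + -1 * w.2)))).
  by apply: elementaryM; apply: elementaryM; exact: E.
by apply/funext => w; rewrite /bump !mul0r !mul1r !mulN1r !addr0 !add0r.
Qed.

Lemma bump_ge0 w : 0 <= bump w.
Proof. by rewrite !mulr_ge0 ?flat_ge0. Qed.

Lemma bump_le1 w : bump w <= 1.
Proof. by rewrite /bump !mulr_ile1 ?mulr_ge0 ?flat_ge0 ?flat0_le1// mulr_ile1 ?flat_ge0 ?flat0_le1. Qed.

Lemma bump_support w : bump w != 0 -> `|w.1| < e /\ `|w.2| < e.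
Proof.
rewrite /bump !mulf_eq0 !negb_or => /andP[/andP[h1 h2] /andP[h3 h4]].
have pos (s : R) : flat 0 s != 0 -> 0 < s.
  by move=> ?; rewrite ltNge; apply: contra_neqN (fun h => flat_eq0 0 h) _.
move/pos in h1; move/pos in h2; move/pos in h3; move/pos in h4.
by split; rewrite ltr_norml; apply/andP; split; lra.
Qed.

Lemma flat0_homo : {homo @flat R 0 : s t / s <= t}.
Proof.
move=> s t st; rewrite {1}/flat; case: ifPn => [s0|_]; last exact: flat_ge0.
have t0 := lt_le_trans s0 st.
by rewrite /flat t0 !expr0 !mul1r ler_expR lerN2 lef_pV2.
Qed.

Let box (a : R) : set (mplane R) := `[- a, a]%classic `*` `[- a, a]%classic.

Let mbox a : measurable (box a). Proof. by apply: measurableX; exact: measurable_itv. Qed.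

Let area_box a : 0 <= a -> area (box a) = ((2 * a) ^+ 2)%:E.
Proof.
move=> a0; rewrite area_setX//; [|exact: measurable_itv..].
rewrite !lebesgue_measure_itv/= lte_fin; case: ltP => [_|a1].
  by rewrite -EFinB opprK -EFinM; congr EFin; ring.
have -> : a = 0 by lra.
by rewrite mulr0 mule0 expr0n.
Qed.

Let Z := fine (\int[area]_w (bump w)%:E)%E.

Let mbump : measurable_fun setT (bump : mplane R -> R).
Proof. by apply: continuous_measurable_plane; exact: elementary_continuous bump_elementary. Qed.

Let Z_lty : (\int[area]_w (bump w)%:E < +oo)%E.
Proof.
apply: (@le_lt_trans _ _ (\int[area]_(w in box e) cst 1%E w)%E).
  rewrite [leRHS]integral_mkcond; apply: ge0_le_integral => //.
  - by move=> w _; rewrite lee_fin bump_ge0.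
  - exact/measurable_EFinP.
  - by apply/(measurable_restrictT _ (mbox e)); exact: measurable_cst.
  - move=> w _; rewrite patchE; case: ifPn => [_|]; first by rewrite lee_fin bump_le1.
    rewrite lee_fin; apply: contraNT; rewrite -ltNge => w0; apply/mem_set.
    have [] := bump_support (lt0r_neq0 w0); rewrite !ltr_norml => /andP[? ?] /andP[? ?].
    by split; rewrite /= in_itv/=; apply/andP; split; exact: ltW.
by rewrite integral_cst// mul1e area_box ?ltry// ltW.
Qed.

Let ZE : (\int[area]_w (bump w)%:E = Z%:E)%E.
Proof. by rewrite /Z fineK// ge0_fin_numE// integral_ge0// => w _; rewrite lee_fin bump_ge0. Qed.

Let Z_gt0 : 0 < Z.
Proof.
rewrite -lte_fin -ZE; pose m := flat 0 (e / 2) ^+ 4 : R.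
have e2 : 0 < e / 2 by rewrite divr_gt0.
apply: (@lt_le_trans _ _ (\int[area]_(w in box (e / 2)) cst m%:E w)%E).
  rewrite integral_cst// area_box ?(ltW e2)// -EFinM lte_fin mulr_gt0// exprn_gt0 ?flat_gt0//.
  by rewrite mulr_gt0.
rewrite [leLHS]integral_mkcond; apply: ge0_le_integral => //.
- by move=> w _; rewrite patchE; case: ifP => // _; rewrite lee_fin exprn_ge0// flat_ge0.
- by apply/(measurable_restrictT _ (mbox _)); exact: measurable_cst.
- exact/measurable_EFinP.
move=> w _; rewrite patchE; case: ifPn => [/set_mem[]|_]; last by rewrite lee_fin bump_ge0.
rewrite /= !in_itv/= => /andP[h1 h2] /andP[h3 h4]; rewrite lee_fin /m /bump.
have le_flat s : e / 2 <= s -> flat 0 (e / 2) <= flat 0 s by exact: flat0_homo.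
rewrite (_ : _ ^+ 4 = (flat 0 (e / 2) * flat 0 (e / 2)) * (flat 0 (e / 2) * flat 0 (e / 2))); last by ring.
have halfD (s : R) : - (e / 2) <= s -> e / 2 <= e + s by move=> ?; lra.
have halfB (s : R) : s <= e / 2 -> e / 2 <= e - s by move=> ?; lra.
apply: ler_pM; rewrite ?mulr_ge0 ?flat_ge0//; apply: ler_pM; rewrite ?flat_ge0//; apply: le_flat.
- exact: halfD.
- exact: halfB.
- exact: halfD.
- exact: halfB.
Qed.

Definition moll (w : R * R) : R := Z^-1 * bump w.

Lemma moll_elementary : elementary moll.
Proof. exact: elementaryZ bump_elementary. Qed.

Lemma moll_ge0 w : 0 <= moll w.
Proof. by rewrite mulr_ge0 ?bump_ge0// invr_ge0 ltW. Qed.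

Lemma moll_support w : moll w != 0 -> `|w.1| < e /\ `|w.2| < e.
Proof. by rewrite mulf_eq0 negb_or => /andP[_]; exact: bump_support. Qed.

Lemma moll_int : (\int[area]_w (moll w)%:E = 1)%E.
Proof.
under eq_integral do rewrite EFinM.
rewrite ge0_integralZl//; last 3 first.
- exact/measurable_EFinP.
- by move=> w _; rewrite lee_fin bump_ge0.
- by rewrite lee_fin invr_ge0 ltW.
by rewrite ZE -EFinM mulVf// gt_eqF.
Qed.

End mollifier.

(** ** Smoothing by dilated convolution *)

Lemma C1_lipschitz (R : realType) (k : R * R -> R) g (B : R) : C1 k g ->
  exists2 M, 0 <= M & forall p q : R * R, `|p.1| <= B -> `|p.2| <= B -> `|q.1| <= B -> `|q.2| <= B ->
    `|k p - k q| <= M * (`|p.1 - q.1| + `|p.2 - q.2|).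
Proof.
move=> Ck; have [_ cg _] := Ck.
have [M1 M1P] := continuous_bounded_box (- 3 * B, - 3 * B) (3 * B, 3 * B) (cg true).
have [M2 M2P] := continuous_bounded_box (- 3 * B, - 3 * B) (3 * B, 3 * B) (cg false).
exists (`|M1| + `|M2|) => [|p q p1 p2 q1 q2]; first by rewrite addr_ge0.
pose e := (p.1 - q.1, p.2 - q.2).
have [s] := MVT_between 0 1 (fun s => C1_line q e s Ck).
rewrite !subr0 normr1 mulr1 ray0.
have -> : ray q e 1 = p.
  by rewrite /ray /e/= !mul1r ![_ + (_ - _)]addrC !subrK -surjective_pairing.
move=> s1 ->.
have in_box (a b : R) : `|a| <= B -> `|b| <= B -> - 3 * B <= b + s * (a - b) <= 3 * B.
  move=> a1 b1; rewrite mulNr -ler_norml; apply: le_trans (ler_normD _ _) _.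
  have : `|s * (a - b)| <= 2 * B.
    rewrite normrM -[leRHS]mul1r ler_pM//; apply: le_trans (ler_normB _ _) _; lra.
  by move: (`|_|) => t; lra.
set z := ray q e s; have B1 : `|g true z| <= `|M1|.
  by apply: le_trans (ler_norm _); apply: M1P; exact: in_box.
have B2 : `|g false z| <= `|M2|.
  by apply: le_trans (ler_norm _); apply: M2P; exact: in_box.
apply: le_trans (ler_normD _ _) _; rewrite !normrM mulrDl.
apply: lerD; apply: ler_pM => //; first by rewrite lerDl.
by rewrite lerDr.
Qed.

Lemma C1_remainder (R : realType) (k : R * R -> R) g gg (B : R) : C1 k g ->
  (forall b, C1 (g b) (gg b)) ->
  exists2 M, 0 <= M & forall (p q : R * R) (h : R), `|p.1| <= B -> `|p.2| <= B ->
    `|q.1| <= B -> `|q.2| <= B -> `|h| <= 1 ->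
    `|k (ray p q h) - k p - h * (g true p * q.1 + g false p * q.2)| <= M * `|h| * `|h|.
Proof.
move=> Ck Cg.
have [M1 M1ge0 M1P] := C1_lipschitz (2 * B) (Cg true).
have [M2 M2ge0 M2P] := C1_lipschitz (2 * B) (Cg false).
exists ((M1 + M2) * (2 * B) * (2 * B)) => [|p q h p1 p2 q1 q2 h1].
  by rewrite -mulrA mulr_ge0 ?addr_ge0// -expr2 sqr_ge0.
have [s] := MVT_between 0 h (fun s => C1_line p q s Ck).
rewrite !subr0 ray0 => sh ->.
have B0 : 0 <= B by exact: le_trans (normr_ge0 _) p1.
set z := ray p q s.
have zp (b a : R) : `|b| <= B -> `|a| <= B -> `|b + s * a| <= 2 * B /\ `|b + s * a - b| <= `|h| * B.
  move=> b1 a1; have sa : `|s * a| <= `|h| * B by rewrite normrM ler_pM.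
  split; last by rewrite addrAC subrr add0r.
  apply: le_trans (ler_normD _ _) _; have : `|h| * B <= B by rewrite ler_piMl.
  by move: b1 sa; move: (`|_|) (`|_|) (`|_|) => *; lra.
have [z1 d1] := zp _ _ p1 q1; have [z2 d2] := zp _ _ p2 q2.
have p1' : `|p.1| <= 2 * B by apply: le_trans p1 _; lra.
have p2' : `|p.2| <= 2 * B by apply: le_trans p2 _; lra.
have L1 := M1P z p z1 z2 p1' p2'; have L2 := M2P z p z1 z2 p1' p2'.
rewrite (_ : _ - _ = h * ((g true z - g true p) * q.1 + (g false z - g false p) * q.2)); last by ring.
have dd : `|z.1 - p.1| + `|z.2 - p.2| <= `|h| * (2 * B).
  by apply: le_trans (lerD d1 d2) _; rewrite -mulrDr; lra.
rewrite normrM mulrC ler_wpM2r//.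
apply: le_trans (ler_normD _ _) _; rewrite !normrM.
have T1 : `|g true z - g true p| * `|q.1| <= M1 * (`|h| * (2 * B)) * B.
  by apply: ler_pM => //; apply: le_trans L1 _; exact: ler_wpM2l.
have T2 : `|g false z - g false p| * `|q.2| <= M2 * (`|h| * (2 * B)) * B.
  by apply: ler_pM => //; apply: le_trans L2 _; exact: ler_wpM2l.
apply: le_trans (lerD T1 T2) _.
have h0 : 0 <= (M1 + M2) * (`|h| * (2 * B)) * B by rewrite !mulr_ge0// addr_ge0.
by move: h0; lra.
Qed.

Section dilated_convolution.
Context {R : realType} {L : nat}.
Variables (c : R * R) (r theta : R).
Hypotheses (hL : (3 <= L)%N) (r_gt0 : 0 < r).
Local Notation Omega := (polygon (@vertex R L c r theta)).

Let mO : measurable (Omega : set (mplane R)). Proof. exact: measurable_polygon. Qed.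

Variable f : mplane R -> R.
Hypothesis f_int : area.-integrable Omega (EFin \o f).

Lemma integrable_mul_continuous (k : R * R -> R) : continuous k ->
  area.-integrable Omega (fun x => (f x * k x)%:E).
Proof.
move=> ck; have [M kM] := continuous_bounded_box (c.1 - r, c.2 - r) (c.1 + r, c.2 + r) ck.
have kO x : Omega x -> `|k x| <= `|M|.
  move=> /(bounded_polygon hL r_gt0)[h1 h2]; apply: le_trans (ler_norm M).
  by apply: kM => /=; [move: h1|move: h2]; rewrite ler_norml => /andP[? ?]; apply/andP; split; lra.
apply: (le_integrable mO _ _ (integrableZl mO `|M| (integrable_abse f_int))).
  apply/measurable_EFinP; apply: measurable_funM.
    by apply/measurable_EFinP; case/integrableP: f_int.
  by apply: measurable_funTS; exact: continuous_measurable_plane.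
move=> x Ox; change (`|f x * k x|%:E <= `| `|M| * `|f x| |%:E)%E.
by rewrite lee_fin !normrM !normr_id mulrC ler_wpM2r//; exact: kO.
Qed.

Let N := \int[area]_(x in Omega) `|f x|.

Lemma Rintegral_mul_le (k : R * R -> R) (A : R) : continuous k ->
  (forall x, Omega x -> `|k x| <= A) -> `|\int[area]_(x in Omega) (f x * k x)| <= A * N.
Proof.
move=> ck kA; apply: le_trans (le_normr_Rintegral _ (integrable_mul_continuous ck)) _ => //.
rewrite -RintegralZl//; last exact: integrable_norm.
apply: le_Rintegral => //.
- exact: (integrable_norm (integrable_mul_continuous ck)).
- have := integrableZl mO A (integrable_norm f_int).
  by apply: eq_integrable => // x _; rewrite EFinM.
- by move=> x Ox; rewrite normrM mulrC ler_wpM2r//; exact: kA.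
Qed.

Variable l : R.

Definition dilate (x : R * R) : R * R := (c.1 + l * (x.1 - c.1), c.2 + l * (x.2 - c.2)).

(** The dilation about the centre pulls the point into the polygon, so that a
    kernel of small support only sees values of [f] in the polygon. *)
Definition dconv (k : R * R -> R) (x : R * R) : R :=
  \int[area]_(z in Omega) (f z * k ((dilate x).1 - z.1, (dilate x).2 - z.2)).

Let cshift (k : R * R -> R) (p : R * R) : continuous k -> continuous (fun z : R * R => k (p.1 - z.1, p.2 - z.2)).
Proof.
move=> ck; apply: (comp_continuous _ ck); apply: pair_continuous => z; apply: cvgB; try exact: cvg_cst.
- exact: cvg_fst.
- exact: cvg_snd.
Qed.

Lemma dconv_integrable (k : R * R -> R) x : continuous k ->
  area.-integrable Omega (fun z => (f z * k ((dilate x).1 - z.1, (dilate x).2 - z.2))%:E).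
Proof. by move=> ck; apply: integrable_mul_continuous; exact: cshift. Qed.

Let in_box x : exists B, 1 <= B /\ forall x' z, `|x'.1 - x.1| <= 1 -> `|x'.2 - x.2| <= 1 -> Omega z ->
  `|(dilate x').1 - z.1| <= B /\ `|(dilate x').2 - z.2| <= B.
Proof.
pose B (x1 c1 : R) := `|l| * (1 + `|x1 - c1|) + r.
have one (x1 x1' c1 z1 : R) : `|x1' - x1| <= 1 -> `|z1 - c1| <= r -> `|c1 + l * (x1' - c1) - z1| <= B x1 c1.
  move=> h1 h2; rewrite (_ : _ - z1 = l * ((x1' - x1) + (x1 - c1)) - (z1 - c1)); last by ring.
  apply: le_trans (ler_normB _ _) _; apply: lerD => //; rewrite normrM ler_wpM2l//.
  by apply: le_trans (ler_normD _ _) _; rewrite lerD2r.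
have B0 (x1 c1 : R) : 0 <= B x1 c1 by rewrite addr_ge0 ?(ltW r_gt0)// mulr_ge0// addr_ge0.
exists (1 + B x.1 c.1 + B x.2 c.2); split; first by rewrite -addrA lerDl addr_ge0.
move=> x' z x1 x2 /(bounded_polygon hL r_gt0)[z1 z2]; split.
  by apply: le_trans (one _ _ _ _ x1 z1) _; have := B0 x.2 c.2; lra.
by apply: le_trans (one _ _ _ _ x2 z2) _; have := B0 x.1 c.1; lra.
Qed.

Lemma dconv_continuous k : elementary k -> continuous (dconv k).
Proof.
move=> ek; have ck := elementary_continuous ek; have [g Ck _] := elementary_C1 ek.
move=> x; apply/cvgrPdist_le => e e0.
have [B [B1 BP]] := in_box x; have [M M0 MP] := C1_lipschitz B Ck.
have N0 : 0 <= N by apply: Rintegral_ge0 => z _; exact: normr_ge0.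
pose A := M * (`|l| + `|l|) * N + 1; have A0 : 0 < A by rewrite ltr_wpDl// !mulr_ge0// addr_ge0.
have eta0 : 0 < Num.min 1 (e / A) by rewrite lt_min ltr01 divr_gt0.
apply: filterS (nbhsx_ballx x _ eta0) => x' [/ltW]; rewrite /= distrC !le_min => /andP[h1 h1'] /ltW; rewrite /= distrC le_min => /andP[h2 h2'].
have x0 : `|x.1 - x.1| <= 1 /\ `|x.2 - x.2| <= 1 by rewrite !subrr normr0.
rewrite /dconv -(RintegralB mO (dconv_integrable x ck) (dconv_integrable x' ck)).
rewrite (_ : \int[area]_(z in _) _ = \int[area]_(z in Omega) (f z *
   (k ((dilate x).1 - z.1, (dilate x).2 - z.2) - k ((dilate x').1 - z.1, (dilate x').2 - z.2)))); last first.
  by apply: eq_Rintegral => z _; rewrite mulrBr.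
apply: le_trans (Rintegral_mul_le (A := M * (`|l| + `|l|) * (e / A)) _ _) _.
- by move=> z; apply: cvgB; exact: cshift.
- move=> z Oz; have [b1 b2] := BP _ _ x0.1 x0.2 Oz; have [b1' b2'] := BP _ _ h1 h2 Oz.
  apply: le_trans (MP ((dilate x).1 - z.1, (dilate x).2 - z.2) ((dilate x').1 - z.1, (dilate x').2 - z.2) b1 b2 b1' b2') _; rewrite -mulrA ler_wpM2l//=.
  rewrite mulrDl; apply: lerD.
    rewrite (_ : _ - _ = - (l * (x'.1 - x.1))); last by ring.
    by rewrite normrN normrM ler_wpM2l.
  rewrite (_ : _ - _ = - (l * (x'.2 - x.2))); last by ring.
  by rewrite normrN normrM ler_wpM2l.
- rewrite mulrAC mulrA ler_pdivrMr// mulrC ler_wpM2l ?(ltW e0)//.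
  by rewrite /A lerDl.
Qed.

(** The second-order remainder of the kernel is uniform on a box, which allows
    differentiation under the integral sign. *)
Lemma dconv_C1 k g : elementary k -> C1 k g -> (forall b, elementary (g b)) ->
  C1 (dconv k) (fun b x => l * dconv (g b) x).
Proof.
move=> ek Ck eg; have ck := elementary_continuous ek.
have cg b := elementary_continuous (eg b).
have /choice[gg ggP] : forall b, exists gg, C1 (g b) gg.
  by move=> b; have [gg] := elementary_C1 (eg b); exists gg.
split; first exact: dconv_continuous.
  by move=> b x; apply: cvgM; [exact: cvg_cst|exact: dconv_continuous].
move=> x d; apply: is_derive_cvg; apply/cvgrPdist_le => e e0.
have [B [B1 BP]] := in_box x.
pose q : R * R := (l * d.1, l * d.2).
pose B' := B + `|q.1| + `|q.2|.
have [M M0 MP] := C1_remainder B' Ck ggP.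
have N0 : 0 <= N by apply: Rintegral_ge0 => z _; exact: normr_ge0.
have MN0 : 0 < M * N + 1 by rewrite ltr_wpDl// mulr_ge0.
near=> h; rewrite addr0 ray0.
have h0 : h != 0 by near: h; exact: nbhs_dnbhs_neq.
have h1 : `|h| <= 1 by near: h; exact: (@dnbhs0_le R R).
have h2 : `|h| <= e / (M * N + 1) by near: h; apply: (@dnbhs0_le R R); exact: divr_gt0.
pose sh z : R * R := ((dilate x).1 - z.1, (dilate x).2 - z.2).
have rayE z : ((dilate (ray x d h)).1 - z.1, (dilate (ray x d h)).2 - z.2) = ray (sh z) q h.
  by rewrite /dilate /ray /sh /q/=; congr pair; ring.
have h_gt0 : 0 < `|h| by rewrite normr_gt0.
rewrite -(ler_pM2l h_gt0) -[leLHS]normrM.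
have cK1 := @cshift k (dilate (ray x d h)) ck; have cK0 := @cshift k (dilate x) ck.
have cG b := @cshift (g b) (dilate x) (@cg b).
have E : h * (l * dconv (g true) x * d.1 + l * dconv (g false) x * d.2 -
      h^-1 * (dconv k (ray x d h) - dconv k x)) = \int[area]_(z in Omega) (f z *
   (- (k (ray (sh z) q h) - k (sh z) - h * (g true (sh z) * q.1 + g false (sh z) * q.2)))).
  rewrite (eq_Rintegral _ (g := fun z : mplane R => h * q.1 * (f z * g true (sh z)) + (h * q.2 * (f z * g false (sh z)) +
     (-1 * (f z * k ((dilate (ray x d h)).1 - z.1, (dilate (ray x d h)).2 - z.2)) + f z * k (sh z))))); last first.
    by move=> z _; rewrite rayE; ring.
  have lin (a : R) (A A' : mplane R -> R) : area.-integrable Omega (EFin \o A) -> area.-integrable Omega (EFin \o A') ->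
      area.-integrable Omega (EFin \o (fun z => a * A z + A' z)) /\
      \int[area]_(z in Omega) (a * A z + A' z) = a * \int[area]_(z in Omega) A z + \int[area]_(z in Omega) A' z.
    move=> iA iA'; have iaA : area.-integrable Omega (EFin \o (fun z => a * A z)).
      by have := integrableZl mO a iA; apply: eq_integrable => // z _; rewrite /= EFinM.
    split; last by rewrite RintegralD// RintegralZl.
    by have := integrableD mO iaA iA'; apply: eq_integrable.
  have [i1 e1] := lin (-1) _ _ (dconv_integrable (ray x d h) ck) (dconv_integrable x ck).
  have [i2 e2] := lin (h * q.2) _ _ (dconv_integrable x (cg false)) i1.
  have [i3 e3] := lin (h * q.1) _ _ (dconv_integrable x (cg true)) i2.
  rewrite e3 e2 e1 -!/(dconv _ _) /q/=.
  rewrite mulrBr mulrA mulfV// mul1r; ring.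
rewrite E; apply: le_trans (Rintegral_mul_le (A := M * `|h| * `|h|) _ _) _.
- rewrite (_ : (fun z => _) = (fun z => h * (g true (sh z) * q.1 + g false (sh z) * q.2) + k (sh z) -
      k ((dilate (ray x d h)).1 - z.1, (dilate (ray x d h)).2 - z.2))); last first.
    by apply/funext => z; rewrite rayE; ring.
  move=> z; apply: cvgB; last exact: cK1.
  apply: cvgD; last exact: cK0.
  apply: cvgM; first exact: cvg_cst.
  by apply: cvgD; (apply: cvgM; last exact: cvg_cst); exact: cG.
- move=> z Oz; rewrite normrN.
  have [||b1 b2] := BP x z _ _ Oz; rewrite ?subrr ?normr0//.
  have q10 := normr_ge0 q.1; have q20 := normr_ge0 q.2.
  by apply: MP => //; rewrite /B' /sh /=; move: (`|q.1|) (`|q.2|) q10 q20 b1 b2 B1; move: (`|_|) (`|_|) => *; lra.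
- rewrite -mulrA mulrAC mulrC -mulrA ler_wpM2l// mulrC.
  by move: h2; rewrite ler_pdivlMr// mulrDr mulr1 mulrC; have := normr_ge0 h; lra.
Unshelve. all: by end_near. Qed.

End dilated_convolution.

(** ** Density of smooth functions in the Sobolev space *)

Lemma Rintegral_lin d (T : measurableType d) (R : realType) (mu : {measure set T -> \bar R})
    (D : set T) (a : R) (f g : T -> R) : measurable D ->
  mu.-integrable D (EFin \o f) -> mu.-integrable D (EFin \o g) ->
  mu.-integrable D (EFin \o (fun x => a * f x + g x)) /\
  \int[mu]_(x in D) (a * f x + g x) = a * \int[mu]_(x in D) f x + \int[mu]_(x in D) g x.
Proof.
move=> mD fi gi; have iaf : mu.-integrable D (EFin \o (fun x => a * f x)).
  by have := integrableZl mD a fi; apply: eq_integrable => // z _; rewrite /= EFinM.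
split; last by rewrite RintegralD// RintegralZl.
by have := integrableD mD iaf gi; apply: eq_integrable.
Qed.

Lemma smooth_partial (R : realType) (f : R * R -> R) b : smooth f -> smooth (partial b f).
Proof.
move=> sf s; have := sf (rcons s b).
by rewrite -cats1 foldr_cat.
Qed.

Lemma smooth_lin (R : realType) (a : R) (f g : R * R -> R) : smooth f -> smooth g ->
  smooth (fun x => a * f x + g x).
Proof.
move=> sf sg; pose P F := exists f g, [/\ smooth f, smooth g & F = fun x : R * R => a * f x + g x].
apply: (@smooth_closed R P); last by exists f, g.
move=> _ [f' [g' [sf' sg' ->]]].
exists (fun b x => a * partial b f' x + partial b g' x).
  exact: C1D (C1Z a (smooth_C1 sf')) (smooth_C1 sg').
by move=> b; exists (partial b f'), (partial b g'); split; [exact: smooth_partial|exact: smooth_partial|].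
Qed.

Lemma smooth_cst (R : realType) (a : R) : smooth (cst a : R * R -> R).
Proof. exact: elementary_smooth (elementary_cst a). Qed.

Lemma sqint_integrable d (T : measurableType d) (R : realType) (mu : {measure set T -> \bar R})
    (D : set T) (f : T -> R) : measurable D -> (mu D < +oo)%E ->
  sqint mu D f -> mu.-integrable D (EFin \o f).
Proof.
move=> mD muD sf.
have s1 : sqint mu D (cst 1).
  by apply: (bounded_sqint mD (M := 1)) => // x _; rewrite normr1.
by have := sqint_integrableM mD sf s1; apply: eq_integrable => // x _ /=; rewrite mulr1.
Qed.

Section density.
Context {R : realType} {L : nat}.
Variables (c : R * R) (r theta : R).
Hypotheses (hL : (3 <= L)%N) (r_gt0 : 0 < r).
Local Notation Omega := (polygon (@vertex R L c r theta)).
Local Notation h := (@apothem R L r).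
Local Notation dilate := (dilate c).
Local Notation dconv := (@dconv R L c r theta).
Local Notation ip := (ip area Omega).

Let mO : measurable (Omega : set (mplane R)). Proof. exact: measurable_polygon. Qed.
Let O_lty : (area Omega < +oo)%E. Proof. exact: area_polygon_lty. Qed.
Let h_gt0 : 0 < h. Proof. exact: apothem_gt0. Qed.

Lemma test_sqint f : test_function Omega f -> sqint area Omega f.
Proof. by move=> [/smooth_C1[cf _ _] _]; exact: sqint_continuous. Qed.

Lemma test_lin a f g : test_function Omega f -> test_function Omega g ->
  test_function Omega (fun x => a * f x + g x).
Proof.
move=> [sf [K [cK KO fK]]] [sg [K' [cK' KO' gK']]]; split; first exact: smooth_lin.
exists (K `|` K'); split; [exact: compactU|by move=> x [/KO|/KO']|].
by move=> x xK; rewrite fK ?gK' ?mulr0 ?addr0// => ?; apply: xK; [right|left].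
Qed.

(** By [test_vanish] the orthogonal complement of the test functions is trivial. *)
Lemma test_dense u : sqint area Omega u -> forall e, 0 < e ->
  exists2 f, test_function Omega f & ip (u - f) (u - f) <= e.
Proof.
apply: (total_dense mO (S := test_function Omega)).
- by move=> f; exact: test_sqint.
- split; first exact: smooth_cst.
  by exists set0; split=> //; exact: compact0.
- by move=> a f g tf tg; exact: test_lin.
- move=> p sp ptest; have p_int := sqint_integrable mO O_lty sp.
  have p0 := test_vanish hL r_gt0 p_int ptest.
  rewrite (ip_ae mO (f' := cst 0) (g' := cst 0)) //; last 2 first.
  - by case: sp.
  - by case: sp.
  by rewrite /ip (eq_Rintegral _ (g := cst 0)) ?Rintegral_cst ?mul0r// => x _; rewrite mulr0.
Qed.

Lemma dconv_smooth f l k : area.-integrable Omega (EFin \o f) -> elementary k -> smooth (dconv f l k).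
Proof.
move=> fi ek; pose P F := exists a k, elementary k /\ F = fun x => a * dconv f l k x.
apply: (@smooth_closed R P); last first.
  by exists 1, k; split=> //; apply/funext => x; rewrite mul1r.
move=> _ [a [k' [ek' ->]]]; have [g Ck eg] := elementary_C1 ek'.
exists (fun b x => a * (l * dconv f l (g b) x)).
  have CT : C1 (dconv f l k') (fun b x => l * dconv f l (g b) x) := dconv_C1 hL r_gt0 fi l ek' Ck eg.
  exact: (C1Z a CT).
by move=> b; exists (a * l), (g b); split=> //; apply/funext => x; rewrite mulrA.
Qed.

Section scale.
Variable l : R.
Hypotheses (l_gt0 : 0 < l) (l_lt1 : l < 1).
Let e := (1 - l) * h / 2.
Let e_gt0 : 0 < e. Proof. by rewrite divr_gt0// mulr_gt0// subr_gt0. Qed.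
Let m := moll e.
Let em : elementary m. Proof. exact: moll_elementary. Qed.
Let cm : continuous m. Proof. exact: elementary_continuous. Qed.
Let sh (x z : R * R) : R * R := ((dilate l x).1 - z.1, (dilate l x).2 - z.2).

Let csh x : continuous (fun z => m (sh x z)).
Proof.
apply: (comp_continuous _ cm); apply: pair_continuous => z; apply: cvgB; try exact: cvg_cst.
- exact: cvg_fst.
- exact: cvg_snd.
Qed.

Lemma moll_inside x z : Omega x -> `|(sh x z).1| <= e -> `|(sh x z).2| <= e -> Omega z.
Proof.
move=> Ox h1 h2; have := @polygon_margin _ _ _ _ theta hL r_gt0 x (- (sh x z).1, - (sh x z).2) l Ox l_gt0.
rewrite /= !normrN => H.
rewrite (_ : z = (c.1 + l * (x.1 - c.1) - (sh x z).1, c.2 + l * (x.2 - c.2) - (sh x z).2)).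
  apply: H; apply: le_trans (lerD h1 h2) _; rewrite le_eqVlt; apply/orP; left; apply/eqP.
  by rewrite /e; field.
by rewrite [LHS]surjective_pairing /sh /dilate/=; congr pair; ring.
Qed.

(** The support of the shifted kernel lies in the polygon, so no mass is lost. *)
Lemma moll_mass x : Omega x -> \int[area]_(z in Omega) m (sh x z) = 1.
Proof.
move=> Ox; rewrite /Rintegral (_ : (\int[area]_(z in Omega) _)%E = 1%E)//.
have d1 : (-1) * (-1) - 0 * 0 != 0 :> R by rewrite mul0r subr0 mulrNN mulr1 oner_neq0.
have mE : measurable_fun setT (EFin \o m) by apply/measurable_EFinP; exact: continuous_measurable_plane.
have mE0 z : (0 <= (EFin \o m) z)%E by rewrite lee_fin moll_ge0.
have := area_linear (dilate l x).1 (dilate l x).2 d1 mE mE0.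
rewrite moll_int// mul0r subr0 mulrNN mulr1 normr1 mul1e => <-.
rewrite integral_mkcond; apply: eq_integral => z _; rewrite patchE.
have <- : sh x z = affine2 (-1) 0 (dilate l x).1 0 (-1) (dilate l x).2 z.
  by rewrite /sh /affine2; congr pair; ring.
case: ifPn => //= zO; congr EFin; apply/esym/eqP; apply: contraNT zO => /moll_support[h1 h2].
by apply/mem_set; exact: moll_inside Ox (ltW h1) (ltW h2).
Qed.

Variable f : mplane R -> R.
Hypothesis sf : sqint area Omega f.
Let f_int : area.-integrable Omega (EFin \o f). Proof. exact: sqint_integrable. Qed.
Let f2_int : area.-integrable Omega (EFin \o (fun x => f x * f x)).
Proof. exact: sqint_integrableM. Qed.

(** Jensen's inequality for the kernel, a probability density: the discriminant of
    the integral of [(s f + t) ^ 2]. *)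
Lemma dconv_sqr_le x : Omega x ->
  dconv f l m x ^+ 2 <= \int[area]_(z in Omega) (f z * f z * m (sh x z)).
Proof.
move=> Ox; rewrite -[leRHS]mulr1 -(moll_mass Ox); apply: quadratic_disc => s t.
have i1 := integrable_mul_continuous hL r_gt0 f2_int (@csh x).
have i2 := integrable_mul_continuous hL r_gt0 f_int (@csh x).
have i3 := polygon_integrable c theta hL r_gt0 (@csh x).
have [i4 e4] := Rintegral_lin (2 * s * t) mO i2 (Rintegral_lin (t ^+ 2 - 1) mO i3 i3).1.
have [_ e5] := Rintegral_lin (s ^+ 2) mO i1 i4.
have := e5; rewrite e4 (Rintegral_lin (t ^+ 2 - 1) mO i3 i3).2 => e6.
rewrite [leRHS](_ : _ = s ^+ 2 * \int[area]_(z in Omega) (f z * f z * m (sh x z)) +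
  (2 * s * t * \int[area]_(z in Omega) (f z * m (sh x z)) +
  ((t ^+ 2 - 1) * \int[area]_(z in Omega) m (sh x z) + \int[area]_(z in Omega) m (sh x z)))); last first.
  by rewrite /dconv -/(sh x _); ring.
rewrite -e6; apply: Rintegral_ge0 => z _.
rewrite (_ : _ + _ = (s * f z + t) ^+ 2 * m (sh x z)); last by ring.
by rewrite mulr_ge0 ?sqr_ge0// moll_ge0.
Qed.

(** After Jensen's inequality, integration in the other order leaves the Jacobian
    [l ^- 2] of the dilation. *)
Lemma dconv_norm_le : ip (dconv f l m) (dconv f l m) <= l ^- 2 * ip f f.
Proof.
have cT : continuous (dconv f l m) := dconv_continuous hL r_gt0 f_int em.
rewrite -lee_fin -(sqint_int mO (sqint_continuous c theta hL r_gt0 cT)).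
pose g : mplane R -> R := f \_ Omega.
have mg : measurable_fun setT g by apply/(measurable_restrictT f mO); case: sf.
have mco d (T : measurableType d) (k : R) (f1 f2 : T -> R) : measurable_fun setT f1 -> measurable_fun setT f2 ->
    measurable_fun setT (fun p => k + l * (f1 p - k) - f2 p).
  move=> m1 m2; apply: measurable_funB m2; apply: measurable_funD; first exact: measurable_cst.
  by apply: measurable_funM; [exact: measurable_cst|apply: measurable_funB m1 _; exact: measurable_cst].
pose H (p : mplane R * mplane R) : \bar R := (\1_Omega p.1 * (g p.2 * g p.2 * m (sh p.1 p.2)))%:E.
have H0 p : (0 <= H p)%E.
  by rewrite lee_fin mulr_ge0// mulr_ge0 ?moll_ge0// -expr2 sqr_ge0.
have mH : measurable_fun setT H.
  apply/measurable_EFinP; apply: measurable_funM.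
    by apply: (measurableT_comp _ measurable_fst); exact: measurable_indic.
  apply: measurable_funM.
    have mg2 : measurable_fun setT (fun p : mplane R * mplane R => g p.2) := measurableT_comp mg measurable_snd.
    exact: measurable_funM.
  apply: (measurableT_comp (continuous_measurable_plane cm)).
  have m11 := measurableT_comp (@measurable_fst _ _ (measurableTypeR R) (measurableTypeR R)) (@measurable_fst _ _ (mplane R) (mplane R)).
  have m12 := measurableT_comp (@measurable_snd _ _ (measurableTypeR R) (measurableTypeR R)) (@measurable_fst _ _ (mplane R) (mplane R)).
  have m21 := measurableT_comp (@measurable_fst _ _ (measurableTypeR R) (measurableTypeR R)) (@measurable_snd _ _ (mplane R) (mplane R)).
  have m22 := measurableT_comp (@measurable_snd _ _ (measurableTypeR R) (measurableTypeR R)) (@measurable_snd _ _ (mplane R) (mplane R)).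
  exact: (measurable_fun_pair (mco _ _ _ _ _ m11 m21) (mco _ _ _ _ _ m12 m22)).
have mHF := measurable_fun_fubini_tonelli_F (m2 := @lebesgue_plane R) _ mH H0.
have mHG := measurable_fun_fubini_tonelli_G (m1 := @lebesgue_plane R) _ mH H0.
apply: (@le_trans _ _ (\int[area]_x \int[area]_z H (x, z))%E).
  rewrite [leLHS]integral_mkcond; apply: ge0_le_integral.
  - exact: measurableT.
  - by move=> x _; rewrite patchE; case: ifP => // _; rewrite lee_fin sqr_ge0.
  - apply/(measurable_restrictT _ mO)/measurable_funTS/measurable_EFinP.
    by apply: continuous_measurable_plane; exact: continuous_sqr.
  - exact: mHF.
  move=> x _; rewrite patchE; case: ifPn => [/set_mem Ox|_]; last by apply: integral_ge0 => z _; exact: H0.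
  have i1 := integrable_mul_continuous hL r_gt0 f2_int (@csh x).
  apply: (@le_trans _ _ (\int[area]_(z in Omega) (f z * f z * m (sh x z)))%:E).
    by rewrite lee_fin; exact: dconv_sqr_le.
  rewrite [leLHS](_ : _ = \int[area]_(z in Omega) (f z * f z * m (sh x z))%:E)%E; last first.
    by rewrite fineK//; exact: (integrable_fin_num mO i1).
  rewrite [leLHS]integral_mkcond le_eqVlt; apply/orP; left; apply/eqP; apply: eq_integral => z _.
  rewrite /H/= indicE mem_set// mul1r /g !patchE; case: ifP => // _.
  by rewrite !mul0r.
rewrite (area_tonelli mH H0).
have l2 : l * l - 0 * 0 != 0 by rewrite mul0r subr0 mulf_neq0// gt_eqF.
have mE : measurable_fun setT (EFin \o m) by apply/measurable_EFinP; exact: continuous_measurable_plane.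
have mE0 z : (0 <= (EFin \o m) z)%E by rewrite lee_fin moll_ge0.
have mass (z : mplane R) : (\int[area]_x (m (sh x z))%:E = (l ^- 2)%:E)%E.
  have := area_linear (c.1 - l * c.1 - z.1) (c.2 - l * c.2 - z.2) l2 mE mE0.
  rewrite moll_int// mul0r subr0 ger0_norm ?mulr_ge0 ?(ltW l_gt0)// => E.
  have -> : (\int[area]_x (m (sh x z))%:E = \int[area]_x (EFin \o m) (affine2 l 0 (c.1 - l * c.1 - z.1) 0 l (c.2 - l * c.2 - z.2) x))%E.
    by apply: eq_integral => x _; congr (EFin (m _)); rewrite /sh /dilate /affine2; congr pair => /=; ring.
  rewrite -[LHS]mul1e -[1%E](_ : (l ^- 2)%:E * (l * l)%:E = _)%E; last first.
    by rewrite -EFinM expr2 mulVf// mulf_neq0// gt_eqF.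
  by rewrite -muleA E mule1.
rewrite EFinM -(sqint_int mO sf).
rewrite -ge0_integralZl//; last 3 first.
- by apply/measurable_EFinP; apply: measurable_funX; case: sf.
- by move=> x _; rewrite lee_fin sqr_ge0.
- by rewrite lee_fin invr_ge0 sqr_ge0.
rewrite [leRHS]integral_mkcond; apply: ge0_le_integral.
- exact: measurableT.
- by move=> z _; apply: integral_ge0 => x _; exact: H0.
- exact: mHG.
- apply/(measurable_restrictT _ mO); apply: measurable_funeM.
  by apply/measurable_EFinP; apply: measurable_funX; case: sf.
move=> z _; rewrite patchE.
have mz : measurable_fun setT (fun x : mplane R => (m (sh x z))%:E).
  apply/measurable_EFinP; apply: (measurableT_comp (continuous_measurable_plane cm)).
  exact: (measurable_fun_pair (mco _ _ _ _ _ measurable_fst (measurable_cst z.1)) (mco _ _ _ _ _ measurable_snd (measurable_cst z.2))).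
apply: (@le_trans _ _ (\int[area]_x ((g z * g z)%:E * (m (sh x z))%:E))%E).
  apply: ge0_le_integral => //.
  - exact: (measurableT_comp mH (measurable_fun_pair (@measurable_id _ _ setT) (measurable_cst z))).
  - by apply: measurable_funeM.
  move=> x _; rewrite /H/= -EFinM lee_fin; apply: ler_piMl.
    by apply: mulr_ge0; [rewrite -expr2 sqr_ge0|exact: moll_ge0].
  by rewrite indicE; case: (_ \in _).
rewrite ge0_integralZl//; last 2 first.
- by move=> x _; rewrite lee_fin moll_ge0.
- by rewrite lee_fin -expr2 sqr_ge0.
rewrite mass /g patchE; case: ifP => _; last by rewrite mul0r mul0e.
by rewrite muleC expr2.
Qed.

End scale.

(** Dilations and small translations move a smooth function by [O(1 - l)]. *)
Lemma dconv_smooth_le phi : smooth phi -> exists2 K, 0 <= K & forall l, 0 < l -> l < 1 ->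
  ip (phi - dconv phi l (moll ((1 - l) * h / 2))) (phi - dconv phi l (moll ((1 - l) * h / 2))) <=
  K * (1 - l).
Proof.
move=> sphi; have Cphi := smooth_C1 sphi; have [cphi _ _] := Cphi.
have [M M0 MP] := C1_lipschitz (`|c.1| + `|c.2| + r) Cphi.
pose Q := M * (h + 2 * r); have Q0 : 0 <= Q by rewrite mulr_ge0// addr_ge0 ?(ltW h_gt0)// mulr_ge0// ltW.
have inb x : Omega x -> `|x.1| <= `|c.1| + `|c.2| + r /\ `|x.2| <= `|c.1| + `|c.2| + r.
  move=> /(bounded_polygon hL r_gt0)[h1 h2]; split.
    rewrite -(subrK c.1 x.1); apply: le_trans (ler_normD _ _) _.
    by move: h1 (normr_ge0 c.2) => *; lra.
  rewrite -(subrK c.2 x.2); apply: le_trans (ler_normD _ _) _.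
  by move: h2 (normr_ge0 c.1) => *; lra.
exists (Q ^+ 2 * fine (area Omega)) => [|l l0 l1]; first by rewrite mulr_ge0 ?sqr_ge0 ?fine_ge0.
set e := (1 - l) * h / 2; have e_gt0 : 0 < e by rewrite divr_gt0// mulr_gt0// subr_gt0.
have em : elementary (moll e) by exact: moll_elementary.
have cm := elementary_continuous em.
have phi_int := polygon_integrable c theta hL r_gt0 cphi.
have csh (x : R * R) : continuous (fun z : R * R => moll e ((dilate l x).1 - z.1, (dilate l x).2 - z.2)).
  apply: (comp_continuous _ cm); apply: pair_continuous => z; apply: cvgB; try exact: cvg_cst.
  - exact: cvg_fst.
  - exact: cvg_snd.
have pt x : Omega x -> `|phi x - dconv phi l (moll e) x| <= Q * (1 - l).
  move=> Ox; set s := fun z : R * R => moll e ((dilate l x).1 - z.1, (dilate l x).2 - z.2).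
  have cs : continuous s by exact: csh.
  have i1 := polygon_integrable c theta hL r_gt0 cs.
  have i2 : area.-integrable Omega (EFin \o (fun z => phi z * s z)) := integrable_mul_continuous hL r_gt0 phi_int cs.
  have mass : \int[area]_(z in Omega) s z = 1 := moll_mass l0 l1 Ox.
  have -> : phi x - dconv phi l (moll e) x = \int[area]_(z in Omega) ((phi x - phi z) * s z).
    rewrite (eq_Rintegral _ (g := fun z : mplane R => -1 * (phi z * s z) + phi x * s z)); last first.
      by move=> z _; ring.
    have i3 : area.-integrable Omega (EFin \o (fun z => phi x * s z)).
      by have := integrableZl mO (phi x) i1; apply: eq_integrable => // z _; rewrite /= EFinM.
    by rewrite (Rintegral_lin (-1) mO i2 i3).2 RintegralZl// mass mulr1 mulN1r addrC.
  have cd : continuous (fun z => (phi x - phi z) * s z).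
    by move=> z; apply: cvgM; [apply: cvgB; [exact: cvg_cst|exact: cphi]|exact: cs].
  have id := polygon_integrable c theta hL r_gt0 cd.
  apply: le_trans (le_normr_Rintegral mO id) _.
  rewrite [leRHS](_ : _ = \int[area]_(z in Omega) (Q * (1 - l) * s z)); last first.
    by rewrite RintegralZl// mass mulr1.
  apply: le_Rintegral => //.
  - exact: (integrable_norm id).
  - by have := integrableZl mO (Q * (1 - l)) i1; apply: eq_integrable => // z _; rewrite /= EFinM.
  move=> z Oz; rewrite normrM [X in _ * X]ger0_norm ?moll_ge0//.
  have [sz|/moll_support[/ltW s1 /ltW s2]] := eqVneq (s z) 0; first by rewrite sz !mulr0.
  rewrite ler_wpM2r ?moll_ge0//.
  have [b1 b2] := inb x Ox; have [b1' b2'] := inb z Oz.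
  apply: le_trans (MP _ _ b1 b2 b1' b2') _; rewrite /Q -mulrA ler_wpM2l//.
  have [r1 r2] := bounded_polygon hL r_gt0 Ox.
  have one (x1 z1 c1 : R) : `|x1 - c1| <= r -> `|c1 + l * (x1 - c1) - z1| <= e -> `|x1 - z1| <= e + (1 - l) * r.
    move=> h1 h2; rewrite (_ : x1 - z1 = (c1 + l * (x1 - c1) - z1) + (1 - l) * (x1 - c1)); last by ring.
    apply: le_trans (ler_normD _ _) _; apply: lerD => //.
    by rewrite normrM ger0_norm ?subr_ge0 ?(ltW l1)// ler_wpM2l// subr_ge0 ltW.
  apply: le_trans (lerD (one _ _ _ r1 s1) (one _ _ _ r2 s2)) _.
  by rewrite /e le_eqVlt; apply/orP; left; apply/eqP; field.
have cT : continuous (dconv phi l (moll e)) := dconv_continuous hL r_gt0 phi_int em.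
have cd : continuous (phi - dconv phi l (moll e)) by move=> x; apply: cvgB; [exact: cphi|exact: cT].
have cdd : continuous (fun x => (phi - dconv phi l (moll e)) x * (phi - dconv phi l (moll e)) x).
  by move=> x; apply: cvgM; exact: cd.
apply: (@le_trans _ _ (\int[area]_(x in Omega) (cst ((Q * (1 - l)) ^+ 2) x))).
  apply: le_Rintegral => //.
  - exact: (polygon_integrable c theta hL r_gt0 cdd).
  - by apply: (polygon_integrable c theta hL r_gt0); exact: cst_continuous.
  move=> x Ox; have := pt x Ox; rewrite !fctE -expr2; move: (_ - _) => y H.
  by rewrite -[y ^+ 2]real_normK ?num_real// lerXn2r// nnegrE ?(le_trans _ H).
rewrite Rintegral_cst//; have V0 : 0 <= fine (area Omega) by rewrite fine_ge0.
have QV : 0 <= Q ^+ 2 * fine (area Omega) by rewrite mulr_ge0// sqr_ge0.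
have l10 : 0 <= 1 - l by rewrite subr_ge0 ltW.
rewrite [leLHS](_ : _ = Q ^+ 2 * fine (area Omega) * ((1 - l) * (1 - l))); last by ring.
by apply: ler_wpM2l => //; rewrite ler_piMl// lerBlDr lerDl ltW.
Qed.

(** The operators are uniformly bounded and converge on the test functions, which
    are dense. *)
Lemma dconv_approx f : sqint area Omega f -> forall e, 0 < e -> exists2 d, 0 < d &
  forall l, 2^-1 <= l -> 1 - d < l -> l < 1 ->
  ip (f - dconv f l (moll ((1 - l) * h / 2))) (f - dconv f l (moll ((1 - l) * h / 2))) <= e.
Proof.
have arith (a b y d s k x : R) : k <= x / 8 -> y <= 4 * a -> b <= k -> d <= y ->
    s <= 2 * b + 2 * d -> a <= x / 36 -> 2 * a + 2 * s <= x by move=> *; lra.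
move=> sf e e0; have [phi tphi phiP] := test_dense sf (divr_gt0 e0 (ltr0n _ 36)).
have [K K0 KP] := dconv_smooth_le tphi.1.
exists (e / (8 * K + 1)) => [|l l2 ld l1]; first by rewrite divr_gt0// ltr_wpDl// mulr_ge0.
have l0 : 0 < l by apply: lt_le_trans l2; rewrite invr_gt0.
have sphi := test_sqint tphi.
have f_int := sqint_integrable mO O_lty sf; have phi_int := sqint_integrable mO O_lty sphi.
set m := moll _; have em : elementary m by apply: moll_elementary; rewrite divr_gt0// mulr_gt0// subr_gt0.
have cm := elementary_continuous em.
have sT (g : mplane R -> R) : area.-integrable Omega (EFin \o g) -> sqint area Omega (dconv g l m).
  by move=> gi; apply: sqint_continuous => //; exact: (dconv_continuous hL r_gt0 gi em).
have sfp : sqint area Omega (f - phi) by exact: sqintB.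
have e1 : f - dconv f l m = (f - phi) + ((phi - dconv phi l m) - dconv (f - phi) l m).
  have -> : dconv (f - phi) l m = dconv f l m - dconv phi l m.
    apply/funext => x; change (dconv (f - phi) l m x = dconv f l m x - dconv phi l m x).
    rewrite /dconv -(RintegralB mO (dconv_integrable hL r_gt0 f_int l x cm) (dconv_integrable hL r_gt0 phi_int l x cm)).
    by apply: eq_Rintegral => z _; rewrite !fctE mulrBl.
  by apply/funext => x; rewrite !fctE/=; ring.
have sTf := sT _ f_int; have sTp := sT _ phi_int; have sTfp := sT _ (sqint_integrable mO O_lty sfp).
have spT : sqint area Omega (phi - dconv phi l m) by exact: sqintB.
have sNT : sqint area Omega (- dconv (f - phi) l m) by rewrite -scaleN1r; exact: sqintZ.
have s2 : sqint area Omega ((phi - dconv phi l m) - dconv (f - phi) l m) by exact: sqintD.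
rewrite e1; apply: le_trans (ip_sqD_le mO sfp s2) _.
have := ip_sqD_le mO spT sNT.
have -> : ip (- dconv (f - phi) l m) (- dconv (f - phi) l m) = ip (dconv (f - phi) l m) (dconv (f - phi) l m).
  by apply: eq_Rintegral => x _; rewrite !fctE mulrNN.
have := dconv_norm_le l0 l1 sfp; rewrite -/m.
have := KP l l0 l1; rewrite -/m.
have fp0 : 0 <= ip (f - phi) (f - phi) by exact: ip_ge0.
have : l ^- 2 * ip (f - phi) (f - phi) <= 4 * ip (f - phi) (f - phi).
  rewrite ler_wpM2r// -[leRHS]invrK lef_pV2 ?posrE ?exprn_gt0//; first by rewrite expr2; nra.
have : K * (1 - l) <= e / 8.
  have : 1 - l <= e / (8 * K + 1) by lra.
  have K1 : 0 < 8 * K + 1 by rewrite ltr_wpDl// mulr_ge0.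
  rewrite ler_pdivlMr//; have : 0 < 1 - l by rewrite subr_gt0.
  by move: (1 - l) K0 => y K0 y0; nra.
by move=> q1 q2 q3 q4 q5; exact: (arith _ _ _ _ _ _ _ q1 q2 q3 q4 q5 phiP).
Qed.

Definition weak_grad (u : mplane R -> R) (g : bool -> mplane R -> R) : Prop :=
  forall b f, test_function Omega f ->
    \int[area]_(x in Omega) (u x * partial b f x) = - \int[area]_(x in Omega) (g b x * f x).

(** The kernel of [dconv] at a point of the polygon is a test function, so the
    weak derivatives pass through the convolution. *)
Lemma partial_dconv u g l b x : sqint area Omega u -> weak_grad u g -> 0 < l -> l < 1 -> Omega x ->
  partial b (dconv u l (moll ((1 - l) * h / 2))) x = l * dconv (g b) l (moll ((1 - l) * h / 2)) x.
Proof.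
move=> su ug l0 l1 Ox; set e := (1 - l) * h / 2.
have e_gt0 : 0 < e by rewrite divr_gt0// mulr_gt0// subr_gt0.
have em : elementary (moll e) by exact: moll_elementary.
have [mg Cm emg] := elementary_C1 em.
have u_int := sqint_integrable mO O_lty su.
rewrite (C1_partial b (dconv_C1 hL r_gt0 u_int l em Cm emg)); congr (_ * _).
pose f (z : R * R) := moll e (affine2 (-1) 0 (dilate l x).1 0 (-1) (dilate l x).2 z).
have ef : elementary f by exact: elementary_affine.
have shE z : ((dilate l x).1 - z.1, (dilate l x).2 - z.2) = affine2 (-1) 0 (dilate l x).1 0 (-1) (dilate l x).2 z.
  by rewrite /affine2; congr pair; ring.
have Cf := C1_comp_affine (-1) 0 (dilate l x).1 0 (-1) (dilate l x).2 Cm.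
have tf : test_function Omega f.
  split; first exact: elementary_smooth.
  exists (`[(dilate l x).1 - e, (dilate l x).1 + e] `*` `[(dilate l x).2 - e, (dilate l x).2 + e]); split.
  - by apply: compact_setX; exact: segment_compact.
  - move=> z [/=]; rewrite !in_itv/= => /andP[? ?] /andP[? ?].
    by apply: (moll_inside l0 Ox); rewrite /= ler_norml; apply/andP; split; rewrite -/e; lra.
  - move=> z zn; apply/eqP; apply/negPn/negP => /moll_support; rewrite -shE/= !ltr_norml.
    move=> [/andP[? ?] /andP[? ?]]; apply: zn; split; rewrite /= in_itv/=; apply/andP; split; lra.
have := ug b f tf; rewrite (C1_partial b Cf).
have -> : \int[area]_(z in Omega) (g b z * f z) = dconv (g b) l (moll e) x.
  by apply: eq_Rintegral => z _; rewrite /f -shE.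
move=> /(congr1 -%R); rewrite opprK => <-; rewrite /dconv.
rewrite [X in _ = - X](eq_Rintegral _ (g := fun z : mplane R => -1 * (u z * mg b ((dilate l x).1 - z.1, (dilate l x).2 - z.2)))).
  rewrite (RintegralZl _ mO (dconv_integrable hL r_gt0 u_int l x (elementary_continuous (emg b)))).
  by rewrite mulN1r opprK.
by move=> z _; rewrite shE; case: b {ug} => /=; ring.
Qed.

(** Dilated convolutions are smooth on the whole plane, and their derivatives are,
    up to the factor [l], the dilated convolutions of the weak derivatives. *)
Lemma weak_grad_dense u g : sqint area Omega u -> (forall b, sqint area Omega (g b)) ->
  weak_grad u g -> forall e, 0 < e -> exists2 phi, smooth phi &
    ip (u - phi) (u - phi) <= e /\ forall b, ip (g b - partial b phi) (g b - partial b phi) <= e.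
Proof.
move=> su sg ug e e0.
have half (t : R) : 0 < t -> t <= 2^-1 -> [/\ 0 < 1 - t / 2, 1 - t / 2 < 1, 2^-1 <= 1 - t / 2 & 1 - (1 - t / 2) < t].
  by move=> *; split; lra.
have twice (x y : R) : x <= e / 4 -> y <= e / 4 -> 2 * x + 2 * y <= e by move=> *; lra.
have four (x y : R) : 0 <= y -> 4 * x <= 4 * (x + y) + 1 by move=> *; lra.
have four' (x y : R) : 0 <= x -> 4 * y <= 4 * (x + y) + 1 by move=> *; lra.
have e4 : 0 < e / 4 by rewrite divr_gt0.
have [d1 d10 P1] := dconv_approx su e4.
have [d2 d20 P2] := dconv_approx (sg true) e4.
have [d3 d30 P3] := dconv_approx (sg false) e4.
have G0 b : 0 <= ip (g b) (g b) by exact: ip_ge0.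
pose Q := 4 * (ip (g true) (g true) + ip (g false) (g false)) + 1.
have Q0 : 0 < Q by rewrite ltr_wpDl// mulr_ge0// addr_ge0.
pose d := Num.min (Num.min d1 d2) (Num.min d3 (Num.min 2^-1 (e / Q))).
have d_gt0 : 0 < d by rewrite !lt_min d10 d20 d30 invr_gt0 ltr0n divr_gt0.
pose l := 1 - d / 2.
have [dd1 dd2 dd3 dd4 dd5] : [/\ d <= d1, d <= d2, d <= d3, d <= 2^-1 & d <= e / Q].
  by rewrite /d !ge_min !lexx !orbT.
have [l0 l1 l2 ld] := half _ d_gt0 dd4; rewrite -/l in l0 l1 l2 ld.
have near1 x : d <= x -> 1 - x < l by move=> dx; rewrite ltrBlDl -ltrBlDr (lt_le_trans ld).
set m := moll ((1 - l) * h / 2).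
have em : elementary m by apply: moll_elementary; rewrite divr_gt0// mulr_gt0// subr_gt0.
have u_int := sqint_integrable mO O_lty su.
exists (dconv u l m); first exact: dconv_smooth.
split.
  apply: le_trans (P1 l l2 (near1 _ dd1) l1) _.
  by rewrite ler_piMr ?(ltW e0)// invf_le1// ler1n.
move=> b; have gb_int := sqint_integrable mO O_lty (sg b).
have sT : sqint area Omega (dconv (g b) l m).
  by apply: sqint_continuous => //; exact: (dconv_continuous hL r_gt0 gb_int em).
have PT : ip (g b - dconv (g b) l m) (g b - dconv (g b) l m) <= e / 4.
  by case: b {gb_int sT}; [exact: (P2 l l2 (near1 _ dd2) l1)|exact: (P3 l l2 (near1 _ dd3) l1)].
have -> : ip (g b - partial b (dconv u l m)) (g b - partial b (dconv u l m)) =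
    ip (l *: (g b - dconv (g b) l m) + (1 - l) *: g b) (l *: (g b - dconv (g b) l m) + (1 - l) *: g b).
  apply: eq_Rintegral => x /set_mem Ox; rewrite !fctE (partial_dconv b su ug l0 l1 Ox) /GRing.scale/=; ring.
have sB : sqint area Omega (g b - dconv (g b) l m) by exact: sqintB.
apply: le_trans (ip_sqD_le mO (sqintZ mO l sB) (sqintZ mO (1 - l) (sg b))) _.
have ZE a (f : mplane R -> R) : sqint area Omega f -> ip (a *: f) (a *: f) = a ^+ 2 * ip f f.
  move=> sf; have saf := sqintZ mO a sf.
  by rewrite ipZ// (ipC _ _ f) ipZ// mulrA -expr2.
rewrite !ZE//.
have l2le : l ^+ 2 <= 1 by rewrite expr_le1// ltW.
have B0 := ip_ge0 area Omega (g b - dconv (g b) l m).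
have T1 : l ^+ 2 * ip (g b - dconv (g b) l m) (g b - dconv (g b) l m) <= e / 4.
  by apply: le_trans PT; rewrite ler_piMl.
have T2 : (1 - l) ^+ 2 * ip (g b) (g b) <= e / 4.
  have l10 : 0 <= 1 - l by rewrite subr_ge0 ltW.
  have lq : 1 - l <= 1 by rewrite gerBl ltW.
  apply: (@le_trans _ _ ((1 - l) * ip (g b) (g b))).
    by rewrite ler_wpM2r// expr2 ler_piMl.
  have gQ : 4 * ip (g b) (g b) <= Q.
    by rewrite /Q; case: b {gb_int sT PT sB B0 T1}; [exact: four|exact: four'].
  have lQ : (1 - l) * Q <= e by rewrite -ler_pdivlMr// (le_trans (ltW ld)).
  rewrite ler_pdivlMr// mulrC mulrCA; apply: le_trans lQ; exact: ler_wpM2l.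
exact: twice.
Qed.

End density.

(** * The energy space *)

Lemma ip_cvg d (T : measurableType d) (R : realType) (mu : {measure set T -> \bar R}) (D : set T)
    (f w : T -> R) (f_ : nat -> T -> R) : measurable D -> sqint mu D f -> (forall n, sqint mu D (f_ n)) ->
  sqint mu D w -> ip mu D (f - f_ n) (f - f_ n) @[n --> \oo] --> (0 : R) ->
  ip mu D (f_ n) w @[n --> \oo] --> ip mu D f w.
Proof.
move=> mD sf sf_ sw f0; apply/cvgrPdist_le => e e0.
have w0 : 0 <= ip mu D w w by exact: ip_ge0.
have d0 : 0 < e ^+ 2 / (ip mu D w w + 1) by rewrite divr_gt0 ?exprn_gt0// ltr_wpDl.
have /cvgrPdist_le/(_ _ d0) := f0; apply: filterS => n.
rewrite sub0r normrN ger0_norm ?ip_ge0// ler_pdivlMr ?ltr_wpDl// mulrDr mulr1 => h.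
have sB : sqint mu D (f - f_ n) by exact: sqintB.
rewrite -ipB// -ler_sqr ?nnegrE ?(ltW e0)// real_normK ?num_real//.
apply: le_trans (ip_CS mD sB sw) _; apply: le_trans h; rewrite lerDl; exact: ip_ge0.
Qed.

Lemma ip_sqr_cvg d (T : measurableType d) (R : realType) (mu : {measure set T -> \bar R}) (D : set T)
    (f : T -> R) (f_ : nat -> T -> R) : measurable D -> sqint mu D f -> (forall n, sqint mu D (f_ n)) ->
  ip mu D (f - f_ n) (f - f_ n) @[n --> \oo] --> (0 : R) ->
  ip mu D (f_ n) (f_ n) @[n --> \oo] --> ip mu D f f.
Proof.
move=> mD sf sf_ f0; have h := ip_cvg mD sf sf_ sf f0.
have -> : (fun n => ip mu D (f_ n) (f_ n)) =
    (fun n => ip mu D (f - f_ n) (f - f_ n) + 2 * ip mu D (f_ n) f - ip mu D f f).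
  by apply/funext => n; rewrite ip_sqB// (ipC _ _ f (f_ n)); ring.
rewrite [X in _ --> X](_ : _ = 0 + 2 * ip mu D f f - ip mu D f f); last by ring.
by apply: cvgB; [apply: cvgD => //; apply: cvgM => //; exact: cvg_cst|exact: cvg_cst].
Qed.

Section energy.
Context {R : realType} {L : nat}.
Variables (c : R * R) (r theta : R).
Hypotheses (hL : (3 <= L)%N) (r_gt0 : 0 < r).
Local Notation v := (@vertex R L c r theta).
Local Notation Omega := (polygon v).
Local Notation bd := (arclength v).
Local Notation h := (@apothem R L r).

Let mO : measurable (Omega : set (mplane R)). Proof. exact: measurable_polygon. Qed.
Let mT : measurable (setT : set (mplane R)). Proof. exact: measurableT. Qed.
Let h_gt0 : 0 < h. Proof. exact: apothem_gt0. Qed.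

Lemma sqint_boundary (f : R * R -> R) : continuous f -> sqint bd setT f.
Proof.
move=> cf; split; first exact: continuous_measurable_plane.
rewrite ge0_integral_arclength; last 2 first.
- by apply/measurable_EFinP; apply: continuous_measurable_plane; exact: continuous_sqr.
- by move=> x; rewrite lee_fin sqr_ge0.
apply: lte_sum_pinfty => k _.
have ck : continuous (fun t => f (edge v k t) ^+ 2).
  by apply: continuous_sqr; apply: (comp_continuous _ cf); exact: edge_continuous.
have := integrable_fin_num _ (continuous_itv_integrable 0 1 ck).
move=> /(_ (measurable_itv _))/fineK <-; rewrite -EFinM; exact: ltry.
Qed.

(** The radial field [k (x - c)] has the same normal component, [k] times the
    apothem, on all edges. *)
Lemma trace_inequality (alpha : R) : 0 < alpha -> exists2 M, 0 <= M & forall phi, smooth phi ->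
  alpha * ip bd setT phi phi <=
  ip area Omega (partial true phi) (partial true phi) +
  ip area Omega (partial false phi) (partial false phi) + M * ip area Omega phi phi.
Proof.
move=> a0; pose k := alpha / h; have k0 : 0 < k by rewrite divr_gt0.
pose M := 2 * k ^+ 2 * r ^+ 2 + 2 * k.
exists M => [|phi sphi].
  rewrite /M addr_ge0//; first by apply: mulr_ge0; [apply: mulr_ge0 => //|]; exact: sqr_ge0.
  by rewrite mulr_ge0// ltW.
have Cphi := smooth_C1 sphi.
pose W (b : bool) (x : R * R) : R := k * (if b then x.1 - c.1 else x.2 - c.2).
pose w (b b' : bool) (x : R * R) : R := k * (b == b')%:R.
have CW b : C1 (W b) (w b).
  have := C1_affine (if b then k else 0) (if b then 0 else k) (if b then - k * c.1 else - k * c.2).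
  by congr C1; [apply/funext => x|apply/funext => b'; apply/funext => x];
    rewrite /W /w; case: b => /=; try case: b' => /=; ring.
have := @jacobi_inequality R L c r theta hL r_gt0 W w alpha M phi _ CW Cphi.
have -> : \int[area]_(x in Omega) (partial true phi x * partial true phi x + partial false phi x * partial false phi x) =
  ip area Omega (partial true phi) (partial true phi) + ip area Omega (partial false phi) (partial false phi).
  have cp b : continuous (fun x => partial b phi x * partial b phi x).
    by have [_ cp _] := Cphi; move=> x; apply: cvgM; exact: cp.
  by rewrite /ip -(RintegralD mO (polygon_integrable c theta hL r_gt0 (cp true)) (polygon_integrable c theta hL r_gt0 (cp false))).
apply.
- move=> i t t01; rewrite /W.
  have : height c theta i (edge v i t) = h.
    have -> : height c theta i (edge v i t) = (1 - t) * height c theta i (v i) + t * height c theta i (v (ordS i)).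
      by rewrite /height /edge/=; ring.
    rewrite !height_vertex dot_vdir_normal dot_vdirS_normal// /apothem; ring.
  move=> e1; rewrite [leRHS](_ : _ = k * height c theta i (edge v i t)); last by rewrite /height; ring.
  by rewrite e1 /k divfK// gt_eqF.
- move=> x /(bounded_polygon hL r_gt0)[x1 x2]; rewrite /W /w /M/= !mulr1.
  have sq (y z : R) : `|y - z| <= r -> (y - z) ^+ 2 <= r ^+ 2.
    by move=> yz; rewrite -real_normK ?num_real// lerXn2r// nnegrE// ltW.
  rewrite !exprMn -mulrDr; apply: lerD; last by lra.
  rewrite [leRHS](_ : _ = alpha ^+ 2 * h^-1 ^+ 2 * (2 * r ^+ 2)); last by ring.
  apply: ler_wpM2l; first by apply: mulr_ge0; exact: sqr_ge0.
  by have := sq _ _ x1; have := sq _ _ x2; lra.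
Qed.

(** A function on the polygon, its two partial derivatives and its boundary
    values, as independent components. *)
Definition triple : Type := ((mplane R -> R) * (bool -> mplane R -> R) * (mplane R -> R))%type.

HB.instance Definition _ := GRing.Lmodule.copy triple
  ((mplane R -> R) * (bool -> mplane R -> R) * (mplane R -> R))%type.

Implicit Types x y z : triple.

Definition sqint3 x : Prop := [/\ sqint area Omega x.1.1,
  forall b, sqint area Omega (x.1.2 b) & sqint bd setT x.2].

Definition mass x y : R := ip area Omega x.1.1 y.1.1.
Definition dirichlet x y : R :=
  ip area Omega (x.1.2 true) (y.1.2 true) + ip area Omega (x.1.2 false) (y.1.2 false).
Definition boundary x y : R := ip bd setT x.2 y.2.

Definition classical (phi : R * R -> R) : triple := (phi, fun b => partial b phi, phi).

Lemma classical_sqint3 phi : smooth phi -> sqint3 (classical phi).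
Proof.
move=> /smooth_C1[c1 c2 _]; split; [exact: sqint_continuous|move=> b|exact: sqint_boundary].
exact: (sqint_continuous c theta hL r_gt0 (c2 b)).
Qed.

Definition norm3 x : R := mass x x + dirichlet x x + boundary x x.

Lemma triple_lin_fun a x y : (a *: x + y).1.1 = a *: x.1.1 + y.1.1. Proof. by []. Qed.

Lemma triple_lin_grad a x y b : (a *: x + y).1.2 b = a *: x.1.2 b + y.1.2 b.
Proof. by []. Qed.

Lemma triple_lin_bd a x y : (a *: x + y).2 = a *: x.2 + y.2. Proof. by []. Qed.

Lemma norm3_ge0 x : 0 <= norm3 x.
Proof.
rewrite /norm3; apply: addr_ge0; last exact: ip_ge0.
by apply: addr_ge0; [exact: ip_ge0|apply: addr_ge0; exact: ip_ge0].
Qed.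

Lemma sqint3P a x y : sqint3 x -> sqint3 y -> sqint3 (a *: x + y).
Proof.
move=> [x1 x2 x3] [y1 y2 y3]; split.
- by rewrite triple_lin_fun; exact: sqintP.
- by move=> b; rewrite triple_lin_grad; exact: sqintP.
- by rewrite triple_lin_bd; exact: sqintP.
Qed.

Lemma sqint3B x y : sqint3 x -> sqint3 y -> sqint3 (x - y).
Proof. by move=> sx sy; rewrite addrC -scaleN1r; exact: sqint3P. Qed.

Lemma mass_lin a x y z : sqint3 x -> sqint3 y -> sqint3 z ->
  mass (a *: x + y) z = a * mass x z + mass y z.
Proof. by move=> [x1 _ _] [y1 _ _] [z1 _ _]; rewrite /mass triple_lin_fun ip_linear. Qed.

Lemma dirichlet_lin a x y z : sqint3 x -> sqint3 y -> sqint3 z ->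
  dirichlet (a *: x + y) z = a * dirichlet x z + dirichlet y z.
Proof.
move=> [_ x1 _] [_ y1 _] [_ z1 _]; rewrite /dirichlet mulrDr addrACA !triple_lin_grad.
by rewrite (ip_linear mO a (x1 true) (y1 true) (z1 true)) (ip_linear mO a (x1 false) (y1 false) (z1 false)).
Qed.

Lemma boundary_lin a x y z : sqint3 x -> sqint3 y -> sqint3 z ->
  boundary (a *: x + y) z = a * boundary x z + boundary y z.
Proof. by move=> [_ _ x1] [_ _ y1] [_ _ z1]; rewrite /boundary triple_lin_bd ip_linear. Qed.

Lemma massC x y : mass x y = mass y x. Proof. exact: ipC. Qed.
Lemma boundaryC x y : boundary x y = boundary y x. Proof. exact: ipC. Qed.
Lemma dirichletC x y : dirichlet x y = dirichlet y x.
Proof. by rewrite /dirichlet ipC (ipC _ _ (x.1.2 false)). Qed.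

Lemma mass_ge0 x : 0 <= mass x x. Proof. exact: ip_ge0. Qed.
Lemma boundary_ge0 x : 0 <= boundary x x. Proof. exact: ip_ge0. Qed.
Lemma dirichlet_ge0 x : 0 <= dirichlet x x. Proof. by rewrite addr_ge0// ip_ge0. Qed.

(** The closure of the smooth functions, each taken with its gradient and its
    boundary values. *)
Definition energetic x : Prop := sqint3 x /\
  forall e, 0 < e -> exists2 phi, smooth phi & norm3 (x - classical phi) <= e.

Lemma classical_energetic phi : smooth phi -> energetic (classical phi).
Proof.
move=> sphi; split; first exact: classical_sqint3.
move=> e e0; exists phi => //; rewrite subrr /norm3.
have z d (T : measurableType d) (mu : {measure set T -> \bar R}) D : ip mu D (0 : T -> R) 0 = 0.
  by rewrite /ip /Rintegral integral0_eq// => t _; rewrite mulr0.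
rewrite /mass /dirichlet /boundary !z !addr0; exact: ltW.
Qed.

Lemma classical_lin a phi psi : smooth phi -> smooth psi ->
  classical (fun p : R * R => a * phi p + psi p) = a *: classical phi + classical psi.
Proof.
move=> sphi spsi; rewrite /classical; congr (_, _, _).
apply/funext => b.
exact: (C1_partial b (C1D (C1Z a (smooth_C1 sphi)) (smooth_C1 spsi))).
Qed.

Lemma norm3_lin_le a x y : sqint3 x -> sqint3 y ->
  norm3 (a *: x + y) <= 2 * a ^+ 2 * norm3 x + 2 * norm3 y.
Proof.
move=> [x1 x2 x3] [y1 y2 y3].
have le d (T : measurableType d) (mu : {measure set T -> \bar R}) D (f g : T -> R) : measurable D ->
   sqint mu D f -> sqint mu D g -> ip mu D (a *: f + g) (a *: f + g) <= 2 * a ^+ 2 * ip mu D f f + 2 * ip mu D g g.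
  move=> mD sf sg; have saf := sqintZ mD a sf; apply: le_trans (ip_sqD_le mD saf sg) _.
  by rewrite ipZ// (ipC _ _ f) ipZ//; lra.
have l1 := le _ _ _ _ _ _ mO x1 y1; have l2 := le _ _ _ _ _ _ mO (x2 true) (y2 true).
have l3 := le _ _ _ _ _ _ mO (x2 false) (y2 false); have l4 := le _ _ _ _ _ _ mT x3 y3.
rewrite /norm3 /mass /dirichlet /boundary triple_lin_fun !triple_lin_grad triple_lin_bd.
apply: le_trans (lerD (lerD l1 (lerD l2 l3)) l4) _.
by rewrite le_eqVlt; apply/orP; left; apply/eqP; ring.
Qed.

Let lin_sub (V : lmodType R) (a : R) (x1 y1 x2 y2 : V) :
  a *: x1 + y1 - (a *: x2 + y2) = a *: (x1 - x2) + (y1 - y2).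
Proof. by rewrite scalerBr opprD addrACA. Qed.

Lemma energeticP a x y : energetic x -> energetic y -> energetic (a *: x + y).
Proof.
move=> [sx ax] [sy ay]; split; first exact: sqint3P.
move=> e e0; pose A := 2 * a ^+ 2 + 1; have A0 : 0 < A by rewrite ltr_wpDl// mulr_ge0// sqr_ge0.
have [phi sphi hphi] := ax (e / (2 * A)) (divr_gt0 e0 (mulr_gt0 (ltr0n _ 2) A0)).
have [psi spsi hpsi] := ay (e / 4) (divr_gt0 e0 (ltr0n _ 4)).
exists (fun p : R * R => a * phi p + psi p); first exact: smooth_lin.
have close z : z = a *: classical phi + classical psi -> norm3 (a *: x + y - z) <= e; last first.
  exact: close (classical_lin a sphi spsi).
move=> ->; rewrite lin_sub; apply: le_trans (norm3_lin_le a (sqint3B sx (classical_sqint3 sphi)) (sqint3B sy (classical_sqint3 spsi))) _.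
have n0 := norm3_ge0 (x - classical phi).
move: hphi; rewrite ler_pdivlMr ?mulr_gt0// mulrCA.
have : norm3 (x - classical phi) * (2 * a ^+ 2) <= norm3 (x - classical phi) * A.
  by rewrite ler_wpM2l// lerDl.
move: hpsi; move: (norm3 _) (norm3 _) => p q'; lra.
Qed.

Lemma energetic0 : energetic 0.
Proof.
have <- : classical (cst 0) = 0; last exact: classical_energetic (smooth_cst 0).
rewrite /classical; congr (_, _, _); apply/funext => b.
exact: (C1_partial b (C1_cst 0)).
Qed.

Lemma energetic_seq x : energetic x -> exists phi : nat -> R * R -> R,
  [/\ forall n, smooth (phi n),
      ip area Omega (x.1.1 - phi n) (x.1.1 - phi n) @[n --> \oo] --> (0 : R),
      forall b, ip area Omega (x.1.2 b - partial b (phi n)) (x.1.2 b - partial b (phi n)) @[n --> \oo] --> (0 : R) &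
      ip bd setT (x.2 - phi n) (x.2 - phi n) @[n --> \oo] --> (0 : R)].
Proof.
move=> [sx ax]; have k0 n : 0 < n.+1%:R^-1 :> R by rewrite invr_gt0.
have /choice[phi phiP] : forall n, exists phi, smooth phi /\ norm3 (x - classical phi) <= n.+1%:R^-1.
  by move=> n; have [phi] := ax _ (k0 n); exists phi.
have to0 (u : nat -> R) : (forall n, 0 <= u n) -> (forall n, u n <= n.+1%:R^-1) -> u n @[n --> \oo] --> (0 : R).
  move=> u0 u1; apply: (@squeeze_cvgr _ _ _ _ (cst 0) (fun n => n.+1%:R^-1)).
  - by near=> n; rewrite u0 u1.
  - exact: cvg_cst.
  - exact: cvg_harmonic.
exists phi; split => [n|||]; first exact: (phiP n).1.
- apply: to0 => n; first exact: ip_ge0.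
  apply: le_trans (phiP n).2; rewrite /norm3 -addrA lerDl addr_ge0 ?dirichlet_ge0 ?boundary_ge0//.
- move=> b; apply: to0 => n; first exact: ip_ge0.
  apply: le_trans (phiP n).2; rewrite /norm3 addrAC; apply: ler_wpDl.
    by rewrite addr_ge0 ?mass_ge0 ?boundary_ge0.
  by rewrite /dirichlet; case: b; [rewrite lerDl|rewrite lerDr]; exact: ip_ge0.
- apply: to0 => n; first exact: ip_ge0.
  by apply: le_trans (phiP n).2; rewrite /norm3 lerDr addr_ge0 ?mass_ge0 ?dirichlet_ge0.
Unshelve. all: by end_near. Qed.

End energy.

(** * Trace, weak derivatives and completeness *)

Section spectrum.
Context {R : realType} {L : nat}.
Variables (c : R * R) (r theta : R).
Hypotheses (hL : (3 <= L)%N) (r_gt0 : 0 < r).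
Local Notation v := (@vertex R L c r theta).
Local Notation Omega := (polygon v).
Local Notation bd := (arclength v).
Local Notation h := (@apothem R L r).
Local Notation mass := (@mass R L c r theta).
Local Notation dirichlet := (@dirichlet R L c r theta).
Local Notation boundary := (@boundary R L c r theta).
Local Notation energetic := (@energetic R L c r theta).
Local Notation norm3 := (@norm3 R L c r theta).
Local Notation sqint3 := (@sqint3 R L c r theta).

Let mO : measurable (Omega : set (mplane R)). Proof. exact: measurable_polygon. Qed.
Let mT : measurable (setT : set (mplane R)). Proof. exact: measurableT. Qed.
Let O_lty : (area Omega < +oo)%E. Proof. exact: area_polygon_lty. Qed.

Let seq_facts x : energetic x -> exists phi : nat -> R * R -> R,
  [/\ forall n, smooth (phi n),
      mass (classical (phi n)) (classical (phi n)) @[n --> \oo] --> mass x x,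
      dirichlet (classical (phi n)) (classical (phi n)) @[n --> \oo] --> dirichlet x x,
      boundary (classical (phi n)) (classical (phi n)) @[n --> \oo] --> boundary x x &
      forall w, sqint area Omega w -> ip area Omega (phi n) w @[n --> \oo] --> ip area Omega x.1.1 w /\
        forall b, ip area Omega (partial b (phi n)) w @[n --> \oo] --> ip area Omega (x.1.2 b) w].
Proof.
move=> ex; have [[x1 x2 x3] _] := ex; have [phi [sphi p1 p2 p3]] := energetic_seq ex.
have s n := classical_sqint3 c theta hL r_gt0 (sphi n).
have s1 n : sqint area Omega (phi n) by case: (s n).
have s2 b n : sqint area Omega (partial b (phi n)) by case: (s n) => _ + _; apply.
have s3 n : sqint bd setT (phi n) by case: (s n).
exists phi; split => //.
- exact: (ip_sqr_cvg mO x1 s1 p1).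
- apply: cvgD; [exact: (ip_sqr_cvg mO (x2 true) (s2 true) (p2 true))|].
  exact: (ip_sqr_cvg mO (x2 false) (s2 false) (p2 false)).
- exact: (ip_sqr_cvg mT x3 s3 p3).
- move=> w sw; split; first exact: (ip_cvg mO x1 s1 sw p1).
  by move=> b; exact: (ip_cvg mO (x2 b) (s2 b) sw (p2 b)).
Qed.

(** Both sides are continuous for [norm3]. *)
Lemma energetic_ineq (alpha M : R) :
  (forall phi, smooth phi -> alpha * boundary (classical phi) (classical phi) <=
    dirichlet (classical phi) (classical phi) + M * mass (classical phi) (classical phi)) ->
  forall x, energetic x -> alpha * boundary x x <= dirichlet x x + M * mass x x.
Proof.
move=> MP x ex; have [phi [sphi p1 p2 p3 _]] := seq_facts ex.
have c1 : alpha * boundary (classical (phi n)) (classical (phi n)) @[n --> \oo] --> alpha * boundary x x.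
  by apply: cvgM => //; exact: cvg_cst.
have c2 : dirichlet (classical (phi n)) (classical (phi n)) + M * mass (classical (phi n)) (classical (phi n))
    @[n --> \oo] --> dirichlet x x + M * mass x x.
  by apply: cvgD => //; apply: cvgM => //; exact: cvg_cst.
apply: (ler_cvg_to c1 c2); near=> n; exact: (MP _ (sphi n)).
Unshelve. all: by end_near. Qed.

Lemma energetic_trace (alpha : R) : 0 < alpha -> exists2 M, 0 <= M & forall x, energetic x ->
  alpha * boundary x x <= dirichlet x x + M * mass x x.
Proof.
move=> a0; have [M M0 MP] := trace_inequality c theta hL r_gt0 a0; exists M => //.
exact: energetic_ineq.
Qed.

Lemma energetic_compact (e : R) : 0 < e -> exists (k : nat) (w : 'I_k -> mplane R -> R),
  (forall i, sqint area Omega (w i) /\ ip area Omega (w i) (w i) <= 1) /\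
  forall x, energetic x -> mass x x <= e * dirichlet x x + \sum_(i < k) ip area Omega x.1.1 (w i) ^+ 2.
Proof.
move=> e0; have [k [w [w1 wP]]] := grid_compact c theta hL r_gt0 e0.
exists k, w; split=> // x ex; have [phi [sphi p1 p2 _ p4]] := seq_facts ex.
have c2 : e * dirichlet (classical (phi n)) (classical (phi n)) + \sum_(i < k) ip area Omega (phi n) (w i) ^+ 2
    @[n --> \oo] --> e * dirichlet x x + \sum_(i < k) ip area Omega x.1.1 (w i) ^+ 2.
  apply: cvgD; first by apply: cvgM => //; exact: cvg_cst.
  elim: (index_enum _) => [|i s IH].
    by rewrite big_nil; under eq_fun do rewrite big_nil; exact: cvg_cst.
  rewrite big_cons; under eq_fun do rewrite big_cons; apply: cvgD => //.
  rewrite expr2; under eq_fun do rewrite expr2.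
  by apply: cvgM; exact: (p4 _ (w1 i).1).1.
apply: (ler_cvg_to p1 c2); near=> n.
have := wP _ _ (smooth_C1 (sphi n)); rewrite /dirichlet/= => /le_trans; apply.
by rewrite lerD2l; apply: ler_sum => i _; rewrite ipC.
Unshelve. all: by end_near. Qed.

Lemma edge_not_interior k t : 0 <= t <= 1 -> ~ Omega (edge v k t).
Proof.
move=> t01; rewrite polygonE// => /(_ k).
have -> : height c theta k (edge v k t) = (1 - t) * height c theta k (v k) + t * height c theta k (v (ordS k)).
  by rewrite /height /edge/=; ring.
rewrite !height_vertex dot_vdir_normal dot_vdirS_normal// /apothem -mulrDl subrK mul1r ltxx.
by [].
Qed.

Lemma smooth_weak_grad phi : smooth phi -> weak_grad c r theta (L := L) phi (fun b => partial b phi).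
Proof.
move=> sphi b f [sf [K [_ KO fK]]].
have Cphi := smooth_C1 sphi; have Cf := smooth_C1 sf.
have [cphi cdphi _] := Cphi; have [cf cdf _] := Cf.
have CF b' : C1 (fun x => phi x * f x * (b == b')%:R)
    (fun i x => (b == b')%:R * (phi x * partial i f x + f x * partial i phi x)).
  have := C1Z (b == b')%:R (C1M Cphi Cf); congr C1.
  by apply/funext => x; rewrite mulrC.
have := divergence c theta hL r_gt0 CF.
rewrite [X in _ = X]big1; last first.
  move=> k _; rewrite (_ : Rintegral _ _ _ = 0) ?mulr0//.
  rewrite /Rintegral integral0_eq// => t; rewrite /= in_itv/= => t01.
  have f0 : f (edge v k t) = 0 by apply: fK => /KO; exact: edge_not_interior.
  by rewrite f0 mulr0 !mul0r addr0.
have i1 : area.-integrable Omega (EFin \o (fun x => phi x * partial b f x)).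
  by apply: polygon_integrable => // x; apply: cvgM; [exact: cphi|exact: cdf].
have i2 : area.-integrable Omega (EFin \o (fun x => partial b phi x * f x)).
  by apply: polygon_integrable => // x; apply: cvgM; [exact: cdphi|exact: cf].
move=> e; apply/eqP; rewrite -addr_eq0 -(RintegralD mO i1 i2) -e; apply/eqP.
apply: eq_Rintegral => x _; rewrite (mulrC (partial b phi x)).
by case: b {CF e i1 i2}; rewrite /= mul1r mul0r ?addr0 ?add0r.
Qed.

Lemma energetic_weak_grad x : energetic x -> weak_grad c r theta (L := L) x.1.1 x.1.2.
Proof.
move=> ex b f tf; have [phi [sphi _ _ _ p4]] := seq_facts ex.
have sf := test_sqint hL r_gt0 tf.
have sdf : sqint area Omega (partial b f).
  by have [/smooth_C1[_ cdf _] _] := tf; apply: sqint_continuous => //; exact: cdf.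
have c1 := (p4 _ sdf).1; have c2 := (p4 _ sf).2 b.
have : (fun n => ip area Omega (phi n) (partial b f)) = (fun n => - ip area Omega (partial b (phi n)) f).
  by apply/funext => n; exact: (smooth_weak_grad (sphi n) b tf).
move=> e; move: c1; rewrite e => c1.
have /cvg_unique := c1; apply => //; exact: cvgN.
Qed.

Let ae_mono (mu : {measure set (mplane R) -> \bar R}) (P Q : mplane R -> Prop) :
  (forall x, P x -> Q x) -> {ae mu, forall x, P x} -> {ae mu, forall x, Q x}.
Proof. by move=> PQ; apply: (@filterS _ _ (ae_filter_ringOfSetsType mu)). Qed.

Lemma weak_grad_unique u u' g g' : area.-integrable Omega (EFin \o u) -> area.-integrable Omega (EFin \o u') ->
  (forall b, area.-integrable Omega (EFin \o g b)) -> (forall b, area.-integrable Omega (EFin \o g' b)) ->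
  weak_grad c r theta (L := L) u g -> weak_grad c r theta (L := L) u' g' ->
  {ae area, forall x, Omega x -> u x = u' x} ->
  forall b, {ae area, forall x, Omega x -> g b x = g' b x}.
Proof.
move=> ui u'i gi g'i ug ug' uu' b.
have := @test_vanish R L c r theta hL r_gt0 (fun p => -1 * g' b p + g b p).
have [i1 _] := Rintegral_lin (-1) mO (g'i b) (gi b).
move=> /(_ i1) H; have {H} : {ae area, forall x : mplane R, Omega x -> -1 * g' b x + g b x = 0}.
  apply: H => f tf; have cf : continuous f by have [/smooth_C1[cf _ _] _] := tf.
  have cdf : continuous (partial b f) by have [/smooth_C1[_ cdf _] _] := tf; exact: cdf.
  have j1 := integrable_mul_continuous hL r_gt0 (gi b) cf.
  have j2 := integrable_mul_continuous hL r_gt0 (g'i b) cf.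
  have [_ e1] := Rintegral_lin (-1) mO j2 j1.
  rewrite (eq_Rintegral _ (g := fun p : mplane R => -1 * (g' b p * f p) + g b p * f p)); last by move=> p _; ring.
  rewrite e1; have := ug b f tf; have := ug' b f tf.
  rewrite (_ : \int[area]_(x in Omega) (u x * partial b f x) = \int[area]_(x in Omega) (u' x * partial b f x)); last first.
    rewrite /Rintegral; congr fine; apply: ae_eq_integral => //.
    - by case/integrableP: (integrable_mul_continuous hL r_gt0 ui cdf).
    - by case/integrableP: (integrable_mul_continuous hL r_gt0 u'i cdf).
    by move: uu'; apply: ae_mono => x + Ox => /(_ Ox) /= ->.
  by move=> -> /oppr_inj ->; ring.
by apply: ae_mono => x + Ox => /(_ Ox) e; apply/eqP; rewrite -subr_eq0 -e mulN1r addrC.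
Qed.

(** By the trace inequality the boundary values vanish together with the function
    and its derivatives. *)
Lemma energetic_unique x y : energetic x -> energetic y ->
  {ae area, forall p, Omega p -> x.1.1 p = y.1.1 p} ->
  (forall b, {ae area, forall p, Omega p -> x.1.2 b p = y.1.2 b p}) /\
  {ae bd, forall p, setT p -> x.2 p = y.2 p}.
Proof.
move=> ex ey xy; have [[x1 x2 x3] _] := ex; have [[y1 y2 y3] _] := ey.
have si f : sqint area Omega f -> area.-integrable Omega (EFin \o f) by exact: sqint_integrable.
have gxy := weak_grad_unique (si _ x1) (si _ y1) (fun b => si _ (x2 b)) (fun b => si _ (y2 b))
  (energetic_weak_grad ex) (energetic_weak_grad ey) xy.
split=> //.
have ez : energetic (x - y) by rewrite addrC -scaleN1r; exact: energeticP.
have [[z1 z2 z3] _] := ez.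
have zero f : sqint area Omega f -> {ae area, forall p, Omega p -> f p = 0} -> ip area Omega f f = 0.
  move=> sf f0; rewrite (ip_ae mO (f' := cst 0) (g' := cst 0)) //; [|by case: sf|by case: sf].
  by rewrite /ip /Rintegral integral0_eq// => p _; rewrite mulr0.
have m0 : mass (x - y) (x - y) = 0.
  by apply: zero => //; move: xy; apply: ae_mono => p + Op => /(_ Op) e; rewrite /= fctE e subrr.
have d0 : dirichlet (x - y) (x - y) = 0.
  rewrite /dirichlet !zero ?addr0//.
  - by have := gxy false; apply: ae_mono => p + Op => /(_ Op) e; rewrite /= !fctE e subrr.
  - by have := gxy true; apply: ae_mono => p + Op => /(_ Op) e; rewrite /= !fctE e subrr.
have [M M0 MP] := energetic_trace ltr01.
have b0 : boundary (x - y) (x - y) = 0.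
  apply/eqP; rewrite eq_le boundary_ge0 andbT; have := MP _ ez.
  by rewrite mul1r m0 d0 mulr0 addr0.
have := ip_eq0 mT z3 b0; apply: ae_mono => p /(_ Logic.I) e _.
by apply/eqP; rewrite -subr_eq0; apply/eqP.
Qed.

(** Each component converges in its own space of square-integrable functions; a
    smooth approximation of a late term approximates the limit. *)
Lemma energetic_complete (x_ : nat -> triple (R := R)) : (forall n, energetic (x_ n)) ->
  (forall e, 0 < e -> exists N, forall m n, (N <= m)%N -> (N <= n)%N -> norm3 (x_ m - x_ n) <= e) ->
  exists2 y, energetic y & forall e, 0 < e -> exists N, forall n, (N <= n)%N -> norm3 (x_ n - y) <= e.
Proof.
move=> ex cx; have sx n : sqint3 (x_ n) by case: (ex n).
have [le1 le2 le3] : [/\ forall z, mass z z <= norm3 z,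
    forall z b, ip area Omega (z.1.2 b) (z.1.2 b) <= norm3 z & forall z, boundary z z <= norm3 z].
  split=> z; rewrite /norm3.
  - by rewrite -addrA lerDl addr_ge0// ?dirichlet_ge0 ?boundary_ge0.
  - move=> b; rewrite addrAC; apply: ler_wpDl; first by apply: addr_ge0; exact: ip_ge0.
    by rewrite /dirichlet; case: b; [rewrite lerDl|rewrite lerDr]; exact: ip_ge0.
  - by rewrite lerDr; apply: addr_ge0; [exact: ip_ge0|apply: addr_ge0; exact: ip_ge0].
have s1 n : sqint area Omega (x_ n).1.1 by case: (sx n).
have s2 b n : sqint area Omega ((x_ n).1.2 b) by case: (sx n) => _ + _; apply.
have s3 n : sqint bd setT (x_ n).2 by case: (sx n).
have [|u su ulim] := sqint_complete (f := fun n => (x_ n).1.1) mO s1.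
  move=> e e0; have [N NP] := cx e e0; exists N => m n Nm Nn.
  by exact: le_trans (le1 (x_ m - x_ n)) (NP m n Nm Nn).
have /choice[g gP] : forall b, exists g, sqint area Omega g /\ forall e, 0 < e -> exists N, forall n, (N <= n)%N ->
    ip area Omega ((x_ n).1.2 b - g) ((x_ n).1.2 b - g) <= e.
  move=> b; have [|g sg glim] := sqint_complete (f := fun n => (x_ n).1.2 b) mO (s2 b).
    move=> e e0; have [N NP] := cx e e0; exists N => m n Nm Nn.
    by exact: le_trans (le2 (x_ m - x_ n) b) (NP m n Nm Nn).
  by exists g.
have [|t st tlim] := sqint_complete (f := fun n => (x_ n).2) mT s3.
  move=> e e0; have [N NP] := cx e e0; exists N => m n Nm Nn.
  by exact: le_trans (le3 (x_ m - x_ n)) (NP m n Nm Nn).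
pose y : triple := (u, g, t).
have sy : sqint3 y by split=> // b; exact: (gP b).1.
have lim e : 0 < e -> exists N, forall n, (N <= n)%N -> norm3 (x_ n - y) <= e.
  move=> e0; have e4 : 0 < e / 4 by rewrite divr_gt0.
  have [N1 P1] := ulim _ e4; have [N2 P2] := (gP true).2 _ e4.
  have [N3 P3] := (gP false).2 _ e4; have [N4 P4] := tlim _ e4.
  exists (maxn (maxn N1 N2) (maxn N3 N4)) => n; rewrite !geq_max => /andP[/andP[h1 h2] /andP[h3 h4]].
  rewrite /norm3 (_ : e = e / 4 + (e / 4 + e / 4) + e / 4); last by field.
  by apply: lerD; [apply: lerD; [exact: P1|apply: lerD; [exact: P2|exact: P3]]|exact: P4].
exists y => //; split=> // e e0.
have e4 : 0 < e / 4 by rewrite divr_gt0.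
have [N NP] := lim _ e4; have [phi sphi hphi] := (ex N).2 _ e4.
exists phi => //.
have sc := classical_sqint3 c theta hL r_gt0 sphi.
have := norm3_lin_le (-1) (sqint3B (sx N) sy) (sqint3B (sx N) sc).
have sub3 (V : lmodType R) (a a' b : V) : -1 *: (a - b) + (a - a') = b - a'.
  by rewrite scaleN1r opprB addrA subrK.
rewrite sub3.
move=> /le_trans; apply; rewrite sqrrN expr1n mulr1.
have := NP N (leqnn _); move: hphi; move: (norm3 _) (norm3 _) => p q; lra.
Qed.

(** The trace inequality makes the boundary values of the approximating smooth
    functions a Cauchy sequence, whose limit is the trace. *)
Lemma weak_grad_energetic u g : sqint area Omega u -> (forall b, sqint area Omega (g b)) ->
  weak_grad c r theta (L := L) u g -> exists t, energetic (u, g, t).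
Proof.
move=> su sg ug.
have arith (N e b D B x : R) : 0 <= N -> 0 <= x -> x * (24 + 8 * N) = e -> D <= 8 * x -> b <= 4 * x ->
    B <= D + N * b -> b + D + B <= e.
  move=> N0 x0 h1 h2 h3 h4; have := ler_wpM2l N0 h3; have := mulr_ge0 N0 x0; move: h1.
  rewrite (_ : x * _ = 24 * x + 8 * (N * x)); last by ring.
  rewrite (_ : N * (4 * x) = 4 * (N * x)); last by ring.
  move: x0 h2 h3 h4; move: (N * x) (N * b) => p q; lra.
have k0 n : 0 < n.+1%:R^-1 :> R by rewrite invr_gt0.
have /choice[phi phiP] : forall n, exists phi, smooth phi /\
    (ip area Omega (u - phi) (u - phi) <= n.+1%:R^-1 /\
     forall b, ip area Omega (g b - partial b phi) (g b - partial b phi) <= n.+1%:R^-1).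
  by move=> n; have [phi sphi h] := weak_grad_dense hL r_gt0 su sg ug (k0 n); exists phi.
have sphi n := (phiP n).1.
have ec n := classical_energetic c theta hL r_gt0 (sphi n).
have [M M0 MP] := energetic_trace ltr01.
have small (e : R) : 0 < e -> exists N, forall n, (N <= n)%N -> n.+1%:R^-1 <= e :> R.
  move=> e0; exists (Num.trunc e^-1) => n Nn; rewrite invf_ple ?posrE//.
  by apply: ltW; apply: lt_le_trans (truncnS_gt _) _; rewrite ler_nat.
have s1 n : sqint area Omega (phi n) by have [[]] := ec n.
have s2 b n : sqint area Omega (partial b (phi n)) by have [[_ + _] _] := ec n; apply.
have close (f p q : mplane R -> R) (d : R) : sqint area Omega f -> sqint area Omega p -> sqint area Omega q ->
    ip area Omega (f - p) (f - p) <= d -> ip area Omega (f - q) (f - q) <= d ->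
    ip area Omega (p - q) (p - q) <= 4 * d.
  move=> sf sp sq hp hq; have sfp := sqintB mO sf sp; have sfq := sqintB mO sf sq.
  have -> : p - q = (f - q) - (f - p) by apply/funext => z; rewrite !fctE/=; ring.
  have sN : sqint area Omega (- (f - p)) by rewrite -scaleN1r; exact: sqintZ.
  apply: le_trans (ip_sqD_le mO sfq sN) _.
  have -> : ip area Omega (- (f - p)) (- (f - p)) = ip area Omega (f - p) (f - p).
    by apply: eq_Rintegral => z _; rewrite !fctE mulrNN.
  lra.
have cauchy e : 0 < e -> exists N, forall m n, (N <= m)%N -> (N <= n)%N ->
    norm3 (classical (phi m) - classical (phi n)) <= e.
  move=> e0; pose A := 24 + 8 * M; have A0 : 0 < A by rewrite ltr_pwDl// mulr_ge0.
  have [N NP] := small _ (divr_gt0 e0 A0); exists N => m n Nm Nn.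
  set d := e / A in NP.
  have [hm1 hm2] := (phiP m).2; have [hn1 hn2] := (phiP n).2.
  have dm := NP m Nm; have dn := NP n Nn.
  have c1 := close _ _ _ d su (s1 m) (s1 n) (le_trans hm1 dm) (le_trans hn1 dn).
  have c2 b := close _ _ _ d (sg b) (s2 b m) (s2 b n) (le_trans (hm2 b) dm) (le_trans (hn2 b) dn).
  have ez : energetic (classical (phi m) - classical (phi n)) by rewrite addrC -scaleN1r; exact: energeticP.
  have := MP _ ez; rewrite mul1r /norm3.
  have : mass (classical (phi m) - classical (phi n)) (classical (phi m) - classical (phi n)) <= 4 * d by exact: c1.
  have : dirichlet (classical (phi m) - classical (phi n)) (classical (phi m) - classical (phi n)) <= 8 * d.
    rewrite (_ : 8 * d = 4 * d + 4 * d); last by ring.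
    by apply: lerD; [exact: (c2 true)|exact: (c2 false)].
  have : d * A = e by rewrite divfK// gt_eqF.
  have : 0 <= d by rewrite ltW// divr_gt0.
  have := M0.
  exact: arith.
have [[[u' g'] t] ey ylim] := energetic_complete ec cauchy.
exists t.
have [[y1 y2 y3] _] := ey; rewrite /= in y1 y2 y3.
split; first by split.
have ylim' e : 0 < e -> exists N, forall n, (N <= n)%N -> ip bd setT (t - phi n) (t - phi n) <= e.
  move=> /ylim[N NP]; exists N => n /NP; apply: le_trans; rewrite /norm3.
  rewrite (_ : ip _ _ _ _ = boundary (classical (phi n) - (u', g', t)) (classical (phi n) - (u', g', t))).
    by rewrite lerDr; apply: addr_ge0; [exact: ip_ge0|apply: addr_ge0; exact: ip_ge0].
  by apply: eq_Rintegral => z _; rewrite /classical/= !fctE -mulrNN !opprB.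
move=> e e0; have e4 : 0 < e / 4 by rewrite divr_gt0.
have [N1 P1] := small _ e4; have [N2 P2] := ylim' _ e4.
pose n := maxn N1 N2; exists (phi n) => //; rewrite /norm3.
rewrite (_ : e = e / 4 + (e / 4 + e / 4) + e / 4); last by field.
have dn := P1 n (leq_maxl _ _); have [hn1 hn2] := (phiP n).2.
apply: lerD; last exact: P2 (leq_maxr _ _).
by apply: lerD; [exact: le_trans dn|apply: lerD; exact: le_trans (hn2 _) dn].
Qed.

End spectrum.

(** * Existence of the eigenvalues *)

Definition box (R : realType) (x : R * R) (eta : R) : set (mplane R) :=
  [set p | `|p.1 - x.1| < eta /\ `|p.2 - x.2| < eta].

Lemma area_box (R : realType) (x : R * R) (eta : R) : 0 < eta ->
  measurable (box x eta) /\
  area (box x eta) = (4 * eta ^+ 2)%:E.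
Proof.
move=> e0.
have -> : box x eta =
    `]x.1 - eta, x.1 + eta[ `*` `]x.2 - eta, x.2 + eta[.
  by apply/seteqP; split=> -[p1 p2]/=; rewrite /box/= !in_itv/= -!ltr_distl.
have mI a b : measurable (`]a, b[ : set (measurableTypeR R)) by exact: measurable_itv.
split; first exact: measurableX.
rewrite [LHS]product_measure1E//= !lebesgue_measure_itv/= !lte_fin.
rewrite !ifT; [|by lra..]; rewrite -!EFinD -EFinM; congr (_%:E); ring.
Qed.

Lemma box_le_integral (R : realType) (D : set (mplane R)) (f : R * R -> R) (x : R * R) (eta k : R) :
  0 < eta -> measurable D -> box x eta `<=` D ->
  area.-integrable D (EFin \o f) -> (forall p, D p -> 0 <= f p) ->
  (forall p, `|p.1 - x.1| < eta -> `|p.2 - x.2| < eta -> k <= f p) ->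
  k * (4 * eta ^+ 2) <= \int[area]_(p in D) f p.
Proof.
move=> e0 mD BD fi f0 kf; have [mB aB] := area_box x e0.
have mf : measurable_fun D (EFin \o f) by case/integrableP: fi.
rewrite -lee_fin /Rintegral fineK; last exact: integrable_fin_num.
rewrite EFinM -aB -integral_cst//.
apply: (@le_trans _ _ (\int[area]_(p in box x eta) (f p)%:E)%E); last exact: ge0_subset_integral.
have [k0|k0] := leP 0 k.
  apply: ge0_le_integral => //.
  - exact: measurable_funS mf.
  - by move=> p [p1 p2]; rewrite lee_fin kf.
apply: (@le_trans _ _ 0%E).
  by rewrite integral_cst// mule_le0_ge0// lee_fin ltW.
by apply: integral_ge0 => p /BD; rewrite lee_fin; exact: f0.
Qed.

Section real_spectrum.
Context {R : realType} {L : nat}.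
Variables (c : R * R) (r theta : R).
Hypotheses (hL : (3 <= L)%N) (r_gt0 : 0 < r).
Local Notation v := (@vertex R L c r theta).
Local Notation Omega := (polygon v).
Local Notation bd := (arclength v).
Local Notation mass := (@mass R L c r theta).
Local Notation dirichlet := (@dirichlet R L c r theta).
Local Notation boundary := (@boundary R L c r theta).
Local Notation energetic := (@energetic R L c r theta).
Local Notation norm3 := (@norm3 R L c r theta).

Let mO : measurable (Omega : set (mplane R)). Proof. exact: measurable_polygon. Qed.

Lemma box_in_polygon : exists2 eta : R, 0 < eta &
  box c eta `<=` Omega.
Proof.
have oO : open Omega by exact: open_interior.
have Oc : Omega c.
  rewrite polygonE// => k; rewrite /height !subrr !mul0r addr0; exact: apothem_gt0.
have /nbhs_ballP[eta /= e0 eO] := open_nbhs_nbhs (conj oO Oc).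
exists eta => // p [p1 p2]; apply: eO; split; rewrite /ball/= distrC//.
Qed.

Lemma triple_sum_fun m (a : 'I_m -> R) (x : 'I_m -> triple (R := R)) :
  (\sum_(i < m) a i *: x i).1.1 = fun p => \sum_(i < m) a i * (x i).1.1 p.
Proof.
apply/funext => p; elim: (index_enum _) => [|i s IH]; first by rewrite !big_nil.
by rewrite !big_cons triple_lin_fun -IH.
Qed.

(** A vanishing combination is a polynomial in one exponential, which has a root at
    each of its values near the centre. *)
Lemma mass_exp_free m (a : 'I_m -> R) :
  mass (\sum_(i < m) a i *: classical (fun p : R * R => expR (i%:R * p.1 + 0 * p.2 + 0)))
       (\sum_(i < m) a i *: classical (fun p : R * R => expR (i%:R * p.1 + 0 * p.2 + 0))) = 0 -> forall i, a i = 0.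
Proof.
have [eta e0 eO] := box_in_polygon.
pose P := \poly_(i < m) (if insub i is Some j then a j else 0).
have funE : (\sum_(i < m) a i *: classical (fun p : R * R => expR (i%:R * p.1 + 0 * p.2 + 0))).1.1 = fun p => P.[expR p.1].
  have -> : (\sum_(i < m) a i *: classical (fun p : R * R => expR (i%:R * p.1 + 0 * p.2 + 0))).1.1 =
      fun p => \sum_(i < m) a i * expR p.1 ^+ i.
    by rewrite triple_sum_fun; apply/funext => p; apply: eq_bigr => i _; rewrite /= mul0r !addr0 expRM_natl.
  apply/funext => p; rewrite horner_poly; apply: eq_bigr => i _.
  by rewrite valK.
rewrite /mass funE => m0.
have cP : continuous (fun p : R * R => P.[expR p.1] * P.[expR p.1]).
  have cP' : continuous (fun p : R * R => P.[expR p.1]).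
    move=> p; apply: (@continuous_comp _ _ _ (fun p : R * R => expR p.1) (horner P)); last exact: continuous_horner.
    by apply: (@continuous_comp _ _ _ fst (@expR R)); [exact: cvg_fst|exact: continuous_expR].
  by move=> p; apply: cvgM; exact: cP'.
have root0 t : `|t - c.1| < eta -> root P (expR t).
  move=> te; apply/negP => /negP Pt; pose x : R * R := (t, c.2).
  have k0 : 0 < P.[expR t] * P.[expR t] by rewrite -expr2 exprn_even_gt0.
  have [d d0 dP] : exists2 d, 0 < d & forall p : R * R, `|p.1 - x.1| < d -> `|p.2 - x.2| < d ->
      P.[expR t] * P.[expR t] / 2 <= P.[expR p.1] * P.[expR p.1].
    have /cvgrPdist_le/(_ _ (divr_gt0 k0 (ltr0n _ 2)))/nbhs_ballP[d /= d0 dP] := cP x.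
    exists d => // p p1 p2; have /dP : ball x d p by split; rewrite /ball/= distrC.
    by rewrite /= ler_norml; set a1 := P.[expR t] * _; set a2 := P.[expR p.1] * _; lra.
  pose e' := Num.min d (eta - `|t - c.1|).
  have e'0 : 0 < e' by rewrite lt_min d0 subr_gt0.
  have e'd : e' <= d by rewrite ge_min lexx.
  have BO : box x e' `<=` Omega.
    apply: subset_trans eO => p [p1 p2]; split.
      have -> : p.1 - c.1 = (p.1 - t) + (t - c.1) by rewrite addrA subrK.
      by apply: le_lt_trans (ler_normD _ _) _; rewrite -ltrBrDr; apply: lt_le_trans p1 _; rewrite ge_min lexx orbT.
    by apply: lt_le_trans p2 _; rewrite ge_min gerBl normr_ge0 orbT.
  have := box_le_integral e'0 mO BO (polygon_integrable c theta hL r_gt0 cP) (fun p _ => sqr_ge0 _)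
    (fun p p1 p2 => dP p (lt_le_trans p1 e'd) (lt_le_trans p2 e'd)).
  by rewrite [leRHS]m0 leNgt mulr_gt0 ?divr_gt0// mulr_gt0// exprn_gt0.
have P0 : P = 0.
  pose s := [seq expR (c.1 + eta / i.+2%:R) | i <- iota 0 (size P)].
  apply: (@roots_geq_poly_eq0 _ P s); last by rewrite size_map size_iota.
    apply/allP => _ /mapP[i _ ->]; apply: root0; rewrite addrAC subrr add0r gtr0_norm ?divr_gt0//.
    by rewrite ltr_pdivrMr// ltr_pMr// ltr1n.
  rewrite map_inj_uniq ?iota_uniq// => i j /expR_inj/addrI/(mulfI (lt0r_neq0 e0))/invr_inj/eqP.
  by rewrite eqr_nat => /eqP[].
move=> i; have := congr1 (fun q : {poly R} => q`_i) P0.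
by rewrite coef_poly ltn_ord valK coef0.
Qed.

(** The abstract theorem needs a genuine module, hence the subtype. *)
Definition energy_space_pred : {pred triple (R := R)} := fun x => `[< energetic x >].

Lemma energy_space_closed : submod_closed energy_space_pred.
Proof.
split=> [|a x y /asboolP ex /asboolP ey]; apply/asboolP; first exact: energetic0.
exact: energeticP.
Qed.

HB.instance Definition _ := GRing.isSubmodClosed.Build R (triple (R := R)) energy_space_pred energy_space_closed.

Definition energy_space := {x : triple (R := R) | x \in energy_space_pred}.

HB.instance Definition _ := SubType.on energy_space.
HB.instance Definition _ := Choice.on energy_space.
HB.instance Definition _ := [SubChoice_isSubLmodule of energy_space by <:].

Lemma energy_spaceP (x : energy_space) : energetic (val x).
Proof. by apply/asboolP; exact: (valP x). Qed.

Definition to_energy x (ex : energetic x) : energy_space := exist _ x (asboolT ex).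

Definition robin (gam : R) x y := dirichlet x y - gam * boundary x y.

(** Half of the Dirichlet energy absorbs the boundary term. *)
Lemma robin_lower (gam : R) : 0 < gam -> exists2 M, 0 <= M & forall x, energetic x ->
  norm3 x <= (5 + M) * (robin gam x x + (M / 2 + 1) * mass x x) /\ mass x x + dirichlet x x / 2 <= robin gam x x + (M / 2 + 1) * mass x x.
Proof.
move=> g0; have [M1 M10 M1P] := energetic_trace c theta hL r_gt0 ltr01.
have [M M0 MP] := energetic_trace c theta hL r_gt0 (mulr_gt0 (ltr0n R 2) g0).
exists (M + M1); first exact: addr_ge0.
move=> x ex; have := M1P _ ex; have := MP _ ex; rewrite /norm3 /robin.
have := mass_ge0 c r theta (L := L) x; have := dirichlet_ge0 c r theta (L := L) x.
move: (mass x x) (dirichlet x x) (boundary x x) => b D B D0 b0 h1 h2.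
have bM1 := mulr_ge0 M10 b0; have bM := mulr_ge0 M0 b0.
have h3 : b + D / 2 <= D - gam * B + ((M + M1) / 2 + 1) * b.
  by rewrite mulrDl mul1r (_ : (M + M1) / 2 * b = M * b / 2 + M1 * b / 2); [lra|field].
split=> //; apply: le_trans (_ : (5 + (M + M1)) * (b + D / 2) <= _); last first.
  by rewrite ler_wpM2l// !addr_ge0.
have h4 := mulr_ge0 (addr_ge0 M0 M10) D0.
rewrite [leRHS](_ : _ = 5 * b + 5 / 2 * D + M * b + M1 * b + (M + M1) * D / 2); last by field.
lra.
Qed.

Theorem robin_spectral (gam : R) : 0 < gam -> exists (E : nat -> R) (e : nat -> triple (R := R)),
  [/\ forall i, energetic (e i), forall i j, mass (e i) (e j) = (i == j)%:R,
      forall i x, energetic x -> robin gam (e i) x = E i * mass (e i) x,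
      {homo E : m n / (m <= n)%N >-> m <= n} &
      (forall n x, energetic x -> (forall i, (i < n)%N -> mass x (e i) = 0) -> E n * mass x x <= robin gam x x) /\
      (forall M, exists n, M < E n)].
Proof.
move=> g0; have [M M0 MP] := robin_lower g0.
have le_div (k x y e : R) : 0 < k -> y <= e / k -> x <= k * y -> x <= e.
  by move=> k0; rewrite ler_pdivlMr// mulrC => h1 /le_trans; apply.
have bil (B : triple -> triple -> R) : (forall x y, B x y = B y x) ->
   (forall a x y z, energetic x -> energetic y -> energetic z -> B (a *: x + y) z = a * B x z + B y z) ->
   symbil (fun x y : energy_space => B (val x) (val y)).
  move=> BC BL; split=> [x y|a x y z]; first exact: BC.
  by rewrite linearP; apply: BL; exact: energy_spaceP.
have := @spectral R energy_space (fun x y => mass (val x) (val y)) (fun x y => robin gam (val x) (val y)) (M / 2 + 1).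
case.
- apply: bil => [x y|a x y z [sx _] [sy _] [sz _]]; [exact: massC|exact: mass_lin].
- apply: bil => [x y|a x y z [sx _] [sy _] [sz _]]; first by rewrite /robin dirichletC boundaryC.
  by rewrite /robin dirichlet_lin// boundary_lin//; ring.
- by move=> x; exact: mass_ge0.
- move=> x; have [_] := MP _ (energy_spaceP x); apply: le_trans; rewrite lerDl divr_ge0 ?dirichlet_ge0//.
- move=> x cx; have [|y ey ylim] := @energetic_complete R L c r theta hL r_gt0 (fun n => val (x n)) (fun n => energy_spaceP (x n)).
    move=> e e0; have [N NP] := cx _ (divr_gt0 e0 (ltr_wpDr M0 (ltr0n R 5))); exists N => m n Nm Nn.
    have vB : val (x m - x n) = val (x m) - val (x n) by rewrite raddfB.
    have := (MP _ (energy_spaceP (x m - x n))).1; have := NP m n Nm Nn; rewrite vB.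
    by apply: le_div; exact: ltr_wpDr.
  exists (to_energy ey) => e e0; have [N NP] := ylim _ (divr_gt0 e0 (ltr_wpDr M0 (ltr0n R 2))); exists N => n Nn.
  have vB : val (x n - to_energy ey) = val (x n) - y by rewrite raddfB.
  have := NP n Nn; rewrite vB; move/(le_div _ _ _ _ (ltr_wpDr M0 (ltr0n R 2))); apply.
  rewrite /robin /norm3; have := mass_ge0 c r theta (L := L) (val (x n) - y); have := dirichlet_ge0 c r theta (L := L) (val (x n) - y).
  have := boundary_ge0 c r theta (L := L) (val (x n) - y); move: (mass _ _) (dirichlet _ _) (boundary _ _) => b D B B0 D0 b0.
  have := mulr_ge0 M0 b0; have := mulr_ge0 M0 D0; have := mulr_ge0 M0 B0; have := mulr_ge0 (ltW g0) B0 => h1 h2 h3 h4.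
  rewrite [_ + _ * b](_ : _ = D - gam * B + (M * b) / 2 + b); last by field.
  rewrite [leRHS](_ : _ = 2 * b + 2 * D + 2 * B + M * b + M * D + M * B); last by ring.
  move: b0 D0 B0 h1 h2 h3 h4; move: (M * b) (M * D) (M * B) (gam * B) => u1 u2 u3 u4; lra.
- move=> e e0; have [k [w [w1 wP]]] := energetic_compact c theta hL r_gt0 (divr_gt0 e0 (ltr0n R 2)).
  exists k, (fun i x => ip area Omega (val x).1.1 (w i)); split.
  - move=> i a x y; have vE : val (a *: x + y) = a *: val x + val y by rewrite linearP.
    have [[x1 _ _] _] := energy_spaceP x; have [[y1 _ _] _] := energy_spaceP y.
    by rewrite vE; exact: (ip_linear mO a x1 y1 (w1 i).1).
  - move=> i x; have [[x1 _ _] _] := energy_spaceP x; have [wi wi1] := w1 i.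
    apply: le_trans (ip_CS mO x1 wi) _; rewrite ler_piMr//; exact: mass_ge0.
  - move=> x; apply: le_trans (wP _ (energy_spaceP x)) _; rewrite lerD2r -mulrA ler_wpM2l ?(ltW e0)//.
    have [_] := MP _ (energy_spaceP x); apply: le_trans; rewrite mulrC lerDr; exact: mass_ge0.
- move=> m.
  have eX (i : nat) : energetic (classical (fun p : R * R => expR (i%:R * p.1 + 0 * p.2 + 0))).
    apply: classical_energetic => //; apply: elementary_smooth; exact: elementary_exp.
  exists (fun i => to_energy (eX i)) => a m0; apply: mass_exp_free.
  move: m0; set z := (X in mass (val X) _); have -> : val z =
      \sum_(i < m) a i *: classical (fun p : R * R => expR (i%:R * p.1 + 0 * p.2 + 0)).
    by rewrite /z raddf_sum; apply: eq_bigr => i _; exact: linearZ.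
  by [].
move=> E [e [e1 e2 e3 e4 e5]]; exists E, (fun i => val (e i)); split=> //.
- by move=> i; exact: energy_spaceP.
- by move=> i x ex; exact: (e2 i (to_energy ex)).
- by split=> // n x ex; exact: (e4 n (to_energy ex)).
Qed.

End real_spectrum.

Local Open Scope complex_scope.

(** * Complex functions as pairs of energetic triples *)

Definition re (T : Type) (R : realType) (u : T -> R[i]) : T -> R := fun x => complex.Re (u x).
Definition im (T : Type) (R : realType) (u : T -> R[i]) : T -> R := fun x => complex.Im (u x).

Lemma ReM (R : realType) (z w : R[i]) : complex.Re (z * w) = complex.Re z * complex.Re w - complex.Im z * complex.Im w.
Proof. by case: z => a b; case: w. Qed.

Lemma ImM (R : realType) (z w : R[i]) : complex.Im (z * w) = complex.Re z * complex.Im w + complex.Im z * complex.Re w.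
Proof. by case: z => a b; case: w. Qed.

Lemma ReB (R : realType) (z w : R[i]) : complex.Re (z - w) = complex.Re z - complex.Re w.
Proof. by case: z => a b; case: w. Qed.

Lemma ImB (R : realType) (z w : R[i]) : complex.Im (z - w) = complex.Im z - complex.Im w.
Proof. by case: z => a b; case: w. Qed.

Lemma complex_eqP (R : realType) (z w : R[i]) : complex.Re z = complex.Re w -> complex.Im z = complex.Im w -> z = w.
Proof. by case: z => a b; case: w => a' b' /= -> ->. Qed.

Lemma Re_sum (R : realType) m (F : 'I_m -> R[i]) : complex.Re (\sum_i F i) = \sum_i complex.Re (F i).
Proof. by elim/big_rec2: _ => // i y z _ <-; case: (F i) => a b; case: z. Qed.

Lemma Im_sum (R : realType) m (F : 'I_m -> R[i]) : complex.Im (\sum_i F i) = \sum_i complex.Im (F i).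
Proof. by elim/big_rec2: _ => // i y z _ <-; case: (F i) => a b; case: z. Qed.

Section complex_square_integrable.
Context d {T : measurableType d} {R : realType}.
Variables (mu : {measure set T -> \bar R}) (D : set T).
Hypothesis mD : measurable D.
Implicit Types f g : T -> R[i].

Let sqnormD f : measurable_fun D (re f) -> measurable_fun D (im f) ->
  sqnormL2 mu D f = (\int[mu]_(x in D) (re f x ^+ 2)%:E + \int[mu]_(x in D) (im f x ^+ 2)%:E)%E.
Proof.
move=> m1 m2; rewrite /sqnormL2 -ge0_integralD//.
- by move=> x _; rewrite lee_fin sqr_ge0.
- by apply/measurable_EFinP; exact: measurable_funX.
- by move=> x _; rewrite lee_fin sqr_ge0.
- by apply/measurable_EFinP; exact: measurable_funX.
Qed.

Lemma L2P f : L2 mu D f <-> sqint mu D (re f) /\ sqint mu D (im f).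
Proof.
have p0 (g : T -> R) : (0 <= \int[mu]_(x in D) (g x ^+ 2)%:E)%E.
  by apply: integral_ge0 => x _; rewrite lee_fin sqr_ge0.
split=> [[m1 m2]|[[m1 l1] [m2 l2]]].
  rewrite sqnormD// => h; split; split=> //.
  - by apply: le_lt_trans h; rewrite leeDl.
  - by apply: le_lt_trans h; rewrite leeDr.
by split=> //; rewrite sqnormD//; exact: lte_add_pinfty.
Qed.

Lemma sqnormL2E f : L2 mu D f -> sqnormL2 mu D f = (ip mu D (re f) (re f) + ip mu D (im f) (im f))%:E.
Proof.
by move=> /L2P[s1 s2]; rewrite sqnormD ?sqint_int//; [case: s1|case: s2].
Qed.

Lemma ipL2E f g : L2 mu D f -> L2 mu D g -> ipL2 mu D f g =
  (ip mu D (re f) (re g) + ip mu D (im f) (im g)) +i* (ip mu D (im f) (re g) - ip mu D (re f) (im g)).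
Proof.
move=> /L2P[f1 f2] /L2P[g1 g2].
have i s t (ss : sqint mu D s) (st : sqint mu D t) : mu.-integrable D (EFin \o (fun x => s x * t x)).
  exact: sqint_integrableM.
rewrite /ipL2 /cintegral /ip -(RintegralD mD (i _ _ f1 g1) (i _ _ f2 g2)).
rewrite -(RintegralB mD (i _ _ f2 g1) (i _ _ f1 g2)).
congr (_ +i* _); apply: eq_Rintegral => x _; rewrite /re /im.
  by rewrite ReM; case: (g x) => a b /=; rewrite mulrN opprK.
by rewrite ImM; case: (g x) => a b /=; rewrite mulrN addrC.
Qed.

Lemma L2B f g : L2 mu D f -> L2 mu D g -> L2 mu D (f \- g).
Proof.
move=> /L2P[f1 f2] /L2P[g1 g2]; apply/L2P.
rewrite (_ : re _ = re f - re g); last by apply/funext => x; exact: ReB.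
rewrite (_ : im _ = im f - im g); last by apply/funext => x; exact: ImB.
by split; exact: sqintB.
Qed.

End complex_square_integrable.

Section complex_energy.
Context {R : realType} {L : nat}.
Variables (c : R * R) (r theta : R).
Hypotheses (hL : (3 <= L)%N) (r_gt0 : 0 < r).
Local Notation v := (@vertex R L c r theta).
Local Notation Omega := (polygon v).
Local Notation bd := (arclength v).
Local Notation mass := (@mass R L c r theta).
Local Notation dirichlet := (@dirichlet R L c r theta).
Local Notation boundary := (@boundary R L c r theta).
Local Notation energetic := (@energetic R L c r theta).
Local Notation norm3 := (@norm3 R L c r theta).
Local Notation robin := (@robin R L c r theta).
Local Notation weak_grad := (@weak_grad R L c r theta).
Implicit Types (u w g t : mplane R -> R[i]).

Let mO : measurable (Omega : set (mplane R)). Proof. exact: measurable_polygon. Qed.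
Let mT : measurable (setT : set (mplane R)). Proof. exact: measurableT. Qed.
Let O_lty : (area Omega < +oo)%E. Proof. exact: area_polygon_lty. Qed.

Let si f : sqint area Omega f -> area.-integrable Omega (EFin \o f).
Proof. exact: sqint_integrable. Qed.

Let ae_mono (mu : {measure set (mplane R) -> \bar R}) (P Q : mplane R -> Prop) :
  (forall x, P x -> Q x) -> {ae mu, forall x, P x} -> {ae mu, forall x, Q x}.
Proof. by move=> PQ; apply: (@filterS _ _ (ae_filter_ringOfSetsType mu)). Qed.

Lemma weak_gradP u (g : bool -> mplane R -> R[i]) :
  (forall b, weak_partial Omega b u (g b)) <->
  (forall b, L2 area Omega (g b)) /\
  weak_grad (re u) (fun b => re (g b)) /\ weak_grad (im u) (fun b => im (g b)).
Proof.
have eC (f1 f2 : mplane R -> R) (z : mplane R -> R[i]) : (forall x, f2 x = re z x * f1 x) ->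
    \int[area]_(x in Omega) complex.Re (z x * (f1 x)%:C) = \int[area]_(x in Omega) f2 x.
  by move=> e; apply: eq_Rintegral => x _; rewrite ReM/= mulr0 subr0 e.
have eI (f1 f2 : mplane R -> R) (z : mplane R -> R[i]) : (forall x, f2 x = im z x * f1 x) ->
    \int[area]_(x in Omega) complex.Im (z x * (f1 x)%:C) = \int[area]_(x in Omega) f2 x.
  by move=> e; apply: eq_Rintegral => x _; rewrite ImM/= mulr0 add0r e.
split=> [h|[s [h1 h2]] b].
  split=> [b|]; first by case: (h b).
  split=> b f tf; have [_ /(_ f tf)] := h b; rewrite /cintegral => -[].
    by rewrite (eC _ (fun x => re u x * partial b f x))// (eC _ (fun x => re (g b) x * f x)).
  by rewrite (eI _ (fun x => im u x * partial b f x))// (eI _ (fun x => im (g b) x * f x)).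
split=> // f tf; apply: complex_eqP; rewrite /cintegral /=.
  by rewrite (eC _ (fun x => re u x * partial b f x))// (eC _ (fun x => re (g b) x * f x))//; exact: h1.
by rewrite (eI _ (fun x => im u x * partial b f x))// (eI _ (fun x => im (g b) x * f x))//; exact: h2.
Qed.

Lemma wpartialP u : H1 Omega u -> forall b, weak_partial Omega b u (wpartial Omega b u).
Proof. by move=> [_ h] b; have [g ug] := h b; exact: (xgetPex _ (ex_intro _ g ug)). Qed.

(** The triples of the real and imaginary parts, with the weak derivatives and
    the trace chosen by [wpartial] and [trace]. *)
Definition re_triple u t : triple (R := R) := (re u, fun b => re (wpartial Omega b u), re t).
Definition im_triple u t : triple (R := R) := (im u, fun b => im (wpartial Omega b u), im t).

(** Weak derivatives are determined up to a null set, so any choice of [wpartial]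
    agrees with the components of the triples. *)
Lemma wpartial_unique u (X Y : triple (R := R)) : energetic X -> energetic Y -> re u = X.1.1 -> im u = Y.1.1 ->
  H1 Omega u /\ forall b, {ae area, forall x, Omega x -> re (wpartial Omega b u) x = X.1.2 b x} /\
    {ae area, forall x, Omega x -> im (wpartial Omega b u) x = Y.1.2 b x}.
Proof.
move=> eX eY uX uY; have [[x1 x2 _] _] := eX; have [[y1 y2 _] _] := eY.
have uL2 : L2 area Omega u by apply/(L2P _ mO); rewrite uX uY.
pose g b : mplane R -> R[i] := fun x => X.1.2 b x +i* Y.1.2 b x.
have gL2 b : L2 area Omega (g b) by apply/(L2P _ mO); split; [exact: x2|exact: y2].
have wg : forall b, weak_partial Omega b u (g b).
  apply/weak_gradP; split=> //; rewrite uX uY; split; exact: energetic_weak_grad.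
have hu : H1 Omega u by split=> // b; exists (g b).
split=> // b; have /weak_gradP[wL2 [w1 w2]] := wpartialP hu; rewrite uX uY in w1 w2.
have ws b' : sqint area Omega (re (wpartial Omega b' u)) /\ sqint area Omega (im (wpartial Omega b' u)).
  exact: (L2P _ mO _).1 (wL2 b').
split.
  apply: (@weak_grad_unique R L c r theta hL r_gt0 _ _ _ _ (si x1) (si x1) (fun b => si (ws b).1) (fun b => si (x2 b)) w1 (energetic_weak_grad hL r_gt0 eX)).
  by apply: aeW.
apply: (@weak_grad_unique R L c r theta hL r_gt0 _ _ _ _ (si y1) (si y1) (fun b => si (ws b).2) (fun b => si (y2 b)) w2 (energetic_weak_grad hL r_gt0 eY)).
by apply: aeW.
Qed.

Lemma H1_energetic u : H1 Omega u -> exists X Y, [/\ energetic X, energetic Y, re u = X.1.1 & im u = Y.1.1].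
Proof.
move=> hu; have [/(L2P _ mO)[u1 u2] _] := hu.
have /weak_gradP[wL2 [w1 w2]] := wpartialP hu.
have [t1 e1] := weak_grad_energetic hL r_gt0 u1 (fun b => ((L2P _ mO _).1 (wL2 b)).1) w1.
have [t2 e2] := weak_grad_energetic hL r_gt0 u2 (fun b => ((L2P _ mO _).1 (wL2 b)).2) w2.
by eexists; eexists; split; [exact: e1|exact: e2| |].
Qed.

Let ipBC d (T : measurableType d) (mu : {measure set T -> \bar R}) D (f g : T -> R) :
  ip mu D (f - g) (f - g) = ip mu D (g - f) (g - f).
Proof. by apply: eq_Rintegral => x _; rewrite !fctE -mulrNN !opprB. Qed.

Let ipaeE (f f' : mplane R -> R) : sqint area Omega f -> sqint area Omega f' ->
  {ae area, forall x, Omega x -> f x = f' x} -> ip area Omega f f = ip area Omega f' f'.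
Proof. by move=> [mf _] [mf' _] ff'; exact: ip_ae. Qed.

Lemma sqnormH1E u (X Y : triple (R := R)) : energetic X -> energetic Y -> re u = X.1.1 -> im u = Y.1.1 ->
  sqnormH1 Omega u = (mass X X + mass Y Y + (dirichlet X X + dirichlet Y Y))%:E.
Proof.
have arith (a1 a2 a3 a4 a5 a6 : R) : a1 + a2 + (a3 + a4) + (a5 + a6) = a1 + a2 + (a3 + a5 + (a4 + a6)) by ring.
move=> eX eY uX uY; have [hu wXY] := wpartial_unique eX eY uX uY.
have [[x1 x2 _] _] := eX; have [[y1 y2 _] _] := eY.
have wL2 b : L2 area Omega (wpartial Omega b u) by case: (wpartialP hu b).
have ws b : sqint area Omega (re (wpartial Omega b u)) /\ sqint area Omega (im (wpartial Omega b u)).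
  exact: (L2P _ mO _).1 (wL2 b).
have wE b : sqnormL2 area Omega (wpartial Omega b u) =
    (ip area Omega (X.1.2 b) (X.1.2 b) + ip area Omega (Y.1.2 b) (Y.1.2 b))%:E.
  rewrite sqnormL2E//; congr (_ + _)%:E; apply: ipaeE => //; [exact: (ws b).1|exact: (wXY b).1|exact: (ws b).2|exact: (wXY b).2].
have uE : sqnormL2 area Omega u = (mass X X + mass Y Y)%:E.
  by rewrite sqnormL2E// ?uX ?uY//; apply/(L2P _ mO); rewrite uX uY.
exact: (eq_trans (f_equal2 adde (f_equal2 adde uE (wE true)) (wE false)) (congr1 EFin (arith _ _ _ _ _ _))).
Qed.

Lemma energeticB (X Y : triple (R := R)) : energetic X -> energetic Y -> energetic (X - Y).
Proof. by move=> eX eY; rewrite addrC -scaleN1r; exact: energeticP. Qed.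

(** The two norms in the definition of a trace dominate the norm of the energy
    space. *)
Lemma is_trace_energetic u t : H1 Omega u -> is_trace v u t -> energetic (re_triple u t) /\ energetic (im_triple u t).
Proof.
have arith e (a1 a2 a3 a4 a5 a6 a7 a8 : R) : 0 <= a1 -> 0 <= a2 -> 0 <= a3 -> 0 <= a4 -> 0 <= a5 -> 0 <= a6 ->
    0 <= a7 -> 0 <= a8 -> a7 + a8 <= e / 2 -> a1 + a2 + (a3 + a4 + (a5 + a6)) <= e / 2 ->
    a1 + (a3 + a4) + a7 <= e /\ a2 + (a5 + a6) + a8 <= e.
  by move=> *; split; lra.
move=> hu [/(L2P _ mT)[t1 t2] [phi [sphi phiu phit]]].
have [X [Y [eX eY uX uY]]] := H1_energetic hu.
have [_ wXY] := wpartial_unique eX eY uX uY.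
have [[x1 x2 _] _] := eX; have [[y1 y2 _] _] := eY.
have ws b : sqint area Omega (re (wpartial Omega b u)) /\ sqint area Omega (im (wpartial Omega b u)).
  by apply/(L2P _ mO); case: (wpartialP hu b).
have eC n : energetic (classical (re (phi n))) by apply: classical_energetic => //; exact: (sphi n).1.
have eD n : energetic (classical (im (phi n))) by apply: classical_energetic => //; exact: (sphi n).2.
have eCX n := energeticB (eC n) eX.
have eDY n := energeticB (eD n) eY.
have nE n : sqnormH1 Omega (phi n \- u) = (mass (classical (re (phi n)) - X) (classical (re (phi n)) - X) +
    mass (classical (im (phi n)) - Y) (classical (im (phi n)) - Y) +
    (dirichlet (classical (re (phi n)) - X) (classical (re (phi n)) - X) +
    dirichlet (classical (im (phi n)) - Y) (classical (im (phi n)) - Y)))%:E.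
  have eR : re (phi n \- u) = (classical (re (phi n)) - X).1.1.
    by apply/funext => x; rewrite /re ReB [RHS]/= fctE -uX.
  have eI : im (phi n \- u) = (classical (im (phi n)) - Y).1.1.
    by apply/funext => x; rewrite /im ImB [RHS]/= fctE -uY.
  exact: (sqnormH1E (eCX n) (eDY n) eR eI).
have sb f : smooth f -> sqint bd setT f by move=> /smooth_C1[cf _ _]; exact: sqint_boundary.
have tE n : sqnormL2 bd setT (phi n \- t) = (ip bd setT (re (phi n) - re t) (re (phi n) - re t) +
    ip bd setT (im (phi n) - im t) (im (phi n) - im t))%:E.
  rewrite sqnormL2E//; last first.
    by apply: L2B => //; apply/(L2P _ mT); split=> //; apply: sb; [exact: (sphi n).1|exact: (sphi n).2].
  by congr (_ + _)%:E; apply: eq_Rintegral => x _; rewrite /re /im ?ReB ?ImB.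
have lim (s : nat -> \bar R) (s' : nat -> R) : (forall n, s n = (s' n)%:E) -> s n @[n --> \oo] --> 0%E ->
    forall e, 0 < e -> exists N, forall n, (N <= n)%N -> s' n <= e.
  move=> ss' /fine_cvgP[_ /cvgrPdist_le h] e /h[N _ NP]; exists N => n Nn.
  by have := NP n Nn; rewrite /= ss' sub0r normrN; apply: le_trans; exact: ler_norm.
have close e : 0 < e -> exists n, norm3 (re_triple u t - classical (re (phi n))) <= e /\
    norm3 (im_triple u t - classical (im (phi n))) <= e.
  move=> e0; have e2 : 0 < e / 2 by rewrite divr_gt0.
  have [N1 P1] := lim _ _ nE phiu _ e2; have [N2 P2] := lim _ _ tE phit _ e2.
  pose n := maxn N1 N2; exists n.
  have := P1 n (leq_maxl _ _); have := P2 n (leq_maxr _ _).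
  have [E1 E2] : (forall b, ip area Omega (re (wpartial Omega b u) - partial b (re (phi n))) (re (wpartial Omega b u) - partial b (re (phi n))) =
      ip area Omega (partial b (re (phi n)) - X.1.2 b) (partial b (re (phi n)) - X.1.2 b)) /\
     (forall b, ip area Omega (im (wpartial Omega b u) - partial b (im (phi n))) (im (wpartial Omega b u) - partial b (im (phi n))) =
      ip area Omega (partial b (im (phi n)) - Y.1.2 b) (partial b (im (phi n)) - Y.1.2 b)).
    have [[_ s1 _] _] := eC n; have [[_ s2 _] _] := eD n.
    split=> b; rewrite [RHS]ipBC; apply: ipaeE.
    - by apply: sqintB => //; [exact: (ws b).1|exact: (s1 b)].
    - by apply: sqintB => //; exact: (s1 b).
    - by apply: ae_mono (wXY b).1 => x h /h hx; rewrite !fctE hx.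
    - by apply: sqintB => //; [exact: (ws b).2|exact: (s2 b)].
    - by apply: sqintB => //; exact: (s2 b).
    - by apply: ae_mono (wXY b).2 => x h /h hx; rewrite !fctE hx.
  rewrite /norm3 /mass /dirichlet /boundary /= !E1 !E2.
  rewrite (ipBC _ _ (re u)) (ipBC _ _ (im u)) (ipBC _ _ (re t)) (ipBC _ _ (im t)) uX uY.
  by apply: arith; exact: ip_ge0.
split; split.
- by split=> //; [rewrite /= uX|move=> b; exact: (ws b).1].
- by move=> e /close[n [h _]]; exists (re (phi n)); [exact: (sphi n).1|].
- by split=> //; [rewrite /= uY|move=> b; exact: (ws b).2].
- by move=> e /close[n [_ h]]; exists (im (phi n)); [exact: (sphi n).2|].
Qed.

End complex_energy.

(** * The Robin form on real and imaginary parts *)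

Section robin_form.
Context {R : realType} {L : nat}.
Variables (c : R * R) (r theta : R).
Hypotheses (hL : (3 <= L)%N) (r_gt0 : 0 < r).
Local Notation v := (@vertex R L c r theta).
Local Notation Omega := (polygon v).
Local Notation bd := (arclength v).
Local Notation mass := (@mass R L c r theta).
Local Notation dirichlet := (@dirichlet R L c r theta).
Local Notation boundary := (@boundary R L c r theta).
Local Notation energetic := (@energetic R L c r theta).
Local Notation robin := (@robin R L c r theta).
Local Notation re_triple := (@re_triple R L c r theta).
Local Notation im_triple := (@im_triple R L c r theta).
Implicit Types (u w g t : mplane R -> R[i]) (X Y Z : triple (R := R)) (gam lam : R).

Let mO : measurable (Omega : set (mplane R)). Proof. exact: measurable_polygon. Qed.
Let mT : measurable (setT : set (mplane R)). Proof. exact: measurableT. Qed.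

Let ae_mono (mu : {measure set (mplane R) -> \bar R}) (P Q : mplane R -> Prop) :
  (forall x, P x -> Q x) -> {ae mu, forall x, P x} -> {ae mu, forall x, Q x}.
Proof. by move=> PQ; apply: (@filterS _ _ (ae_filter_ringOfSetsType mu)). Qed.

Lemma H1_trace u : H1 Omega u -> exists t, is_trace v u t.
Proof.
move=> hu; have [X [Y [eX eY uX uY]]] := H1_energetic hL r_gt0 hu.
have [[x1 x2 x3] _] := eX; have [[y1 y2 y3] _] := eY.
have [phi [sphi p1 p2 p3]] := energetic_seq eX.
have [psi [spsi q1 q2 q3]] := energetic_seq eY.
pose t : mplane R -> R[i] := fun x => X.2 x +i* Y.2 x.
pose f n : mplane R -> R[i] := fun x => phi n x +i* psi n x.
have ipBC d (T : measurableType d) (mu : {measure set T -> \bar R}) D (f1 f2 : T -> R) :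
    ip mu D (f1 - f2) (f1 - f2) = ip mu D (f2 - f1) (f2 - f1).
  by apply: eq_Rintegral => x _; rewrite !fctE -mulrNN !opprB.
have eC n : energetic (classical (phi n)) by apply: classical_energetic.
have eD n : energetic (classical (psi n)) by apply: classical_energetic.
have tL2 : L2 bd setT t by apply/(L2P _ mT).
exists t; split=> //; exists f; split.
- by move=> n; split; [exact: sphi|exact: spsi].
- have nE n : sqnormH1 Omega (f n \- u) = (mass (classical (phi n) - X) (classical (phi n) - X) +
      mass (classical (psi n) - Y) (classical (psi n) - Y) +
      (dirichlet (classical (phi n) - X) (classical (phi n) - X) +
      dirichlet (classical (psi n) - Y) (classical (psi n) - Y)))%:E.
    have eR : re (f n \- u) = (classical (phi n) - X).1.1.
      by apply/funext => x; rewrite /re ReB [RHS]/= fctE -uX.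
    have eI : im (f n \- u) = (classical (psi n) - Y).1.1.
      by apply/funext => x; rewrite /im ImB [RHS]/= fctE -uY.
    have := sqnormH1E hL r_gt0 (energeticB hL r_gt0 (eC n) eX) (energeticB hL r_gt0 (eD n) eY) eR eI.
    by move=> ->.
  under eq_fun do rewrite nE.
  apply: cvg_EFin; first by near=> n.
  rewrite [X in _ --> X](_ : _ = 0 + 0 + (0 + 0 + (0 + 0))); last by rewrite !addr0.
  have flip (g : mplane R -> R) (s : nat -> mplane R -> R) : ip area Omega (g - s n) (g - s n) @[n --> \oo] --> (0 : R) ->
      ip area Omega (s n - g) (s n - g) @[n --> \oo] --> (0 : R).
    by under eq_fun do rewrite ipBC.
  apply: cvgD; first by apply: cvgD; [exact: (flip _ _ p1)|exact: (flip _ _ q1)].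
  apply: cvgD; apply: cvgD.
  - exact: (flip _ _ (p2 true)).
  - exact: (flip _ _ (p2 false)).
  - exact: (flip _ _ (q2 true)).
  - exact: (flip _ _ (q2 false)).
- have tE n : sqnormL2 bd setT (f n \- t) = (ip bd setT (X.2 - phi n) (X.2 - phi n) +
      ip bd setT (Y.2 - psi n) (Y.2 - psi n))%:E.
    rewrite sqnormL2E//; last first.
      by apply: L2B => //; apply/(L2P _ mT); have [[_ _ h1] _] := eC n; have [[_ _ h2] _] := eD n.
    rewrite ipBC (ipBC _ _ _ _ Y.2); congr (_ + _)%:E; apply: eq_Rintegral => x _; rewrite /re /im ?ReB ?ImB//.
  under eq_fun do rewrite tE.
  apply: cvg_EFin; first by near=> n.
  rewrite [X in _ --> X](_ : _ = 0 + 0); last by rewrite !addr0.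
  exact: cvgD.
Unshelve. all: by end_near. Qed.

Lemma trace_energetic u : H1 Omega u -> energetic (re_triple u (trace v u)) /\ energetic (im_triple u (trace v u)).
Proof.
move=> hu; have [t tP] := H1_trace hu; apply: is_trace_energetic => //.
exact: (xgetPex _ (ex_intro _ t tP)).
Qed.

Lemma robin_formE gam u w : H1 Omega u -> H1 Omega w ->
  let U1 := re_triple u (trace v u) in let U2 := im_triple u (trace v u) in
  let W1 := re_triple w (trace v w) in let W2 := im_triple w (trace v w) in
  robin_form v gam u w = (robin gam U1 W1 + robin gam U2 W2) +i* (robin gam U2 W1 - robin gam U1 W2).
Proof.
move=> hu hw U1 U2 W1 W2.
have [[[u1 u1' u1''] _] [[u2 u2' u2''] _]] := trace_energetic hu.
have [[[w1 w1' w1''] _] [[w2 w2' w2''] _]] := trace_energetic hw.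
have tu : L2 bd setT (trace v u) := (L2P _ mT _).2 (conj u1'' u2'').
have tw : L2 bd setT (trace v w) := (L2P _ mT _).2 (conj w1'' w2'').
have du b : L2 area Omega (wpartial Omega b u) := (L2P _ mO _).2 (conj (u1' b) (u2' b)).
have dw b : L2 area Omega (wpartial Omega b w) := (L2P _ mO _).2 (conj (w1' b) (w2' b)).
have e1 := ipL2E mO (du true) (dw true); have e2 := ipL2E mO (du false) (dw false); have e3 := ipL2E mT tu tw.
rewrite /robin_form big_bool.
apply: (etrans (f_equal2 (fun z1 z2 => z1 - gam%:C * z2) (f_equal2 +%R e1 e2) e3)).
have cx (a1 a2 a3 a4 a5 a6 b1 b2 b3 b4 b5 b6 : R) :
    (a1 + a2) +i* (b1 - b2) + (a3 + a4) +i* (b3 - b4) - gam%:C * ((a5 + a6) +i* (b5 - b6)) =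
    (a1 + a3 - gam * a5 + (a2 + a4 - gam * a6)) +i* (b1 + b3 - gam * b5 - (b2 + b4 - gam * b6)).
  by apply: complex_eqP; rewrite /=; ring.
exact: cx.
Qed.

Lemma ip0l d (T : measurableType d) (mu : {measure set T -> \bar R}) D (f : T -> R) : ip mu D 0 f = 0.
Proof. by rewrite /ip /Rintegral integral0_eq// => x _; rewrite mul0r. Qed.

Lemma robin0r gam X : robin gam X 0 = 0.
Proof. by rewrite /robin dirichletC boundaryC /dirichlet /boundary !ip0l !addr0 mulr0 subr0. Qed.

(** The function component determines the others up to null sets. *)
Lemma robin_ext gam Z X X' : energetic Z -> energetic X -> energetic X' ->
  {ae area, forall x, Omega x -> X.1.1 x = X'.1.1 x} -> robin gam Z X = robin gam Z X'.
Proof.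
move=> eZ eX eX' XX'; have [h1 h2] := energetic_unique hL r_gt0 eX eX' XX'.
have [[z1 z2 z3] _] := eZ; have [[x1 x2 x3] _] := eX; have [[y1 y2 y3] _] := eX'.
have m d (T : measurableType d) (mu : {measure set T -> \bar R}) D f : sqint mu D f -> measurable_fun D f by case.
have zr d (T : measurableType d) (mu : {measure set T -> \bar R}) D (f : T -> R) : {ae mu, forall x, D x -> f x = f x}.
  by apply: aeW.
rewrite /robin /dirichlet /boundary; congr (_ + _ - _ * _).
- exact: (ip_ae mO (m _ _ _ _ _ (z2 true)) (m _ _ _ _ _ (z2 true)) (m _ _ _ _ _ (x2 true)) (m _ _ _ _ _ (y2 true)) (zr _ _ _ _ _) (h1 true)).
- exact: (ip_ae mO (m _ _ _ _ _ (z2 false)) (m _ _ _ _ _ (z2 false)) (m _ _ _ _ _ (x2 false)) (m _ _ _ _ _ (y2 false)) (zr _ _ _ _ _) (h1 false)).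
- exact: (ip_ae mT (m _ _ _ _ _ z3) (m _ _ _ _ _ z3) (m _ _ _ _ _ x3) (m _ _ _ _ _ y3) (zr _ _ _ _ _) h2).
Qed.

Definition eigenvector gam lam X : Prop :=
  energetic X /\ forall Z, energetic Z -> robin gam X Z = lam * mass X Z.

Lemma robin_lin gam a X Y Z : energetic X -> energetic Y -> energetic Z ->
  robin gam (a *: X + Y) Z = a * robin gam X Z + robin gam Y Z.
Proof.
move=> [sX _] [sY _] [sZ _]; rewrite /robin dirichlet_lin// boundary_lin//; ring.
Qed.

Lemma robinC gam X Y : robin gam X Y = robin gam Y X.
Proof. by rewrite /robin dirichletC boundaryC. Qed.

(** Testing with real functions separates the real and imaginary parts of the
    eigenvalue equation. *)
Lemma eigenspaceP gam lam u : robin_eigenspace v gam lam u <->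
  [/\ H1 Omega u, eigenvector gam lam (re_triple u (trace v u)) & eigenvector gam lam (im_triple u (trace v u))].
Proof.
have L2u w : H1 Omega w -> L2 area Omega w by case.
have lu w : H1 Omega w -> L2 area Omega (fun x => lam%:C * w x) /\
    forall w', H1 Omega w' -> ipL2 area Omega (fun x => lam%:C * w x) w' =
      (lam * (ip area Omega (re w) (re w') + ip area Omega (im w) (im w'))) +i*
      (lam * (ip area Omega (im w) (re w') - ip area Omega (re w) (im w'))).
  move=> hw; have /(L2P _ mO)[s1 s2] := L2u w hw.
  have eR : re (fun x => lam%:C * w x) = lam *: re w.
    by apply/funext => x; rewrite /re ReM/= mul0r subr0.
  have eI : im (fun x => lam%:C * w x) = lam *: im w.
    by apply/funext => x; rewrite /im ImM/= mul0r addr0.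
  have l2 : L2 area Omega (fun x => lam%:C * w x).
    by apply/(L2P _ mO); rewrite eR eI; split; exact: sqintZ.
  split=> // w' hw'; have /(L2P _ mO)[t1 t2] := L2u w' hw'.
  by rewrite (ipL2E mO l2 (L2u w' hw')) eR eI !ipZ// mulrDr mulrBr.
split=> [[hu _ uw]|[hu [e1 h1] [e2 h2]]].
  have [e1 e2] := trace_energetic hu.
  have test X : energetic X -> exists w, [/\ H1 Omega w, re w = X.1.1 & im w = 0].
    move=> eX; pose w : mplane R -> R[i] := fun x => (X.1.1 x)%:C; exists w.
    have [] // := wpartial_unique hL r_gt0 (u := w) eX (energetic0 c theta hL r_gt0).
  have key X : energetic X -> robin gam (re_triple u (trace v u)) X = lam * mass (re_triple u (trace v u)) X /\
     robin gam (im_triple u (trace v u)) X = lam * mass (im_triple u (trace v u)) X.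
    move=> eX; have [w [hw w1 w2]] := test X eX; have := uw w hw.
    have [f1 f2] := trace_energetic hw.
    rewrite (robin_formE gam hu hw) ((lu _ hu).2 _ hw) w1 w2 => -[].
    have z0 U : energetic U -> robin gam U (im_triple w (trace v w)) = 0.
      move=> eU; rewrite (robin_ext gam eU f2 (energetic0 c theta hL r_gt0)) ?robin0r//.
      by apply: aeW => x _; rewrite /= w2.
    have x1 U : energetic U -> robin gam U (re_triple w (trace v w)) = robin gam U X.
      by move=> eU; apply: robin_ext => //; apply: aeW => x _; rewrite /= w1.
    by rewrite !z0// !x1// !addr0 !subr0 !(ipC _ _ _ 0) !ip0l !addr0 !subr0.
  by split=> //; split=> // X eX; [exact: (key X eX).1|exact: (key X eX).2].
split=> //; first exact: (lu _ hu).1.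
move=> w hw; rewrite (robin_formE gam hu hw) ((lu _ hu).2 _ hw).
have [f1 f2] := trace_energetic hw.
by rewrite !h1// !h2// -mulrDr -mulrBr.
Qed.

End robin_form.

(** * Eigenspaces and the list of eigenvalues *)

Section eigenspaces.
Context {R : realType} {L : nat}.
Variables (c : R * R) (r theta : R).
Hypotheses (hL : (3 <= L)%N) (r_gt0 : 0 < r).
Local Notation v := (@vertex R L c r theta).
Local Notation Omega := (polygon v).
Local Notation mass := (@mass R L c r theta).
Local Notation energetic := (@energetic R L c r theta).
Local Notation robin := (@robin R L c r theta).
Local Notation eigenvector := (@eigenvector R L c r theta).
Implicit Types (u w g t : mplane R -> R[i]) (X Y Z : triple (R := R)) (gam lam : R).

Let mO : measurable (Omega : set (mplane R)). Proof. exact: measurable_polygon. Qed.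

Let ae_mono (mu : {measure set (mplane R) -> \bar R}) (P Q : mplane R -> Prop) :
  (forall x, P x -> Q x) -> {ae mu, forall x, P x} -> {ae mu, forall x, Q x}.
Proof. by move=> PQ; apply: (@filterS _ _ (ae_filter_ringOfSetsType mu)). Qed.

Let mass_linE a X Y Z : energetic X -> energetic Y -> energetic Z ->
  mass (a *: X + Y) Z = a * mass X Z + mass Y Z.
Proof. by move=> [sX _] [sY _] [sZ _]; exact: mass_lin. Qed.

Lemma eigenvectorP gam lam a X Y : eigenvector gam lam X -> eigenvector gam lam Y -> eigenvector gam lam (a *: X + Y).
Proof.
move=> [eX hX] [eY hY]; split; first exact: energeticP.
by move=> Z eZ; rewrite robin_lin// hX// hY// mass_linE//; ring.
Qed.

Lemma eigenvector0 gam lam : eigenvector gam lam 0.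
Proof.
split; first exact: energetic0.
by move=> Z _; rewrite robinC robin0r /mass ip0l mulr0.
Qed.

Lemma eigenvector_sum gam lam m (a : 'I_m -> R) (X : 'I_m -> triple (R := R)) :
  (forall i, eigenvector gam lam (X i)) -> eigenvector gam lam (\sum_(i < m) a i *: X i).
Proof.
move=> h; elim/big_ind: _ => [|Y Z hY hZ|i _]; first exact: eigenvector0.
  by rewrite -[Y]scale1r; exact: eigenvectorP.
by rewrite -[_ *: _]addr0; apply: eigenvectorP => //; exact: eigenvector0.
Qed.

Lemma energetic_sum m (a : 'I_m -> R) (X : 'I_m -> triple (R := R)) :
  (forall i, energetic (X i)) -> energetic (\sum_(i < m) a i *: X i).
Proof.
move=> h; elim/big_ind: _ => [|Y Z hY hZ|i _]; first exact: energetic0.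
  by rewrite -[Y]scale1r; exact: energeticP.
by rewrite -[_ *: _]addr0; apply: energeticP => //; exact: energetic0.
Qed.

Lemma form_sum (B : triple (R := R) -> triple (R := R) -> R) m (a : 'I_m -> R) (X : 'I_m -> triple (R := R)) Z :
  (forall a X Y Z, energetic X -> energetic Y -> energetic Z -> B (a *: X + Y) Z = a * B X Z + B Y Z) ->
  (forall i, energetic (X i)) -> energetic Z -> B (\sum_(i < m) a i *: X i) Z = \sum_(i < m) a i * B (X i) Z.
Proof.
move=> BL eX eZ; have e0 := energetic0 c theta hL r_gt0.
have B0 : B 0 Z = 0.
  by have := BL 1 0 0 Z e0 e0 eZ; rewrite scaler0 addr0 mul1r -[LHS]addr0 => /addrI <-.
suff h (s : seq 'I_m) : energetic (\sum_(i <- s) a i *: X i) /\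
    B (\sum_(i <- s) a i *: X i) Z = \sum_(i <- s) a i * B (X i) Z by case: (h (index_enum _)).
elim: s => [|i s [IH1 IH2]]; first by rewrite !big_nil; split=> //; exact: energetic0.
rewrite !big_cons; split; first exact: energeticP.
by rewrite (BL (a i) _ _ _ (eX i) IH1 eZ) IH2.
Qed.

Lemma mass_sum m (a : 'I_m -> R) (X : 'I_m -> triple (R := R)) Z : (forall i, energetic (X i)) -> energetic Z ->
  mass (\sum_(i < m) a i *: X i) Z = \sum_(i < m) a i * mass (X i) Z.
Proof. exact: form_sum mass_linE. Qed.

Lemma mass_vanish X Z : energetic X -> energetic Z -> {ae area, forall x, Omega x -> X.1.1 x = 0} -> mass X Z = 0.
Proof.
move=> [[[mX _] _ _] _] [[[mZ _] _ _] _] X0.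
have -> : mass X Z = ip area Omega 0 Z.1.1.
  have m0 : measurable_fun Omega (0 : mplane R -> R) by exact: measurable_cst.
  have zr : {ae area, forall x, Omega x -> Z.1.1 x = Z.1.1 x} by apply: aeW.
  exact: (ip_ae mO mX m0 mZ mZ X0 zr).
exact: ip0l.
Qed.

Lemma eigenvector_ext gam lam X X' : eigenvector gam lam X -> energetic X' -> X'.1.1 = X.1.1 -> eigenvector gam lam X'.
Proof.
move=> [eX hX] eX' XX'; split=> // Z eZ.
have ae : {ae area, forall x, Omega x -> X'.1.1 x = X.1.1 x} by apply: aeW => x _; rewrite XX'.
have e1 := robin_ext hL r_gt0 gam eZ eX' eX ae.
by rewrite robinC e1 robinC hX// /mass XX'.
Qed.

Lemma eigenspace_of gam lam X Y : eigenvector gam lam X -> eigenvector gam lam Y ->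
  robin_eigenspace v gam lam (fun x => X.1.1 x +i* Y.1.1 x).
Proof.
move=> hX hY; have [eX _] := hX; have [eY _] := hY.
set u := (X in robin_eigenspace _ _ _ X).
have [hu _] := wpartial_unique hL r_gt0 (u := u) eX eY erefl erefl.
have [e1 e2] := trace_energetic hL r_gt0 hu.
by apply/eigenspaceP => //; split=> //; [exact: (eigenvector_ext hX)|exact: (eigenvector_ext hY)].
Qed.

Section spectrum_listing.
Variables (gam : R) (E : nat -> R) (e : nat -> triple (R := R)).
Hypotheses (e_energetic : forall i, energetic (e i))
  (e_ortho : forall i j, mass (e i) (e j) = (i == j)%:R)
  (e_eigen : forall i x, energetic x -> robin gam (e i) x = E i * mass (e i) x)
  (E_homo : {homo E : m n / (m <= n)%N >-> m <= n})
  (E_min : forall n x, energetic x -> (forall i, (i < n)%N -> mass x (e i) = 0) -> E n * mass x x <= robin gam x x)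
  (E_unbounded : forall M, exists n, M < E n).

Lemma eigenvector_basis i : eigenvector gam (E i) (e i).
Proof. by split=> // Z eZ; exact: e_eigen. Qed.

(** Symmetry makes [X] orthogonal to the eigenvectors of the other eigenvalues, so
    the minimum principle holds beyond [lam] and forces the mass to vanish. *)
Lemma eigenvector_vanish lam X : eigenvector gam lam X -> (forall n, E n = lam -> mass X (e n) = 0) ->
  {ae area, forall x, Omega x -> X.1.1 x = 0}.
Proof.
move=> [eX hX] X0; have [n lamn] := E_unbounded lam.
have /E_min : forall i, (i < n)%N -> mass X (e i) = 0.
  move=> i _; have [/X0//|Elam] := eqVneq (E i) lam.
  have := hX _ (e_energetic i); rewrite robinC e_eigen// (massC _ _ _ X).
  move=> /eqP; rewrite -subr_eq0 -mulrBl mulf_eq0 subr_eq0 (negbTE Elam)/= => /eqP ->//.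
move=> /(_ eX); rewrite hX// -subr_ge0 -mulrBl => h.
have [[x1 _ _] _] := eX; apply: (ip_eq0 mO x1); apply/eqP; rewrite eq_le [X in _ && X]ip_ge0 andbT.
by move: h; rewrite nmulr_rge0// subr_lt0.
Qed.

(** Finitely many members of the list equal [lam]. If there were more free
    eigenfunctions than that, a nontrivial combination would be orthogonal to
    the corresponding [e n], and so would vanish. *)
Lemma eigenspace_dim lam m : dim_ge area Omega (robin_eigenspace v gam lam) m <->
  exists s : seq nat, [/\ uniq s, size s = m & forall n, n \in s -> E n = lam].
Proof.
split=> [[u [uV ufree]]|[s [us sm sE]]].
  have [N lamN] := E_unbounded lam.
  (* as [E] is nondecreasing and [lam < E N], all indices of [lam] are in [J] *)
  pose J := [seq n <- iota 0 N | E n == lam].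
  have [mJ|Jm] := leqP m (size J).
    exists (take m J); split.
    - by apply: take_uniq; apply: filter_uniq; exact: iota_uniq.
    - exact: size_takel.
    - by move=> n /mem_take; rewrite mem_filter => /andP[/eqP].
  pose U1 i := re_triple c r theta (L := L) (u i) (trace v (u i)).
  pose U2 i := im_triple c r theta (L := L) (u i) (trace v (u i)).
  have hU i : eigenvector gam lam (U1 i) /\ eigenvector gam lam (U2 i).
    by have /eigenspaceP := uV i => /(_ hL r_gt0)[].
  have [a [j aj] aO] := @ex_kernel _ (size J) m (fun j i => mass (U1 j) (e (nth 0%N J i)) +i* mass (U2 j) (e (nth 0%N J i))) Jm.
  exfalso; move/eqP: aj; apply; apply: ufree.
  have eU1 i := (hU i).1.1; have eU2 i := (hU i).2.1.
  pose Z1 := \sum_(i < m) complex.Re (a i) *: U1 i + \sum_(i < m) (- complex.Im (a i)) *: U2 i.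
  pose Z2 := \sum_(i < m) complex.Re (a i) *: U2 i + \sum_(i < m) complex.Im (a i) *: U1 i.
  have hS (b : 'I_m -> R) (W : 'I_m -> triple (R := R)) := @eigenvector_sum gam lam m b W.
  have hZ1 : eigenvector gam lam Z1.
    rewrite /Z1 -[X in X + _]scale1r; apply: eigenvectorP; apply: hS => i; [exact: (hU i).1|exact: (hU i).2].
  have hZ2 : eigenvector gam lam Z2.
    rewrite /Z2 -[X in X + _]scale1r; apply: eigenvectorP; apply: hS => i; [exact: (hU i).2|exact: (hU i).1].
  have mZ n : E n = lam -> mass Z1 (e n) = 0 /\ mass Z2 (e n) = 0.
    move=> En.
    have nJ : n \in J.
      rewrite mem_filter En eqxx mem_iota /= add0n ltnNge; apply/negP => Nn.
      by have := E_homo Nn; rewrite En leNgt lamN.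
    have := aO (Ordinal (etrans (index_mem n J) nJ)); rewrite /= nth_index//.
    move=> a0; have := congr1 (@complex.Re R) a0; have := congr1 (@complex.Im R) a0.
    rewrite Re_sum Im_sum /= => a2 a1.
    rewrite /Z1 /Z2 -[X in mass (X + _) _ = 0 /\ _]scale1r -[X in _ /\ mass (X + _) _ = 0]scale1r.
    have es b W : (forall i, energetic (W i)) -> energetic (\sum_(i < m) b i *: W i) by exact: energetic_sum.
    rewrite !mass_linE//; [|exact: es..]; rewrite !mass_sum// !mul1r -!big_split/=; split.
      by rewrite -[RHS]a1; apply: eq_bigr => i _; rewrite ReM/= mulNr.
    by rewrite -[RHS]a2; apply: eq_bigr => i _; rewrite ImM.
  have Z10 := eigenvector_vanish hZ1 (fun n En => (mZ n En).1).
  have Z20 := eigenvector_vanish hZ2 (fun n En => (mZ n En).2).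
  have Z1E x : Z1.1.1 x = complex.Re (\sum_(i < m) a i * u i x).
    have addE (A B : triple (R := R)) : (A + B).1.1 x = A.1.1 x + B.1.1 x by [].
    rewrite /Z1 addE !triple_sum_fun -big_split/= Re_sum.
    by apply: eq_bigr => i _; rewrite ReM mulNr.
  have Z2E x : Z2.1.1 x = complex.Im (\sum_(i < m) a i * u i x).
    have addE (A B : triple (R := R)) : (A + B).1.1 x = A.1.1 x + B.1.1 x by [].
    rewrite /Z2 addE !triple_sum_fun -big_split/= Im_sum.
    by apply: eq_bigr => i _; rewrite ImM.
  move: Z10 Z20; apply: (@filterS2 _ _ (ae_filter_ringOfSetsType area)) => x z1 z2 Ox.
  by apply: complex_eqP; rewrite -?Z1E -?Z2E; [exact: z1|exact: z2].
pose X (i : 'I_m) := e (nth 0%N s i).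
have XE (i : 'I_m) : E (nth 0%N s i) = lam by apply: sE; rewrite mem_nth// sm.
have hX (i : 'I_m) : eigenvector gam lam (X i) by rewrite -(XE i); exact: eigenvector_basis.
exists (fun i x => (X i).1.1 x +i* (0 : triple (R := R)).1.1 x); split=> [i|a a0].
  by apply: eigenspace_of => //; exact: eigenvector0.
have key (b : 'I_m -> R) : {ae area, forall x, Omega x -> \sum_(i < m) b i * (X i).1.1 x = 0} -> forall i, b i = 0.
  move=> b0 i; have eX j : energetic (X j) by exact: e_energetic.
  have := mass_vanish (energetic_sum b eX) (eX i); rewrite triple_sum_fun mass_sum// => /(_ b0) <-.
  rewrite (bigD1 i)//= e_ortho eqxx mulr1 big1 ?addr0// => j ji.
  by rewrite e_ortho nth_uniq ?sm// (inj_eq val_inj) (negbTE ji) mulr0.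
move=> i; apply: complex_eqP; apply: (key (fun i => _ (a i))).
  apply: ae_mono a0 => x h /h /(congr1 (@complex.Re R)); rewrite Re_sum => e1; rewrite -[RHS]e1.
  by apply: eq_bigr => j _; rewrite ReM/= mulr0 subr0.
apply: ae_mono a0 => x h /h /(congr1 (@complex.Im R)); rewrite Im_sum => e1; rewrite -[RHS]e1.
by apply: eq_bigr => j _; rewrite ImM/= mulr0 add0r.
Qed.

Lemma robin_spectrumP : robin_spectrum v gam E.
Proof. by split; [exact: E_homo|exact: eigenspace_dim]. Qed.

(** Multiplicities determine a nondecreasing list: at the first index where two
    lists differ, the smaller value occurs more often in one of them. *)
Lemma robin_eigenvalueE n : robin_eigenvalue v gam n = E n.-1.
Proof.
rewrite /robin_eigenvalue; suff -> : xget (fun=> 0) [set E' | robin_spectrum v gam E'] = E by [].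
have [hF dF] := @xgetPex _ (fun=> 0) [set E' | robin_spectrum v gam E'] (ex_intro _ E robin_spectrumP).
move: hF dF; set F := xget _ _ => hF dF.
have half (G H : nat -> R) : {homo H : m n / (m <= n)%N >-> m <= n} ->
    (forall lam (m : nat), (exists s : seq nat, [/\ uniq s, size s = m & forall n, n \in s -> G n = lam]) ->
     exists s : seq nat, [/\ uniq s, size s = m & forall n, n \in s -> H n = lam]) ->
    forall n, (forall k, (k < n)%N -> G k = H k) -> H n <= G n.
  move=> hH GH k kE; rewrite leNgt; apply/negP => lt.
  pose J := [seq i <- iota 0 k | G i == G k].
  have [|s [us ss sH]] := GH (G k) (size J).+1.
    exists (k :: J); split=> //=; first by rewrite mem_filter mem_iota/= add0n ltnn andbF/= filter_uniq// iota_uniq.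
    by move=> i; rewrite in_cons => /predU1P[->//|]; rewrite mem_filter => /andP[/eqP].
  have /uniq_leq_size : {subset s <= J}.
    move=> i is'; have Hi := sH i is'; have ik : (i < k)%N.
      by rewrite ltnNge; apply/negP => /hH; rewrite Hi leNgt lt.
    by rewrite mem_filter kE// Hi eqxx mem_iota/= add0n.
  by move=> /(_ us); rewrite ss ltnn.
apply/funext; elim/ltn_ind => k IH; apply/eqP; rewrite eq_le; apply/andP; split.
  by apply: (half E F hF) => [lam m h|i ik]; [apply/dF/eigenspace_dim|rewrite IH].
by apply: (half F E E_homo) => [lam m h|i ik]; [apply/eigenspace_dim/dF|rewrite IH].
Qed.

End spectrum_listing.

End eigenspaces.

(** * Exponentials at the vertices *)

Lemma Rintegral_bound d (T : measurableType d) (R : realType) (mu : {measure set T -> \bar R}) (D : set T)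
    (f : T -> R) (B : R) : measurable D -> (mu D < +oo)%E -> mu.-integrable D (EFin \o f) ->
  (forall x, D x -> `|f x| <= B) -> `|\int[mu]_(x in D) f x| <= B * fine (mu D).
Proof.
move=> mD D_lty fi fB; have Dfin : mu D \is a fin_num by rewrite ge0_fin_numE.
apply: le_trans (le_normr_Rintegral mD fi) _.
have -> : B * fine (mu D) = \int[mu]_(x in D) B.
  by rewrite /Rintegral integral_cst// -[in RHS](fineK Dfin) -EFinM.
apply: le_Rintegral => //; first exact: (integrable_norm fi).
by apply: (bounded_integrable (M := `|B|)) => //; exact: measurable_cst.
Qed.

Section modes.
Context {R : realType} {L : nat}.
Variables (c : R * R) (r theta : R).
Hypotheses (hL : (3 <= L)%N) (r_gt0 : 0 < r).
Local Notation v := (@vertex R L c r theta).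
Local Notation Omega := (polygon v).
Local Notation bd := (arclength v).
Local Notation h := (@apothem R L r).
Local Notation step := (pi / L%:R : R).
Local Notation ed := (@vdir R L theta).
Local Notation nu := (@edge_normal R L theta).
Local Notation mass := (@mass R L c r theta).
Local Notation dirichlet := (@dirichlet R L c r theta).
Local Notation boundary := (@boundary R L c r theta).
Local Notation energetic := (@energetic R L c r theta).
Local Notation robin := (@robin R L c r theta).
Implicit Types (a gam : R) (i j k : 'I_L).

Let mO : measurable (Omega : set (mplane R)). Proof. exact: measurable_polygon. Qed.
Let O_lty : (area Omega < +oo)%E. Proof. exact: area_polygon_lty. Qed.

Local Notation m := (cos (2 * step)).

(** On an edge the larger mode of its two ends exceeds every other mode by the
    factor [exp (a rho)]; the same rate separates the masses of the modes from
    their mutual overlaps. *)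
Definition rho : R := r * (1 - m) / 2.

Lemma rho_gt0 : 0 < rho.
Proof. by rewrite !divr_gt0// mulr_gt0// subr_gt0 cos2_lt1. Qed.

Definition proj k (x : R * R) : R := (x.1 - c.1) * (ed k).1 + (x.2 - c.2) * (ed k).2.

(** An exponential with Laplacian [a ^ 2] times itself, whose normal derivative is
    [a cos (pi / L)] times itself on the two edges at the vertex [k]. *)
Definition mode a k (x : R * R) : R := expR (a * proj k x).

Lemma mode_gt0 a k x : 0 < mode a k x. Proof. exact: expR_gt0. Qed.

Lemma mode_elementary a k : elementary (mode a k).
Proof.
have := elementary_exp (a * (ed k).1) (a * (ed k).2) (- (a * (c.1 * (ed k).1 + c.2 * (ed k).2))).
by congr elementary; apply/funext => x; rewrite /mode /proj; congr expR; ring.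
Qed.

Lemma mode_smooth a k : smooth (mode a k).
Proof. exact: elementary_smooth (mode_elementary a k). Qed.

Definition mode_grad a k b (x : R * R) : R := a * (if b then (ed k).1 else (ed k).2) * mode a k x.

Lemma mode_C1 a k : C1 (mode a k) (mode_grad a k).
Proof.
have := C1_expR (C1_affine (a * (ed k).1) (a * (ed k).2) (- (a * (c.1 * (ed k).1 + c.2 * (ed k).2)))).
have -> : (fun x => expR (a * (ed k).1 * x.1 + a * (ed k).2 * x.2 - a * (c.1 * (ed k).1 + c.2 * (ed k).2))) = mode a k.
  by apply/funext => x; rewrite /mode /proj; congr expR; ring.
congr C1; apply/funext => b; apply/funext => x; rewrite /mode_grad /mode /proj -/step.
by rewrite mulrC; congr (_ * _); [case: b|congr expR; ring].
Qed.

Lemma mode_cont a k : continuous (mode a k). Proof. by have [] := mode_C1 a k. Qed.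

Lemma partial_mode a k b : partial b (mode a k) = mode_grad a k b.
Proof. exact: C1_partial (mode_C1 a k). Qed.

Lemma mode_grad_C1 a k b : C1 (mode_grad a k b)
  (fun b' x => a * (if b then (ed k).1 else (ed k).2) * mode_grad a k b' x).
Proof. exact: C1Z (mode_C1 a k). Qed.

Lemma proj_edge k i t : proj k (edge v i t) = r * ((1 - t) * dot (ed i) (ed k) + t * dot (ed (ordS i)) (ed k)).
Proof. by rewrite /proj /edge /dot/=; ring. Qed.

Lemma mode_edge a k i t : mode a k (edge v i t) = expR (a * (r * ((1 - t) * dot (ed i) (ed k) + t * dot (ed (ordS i)) (ed k)))).
Proof. by rewrite /mode proj_edge. Qed.

(** Convexity: the barycentric coordinates of the sector of [x]. *)
Lemma polygon_linear_le (d : R * R) (B : R) x : 0 <= B -> (forall i, dot (ed i) d <= B) -> Omega x ->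
  (x.1 - c.1) * d.1 + (x.2 - c.2) * d.2 <= r * B.
Proof.
move=> B0 dB /(polygon_tri hL r_gt0)[k [p [q [p0 q0 pq ->]]]].
have -> : ((tri c r theta k (p, q)).1 - c.1) * d.1 + ((tri c r theta k (p, q)).2 - c.2) * d.2 =
    r * (p * dot (ed k) d + q * dot (ed (ordS k)) d).
  by rewrite /tri /affine2 /dot/=; ring.
rewrite ler_pM2l//; have := ler_wpM2l p0 (dB k); have := ler_wpM2l q0 (dB (ordS k)).
have : (p + q) * B <= 1 * B by rewrite ler_wpM2r// ltW.
by rewrite mulrDl mul1r; lra.
Qed.

Lemma m_lt1 : m < 1. Proof. exact: cos2_lt1. Qed.

Lemma proj_pair_le x j k : j != k -> Omega x -> proj k x + proj j x <= r * (1 + m).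
Proof.
move=> jk Ox; have m1 := m_lt1.
have m_ge : -1 <= m by exact: cos_geN1.
have m1_ge0 : 0 <= 1 + m by rewrite -(subrr 1) lerD2l.
have -> : proj k x + proj j x = (x.1 - c.1) * ((ed k).1 + (ed j).1) + (x.2 - c.2) * ((ed k).2 + (ed j).2).
  by rewrite /proj; ring.
apply: (@polygon_linear_le ((ed k).1 + (ed j).1, (ed k).2 + (ed j).2)) => //.
move=> i; rewrite (_ : dot _ _ = dot (ed i) (ed k) + dot (ed i) (ed j)); last by rewrite /dot/=; ring.
have [e|ik] := eqVneq i k.
  by apply: lerD; [exact: dot_vdir_le|apply: dot_vdir_far => //; rewrite e eq_sym].
by rewrite addrC; apply: lerD; [exact: dot_vdir_le|exact: dot_vdir_far].
Qed.

Definition offdiag a : R := expR (a * (r * (1 + m))).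

Lemma offdiag_gt0 a : 0 < offdiag a. Proof. exact: expR_gt0. Qed.

Lemma mode_pair_le a x j k : 0 <= a -> j != k -> Omega x -> mode a k x * mode a j x <= offdiag a.
Proof.
by move=> a0 jk Ox; rewrite /mode -expRD ler_expR -mulrDr ler_wpM2l// proj_pair_le.
Qed.

Lemma mass_modes_le a j k : 0 <= a -> j != k ->
  `|mass (classical (mode a k)) (classical (mode a j))| <= offdiag a * fine (area Omega).
Proof.
move=> a0 jk; apply: Rintegral_bound => //.
  by apply: polygon_integrable => //; move=> x; apply: cvgM; exact: mode_cont.
move=> x Ox /=; rewrite ger0_norm ?mode_pair_le// ltW// mulr_gt0 ?mode_gt0//.
Qed.

(** Half the side of the square of [vertex_box]. *)
Definition eta : R := (1 - m) / 16 * h.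

Lemma eta_gt0 : 0 < eta.
Proof. by rewrite mulr_gt0 ?apothem_gt0// divr_gt0// subr_gt0 m_lt1. Qed.

(** With these fractions [proj k] stays within [r (1 - m) / 4] of its maximum [r],
    so that the square of the mode exceeds [offdiag a] by [exp (a rho)]. *)
Lemma vertex_box k : let x0 := (c.1 + (1 - (1 - m) / 8) * r * (ed k).1, c.2 + (1 - (1 - m) / 8) * r * (ed k).2) in
  box x0 eta `<=` Omega /\
  forall x, `|x.1 - x0.1| < eta -> `|x.2 - x0.2| < eta -> r * (1 - (1 - m) / 4) <= proj k x.
Proof.
move=> x0; have m1 := m_lt1; have h0 := apothem_gt0 hL r_gt0; have r0 := r_gt0.
have m_ge : -1 <= m by exact: cos_geN1.
have e0 := eta_gt0.
have hr : h <= r by rewrite /apothem ler_piMr ?(ltW r_gt0)// cos_le1.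
have lin (y1 y2 n1 n2 : R) : `|y1| < eta -> `|y2| < eta -> `|n1| <= 1 -> `|n2| <= 1 -> `|y1 * n1 + y2 * n2| < 2 * eta.
  move=> h1 h2 h3 h4; apply: le_lt_trans (ler_normD _ _) _; rewrite !normrM.
  have k1 : `|y1| * `|n1| <= `|y1| by rewrite ler_piMr.
  have k2 : `|y2| * `|n2| <= `|y2| by rewrite ler_piMr.
  by lra.
have eh : 2 * eta = (1 - m) / 8 * h by rewrite /eta; field.
split=> [x [x1 x2]|x x1 x2].
  rewrite polygonE// => i.
  have -> : height c theta i x = (1 - (1 - m) / 8) * (r * dot (ed k) (nu i)) + ((x.1 - x0.1) * (nu i).1 + (x.2 - x0.2) * (nu i).2).
    by rewrite /height /x0 /dot/=; ring.
  have := lin _ _ (nu i).1 (nu i).2 x1 x2; rewrite !cos_max !sin_max => /(_ isT isT)/ltr_normlW l1.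
  have l2 : (1 - (1 - m) / 8) * (r * dot (ed k) (nu i)) <= (1 - (1 - m) / 8) * h.
    by apply: ler_wpM2l; [lra|rewrite /apothem ler_pM2l// dot_vdir_normal_le].
  have : (1 - (1 - m) / 8) * h = h - (1 - m) / 8 * h by ring.
  move: l1 l2; rewrite eh => l1 l2 e1; rewrite [ltRHS](_ : h = (1 - (1 - m) / 8) * h + (1 - m) / 8 * h).
    exact: ler_ltD.
  by rewrite e1 subrK.
have -> : proj k x = (1 - (1 - m) / 8) * r + ((x.1 - x0.1) * (ed k).1 + (x.2 - x0.2) * (ed k).2).
  rewrite [LHS](_ : _ = (1 - (1 - m) / 8) * r * ((ed k).1 ^+ 2 + (ed k).2 ^+ 2) + ((x.1 - x0.1) * (ed k).1 + (x.2 - x0.2) * (ed k).2)).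
    by rewrite vdir_sq mulr1.
  by rewrite /proj /x0/=; ring.
have := lin _ _ (ed k).1 (ed k).2 x1 x2; rewrite !cos_max !sin_max => /(_ isT isT).
rewrite ltr_norml eh => /andP[l1 _].
have l2 : (1 - m) / 8 * h <= (1 - m) / 8 * r by rewrite ler_wpM2l// divr_ge0// subr_ge0 ltW.
have e1 : r * (1 - (1 - m) / 4) = r - 2 * ((1 - m) / 8 * r) by field.
have e2 : (1 - (1 - m) / 8) * r = r - (1 - m) / 8 * r by ring.
by rewrite e1 e2; move: l1 l2; set q1 := _ / 8 * h; set q2 := _ / 8 * r; set q3 := _ * (ed k).1 + _; lra.
Qed.

Lemma mass_mode_ge a k : 0 <= a ->
  4 * eta ^+ 2 * (offdiag a * expR (a * rho)) <= mass (classical (mode a k)) (classical (mode a k)).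
Proof.
move=> a0; have [BO Bp] := vertex_box k; rewrite mulrC.
apply: (box_le_integral eta_gt0 mO BO).
- by apply: polygon_integrable => //; move=> x; apply: cvgM; exact: mode_cont.
- by move=> x _; rewrite mulr_ge0// ltW ?mode_gt0.
- move=> x x1 x2; rewrite /offdiag /mode -!expRD ler_expR -!mulrDr ler_wpM2l//.
  have := Bp x x1 x2; rewrite /rho.
  have -> : r * (1 + m) + r * (1 - m) / 2 = 2 * (r * (1 - (1 - m) / 4)) by field.
  by lra.
Qed.

End modes.

(** * Bounds on the eigenvalues from the exponentials *)

Lemma quad_bound (R : realType) (n : nat) (N : 'I_n -> 'I_n -> R) (B : R) (C : 'I_n -> R) :
  (forall k j, `|N k j| <= B) ->
  `|\sum_k C k * \sum_j C j * N k j| <= B * n%:R * \sum_k C k ^+ 2.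
Proof.
move=> NB; have half k j : `|C k * (C j * N k j)| <= B / 2 * (C k ^+ 2 + C j ^+ 2).
  have B0 : 0 <= B by apply: le_trans (NB k j).
  rewrite mulrA normrM mulrC; apply: le_trans (_ : B * `|C k * C j| <= _); first exact: ler_wpM2r.
  rewrite -mulrA; apply: ler_wpM2l => //; rewrite normrM -(real_normK (num_real (C k))) -(real_normK (num_real (C j))).
  by have := sqr_ge0 (`|C k| - `|C j|); rewrite sqrrB => ?; rewrite -ler_pdivrMl ?invr_gt0// invrK; lra.
apply: le_trans (ler_norm_sum _ _ _) _.
apply: le_trans (_ : \sum_k \sum_j B / 2 * (C k ^+ 2 + C j ^+ 2) <= _).
  apply: ler_sum => k _; rewrite mulr_sumr; apply: le_trans (ler_norm_sum _ _ _) _.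
  by apply: ler_sum => j _; exact: half.
under eq_bigr do rewrite -mulr_sumr big_split/= sumr_const card_ord.
rewrite -mulr_sumr big_split/= sumr_const card_ord sumrMnl -mulr_natr.
by rewrite le_eqVlt; apply/orP; left; apply/eqP; field.
Qed.

Section mode_estimates.
Context {R : realType} {L : nat}.
Variables (c : R * R) (r theta : R).
Hypotheses (hL : (3 <= L)%N) (r_gt0 : 0 < r).
Local Notation v := (@vertex R L c r theta).
Local Notation Omega := (polygon v).
Local Notation bd := (arclength v).
Local Notation h := (@apothem R L r).
Local Notation step := (pi / L%:R : R).
Local Notation ed := (@vdir R L theta).
Local Notation nu := (@edge_normal R L theta).
Local Notation mass := (@mass R L c r theta).
Local Notation dirichlet := (@dirichlet R L c r theta).
Local Notation boundary := (@boundary R L c r theta).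
Local Notation energetic := (@energetic R L c r theta).
Local Notation robin := (@robin R L c r theta).
Local Notation mode := (@mode R L c theta).
Local Notation mode_grad := (@mode_grad R L c theta).
Local Notation rho := (@rho R L r).
Local Notation eta := (@eta R L r).
Local Notation offdiag := (@offdiag R L r).
Local Notation m := (cos (2 * step)).
Implicit Types (a gam : R) (i j k : 'I_L).

Let mO : measurable (Omega : set (mplane R)). Proof. exact: measurable_polygon. Qed.
Let O_lty : (area Omega < +oo)%E. Proof. exact: area_polygon_lty. Qed.

Definition side : R := 2 * r * sin step.

Lemma side_gt0 : 0 < side.
Proof. by rewrite !mulr_gt0// sin_step_gt0. Qed.

Definition mode_triple a k : triple (R := R) := classical (mode a k).

Lemma mode_energetic a k : energetic (mode_triple a k).
Proof. by apply: classical_energetic => //; exact: mode_smooth. Qed.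

Let mcont a k : continuous (mode a k). Proof. exact: mode_cont. Qed.

(** By Green's formula only the boundary defect of the mode remains, and it vanishes
    on the two edges at its vertex. *)
Lemma robin_mode a k j : robin (a * cos step) (mode_triple a k) (mode_triple a j) +
    a ^+ 2 * mass (mode_triple a k) (mode_triple a j) =
  \sum_(i < L) side * \int[lebesgue_measure]_(t in `[0, 1])
    (a * (dot (ed k) (nu i) - cos step) * (mode a k (edge v i t) * mode a j (edge v i t))).
Proof.
have cM (f g : R * R -> R) : continuous f -> continuous g -> continuous (fun x => f x * g x).
  by move=> cf cg x; apply: cvgM; [exact: cf|exact: cg].
have cm k' : continuous (mode a k') by have [] := mode_C1 c theta a k'.
have cg k' b : continuous (mode_grad a k' b) by have [_ /(_ b)] := mode_C1 c theta a k'.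
have CF b : C1 (fun x => mode_grad a k b x * mode a j x)
    (fun b' x => mode_grad a k b x * mode_grad a j b' x + mode a j x * (a * (if b then (ed k).1 else (ed k).2) * mode_grad a k b' x)).
  exact: C1M (mode_grad_C1 c theta a k b) (mode_C1 c theta a j).
have := divergence c theta hL r_gt0 CF.
have I b : area.-integrable Omega (EFin \o (fun x => mode_grad a k b x * mode_grad a j b x)).
  exact: (polygon_integrable c theta hL r_gt0 (cM _ _ (cg k b) (cg j b))).
have I3 : area.-integrable Omega (EFin \o (fun x => mode a k x * mode a j x)).
  exact: (polygon_integrable c theta hL r_gt0 (cM _ _ (cm k) (cm j))).
have I12 : area.-integrable Omega (EFin \o (fun x => mode_grad a k true x * mode_grad a j true x + mode_grad a k false x * mode_grad a j false x)).
  by apply: (polygon_integrable c theta hL r_gt0) => x; apply: cvgD; apply: cM; exact: cg.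
have I4 : area.-integrable Omega (EFin \o (fun x => a ^+ 2 * (mode a k x * mode a j x))).
  by apply: (polygon_integrable c theta hL r_gt0) => x; apply: cvgM; [exact: cvg_cst|apply: cM; exact: mcont].
have dE : dirichlet (mode_triple a k) (mode_triple a j) + a ^+ 2 * mass (mode_triple a k) (mode_triple a j) =
    \int[area]_(x in Omega) (mode_grad a k true x * mode_grad a j true x + mode_grad a k false x * mode_grad a j false x + a ^+ 2 * (mode a k x * mode a j x)).
  rewrite (RintegralD mO I12 I4) (RintegralD mO (I true) (I false)) (RintegralZl _ mO I3).
  by rewrite /dirichlet /mass /ip /mode_triple /classical /= !partial_mode.
rewrite (eq_Rintegral _ (g := fun x : mplane R => mode_grad a k true x * mode_grad a j true x + mode_grad a k false x * mode_grad a j false x + a ^+ 2 * (mode a k x * mode a j x))); last first.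
  move=> x _; rewrite [RHS](_ : _ = mode_grad a k true x * mode_grad a j true x + mode_grad a k false x * mode_grad a j false x + a ^+ 2 * (((ed k).1 ^+ 2 + (ed k).2 ^+ 2) * mode a k x * mode a j x)).
    by rewrite /mode_grad/=; ring.
  by rewrite vdir_sq mul1r.
rewrite -dE => green; rewrite /robin addrAC green.
have bE := Rintegral_arclength v (cM _ _ (cm k) (cm j)).
have -> : boundary (mode_triple a k) (mode_triple a j) = \int[bd]_x (mode a k x * mode a j x) by [].
rewrite bE.
rewrite mulr_sumr -sumrB; apply: eq_bigr => i _; rewrite (edge_lengthE c theta hL r_gt0) -/side.
have ce (f : R * R -> R) : continuous f -> continuous (fun t => f (edge v i t)).
  by move=> cf; apply: (comp_continuous _ cf); exact: edge_continuous.
rewrite mulrCA -mulrBr; congr (_ * _).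
have J1 : lebesgue_measure.-integrable `[0, 1] (EFin \o (fun t : R => mode_grad a k true (edge v i t) * mode a j (edge v i t) * (nu i).1 + mode_grad a k false (edge v i t) * mode a j (edge v i t) * (nu i).2)).
  apply: continuous_itv_integrable; apply: (ce (fun x => mode_grad a k true x * mode a j x * (nu i).1 + mode_grad a k false x * mode a j x * (nu i).2)).
  move=> x; apply: cvgD; apply: cvgM; try exact: cvg_cst; apply: cvgM; try exact: mcont; exact: cg.
have J2 : lebesgue_measure.-integrable `[0, 1] (EFin \o (fun t : R => mode a k (edge v i t) * mode a j (edge v i t))).
  by apply: continuous_itv_integrable; apply: (ce (fun x => mode a k x * mode a j x)); exact: cM.
have J3 : lebesgue_measure.-integrable `[0, 1] (EFin \o (fun t : R => a * cos step * (mode a k (edge v i t) * mode a j (edge v i t)))).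
  by apply: continuous_itv_integrable; apply: (ce (fun x => a * cos step * (mode a k x * mode a j x))) => x; apply: cvgM; [exact: cvg_cst|exact: cM].
have mI : measurable (`[0, 1] : set (measurableTypeR R)) by exact: measurable_itv.
rewrite -(RintegralZl _ mI J2) -(RintegralB mI J1 J3).
by apply: eq_Rintegral => t _; rewrite /mode_grad /dot; ring.
Qed.

Lemma edge_dot_le i j t : 0 <= t <= 1 -> (1 - t) * dot (ed i) (ed j) + t * dot (ed (ordS i)) (ed j) <= 1.
Proof.
move=> /andP[t0 t1]; have d1 := dot_vdir_le theta hL j i; have d2 := dot_vdir_le theta hL j (ordS i).
have t1' : 0 <= 1 - t by rewrite subr_ge0.
by have := ler_wpM2l t0 d2; have := ler_wpM2l t1' d1; lra.
Qed.

Lemma edge_dot_far i k t : 0 <= t <= 1 -> k != i -> k != ordS i ->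
  (1 - t) * dot (ed i) (ed k) + t * dot (ed (ordS i)) (ed k) <= m.
Proof.
move=> /andP[t0 t1] ki kSi; rewrite eq_sym in ki; rewrite eq_sym in kSi.
have d1 := dot_vdir_far theta hL ki; have d2 := dot_vdir_far theta hL kSi.
have t1' : 0 <= 1 - t by rewrite subr_ge0.
by have := ler_wpM2l t0 d2; have := ler_wpM2l t1' d1; lra.
Qed.

Lemma dot_normal_abs i k : `|dot (ed k) (nu i) - cos step| <= 2.
Proof.
have : `|dot (ed k) (nu i)| <= 1 by rewrite /dot/= -cosB cos_max.
have : `|cos step| <= 1 by rewrite cos_max.
rewrite !ler_norml => /andP[h1 h2] /andP[h3 h4]; apply/andP; split; lra.
Qed.

Lemma robin_mode_le a k j : 0 <= a ->
  `|robin (a * cos step) (mode_triple a k) (mode_triple a j) + a ^+ 2 * mass (mode_triple a k) (mode_triple a j)|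
  <= 2 * L%:R * side * a * offdiag a.
Proof.
move=> a0; rewrite robin_mode.
have cM (f g : R * R -> R) : continuous f -> continuous g -> continuous (fun x => f x * g x).
  by move=> cf cg x; apply: cvgM; [exact: cf|exact: cg].
apply: le_trans (ler_norm_sum _ _ _) _.
apply: le_trans (_ : \sum_(i < L) 2 * side * a * offdiag a <= _); last first.
  by rewrite sumr_const card_ord -mulr_natr le_eqVlt; apply/orP; left; apply/eqP; ring.
apply: ler_sum => i _; rewrite normrM (ger0_norm (ltW side_gt0)) [leRHS](_ : _ = side * (2 * a * offdiag a)); last by ring.
rewrite ler_pM2l ?side_gt0//.
have mI : measurable (`[0, 1] : set (measurableTypeR R)) by exact: measurable_itv.
have I01 : lebesgue_measure (`[0, 1] : set (measurableTypeR R)) = 1%:E.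
  by rewrite lebesgue_measure_itv/= lte_fin ltr01 -EFinD subr0.
have lt01 : (lebesgue_measure (`[0%R, 1%R] : set (measurableTypeR R)) < +oo)%E by rewrite I01 ltry.
have := @Rintegral_bound _ _ R lebesgue_measure `[0, 1] (fun t => a * (dot (ed k) (nu i) - cos step) * (mode a k (edge v i t) * mode a j (edge v i t))) (2 * a * offdiag a) mI.
rewrite (_ : fine _ = 1); last exact: (congr1 fine I01).
rewrite mulr1; apply.
  exact: lt01.
  apply: continuous_itv_integrable; apply: (comp_continuous (f := fun t => edge v i t) (g := fun x => a * (dot (ed k) (nu i) - cos step) * (mode a k x * mode a j x))).
    exact: edge_continuous.
  by move=> x; apply: cvgM; [exact: cvg_cst|apply: cM; exact: mcont].
move=> t; rewrite /= in_itv/= => t01.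
have P0 : 0 <= 2 * a * offdiag a by rewrite !mulr_ge0// ltW// offdiag_gt0.
have [e|ki] := eqVneq k i; first by rewrite e dot_vdir_normal subrr mulr0 mul0r normr0.
have [e|kSi] := eqVneq k (ordS i); first by rewrite e dot_vdirS_normal// subrr mulr0 mul0r normr0.
rewrite normrM; apply: ler_pM => //.
  by rewrite normrM (ger0_norm a0) mulrC ler_wpM2r// dot_normal_abs.
rewrite ger0_norm; last by apply: mulr_ge0; apply: ltW; exact: mode_gt0.
rewrite !mode_edge -expRD /offdiag ler_expR -mulrDr ler_wpM2l// -mulrDr ler_pM2l// addrC.
by apply: lerD; [exact: edge_dot_le|exact: edge_dot_far].
Qed.

(** The modes are almost orthogonal, and all entries of the form plus [a ^+ 2] times
    the mass are of the order of the overlaps. *)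
Lemma modes_upper a (C : 'I_L -> R) (w := \sum_k C k *: mode_triple a k) : 0 <= a ->
  L%:R * fine (area Omega) <= 2 * eta ^+ 2 * expR (a * rho) ->
  2 * eta ^+ 2 * (offdiag a * expR (a * rho)) * \sum_k C k ^+ 2 <= mass w w /\
  robin (a * cos step) w w + a ^+ 2 * mass w w <= 2 * L%:R ^+ 2 * side * a * offdiag a * \sum_k C k ^+ 2.
Proof.
move=> a0 big; have eU := mode_energetic a; have ew : energetic w by exact: energetic_sum.
have S0 : 0 <= \sum_k C k ^+ 2 by apply: sumr_ge0 => k _; exact: sqr_ge0.
have massL X Y Z b : energetic X -> energetic Y -> energetic Z -> mass (b *: X + Y) Z = b * mass X Z + mass Y Z.
  by move=> [sX _] [sY _] [sZ _]; exact: mass_lin.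
have dbl (B : triple (R := R) -> triple (R := R) -> R) : (forall X Y, B X Y = B Y X) ->
    (forall b X Y Z, energetic X -> energetic Y -> energetic Z -> B (b *: X + Y) Z = b * B X Z + B Y Z) ->
    B w w = \sum_k C k * \sum_j C j * B (mode_triple a k) (mode_triple a j).
  move=> BC BL; rewrite (form_sum hL r_gt0 C BL eU ew); apply: eq_bigr => k _.
  congr (_ * _); rewrite BC (form_sum hL r_gt0 C BL eU (eU k)); apply: eq_bigr => j _.
  by rewrite BC.
split.
  rewrite (dbl _ (@massC R L c r theta)); last by move=> b X Y Z; exact: massL.
  pose N k j := if k == j then 0 else mass (mode_triple a k) (mode_triple a j).
  have NB k j : `|N k j| <= offdiag a * fine (area Omega).
    rewrite /N; have [_|kj] := eqVneq k j; last by apply: mass_modes_le => //; rewrite eq_sym.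
    by rewrite normr0 mulr_ge0 ?fine_ge0// ltW ?offdiag_gt0.
  have := quad_bound C NB; rewrite ler_norml => /andP[lo _].
  have -> : \sum_k C k * \sum_j C j * mass (mode_triple a k) (mode_triple a j) =
      \sum_k C k ^+ 2 * mass (mode_triple a k) (mode_triple a k) + \sum_k C k * \sum_j C j * N k j.
    rewrite -big_split/=; apply: eq_bigr => k _; rewrite expr2 -mulrA -mulrDr; congr (_ * _).
    rewrite (bigD1 k)//= [in RHS](bigD1 k)//= /N eqxx mulr0 add0r; congr (_ + _).
    by apply: eq_bigr => j jk; rewrite eq_sym (negbTE jk).
  have diag : 4 * eta ^+ 2 * (offdiag a * expR (a * rho)) * \sum_k C k ^+ 2 <=
      \sum_k C k ^+ 2 * mass (mode_triple a k) (mode_triple a k).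
    rewrite mulrC mulr_suml; apply: ler_sum => k _; apply: ler_wpM2l; first exact: sqr_ge0.
    exact: mass_mode_ge.
  have : offdiag a * fine (area Omega) * L%:R * \sum_k C k ^+ 2 <=
      2 * eta ^+ 2 * (offdiag a * expR (a * rho)) * \sum_k C k ^+ 2.
    apply: ler_wpM2r => //; rewrite -mulrA (mulrC (fine _)) [leRHS](_ : _ = offdiag a * (2 * eta ^+ 2 * expR (a * rho))); last by ring.
    by rewrite ler_pM2l ?offdiag_gt0.
  move: lo diag; have arith (s1 s2 q1 q2 x y : R) : 4 * x = s1 -> 2 * x = s2 -> - y <= q2 -> s1 <= q1 -> y <= s2 -> s2 <= q1 + q2.
    by move=> *; lra.
  by apply: (arith _ _ _ _ (eta ^+ 2 * (offdiag a * expR (a * rho)) * \sum_k C k ^+ 2)); ring.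
have := @quad_bound R L (fun k j => robin (a * cos step) (mode_triple a k) (mode_triple a j) + a ^+ 2 * mass (mode_triple a k) (mode_triple a j)) _ C (fun k j => robin_mode_le k j a0).
have -> : \sum_k C k * (\sum_j C j * (robin (a * cos step) (mode_triple a k) (mode_triple a j) + a ^+ 2 * mass (mode_triple a k) (mode_triple a j))) =
    robin (a * cos step) w w + a ^+ 2 * mass w w.
  rewrite (dbl (fun X Y => robin (a * cos step) X Y + a ^+ 2 * mass X Y))//.
  - by move=> X Y; rewrite robinC massC.
  - by move=> b X Y Z eX eY eZ; rewrite robin_lin// massL//; ring.
move=> /(le_trans (ler_norm _))/le_trans; apply.
by rewrite le_eqVlt; apply/orP; left; apply/eqP; ring.
Qed.

(** The [L] modes contain a nontrivial combination orthogonal to the first [n]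
    eigenvectors. *)
Lemma eigenvalue_upper a (E : nat -> R) (e : nat -> triple (R := R)) (n : nat) : 0 <= a ->
  L%:R * fine (area Omega) <= 2 * eta ^+ 2 * expR (a * rho) -> (n < L)%N ->
  (forall i : nat, energetic (e i)) ->
  (forall x, energetic x -> (forall i : nat, (i < n)%N -> mass x (e i) = 0) -> E n * mass x x <= robin (a * cos step) x x) ->
  E n <= - a ^+ 2 + L%:R ^+ 2 * side / eta ^+ 2 * a * expR (- (a * rho)).
Proof.
move=> a0 big nL ee Emin.
have arith (x y K W : R) : x + y * W <= K * W -> x <= (- y + K) * W by rewrite mulrDl mulNr; lra.
have [C [j Cj] CO] := ex_kernel (fun (j : 'I_L) (i : 'I_n) => mass (mode_triple a j) (e i)) nL.
pose w := \sum_k C k *: mode_triple a k.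
have ew : energetic w by apply: energetic_sum => // k; exact: mode_energetic.
have [lo up] := modes_upper C a0 big; rewrite -/w in lo up.
have S0 : 0 < \sum_k C k ^+ 2.
  rewrite (bigD1 j)//=; apply: ltr_pwDl; first by rewrite exprn_even_gt0.
  by apply: sumr_ge0 => k _; exact: sqr_ge0.
have P0 := offdiag_gt0 r a (L := L); have X0 := expR_gt0 (a * rho); have e0 := eta_gt0 hL r_gt0.
have w0 : 0 < mass w w.
  apply: lt_le_trans lo; apply: mulr_gt0 => //; apply: mulr_gt0; last exact: mulr_gt0.
  by apply: mulr_gt0 => //; exact: exprn_gt0.
have /(Emin w ew) : forall i : nat, (i < n)%N -> mass w (e i) = 0.
  by move=> i ni; rewrite (mass_sum hL r_gt0 C (mode_energetic a) (ee i)); exact: (CO (Ordinal ni)).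
move=> h1; rewrite -(ler_pM2r w0); apply: le_trans h1 _.
apply: arith; apply: le_trans up _.
rewrite [leLHS](_ : _ = L%:R ^+ 2 * side / eta ^+ 2 * a * expR (- (a * rho)) * (2 * eta ^+ 2 * (offdiag a * expR (a * rho)) * \sum_k C k ^+ 2)).
  apply: ler_wpM2l lo; apply: mulr_ge0; last exact: expR_ge0.
  apply: mulr_ge0 a0; apply: divr_ge0; last exact: sqr_ge0.
  by apply: mulr_ge0; [exact: sqr_ge0|exact: ltW side_gt0].
rewrite expRN; field.
by rewrite !gt_eqF.
Qed.

(** The sum [Phi] of the modes satisfies [Laplacian Phi = a ^ 2 Phi], so the field
    [W = grad Phi / Phi] has [div W + |W| ^ 2 = a ^ 2]. On an edge the modes of its
    ends dominate [Phi], which makes the normal component of [W] equal to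
    [a cos (pi / L)] up to an exponentially small error. *)
Lemma boundary_modes a : 0 <= a -> forall x, energetic x ->
  (a * cos step - 2 * L%:R * a * expR (- (a * rho))) * boundary x x <= dirichlet x x + a ^+ 2 * mass x x.
Proof.
move=> a0; apply: energetic_ineq => // phi sphi; have Cphi := smooth_C1 sphi.
pose Phi x := \sum_k mode a k x.
pose dPhi b x := \sum_k mode_grad a k b x.
have Phi0 x : 0 < Phi x.
  pose k0 : 'I_L := Ordinal (leq_trans (isT : (0 < 3)%N) hL).
  rewrite /Phi (bigD1 k0)//=; apply: ltr_pwDl; first exact: mode_gt0.
  by apply: sumr_ge0 => k _; apply: ltW; exact: mode_gt0.
have CPhi : C1 Phi dPhi by apply: C1_sum => k; exact: mode_C1.
have CV := C1V CPhi (fun x => lt0r_neq0 (Phi0 x)).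
have CdPhi b : C1 (dPhi b) (fun b' x => \sum_k a * (if b then (ed k).1 else (ed k).2) * mode_grad a k b' x).
  by apply: C1_sum => k; exact: mode_grad_C1.
have CW b := C1M (CdPhi b) CV.
have := @jacobi_inequality R L c r theta hL r_gt0 (fun b x => dPhi b x * (Phi x)^-1) _ (a * cos step - 2 * L%:R * a * expR (- (a * rho))) (a ^+ 2) phi _ CW Cphi.
have -> : \int[area]_(x in Omega) (partial true phi x * partial true phi x + partial false phi x * partial false phi x) =
    dirichlet (classical phi) (classical phi).
  have cp b : continuous (fun x => partial b phi x * partial b phi x).
    by have [_ cp _] := Cphi; move=> x; apply: cvgM; exact: cp.
  by rewrite /dirichlet /ip -(RintegralD mO (polygon_integrable c theta hL r_gt0 (cp true)) (polygon_integrable c theta hL r_gt0 (cp false))).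
apply.
- move=> i t t01; set y := edge v i t.
  have -> : dPhi true y * (Phi y)^-1 * (nu i).1 + dPhi false y * (Phi y)^-1 * (nu i).2 =
      (\sum_k a * dot (ed k) (nu i) * mode a k y) / Phi y.
    rewrite -!mulrA ![_^-1 * _]mulrC !mulrA -mulrDl; congr (_ / _).
    by rewrite /dPhi !mulr_suml -big_split/=; apply: eq_bigr => k _; rewrite /mode_grad /dot/=; ring.
  rewrite ler_pdivlMr// /Phi mulrBl mulr_sumr lerBlDr -lerBlDl -sumrB.
  apply: le_trans (_ : \sum_(k < L) 2 * a * expR (- (a * rho)) * Phi y <= _); last first.
    by rewrite sumr_const card_ord -mulr_natr le_eqVlt; apply/orP; left; apply/eqP; rewrite /Phi; ring.
  apply: ler_sum => k _.
  have [e|ki] := eqVneq k i.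
    by rewrite e dot_vdir_normal subrr !mulr_ge0 ?expR_ge0// ltW.
  have [e|kSi] := eqVneq k (ordS i).
    by rewrite e dot_vdirS_normal// subrr !mulr_ge0 ?expR_ge0// ltW.
  rewrite [leLHS](_ : _ = a * (cos step - dot (ed k) (nu i)) * mode a k y); last by ring.
  rewrite -[leRHS]mulrA; apply: ler_pM.
  + by rewrite mulr_ge0// subr_ge0 dot_vdir_normal_le.
  + exact/ltW/mode_gt0.
  + rewrite mulrC ler_wpM2r//; apply: le_trans (ler_norm _) _; rewrite distrC; exact: dot_normal_abs.
  have big : expR (a * (r * ((1 + m) / 2))) <= Phi y.
    have dS : dot (ed i) (ed (ordS i)) = m.
      by rewrite vdirE vdirSE// /dot/= -cosB -cosN; congr cos; ring.
    have dd j : dot (ed j) (ed j) = 1 by rewrite /dot -!expr2 vdir_sq.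
    have le1 j : mode a j y <= Phi y.
      by rewrite /Phi (bigD1 j)//= lerDl; apply: sumr_ge0 => k' _; apply: ltW; exact: mode_gt0.
    have m1 := m_lt1 hL (R := R).
    (* each end dominates on its half of the edge *)
    have [th|th] := leP t (2^-1).
      apply: le_trans (le1 i); rewrite mode_edge ler_expR ler_wpM2l// ler_pM2l// dd.
      have -> : dot (ed (ordS i)) (ed i) = m by rewrite -dS /dot mulrC (mulrC (ed (ordS i)).2).
      have : t * (1 - m) <= 2^-1 * (1 - m) by rewrite ler_wpM2r// subr_ge0 ltW.
      by lra.
    apply: le_trans (le1 (ordS i)); rewrite mode_edge ler_expR ler_wpM2l// ler_pM2l// dd dS.
    have : (1 - t) * (1 - m) <= 2^-1 * (1 - m) by rewrite ler_wpM2r ?subr_ge0 ?(ltW m1)//; lra.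
    by lra.
  apply: le_trans (_ : expR (- (a * rho)) * expR (a * (r * ((1 + m) / 2))) <= _); last first.
    by rewrite ler_wpM2l// expR_ge0.
  rewrite -expRD /y mode_edge ler_expR [leRHS](_ : _ = a * (r * m)); last by rewrite /rho; field.
  by rewrite ler_wpM2l// ler_pM2l// edge_dot_far.
- move=> x Ox /=; set P := Phi x; have P0 : P != 0 by exact: lt0r_neq0 (Phi0 x).
  have lap : \sum_k a * (ed k).1 * mode_grad a k true x + \sum_k a * (ed k).2 * mode_grad a k false x = a ^+ 2 * P.
    rewrite -big_split mulr_sumr; apply: eq_bigr => k _.
    rewrite [LHS](_ : _ = a ^+ 2 * (((ed k).1 ^+ 2 + (ed k).2 ^+ 2) * mode a k x)); last by rewrite /mode_grad/=; ring.
    by rewrite vdir_sq mul1r.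
  move: lap; move: (\sum_k _) (\sum_k _) => s1 s2 lap.
  rewrite [leLHS](_ : _ = (s1 + s2) / P); last by field.
  by rewrite (addrC s1) lap mulfK.
Qed.

End mode_estimates.

(** * The asymptotics *)

Lemma exp_beats_linear (R : realType) (K k : R) : 0 <= K -> 0 < k -> exists G : R,
  forall x, G <= x -> K * (x + 1) * expR (- (k * x)) <= 1.
Proof.
(* beyond this point [(k x) ^ 2 / 2], a lower bound of the exponential, exceeds
   [2 K x], which exceeds [K (x + 1)] *)
move=> K0 k0; exists (1 + 4 * K / k ^+ 2) => x Gx.
have D0 : 0 <= 4 * K / k ^+ 2 by rewrite divr_ge0 ?sqr_ge0// mulr_ge0.
have x1 : 1 <= x by lra.
have x0 : 0 <= k * x by rewrite mulr_ge0 ?(ltW k0)//; lra.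
rewrite expRN ler_pdivrMr ?expR_gt0// mul1r.
have := expR_ge1Dxn 1 x0; apply: le_trans.
have h1 : 4 * K <= x * k ^+ 2 by rewrite -ler_pdivrMr ?exprn_gt0//; lra.
have h2 : K * (x + 1) <= 2 * (K * x) by have := ler_wpM2l K0 x1; lra.
have h3 : 4 * K * x <= x * k ^+ 2 * x by rewrite ler_wpM2r//; lra.
have e1 : (k * x) ^+ 2 / 2`!%:R = x * k ^+ 2 * x / 2 by rewrite (_ : 2`! = 2)%N//; field.
by rewrite e1; lra.
Qed.

Section asymptotics.
Context {R : realType} {L : nat}.
Variables (c : R * R) (r theta : R).
Hypotheses (hL : (3 <= L)%N) (r_gt0 : 0 < r).
Local Notation v := (@vertex R L c r theta).
Local Notation Omega := (polygon v).
Local Notation s := (cos (pi / L%:R : R)).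
Local Notation rho := (@rho R L r).
Local Notation eta := (@eta R L r).
Local Notation side := (@side R L r).
Local Notation mass := (@mass R L c r theta).
Local Notation dirichlet := (@dirichlet R L c r theta).
Local Notation boundary := (@boundary R L c r theta).
Local Notation energetic := (@energetic R L c r theta).
Local Notation robin := (@robin R L c r theta).

Let s0 : 0 < s. Proof. exact: cos_step_gt0. Qed.
Let s1 : s <= 1. Proof. exact: cos_le1. Qed.
Let rho0 : 0 < rho. Proof. exact: rho_gt0. Qed.

Let expR_mono (x y z : R) : 0 <= z -> y <= x -> expR (- (x * z)) <= expR (- (y * z)).
Proof. by move=> z0 yx; rewrite ler_expR lerN2 ler_wpM2r. Qed.

Let expR_half (x y : R) : expR (- (x * y)) = expR (- (x * (y / 2))) * expR (- (x * (y / 2))).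
Proof. by rewrite -expRD; congr expR; field. Qed.

(** Raising [a] above [gam / cos (pi / L)] by an exponentially small amount pays for
    the error on the edges. *)
Lemma lower_field : exists G : R, forall gam, G <= gam -> exists2 a, 0 <= a &
  gam <= a * s - 2 * L%:R * a * expR (- (a * rho)) /\ a ^+ 2 <= (gam / s) ^+ 2 + expR (- (rho / 4 * gam)).
Proof.
have L0 : 0 <= 2 * L%:R :> R by rewrite mulr_ge0.
have r2 : 0 < rho / 2 by rewrite divr_gt0.
have r4 : 0 < rho / 4 by rewrite divr_gt0.
have K0 : 0 <= 2 / s ^+ 2 by rewrite divr_ge0 ?sqr_ge0.
have [G1 P1] := exp_beats_linear L0 r2; have [G2 P2] := exp_beats_linear K0 r4.
exists (Num.max 0 (Num.max G1 G2)) => gam; rewrite !ge_max => /and3P[g0 gG1 gG2].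
(* half of the decay rate pays for the factor [2 L a] in front of the error *)
pose t := expR (- (gam * (rho / 2))); pose a := gam / s + t / s.
have t0 : 0 < t by exact: expR_gt0.
have t1 : t <= 1 by rewrite -expR0 ler_expR oppr_le0 mulr_ge0 ?(ltW r2).
have ga : gam <= a.
  have : gam <= gam / s by rewrite ler_pdivlMr// ler_piMr.
  by have : 0 <= t / s by [rewrite divr_ge0// ltW]; rewrite /a; lra.
have a0 : 0 <= a by exact: le_trans ga.
exists a => //; split.
  have -> : a * s = gam + t by rewrite /a; field; rewrite gt_eqF.
  rewrite -addrA lerDl subr_ge0 (expR_half a rho) [leLHS]mulrA.
  have e1 : expR (- (a * (rho / 2))) <= t by apply: expR_mono => //; exact: ltW.
  have e2 : 2 * L%:R * a * expR (- (a * (rho / 2))) <= 1.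
    have := P1 a (le_trans gG1 ga); apply: le_trans; rewrite (mulrC (rho / 2)).
    apply: ler_wpM2r; first exact: expR_ge0.
    by apply: ler_wpM2l => //; lra.
  apply: le_trans (_ : 1 * t <= _); last by rewrite mul1r.
  by apply: ler_pM => //; first by apply: mulr_ge0; [exact: mulr_ge0|exact: expR_ge0].
have -> : a ^+ 2 = (gam / s) ^+ 2 + (2 * gam + t) / s ^+ 2 * t by rewrite /a; field; rewrite gt_eqF.
rewrite lerD2l /t -/t (_ : expR (- (rho / 4 * gam)) = 1 * expR (- (rho / 4 * gam))) ?mul1r//.
have tE : t = expR (- (rho / 4 * gam)) * expR (- (rho / 4 * gam)) by rewrite /t -expRD; congr expR; field.
rewrite [in X in _ * X]tE mulrA -[leRHS]mul1r; apply: ler_wpM2r; first exact: expR_ge0.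
apply: le_trans (P2 gam gG2); apply: ler_wpM2r; first exact: expR_ge0.
by rewrite [leRHS]mulrAC ler_wpM2r ?invr_ge0 ?sqr_ge0//; lra.
Qed.

Lemma upper_exponent : exists G : R, forall gam, G <= gam -> let a := gam / s in
  [/\ 0 <= a, L%:R * fine (area Omega) <= 2 * eta ^+ 2 * expR (a * rho) &
  L%:R ^+ 2 * side / eta ^+ 2 * a * expR (- (a * rho)) <= expR (- (rho / 4 * gam))].
Proof.
have e0 := eta_gt0 hL r_gt0; have ee0 : 0 < eta ^+ 2 by exact: exprn_gt0.
have V0 : 0 <= fine (area Omega) by rewrite fine_ge0.
have r2 : 0 < rho / 2 by rewrite divr_gt0.
have K1 : 0 <= L%:R * fine (area Omega) / (2 * eta ^+ 2).
  by apply: divr_ge0; apply: mulr_ge0 => //; exact: ltW.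
have K2 : 0 <= L%:R ^+ 2 * side / eta ^+ 2.
  apply: divr_ge0; last exact: ltW.
  by apply: mulr_ge0; [exact: sqr_ge0|apply: ltW; exact: side_gt0].
have [G1 P1] := exp_beats_linear K1 rho0; have [G2 P2] := exp_beats_linear K2 r2.
exists (Num.max 0 (Num.max G1 G2)) => gam; rewrite !ge_max => /and3P[g0 gG1 gG2] a.
have ga : gam <= a by rewrite ler_pdivlMr// ler_piMr.
have a0 : 0 <= a by exact: le_trans ga.
split=> //.
  have := P1 a (le_trans gG1 ga); rewrite expRN ler_pdivrMr ?expR_gt0// mul1r (mulrC rho) => h1.
  rewrite -ler_pdivrMl; last by rewrite mulr_gt0.
  rewrite mulrC; apply: le_trans h1; rewrite ler_peMr//; lra.
rewrite (expR_half a rho) [leLHS]mulrA -[leRHS]mul1r; apply: ler_pM; [|exact: expR_ge0| |].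
- by apply: mulr_ge0; [exact: mulr_ge0|exact: expR_ge0].
- have := P2 a (le_trans gG2 ga); apply: le_trans; rewrite (mulrC (rho / 2)).
  apply: ler_wpM2r; first exact: expR_ge0.
    by apply: ler_wpM2l => //; lra.
- rewrite ler_expR lerN2; have := ler_wpM2r (ltW rho0) ga.
  have := mulr_ge0 g0 (ltW rho0); have -> : rho / 4 * gam = gam * rho / 4 by ring.
  by rewrite mulrA; move: (gam * rho) (a * rho) => *; lra.
Qed.

Theorem robin_eigenvalue_asymptotics : exists G : R, forall gam, G <= gam -> forall n, (1 <= n <= L)%N ->
  `|robin_eigenvalue v gam n + (gam / s) ^+ 2| <= expR (- (rho / 4 * gam)).
Proof.
have [G1 P1] := lower_field; have [G2 P2] := upper_exponent.
exists (Num.max 1 (Num.max G1 G2)) => gam; rewrite !ge_max => /and3P[g1 gG1 gG2] [//|n] /= nL.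
have g0 : 0 < gam by exact: lt_le_trans g1.
have [E [e [ee e1 e2 e3 [e4 e5]]]] := robin_spectral c theta hL r_gt0 g0.
rewrite (robin_eigenvalueE hL r_gt0 ee e1 e2 e3 e4 e5) /=.
have [a a0 [ga aE]] := P1 gam gG1.
have lower : - a ^+ 2 <= E n.
  apply: le_trans (e3 0%N n (leq0n n)).
  have := e2 0%N _ (ee 0%N); rewrite e1 eqxx mulr1 => <-.
  have := boundary_modes hL r_gt0 a0 (ee 0%N); rewrite e1 eqxx mulr1 /robin.
  have := ler_wpM2r (boundary_ge0 c r theta (L := L) (e 0%N)) ga.
  by move: (_ * boundary _ _) (_ * boundary _ _) => *; lra.
have [b0 bbig bE] := P2 gam gG2; set b := gam / s in b0 bbig bE.
have upper : E n <= - b ^+ 2 + expR (- (rho / 4 * gam)).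
  apply: le_trans (_ : - b ^+ 2 + L%:R ^+ 2 * side / eta ^+ 2 * b * expR (- (b * rho)) <= _); last by rewrite lerD2l.
  apply: (eigenvalue_upper hL r_gt0 b0 bbig nL ee) => x ex xe.
  have -> : b * s = gam by rewrite /b divfK// gt_eqF.
  exact: (e4 n x ex xe).
by rewrite ler_norml; apply/andP; split; move: lower upper aE; rewrite -/b; lra.
Qed.

End asymptotics.

Theorem corollary1p4 (R : realType) (L : nat) (hL : (3 <= L)%N)
    (v : 'I_L -> R * R) (hv : regular_vertices v) :
  exists2 c : R, 0 < c &
    forall n : nat, (1 <= n <= L)%N ->
      (fun gam : R => robin_eigenvalue v gam n) =
      (fun gam : R => - (gam ^+ 2 / sin ((L%:R - 2) * pi / (2 * L%:R)) ^+ 2))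
        +O_ (+oo_R) (fun gam : R => expR (- c * gam)).
Proof.
have [c [r [theta [r_gt0 vE]]]] := hv.
have {vE} -> : v = vertex c r theta by apply/funext => k; rewrite vE.
exists (rho r (L := L) / 4); first by rewrite divr_gt0// rho_gt0.
move=> n nL; apply/eqaddOP; have [G GP] := robin_eigenvalue_asymptotics c theta hL r_gt0.
have sE : sin ((L%:R - 2) * pi / (2 * L%:R)) = cos (pi / L%:R) :> R.
  rewrite [X in sin X](_ : _ = - (pi / L%:R - pi / 2)); last by field; rewrite pnatr_eq0 -lt0n (leq_trans _ hL).
  by rewrite sinN sinBpihalf opprK.
have fE (gam : R) : robin_eigenvalue (vertex (L := L) c r theta) gam n - - (gam ^+ 2 / sin ((L%:R - 2) * pi / (2 * L%:R)) ^+ 2) =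
    robin_eigenvalue (vertex (L := L) c r theta) gam n + (gam / cos (pi / L%:R)) ^+ 2.
  by rewrite opprK sE expr_div_n.
near=> k; near=> gam.
rewrite [X in `|X| <= _](fE gam); apply: le_trans (GP gam _ n nL) _.
  by near: gam; apply: nbhs_pinfty_ge; exact: num_real.
by rewrite mulNr (ger0_norm (expR_ge0 _)) ler_peMl ?expR_ge0//.
Unshelve. all: by end_near. Qed.
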